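(* Let $X\subseteq\mathbb{R}^d$ be a fat closed subanalytic set. Let $f\in\mathcal{C}^\infty(X)$ be such that $f\circ c$ is real analytic for every real analytic curve $c:\mathbb{R}\to\mathbb{R}^d$ with $c(\mathbb{R})\subseteq X$. Then $f$ extends to a holomorphic function defined on an open neighborhood of $X$ in $\mathbb{C}^d$.
   Context: $\mathcal{C}^\infty(X)$ is the set of $f:X\to\mathbb{R}$ such that every $x\in X$ has an open neighborhood $U$ in $\mathbb{R}^d$ and a smooth $F:U\to\mathbb{R}$ with $F=f$ on $U\cap X$. A nonempty closed set $X$ is fat if $X=\overline{\mathrm{int}(X)}$. Subanalytic is meant in the sense of real analytic geometry. *)

(* Defs.v *)
From HB Require Import structures.
From mathcomp Require Import all_boot all_order all_algebra.
From mathcomp Require Import all_classical all_reals all_analysis.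
From mathcomp.real_closed Require Export complex.
Export Order.TTheory GRing.Theory Num.Theory.
Import numFieldNormedType.Exports.

Set Implicit Arguments.
Unset Strict Implicit.
Unset Printing Implicit Defensive.

Local Open Scope ring_scope.
Local Open Scope classical_set_scope.

(* Multivariate power series over a numeric domain K (K = R or K = R[i]).
   Points of K^n are row vectors 'rV[K]_n; multi-indices are 'I_n -> nat. *)

Definition psum (K : numDomainType) (n : nat) (a : ('I_n -> nat) -> K)
  (h : 'rV[K]_n) (N : nat) : K :=
  \sum_(al : {ffun 'I_n -> 'I_N.+1} | (\sum_i (al i : nat) <= N)%N)
     a (fun i => (al i : nat)) * \prod_i (h ord0 i) ^+ (al i : nat).

Definition pabs (K : numDomainType) (n : nat) (a : ('I_n -> nat) -> K)
  (h : 'rV[K]_n) (N : nat) : K :=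
  \sum_(al : {ffun 'I_n -> 'I_N.+1} | (\sum_i (al i : nat) <= N)%N)
     `|a (fun i => (al i : nat))| * \prod_i `|h ord0 i| ^+ (al i : nat).

Definition ps_abs_conv_to (K : numDomainType) (n : nat)
  (a : ('I_n -> nat) -> K) (h : 'rV[K]_n) (l : K) : Prop :=
  (exists M : K, forall N, pabs a h N <= M) /\
  (forall e : K, 0 < e -> exists N0 : nat, forall N : nat, (N0 <= N)%N ->
      `|psum a h N - l| < e).

Definition analytic_at (K : numDomainType) (n : nat)
  (f : 'rV[K]_n -> K) (z0 : 'rV[K]_n) : Prop :=
  exists (a : ('I_n -> nat) -> K) (r : K), 0 < r /\
    forall z : 'rV[K]_n, (forall i, `|z ord0 i - z0 ord0 i| < r) ->
      ps_abs_conv_to a (z - z0) (f z).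

Definition analytic_on (K : numDomainType) (n : nat)
  (U : set 'rV[K]_n) (f : 'rV[K]_n -> K) : Prop :=
  forall z, U z -> analytic_at f z.

Definition sup_open (K : numDomainType) (n : nat) (V : set 'rV[K]_n) : Prop :=
  forall z, V z -> exists r : K, 0 < r /\
    forall w : 'rV[K]_n, (forall i, `|w ord0 i - z ord0 i| < r) -> V w.

Definition holomorphic_on (R : realType) (d : nat)
  (V : set 'rV[R[i]]_d) (F : 'rV[R[i]]_d -> R[i]) : Prop :=
  analytic_on V F.

Definition real_analytic_curve (R : realType) (d : nat) (c : R -> 'rV[R]_d) : Prop :=
  forall (i : 'I_d) (t : R),
    analytic_at (fun s : 'rV[R]_1 => c (s ord0 ord0) ord0 i) (const_mx t).

Definition unitv (R : realType) (d : nat) (i : 'I_d) : 'rV[R]_d := delta_mx ord0 i.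

Fixpoint ipd (R : realType) (d : nat) (l : seq 'I_d) (F : 'rV[R]_d -> R)
  : 'rV[R]_d -> R :=
  match l with
  | [::] => F
  | i :: l' => fun x => 'D_(unitv R i) (ipd l' F) x
  end.

Definition smooth_on (R : realType) (d : nat) (U : set 'rV[R]_d)
  (F : 'rV[R]_d -> R) : Prop :=
  forall (l : seq 'I_d) (x : 'rV[R]_d), U x ->
    (ipd l F y @[y --> x] --> ipd l F x) /\
    (forall i : 'I_d, derivable (ipd l F) x (unitv R i)).

Definition Cinf_on (R : realType) (d : nat) (X : set 'rV[R]_d)
  (f : 'rV[R]_d -> R) : Prop :=
  forall x, X x -> exists (U : set 'rV[R]_d) (F : 'rV[R]_d -> R),
    open U /\ U x /\ smooth_on U F /\ (forall y, U y -> X y -> F y = f y).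

Definition fat (R : realType) (d : nat) (X : set 'rV[R]_d) : Prop :=
  X !=set0 /\ closed X /\ X = closure (interior X).

(* Semianalytic and subanalytic sets (Bierstone--Milman) *)

Definition semianalytic (R : realType) (n : nat) (S : set 'rV[R]_n) : Prop :=
  forall x : 'rV[R]_n, exists U : set 'rV[R]_n, open U /\ U x /\
    exists (k l : nat) (f : 'I_k -> 'rV[R]_n -> R) (g : 'I_k -> 'I_l -> 'rV[R]_n -> R),
      (forall p, analytic_on U (f p)) /\ (forall p q, analytic_on U (g p q)) /\
      S `&` U = [set y | U y /\ exists p, f p y = 0 /\ forall q, 0 < g p q y].

Definition subanalytic (R : realType) (d : nat) (X : set 'rV[R]_d) : Prop :=
  forall x : 'rV[R]_d, exists U : set 'rV[R]_d, open U /\ U x /\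
    exists (m : nat) (A : set 'rV[R]_(d + m)),
      semianalytic A /\ compact (closure A) /\
      X `&` U = (@lsubmx R 1 d m) @` A.

Definition complexify (R : realType) (d : nat) (x : 'rV[R]_d) : 'rV[R[i]]_d :=
  map_mx (fun t => (t%:C)%C) x.

(* Main.v *)
Require Import Defs.
From HB Require Import structures.
From mathcomp Require Import all_boot all_order all_algebra.
From mathcomp Require Import all_classical all_reals all_analysis.
From mathcomp Require Import ring lra zify.
Import Order.TTheory GRing.Theory Num.Theory.
Import numFieldNormedType.Exports.

Set Implicit Arguments.
Unset Strict Implicit.
Unset Printing Implicit Defensive.

Local Open Scope ring_scope.
Local Open Scope classical_set_scope.

(* Bounded points of a subanalytic set are followed along ultrafilters.  Resolution of
   an analytic germ to a monomial times a unit (after substitutions through which the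
   ultrafilter lifts) provides analytic charts of X that carry a given ultrafilter.
   For an ultrafilter avoiding every nowhere dense set, a chart with the least number of
   variables has d of them and a nonzero Jacobian: otherwise its fibres could be cut by
   the vanishing of a minor.  Inverting it along a line gives a horn
   x0 + c(t) + t^N z in X, with t and z small.

   On the curves t |-> x0 + c(t) + t^N z the function f is analytic; by Baire its Taylor
   coefficients grow geometrically, uniformly for z in some cube, and mixed finite
   differences in z turn this into |D^l f(x0)| <= C^(m+1) m! with m = |l|.  Hence the
   Taylor series of f at x0 converges.  It agrees with f on X near x0: along an analytic
   curve in X through x0 the difference is analytic and flat at x0, and the charts
   provide enough such curves.  The complexified local sums agree on overlaps because
   they agree on the interior of X, which is dense in X. *)

(** * Complete valued fields and absolutely convergent series *)

(** An ultrafilter replaces the finite covers of resolution: every alternative met on the way (a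
    sign, which of two coordinates dominates, the limit of a quotient) is decided for almost all
    points, so each argument works in a single chart.

    The obstacle is that X may have an outward cusp at x0: then no open cone with vertex x0 lies in
    X near x0, and f cannot be tested on segments. The horn is the substitute. Its price is that a
    derivative of order m only shows in the coefficient of t^(N m), but a bound C^(N m) there is
    still geometric in m. The step of the differences is proportional to 1/(m+1), and the resulting
    (m+1)^m has the size of m! up to a geometric factor.

    Estimates run through the weighted l1 norm of power series on polydiscs; it is
    submultiplicative, so products, compositions and implicit functions become norm estimates. The
    scalars form a [vfield], a complete field with absolute value and an isometric copy of the
    reals, so that real charts and holomorphic extensions share their proofs; [emb] supplies scalars
    of prescribed absolute value. *)

Record vfield (R : realType) := VField {
  vsort :> fieldType;
  nu : vsort -> R;
  emb : R -> vsort;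
  nu_ge0 : forall x, 0 <= nu x;
  nu_eq0 : forall x, nu x = 0 -> x = 0;
  nuM : forall x y, nu (x * y) = nu x * nu y;
  nuD : forall x y, nu (x + y) <= nu x + nu y;
  nu_emb : forall t, nu (emb t) = `|t|;
  embD : forall s t, emb (s + t) = emb s + emb t;
  embM : forall s t, emb (s * t) = emb s * emb t;
  emb1 : emb 1 = 1;
  nu_complete : forall u : nat -> vsort,
    (forall e, 0 < e -> exists N, forall m n, (N <= m)%N -> (N <= n)%N ->
       nu (u m - u n) < e) ->
    exists l, forall e, 0 < e -> exists N, forall n, (N <= n)%N ->
       nu (u n - l) < e }.

Section Valued.
Variables (R : realType) (K : vfield R).
Implicit Types (x y c : K) (u v : nat -> K).

Lemma emb0 : emb K 0 = 0.
Proof.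
have := embD K 0 0; rewrite addr0 => /eqP.
by rewrite -[X in X == _]addr0 (inj_eq (addrI _)) eq_sym => /eqP.
Qed.

Lemma nu0 : nu (0 : K) = 0.
Proof. by rewrite -emb0 nu_emb normr0. Qed.

Lemma nu1 : nu (1 : K) = 1.
Proof. by rewrite -(emb1 K) nu_emb normr1. Qed.

Lemma nuN x : nu (- x) = nu x.
Proof.
have h : nu (-1 : K) = 1.
  have e : nu (-1 : K) * nu (-1 : K) = 1 by rewrite -nuM mulrNN mulr1 nu1.
  have := nu_ge0 (-1 : K); nra.
by rewrite -mulN1r nuM h mul1r.
Qed.

Lemma nuB x y : nu (x - y) <= nu x + nu y.
Proof. by rewrite -(nuN y) nuD. Qed.

Lemma nu_sym x y : nu (x - y) = nu (y - x).
Proof. by rewrite -nuN opprB. Qed.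

Lemma nuX x n : nu (x ^+ n) = nu x ^+ n.
Proof. by elim: n => [|n IH]; rewrite ?expr0 ?nu1 // !exprS nuM IH. Qed.

Lemma nu_sum I (r : seq I) (P : pred I) (F : I -> K) :
  nu (\sum_(i <- r | P i) F i) <= \sum_(i <- r | P i) nu (F i).
Proof.
elim/big_rec2: _ => [|i a b _ h]; first by rewrite nu0.
by apply: le_trans (nuD _ _) _; rewrite lerD2l.
Qed.

Definition cv u (l : K) : Prop :=
  forall e : R, 0 < e -> exists N, forall k, (N <= k)%N -> nu (u k - l) < e.

Lemma cv_cst c : cv (fun=> c) c.
Proof. by move=> e e0; exists 0%N => k _; rewrite subrr nu0. Qed.

Lemma cv_uniq u l l' : cv u l -> cv u l' -> l = l'.
Proof.
move=> h h'; apply/eqP; rewrite -subr_eq0; apply/eqP/nu_eq0/eqP.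
rewrite eq_le nu_ge0 andbT leNgt; apply/negP => p.
have [N hN] := h _ (divr_gt0 p (ltr0n R 2)).
have [N' hN'] := h' _ (divr_gt0 p (ltr0n R 2)).
have := hN _ (leq_maxl N N'); have := hN' _ (leq_maxr N N').
set w := u _ => a b.
have := nuD (l - w) (w - l'); rewrite addrA subrK (nu_sym l w).
lra.
Qed.

Lemma cv_ext u v l : (forall k, u k = v k) -> cv u l -> cv v l.
Proof. by move=> e h t /h [N hN]; exists N => k /hN; rewrite e. Qed.

Lemma cvD u v l l' : cv u l -> cv v l' -> cv (fun k => u k + v k) (l + l').
Proof.
move=> h h' e e0.
have [N hN] := h _ (divr_gt0 e0 (ltr0n R 2)).
have [N' hN'] := h' _ (divr_gt0 e0 (ltr0n R 2)).
exists (maxn N N') => k; rewrite geq_max => /andP[/hN a /hN' b].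
have -> : u k + v k - (l + l') = (u k - l) + (v k - l') by ring.
by have := nuD (u k - l) (v k - l'); lra.
Qed.

Lemma cvM_l u l c : cv u l -> cv (fun k => c * u k) (c * l).
Proof.
move=> h e e0; have p : 0 < nu c + 1 by have := nu_ge0 c; lra.
have [N hN] := h _ (divr_gt0 e0 p).
exists N => k /hN; rewrite -mulrBr nuM ltr_pdivlMr // => a.
have := nu_ge0 (u k - l); nra.
Qed.

Lemma cvB u v l l' : cv u l -> cv v l' -> cv (fun k => u k - v k) (l - l').
Proof.
move=> h h'; apply: cvD => //.
by rewrite -mulN1r; apply: cv_ext (cvM_l (-1) h') => k; rewrite mulN1r.
Qed.

Lemma cv_sum I (r : seq I) (F : I -> nat -> K) (l : I -> K) :
  (forall i, cv (F i) (l i)) ->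
  cv (fun k => \sum_(i <- r) F i k) (\sum_(i <- r) l i).
Proof.
move=> h; elim: r => [|i r IH].
  by rewrite big_nil; apply: cv_ext (cv_cst 0) => k; rewrite big_nil.
rewrite big_cons; apply: cv_ext (cvD (h i) IH) => k; by rewrite big_cons.
Qed.

Lemma cv_le u l c B N : cv u l -> (forall k, (N <= k)%N -> nu (u k - c) <= B) ->
  nu (l - c) <= B.
Proof.
move=> h b; rewrite leNgt; apply/negP => p.
have [N' hN'] := h (nu (l - c) - B) ltac:(lra).
have := hN' _ (leq_maxr N N'); have := b _ (leq_maxl N N').
set w := u _ => a1 a2.
have := nuD (l - w) (w - c); rewrite addrA subrK (nu_sym l w); lra.
Qed.

Lemma cv_nu_le u l B : cv u l -> (forall k, nu (u k) <= B) -> nu l <= B.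
Proof.
move=> h b; rewrite -[l]subr0; apply: (@cv_le u l 0 B 0%N h) => k _.
by rewrite subr0.
Qed.

Lemma cv_shift u l n : cv u l -> cv (fun k => u (k + n)%N) l.
Proof.
move=> h e /h[N hN]; exists N => k hk; apply: hN; exact: leq_trans (leq_addr _ _).
Qed.

Lemma cv_unshift u l n : cv (fun k => u (k + n)%N) l -> cv u l.
Proof.
move=> h e /h[N hN]; exists (N + n)%N => k hk.
have kn : (n <= k)%N by lia.
by rewrite -(subnK kn); apply: hN; lia.
Qed.

Lemma sum_ge0 (b : nat -> R) m n : (forall j, 0 <= b j) ->
  0 <= \sum_(m <= j < n) b j.
Proof. by move=> h; apply: sumr_ge0. Qed.

Lemma sum_mono (b : nat -> R) m n : (forall j, 0 <= b j) -> (m <= n)%N ->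
  \sum_(0 <= j < m) b j <= \sum_(0 <= j < n) b j.
Proof.
by move=> h mn; rewrite (big_cat_nat (leq0n m) mn) /= lerDl sum_ge0.
Qed.

Lemma bounded_tail (b : nat -> R) M : (forall j, 0 <= b j) ->
  (forall J, \sum_(0 <= j < J) b j <= M) ->
  forall e, 0 < e -> exists N, forall m n, (N <= m)%N -> (m <= n)%N ->
    \sum_(m <= j < n) b j < e.
Proof.
move=> b0 bM e e0.
pose S := [set s | exists J, s = \sum_(0 <= j < J) b j].
have hS : has_sup S.
  by split; [exists (\sum_(0 <= j < 0) b j), 0%N | exists M => _ [J ->]].
have [_ [N ->] hN] := sup_adherent e0 hS.
exists N => m n Nm mn.
have : \sum_(0 <= j < n) b j <= sup S by apply: (sup_upper_bound hS); exists n.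
rewrite (big_cat_nat (n := m)) //=; have := sum_mono b0 Nm; lra.
Qed.

Lemma abs_cv u (b : nat -> R) M : (forall j, nu (u j) <= b j) ->
  (forall J, \sum_(0 <= j < J) b j <= M) ->
  exists l, cv (fun J => \sum_(0 <= j < J) u j) l /\ nu l <= M.
Proof.
move=> ub bM; have b0 j : 0 <= b j := le_trans (nu_ge0 _) (ub j).
have [l hl] : exists l, cv (fun J => \sum_(0 <= j < J) u j) l.
  apply: nu_complete => e e0; have [N hN] := bounded_tail b0 bM e0.
  have hw m n : (N <= m)%N -> (m <= n)%N ->
      nu (\sum_(0 <= j < m) u j - \sum_(0 <= j < n) u j) < e.
    move=> Nm mn; rewrite nu_sym (big_cat_nat (leq0n m) mn) /= addrAC subrr add0r.
    apply: le_lt_trans (hN _ _ Nm mn); apply: le_trans (nu_sum _ _ _) _.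
    by apply: ler_sum.
  exists N => m n hm hn; have [mn|nm] := leqP m n; first exact: hw.
  by rewrite nu_sym; apply: hw => //; exact: ltnW.
exists l; split => //; apply: (cv_nu_le hl) => k.
by apply: le_trans (bM k); apply: le_trans (nu_sum _ _ _) _; apply: ler_sum.
Qed.

(** A rectangle [K0] x [J0] whose partial sum of [b] is within e/4 of the supremum leaves less than
    e/4 outside it. Row tails beyond [J0] are therefore small uniformly in the number of rows, and
    only limits of finitely many rows and columns remain. *)
Lemma double_series (a : nat -> nat -> K) (b : nat -> nat -> R) M
    (fk : nat -> K) f (cj : nat -> K) :
  (forall k j, nu (a k j) <= b k j) ->
  (forall k0 j0, \sum_(0 <= k < k0) \sum_(0 <= j < j0) b k j <= M) ->
  (forall k, cv (fun J => \sum_(0 <= j < J) a k j) (fk k)) ->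
  cv (fun k0 => \sum_(0 <= k < k0) fk k) f ->
  (forall j, cv (fun k0 => \sum_(0 <= k < k0) a k j) (cj j)) ->
  cv (fun J => \sum_(0 <= j < J) cj j) f.
Proof.
move=> ab bM hfk hf hc e e0.
have b0 k j : 0 <= b k j := le_trans (nu_ge0 _) (ab k j).
pose D k0 j0 := \sum_(0 <= k < k0) \sum_(0 <= j < j0) b k j.
have Dmono k1 k2 j1 j2 : (k1 <= k2)%N -> (j1 <= j2)%N -> D k1 j1 <= D k2 j2.
  move=> hk hj; apply: (@le_trans _ _ (D k1 j2)).
    by apply: ler_sum => k _; exact: sum_mono.
  by apply: sum_mono => // k; exact: sum_ge0.
pose S := [set s | exists k0 j0, s = D k0 j0].
have hS : has_sup S.
  by split; [exists (D 0%N 0%N), 0%N, 0%N | exists M => _ [k0 [j0 ->]]; exact: bM].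
have e4 : 0 < e / 4 by lra.
have [_ [K0 [J0 ->]] hKJ] := sup_adherent e4 hS.
exists J0 => J hJ.
have [K1 hK1] := hf _ e4.
have [K2 hK2] := cv_sum (index_iota 0 J) hc e4.
pose k0 := maxn K0 (maxn K1 K2).
have a1 : nu (\sum_(0 <= k < k0) fk k - f) < e / 4 by apply: hK1; rewrite /k0; lia.
have := hK2 k0 ltac:(rewrite /k0; lia); rewrite exchange_big /= => a2.
have a3 : nu (\sum_(0 <= k < k0) fk k - \sum_(0 <= k < k0) \sum_(0 <= j < J) a k j)
          <= e / 4.
  have := cv_sum (index_iota 0 k0) hfk.
  move=> h; apply: (@cv_le _ _ _ _ J h) => J' hJ'.
  rewrite -sumrB; apply: le_trans (nu_sum _ _ _) _.
  apply: (@le_trans _ _ (D k0 J' - D k0 J)).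
    rewrite /D -sumrB; apply: ler_sum => k _.
    rewrite !(big_cat_nat (leq0n J) hJ') /= (addrC (\sum_(0 <= i < J) a k i)).
    rewrite (addrC (\sum_(0 <= i < J) b k i)) !addrK.
    by apply: le_trans (nu_sum _ _ _) _; apply: ler_sum.
  have : D k0 J' <= sup S by apply: (sup_upper_bound hS); exists k0, J'.
  have : D K0 J0 <= D k0 J by apply: Dmono => //; rewrite /k0; lia.
  lra.
move: a1 a2 a3.
set p := \sum_(0 <= k < k0) fk k; set q := \sum_(0 <= k < k0) _.
set c := \sum_(0 <= j < J) cj j => a1 a2 a3.
have -> : c - f = (c - q) + ((q - p) + (p - f)) by ring.
have := nuD (c - q) ((q - p) + (p - f)); have := nuD (q - p) (p - f).
rewrite (nu_sym c q) (nu_sym q p); lra.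
Qed.

End Valued.

(** * Functions given by nested convergent power series *)

Section Analytic.
Variables (R : realType) (K : vfield R).
Local Notation E := (nat -> K).
Implicit Types (x y : E) (f g : E -> K) (r M : R) (n : nat).

(** Closed polydisc in the first [n] coordinates. Points are infinite sequences of which only an
    initial segment matters, so that the number of variables can change without casts. *)
Definition pd n r x := forall i, (i < n)%N -> nu (x i) <= r.

(* [A n r M f]: in its first n variables f is the sum of a power series whose
   weighted l1-norm on the polydisc of radius r is at most M; the series is
   organised as a series in the last variable with coefficients in A n.-1. *)
Fixpoint A n r M f : Prop :=
  match n with
  | 0 => exists c : K, nu c <= M /\ forall x, f x = c
  | n'.+1 => exists (c : nat -> E -> K) (m : nat -> R),
     [/\ forall j, A n' r (m j) (c j),
         forall J, \sum_(0 <= j < J) m j * r ^+ j <= M &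
         forall x, pd n'.+1 r x ->
           cv (fun J => \sum_(0 <= j < J) c j x * x n' ^+ j) (f x)]
  end.

Lemma pdS n r x : pd n.+1 r x -> pd n r x.
Proof. by move=> h i hi; apply: h; exact: ltnW. Qed.

Lemma pd_le n r r' x : r <= r' -> pd n r x -> pd n r' x.
Proof. by move=> rr h i /h hi; exact: le_trans rr. Qed.

Lemma A_inv n r M f : A n.+1 r M f -> exists (c : nat -> E -> K) (m : nat -> R),
  [/\ forall j, A n r (m j) (c j),
      forall J, \sum_(0 <= j < J) m j * r ^+ j <= M &
      forall x, pd n.+1 r x ->
        cv (fun J => \sum_(0 <= j < J) c j x * x n ^+ j) (f x)].
Proof. by []. Qed.

Lemma A_mk n r M f (c : nat -> E -> K) (m : nat -> R) :
  (forall j, A n r (m j) (c j)) ->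
  (forall J, \sum_(0 <= j < J) m j * r ^+ j <= M) ->
  (forall x, pd n.+1 r x ->
     cv (fun J => \sum_(0 <= j < J) c j x * x n ^+ j) (f x)) -> A n.+1 r M f.
Proof. by move=> h1 h2 h3; exists c, m. Qed.

Lemma A_ge0 n r M f : A n r M f -> 0 <= M.
Proof.
elim: n M f => [|n IH] M f; first by move=> [c [cM _]]; exact: le_trans (nu_ge0 _) cM.
move=> /A_inv [c [m [hc hm _]]].
by have := hm 1%N; rewrite big_nat1 expr0 mulr1; apply: le_trans (IH _ _ (hc 0%N)).
Qed.

Lemma A_le n r M M' f : A n r M f -> M <= M' -> A n r M' f.
Proof.
case: n => [|n]; first by move=> [c [cM h]] MM; exists c; split => //; exact: le_trans MM.
by move=> /A_inv [c [m [hc hm h]]] MM; apply: (A_mk (c := c) (m := m)) => // J; exact: le_trans MM.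
Qed.

Lemma A_ext n r M f g : (forall x, pd n r x -> f x = g x) -> A n r M f -> A n r M g.
Proof.
case: n => [|n] e.
  by move=> [c [cM h]]; exists c; split => // x; rewrite -e.
by move=> /A_inv [c [m [hc hm h]]]; apply: (A_mk (c := c) (m := m)) => // x hx; rewrite -e //; exact: h.
Qed.

Lemma A_shrink n r r' M f : 0 <= r' -> r' <= r -> A n r M f -> A n r' M f.
Proof.
move=> r0 rr; elim: n M f => [//|n IH] M f /A_inv [c [m [hc hm h]]].
apply: (A_mk (c := c) (m := m)) => [j|J|x hx]; first exact: IH.
- apply: le_trans (hm J); apply: ler_sum => j _.
  apply: ler_wpM2l; first exact: A_ge0 (hc j).
  by apply: lerXn2r; rewrite ?nnegrE //; exact: le_trans rr.
- by apply: h; exact: pd_le hx.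
Qed.

Lemma A_bound n r M f x : 0 <= r -> A n r M f -> pd n r x -> nu (f x) <= M.
Proof.
move=> r0; elim: n M f => [|n IH] M f.
  by move=> [c [cM h]] _; rewrite h.
move=> /A_inv [c [m [hc hm h]]] hx.
have xn : nu (x n) <= r by apply: hx.
have hb j : nu (c j x * x n ^+ j) <= m j * r ^+ j.
  rewrite nuM nuX; apply: ler_pM; rewrite ?exprn_ge0 ?nu_ge0 //.
    by apply: IH => //; exact: pdS.
  by apply: lerXn2r; rewrite ?nnegrE ?nu_ge0.
have [l [hl lM]] := abs_cv hb hm.
by rewrite (cv_uniq (h _ hx) hl).
Qed.

Lemma A_dep n r M f x y : A n r M f -> pd n r x ->
  (forall i, (i < n)%N -> x i = y i) -> f x = f y.
Proof.
elim: n M f => [|n IH] M f.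
  by move=> [c [cM h]] _ _; rewrite !h.
move=> /A_inv [c [m [hc hm h]]] hx xy.
have hy : pd n.+1 r y by move=> i hi; rewrite -xy //; exact: hx.
apply: (cv_uniq (h _ hx)); apply: cv_ext (h _ hy) => J.
apply: eq_bigr => j _; rewrite xy // (IH _ _ (hc j) (pdS hx)) // => i hi.
by apply: xy; exact: ltnW.
Qed.

Lemma A_cst n r M c : 0 <= r -> nu c <= M -> A n r M (fun=> c).
Proof.
move=> r0; elim: n M c => [|n IH] M c cM; first by exists c.
exists (fun j => if j == 0%N then fun=> c else fun=> 0), (fun j => if j == 0%N then M else 0).
have M0 : 0 <= M by exact: le_trans (nu_ge0 _) cM.
split.
- by move=> [|j] /=; apply: IH => //; rewrite nu0.
- case=> [|J]; first by rewrite big_geq.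
  rewrite big_nat_recl // big1 => [|i _]; first by rewrite /= expr0 mulr1 addr0.
  by rewrite /= mul0r.
- move=> x _; apply: (@cv_unshift _ _ _ _ 1); apply: cv_ext (cv_cst c) => J.
  rewrite addn1 big_nat_recl // big1 => [|i _]; first by rewrite /= expr0 mulr1 addr0.
  by rewrite /= mul0r.
Qed.

Lemma A_weak n r M f : 0 <= r -> A n r M f -> A n.+1 r M f.
Proof.
move=> r0 h.
apply: (A_mk (c := (fun j => if j == 0%N then f else fun=> 0)) (m := (fun j => if j == 0%N then M else 0))).
- by move=> [|j] //=; apply: A_cst; rewrite ?nu0.
- case=> [|J]; first by rewrite big_geq //; exact: A_ge0 h.
  rewrite big_nat_recl // big1 => [|i _]; first by rewrite /= expr0 mulr1 addr0.
  by rewrite /= mul0r.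
- move=> x _; apply: (@cv_unshift _ _ _ _ 1); apply: cv_ext (cv_cst (f x)) => J.
  rewrite addn1 big_nat_recl // big1 => [|i _]; first by rewrite /= expr0 mulr1 addr0.
  by rewrite /= mul0r.
Qed.

Lemma A_weaken n n' r M f : 0 <= r -> (n <= n')%N -> A n r M f -> A n' r M f.
Proof.
move=> r0 /subnK <-; elim: (n' - n)%N => [|k IH] h //.
by rewrite addSn; apply: A_weak => //; exact: IH.
Qed.

Lemma A_last n r : 0 <= r -> A n.+1 r r (fun x => x n).
Proof.
move=> r0.
apply: (A_mk (c := (fun j => if j == 1%N then fun=> 1 else fun=> 0)) (m := (fun j => if j == 1%N then 1 else 0))).
- by move=> j; case: eqP => _; apply: A_cst; rewrite ?nu0 ?nu1.
- case=> [|[|J]]; first by rewrite big_geq.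
    by rewrite big_nat1 /= mul0r.
  rewrite 2?big_nat_recl // big1 => [|i _]; last by rewrite /= mul0r.
  by rewrite /= mul0r add0r addr0 mul1r expr1.
- move=> x _; apply: (@cv_unshift _ _ _ _ 2); apply: cv_ext (cv_cst (x n)) => J.
  rewrite addn2 2?big_nat_recl // big1 => [|i _]; last by rewrite /= mul0r.
  by rewrite /= mul0r add0r addr0 mul1r expr1.
Qed.

Lemma A_coord n r i : 0 <= r -> (i < n)%N -> A n r r (fun x => x i).
Proof. by move=> r0 hi; apply: (@A_weaken i.+1) => //; exact: A_last. Qed.

(** Completeness of the weighted l1 norm: coefficients are summed exponent by exponent through the
    induction, and [double_series] reorders the values. Sums, products and compositions are all
    instances, so rearrangement of series is dealt with here once. *)
Lemma A_csum n r M (fk : nat -> E -> K) (m : nat -> R) f : 0 < r ->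
  (forall k, A n r (m k) (fk k)) -> (forall k0, \sum_(0 <= k < k0) m k <= M) ->
  (forall x, pd n r x -> cv (fun k0 => \sum_(0 <= k < k0) fk k x) (f x)) ->
  A n r M f.
Proof.
move=> r0; elim: n M fk m f => [|n IH] M fk m f hA hm hf.
  have [l [hl lM]] : exists l, cv (fun k0 => \sum_(0 <= k < k0) fk k (fun=> 0)) l /\ nu l <= M.
    apply: (abs_cv (b := m)) => // k.
    by have [c [cM ->]] := hA k.
  exists l; split => // x; apply: (cv_uniq (hf x _)) => //.
  apply: cv_ext hl => k0; apply: eq_bigr => k _.
  by have [c [cM h]] := hA k; rewrite !h.
have [c hc] := choice (fun k => A_inv (hA k)).
have {hc}[b hb] := choice hc.
have b0 k j : 0 <= b k j by have [h _ _] := hb k; exact: A_ge0 (h j).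
have rj j : 0 < r ^+ j by exact: exprn_gt0.
have hbr k0 J : \sum_(0 <= k < k0) \sum_(0 <= j < J) b k j * r ^+ j <= M.
  by apply: le_trans (hm k0); apply: ler_sum => k _; have [_ h _] := hb k; exact: h.
have hbj j k0 : \sum_(0 <= k < k0) b k j <= M / r ^+ j.
  rewrite ler_pdivlMr // mulr_suml; apply: le_trans (hbr k0 j.+1).
  apply: ler_sum => k _; rewrite big_nat_recr //= lerDr sum_ge0 // => i.
  by rewrite mulr_ge0 // ltW.
pose S j := [set s | exists k0, s = \sum_(0 <= k < k0) b k j].
have hS j : has_sup (S j).
  split; first by exists (\sum_(0 <= k < 0) b k j), 0%N.
  by exists (M / r ^+ j) => _ [k0 ->].
(* The exact sum over k of the bounds [b k j]. The cruder M / r^j would be useless: weighted by r^j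
   it does not sum to a bounded quantity. *)
pose mm j := sup (S j).
have hmm j k0 : \sum_(0 <= k < k0) b k j <= mm j.
  by apply: (sup_upper_bound (hS j)); exists k0.
have hcb k j x : pd n r x -> nu (c k j x) <= b k j.
  by move=> hx; have [h _ _] := hb k; apply: (A_bound (ltW r0) (h j)).
have hcc j x : exists l, pd n r x -> cv (fun k0 => \sum_(0 <= k < k0) c k j x) l.
  case: (pselect (pd n r x)) => [hx|]; last by exists 0.
  have [l [hl _]] := abs_cv (fun k => hcb k j x hx) (hmm j).
  by exists l.
have [cc hcc'] := choice (fun jx : nat * E => hcc jx.1 jx.2).
apply: (A_mk (c := fun j x => cc (j, x)) (m := mm)).
- move=> j; apply: (IH _ (fun k => c k j) (fun k => b k j)).
  + by move=> k; have [h _ _] := hb k.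
  + exact: hmm.
  + by move=> x; exact: (hcc' (j, x)).
- move=> J; rewrite leNgt; apply/negP => lt.
  have hk e : 0 < e -> exists k0, forall j, (j < J)%N -> mm j - e < \sum_(0 <= k < k0) b k j.
    elim: J {lt} => [|J IHJ] e0; first by exists 0%N.
    have [k1 h1] := IHJ e0.
    have [_ [k2 ->] h2] := sup_adherent e0 (hS J).
    exists (maxn k1 k2) => j; rewrite ltnS leq_eqVlt => /orP[/eqP ->|/h1 h].
      apply: lt_le_trans h2 _; apply: sum_mono => //; exact: leq_maxr.
    apply: lt_le_trans h _; apply: sum_mono => //; exact: leq_maxl.
  (* If the weighted sum exceeded M by D > 0, lowering every [mm j] by e would cost less than D in
     total, while one common [k0] reaches all the lowered values for j < J; this contradicts
     [hbr]. *)
  pose D := \sum_(0 <= j < J) mm j * r ^+ j - M.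
  have Jr : 0 < \sum_(0 <= j < J) r ^+ j + 1.
    by rewrite ltr_wpDl // sumr_ge0 // => j _; exact: ltW.
  have e0 : 0 < D / (\sum_(0 <= j < J) r ^+ j + 1) by rewrite divr_gt0 // subr_gt0.
  set e := D / _ in e0; have := hk e e0.
  move=> [k0 h0].
  have : \sum_(0 <= j < J) (mm j - e) * r ^+ j <= M.
    apply: le_trans (hbr k0 J); rewrite exchange_big /=; apply: ler_sum_nat => j hj.
    rewrite -mulr_suml; apply: ler_wpM2r; first exact: ltW.
    by apply/ltW/h0; case/andP: hj.
  have -> : \sum_(0 <= j < J) (mm j - e) * r ^+ j =
            \sum_(0 <= j < J) mm j * r ^+ j - e * \sum_(0 <= j < J) r ^+ j.
    by rewrite mulr_sumr -sumrB; apply: eq_bigr => j _; rewrite mulrBl.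
  have : e * (\sum_(0 <= j < J) r ^+ j + 1) = D by rewrite /e divfK // gt_eqF.
  by rewrite /D mulrDr mulr1; lra.
- move=> x hx.
  have xn : nu (x n) <= r by apply: hx.
  apply: (@double_series _ _ (fun k j => c k j x * x n ^+ j)
    (fun k j => b k j * r ^+ j) M (fun k => fk k x)) => //.
  + move=> k j; rewrite nuM nuX; apply: ler_pM; rewrite ?exprn_ge0 ?nu_ge0 //.
      by apply: hcb; exact: pdS.
    by apply: lerXn2r; rewrite ?nnegrE ?nu_ge0 ?(ltW r0).
  + by move=> k; have [_ _ h] := hb k; exact: h.
  + exact: hf.
  + move=> j; have := cvM_l (x n ^+ j) (hcc' (j, x) (pdS hx)).
    rewrite mulrC; apply: cv_ext => k0; rewrite mulr_sumr.
    by apply: eq_bigr => k _; rewrite mulrC.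
Qed.

Lemma A_add n r M M' f g : 0 < r -> A n r M f -> A n r M' g ->
  A n r (M + M') (fun x => f x + g x).
Proof.
move=> r0 hf hg.
apply: (@A_csum _ _ _ (fun k => if k == 0%N then f else if k == 1%N then g else fun=> 0)
   (fun k => if k == 0%N then M else if k == 1%N then M' else 0)) => //.
- by move=> [|[|k]] //=; apply: A_cst; rewrite ?nu0 // ltW.
- have := A_ge0 hf; have := A_ge0 hg => M0 M0'.
  case=> [|[|J]]; [by rewrite big_geq ?addr_ge0|by rewrite big_nat1 /= lerDl|].
  by rewrite 2?big_nat_recl // big1 ?addr0.
- move=> x _; apply: (@cv_unshift _ _ _ _ 2); apply: cv_ext (cv_cst (f x + g x)) => J.
  by rewrite addn2 2?big_nat_recl // big1 ?addr0.
Qed.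

Lemma A_scale n r M f c : 0 < r -> A n r M f -> A n r (nu c * M) (fun x => c * f x).
Proof.
move=> r0; elim: n M f => [|n IH] M f.
  move=> [d [dM h]]; exists (c * d); split => [|x]; last by rewrite h.
  by rewrite nuM ler_wpM2l // nu_ge0.
move=> /A_inv [d [m [hc hm h]]].
apply: (A_mk (c := (fun j x => c * d j x)) (m := (fun j => nu c * m j))).
- by move=> j; exact: IH.
- move=> J; under eq_bigr do rewrite -mulrA.
  by rewrite -mulr_sumr ler_wpM2l // nu_ge0.
- move=> x hx; apply: cv_ext (cvM_l c (h x hx)) => J.
  by rewrite mulr_sumr; apply: eq_bigr => j _; rewrite mulrA.
Qed.

(* Multiplication by the monomial c x_n^k only shifts coefficients, so the general
   product is a countable sum of such products and no Cauchy product is needed. *)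
Lemma A_mul n r M M' f g : 0 < r -> A n r M f -> A n r M' g ->
  A n r (M * M') (fun x => f x * g x).
Proof.
move=> r0; elim: n M M' f g => [|n IH] M M' f g.
  move=> [c [cM h]] [d [dM h']]; exists (c * d); split => [|x]; last by rewrite h h'.
  by rewrite nuM ler_pM ?nu_ge0.
move=> /A_inv [c [m [hc hm h]]] /A_inv [d [m' [hd hm' h']]].
have m0 j : 0 <= m j by exact: A_ge0 (hc j).
have m0' j : 0 <= m' j by exact: A_ge0 (hd j).
have M0 : 0 <= M by have := hm 0%N; rewrite big_geq.
apply: (@A_csum _ _ _ (fun k x => f x * (d k x * x n ^+ k)) (fun k => M * (m' k * r ^+ k))) => //.
- move=> k.
  apply: (A_mk (c := (fun j x => if (j < k)%N then 0 else c (j - k)%N x * d k x)) (m := (fun j => if (j < k)%N then 0 else m (j - k)%N * m' k))).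
  + move=> j; case: ifP => _; first by apply: A_cst; [exact: ltW|rewrite nu0].
    exact: IH.
  + move=> J; have [Jk|kJ] := leqP J k.
      rewrite big_nat big1 => [|j /andP[_ hj]]; last by rewrite (leq_trans hj Jk) mul0r.
      by rewrite !mulr_ge0 // exprn_ge0 // ltW.
    rewrite (big_cat_nat (leq0n k) (ltnW kJ)) /= big_nat big1 => [|j /andP[_ ->]]; last by rewrite mul0r.
    rewrite add0r -{1}[k]add0n big_addn.
    apply: (@le_trans _ _ (\sum_(0 <= i < J - k) m i * r ^+ i * (m' k * r ^+ k))).
      apply: ler_sum => j _; rewrite ltnNge leq_addl /= addnK exprD.
      by rewrite le_eqVlt; apply/orP; left; apply/eqP; ring.
    by rewrite -mulr_suml ler_wpM2r // mulr_ge0 // exprn_ge0 // ltW.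
  + move=> x hx; apply: (@cv_unshift _ _ _ _ k).
    rewrite mulrC; apply: cv_ext (cvM_l (d k x * x n ^+ k) (h x hx)) => J.
    rewrite mulr_sumr (big_cat_nat (leq0n k) (leq_addl J k)) /=.
    rewrite [X in X + _]big_nat [X in X + _]big1 => [|j /andP[_ ->]]; last by rewrite mul0r.
    have bk (F : nat -> K) : \sum_(k <= i < J + k) F i = \sum_(0 <= i < J) F (i + k)%N.
      by rewrite -{1}[k]add0n big_addn addnK.
    rewrite add0r bk; apply: eq_bigr => j _.
    by rewrite ltnNge leq_addl /= addnK exprD; ring.
- by move=> J; rewrite -mulr_sumr ler_wpM2l.
- move=> x hx; apply: cv_ext (cvM_l (f x) (h' x hx)) => J.
  by rewrite mulr_sumr.
Qed.

Lemma A_exp n r M f k : 0 < r -> A n r M f -> A n r (M ^+ k) (fun x => f x ^+ k).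
Proof.
move=> r0 h; elim: k => [|k IH].
  by apply: (@A_ext _ _ _ (fun=> 1)) => //; apply: A_cst; [exact: ltW|rewrite nu1 expr0].
rewrite exprS; apply: (@A_ext _ _ _ (fun x => f x * f x ^+ k)); last exact: A_mul.
by move=> x _; rewrite exprS.
Qed.

Lemma A_comp m n r s M f (g : E -> E) : 0 < r ->
  A m s M f -> (forall i, (i < m)%N -> A n r s (fun x => g x i)) ->
  A n r M (fun x => f (g x)).
Proof.
move=> r0; elim: m M f => [|m IH] M f.
  move=> [c [cM h]] _; apply: (@A_ext _ _ _ (fun=> c)); first by move=> x _; rewrite h.
  by apply: A_cst => //; exact: ltW.
move=> /A_inv [c [w [hc hw h]]] hg.
apply: (@A_csum _ _ _ (fun j x => c j (g x) * g x m ^+ j) (fun j => w j * s ^+ j)) => //.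
- move=> j; apply: A_mul => //.
    by apply: IH => // i hi; apply: hg; exact: ltnW.
  by apply: A_exp => //; exact: hg.
- move=> x hx; apply: h => i hi.
  exact: (A_bound (ltW r0) (hg i hi)).
Qed.

(** Every monomial of f has degree at least 1, so shrinking the radius by t shrinks the norm by t.
    This makes germs vanishing at 0 small enough to be substituted into other series. *)
Lemma A_scaling n r t M f : 0 < r -> 0 <= t -> t <= 1 -> A n r M f ->
  f (fun=> 0) = 0 -> A n (t * r) (t * M) f.
Proof.
move=> r0 t0 t1; have tr : t * r <= r by rewrite ger_pMl.
elim: n M f => [|n IH] M f.
  move=> [c [cM h]]; rewrite h => c0; exists c; split => //.
  by rewrite c0 nu0 mulr_ge0 //; rewrite c0 nu0 in cM.
move=> /A_inv [c [m [hc hm h]]] f0.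
have hz : pd n.+1 r (fun=> 0) by move=> i _; rewrite nu0 ltW.
have c00 : c 0%N (fun=> 0) = 0.
  apply: etrans f0; apply: (cv_uniq _ (h _ hz)); apply: (@cv_unshift _ _ _ _ 1).
  apply: cv_ext (cv_cst _) => J; rewrite addn1 big_nat_recl // big1 => [|j _].
    by rewrite expr0 mulr1 addr0.
  by rewrite exprS mul0r mulr0.
have m0 j : 0 <= m j by exact: A_ge0 (hc j).
apply: (A_mk (c := c) (m := (fun j => if j == 0%N then t * m j else m j))).
- case=> [|j] /=; first exact: IH.
  by apply: A_shrink (hc j.+1) => //; rewrite mulr_ge0 // ltW.
- move=> J; apply: (@le_trans _ _ (\sum_(0 <= j < J) t * (m j * r ^+ j))).
    apply: ler_sum => -[|j] _ /=; first by rewrite !expr0 !mulr1.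
    rewrite exprMn mulrCA ler_wpM2r ?mulr_ge0 ?exprn_ge0 ?(ltW r0) //.
    by rewrite exprS ler_piMr ?exprn_ile1.
  by rewrite -mulr_sumr ler_wpM2l.
- move=> x hx; apply: h; exact: pd_le hx.
Qed.

End Analytic.

(** * Germs of analytic functions at the origin *)

Section Germs.
Variables (R : realType) (K : vfield R).
Local Notation E := (nat -> K).
Implicit Types (x y : E) (f g : E -> K) (r M : R) (n : nat).

Definition E0 : E := fun=> 0.

Definition upd x (i : nat) v : E := fun j => if j == i then v else x j.

Lemma upd_same x i v : upd x i v i = v.
Proof. by rewrite /upd eqxx. Qed.

Lemma upd_other x i v j : j != i -> upd x i v j = x j.
Proof. by rewrite /upd => /negbTE ->. Qed.

Definition joinE n x y : E := fun i => if (i < n)%N then x i else y (i - n)%N.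

(** Germs are represented by total functions whose radius is hidden in the existential; equality of
    germs is [near0] of pointwise equality. *)
Definition AG n f := exists r M, 0 < r /\ A n r M f.

Definition near0 n (P : E -> Prop) := exists r, 0 < r /\ forall x, pd n r x -> P x.

Lemma pd0 n r : 0 <= r -> pd n r E0.
Proof. by move=> r0 i _; rewrite nu0. Qed.

Lemma near0_at n P : near0 n P -> P E0.
Proof. by move=> [r [r0 h]]; apply: h; apply: pd0; exact: ltW. Qed.

Lemma near0I n P Q : near0 n P -> near0 n Q -> near0 n (fun x => P x /\ Q x).
Proof.
move=> [r [r0 h]] [s [s0 k]]; exists (Num.min r s); rewrite lt_min r0 s0; split => // x hx.
split; [apply: h|apply: k]; apply: pd_le hx; by rewrite ge_min lexx ?orbT.
Qed.

Lemma near0S n (P Q : E -> Prop) : (forall x, P x -> Q x) -> near0 n P -> near0 n Q.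
Proof. by move=> PQ [r [r0 h]]; exists r; split => // x hx; apply: PQ; exact: h. Qed.

Lemma near0T n (P : E -> Prop) : (forall x, P x) -> near0 n P.
Proof. by move=> h; exists 1. Qed.

Lemma near0_all n m (P : nat -> E -> Prop) : (forall i, (i < m)%N -> near0 n (P i)) ->
  near0 n (fun x => forall i, (i < m)%N -> P i x).
Proof.
elim: m => [|m IH] h; first by apply: near0T.
have := near0I (IH (fun i hi => h i (ltnW hi))) (h m (ltnSn m)).
apply: near0S => x [h1 h2] i; rewrite ltnS leq_eqVlt => /orP[/eqP -> //|]; exact: h1.
Qed.

Lemma near0_weaken n m P : (n <= m)%N -> near0 n P -> near0 m P.
Proof.
move=> nm [r [r0 h]]; exists r; split => // x hx; apply: h => i hi.
by apply: hx; exact: leq_trans nm.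
Qed.

Lemma AG_ext n f g : near0 n (fun x => f x = g x) -> AG n f -> AG n g.
Proof.
move=> [s [s0 e]] [r [M [r0 h]]].
have t0 : 0 < Num.min r s by rewrite lt_min r0.
exists (Num.min r s), M; split => //; apply: (@A_ext _ _ _ _ _ f) => [x hx|].
  by apply: e; apply: pd_le hx; rewrite ge_min lexx orbT.
by apply: A_shrink h; rewrite ?ge_min ?lexx ?(ltW t0).
Qed.

Lemma AG_ext1 n f g : f =1 g -> AG n f -> AG n g.
Proof. by move=> e; apply: AG_ext; exact: near0T. Qed.

Lemma AG_common n f g : AG n f -> AG n g -> exists r M M', [/\ 0 < r, A n r M f & A n r M' g].
Proof.
move=> [r [M [r0 h]]] [s [M' [s0 h']]].
have t0 : 0 < Num.min r s by rewrite lt_min r0.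
exists (Num.min r s), M, M'; split => //.
- by apply: A_shrink h; rewrite ?ge_min ?lexx ?(ltW t0).
- by apply: A_shrink h'; rewrite ?ge_min ?lexx ?orbT ?(ltW t0).
Qed.

Lemma AG_cst n c : AG n (fun=> c).
Proof. by exists 1, (nu c); split => //; apply: A_cst. Qed.

Lemma AG_coord n i : (i < n)%N -> AG n (fun x => x i).
Proof. by exists 1, 1; split => //; apply: A_coord. Qed.

Lemma AG_add n f g : AG n f -> AG n g -> AG n (fun x => f x + g x).
Proof.
by move=> h k; have [r [M [M' [r0 h1 h2]]]] := AG_common h k;
  exists r, (M + M'); split => //; exact: A_add.
Qed.

Lemma AG_mul n f g : AG n f -> AG n g -> AG n (fun x => f x * g x).
Proof.
by move=> h k; have [r [M [M' [r0 h1 h2]]]] := AG_common h k;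
  exists r, (M * M'); split => //; exact: A_mul.
Qed.

Lemma AG_opp n f : AG n f -> AG n (fun x => - f x).
Proof.
move=> h; apply: AG_ext1 (AG_mul (AG_cst n (-1)) h) => x; exact: mulN1r.
Qed.

Lemma AG_sub n f g : AG n f -> AG n g -> AG n (fun x => f x - g x).
Proof. by move=> h k; apply: AG_add => //; exact: AG_opp. Qed.

Lemma AG_exp n f k : AG n f -> AG n (fun x => f x ^+ k).
Proof. by move=> [r [M [r0 h]]]; exists r, (M ^+ k); split => //; exact: A_exp. Qed.

Lemma AG_sum I (s : seq I) n (F : I -> E -> K) (P : pred I) : (forall i, P i -> AG n (F i)) ->
  AG n (fun x => \sum_(i <- s | P i) F i x).
Proof.
move=> h; elim: s => [|i s IH].
  by apply: AG_ext1 (AG_cst n 0) => x; rewrite big_nil.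
case Pi: (P i); last by apply: AG_ext1 IH => x; rewrite big_cons Pi.
by apply: AG_ext1 (AG_add (h i Pi) IH) => x; rewrite big_cons Pi.
Qed.

Lemma AG_prod I (s : seq I) n (F : I -> E -> K) (P : pred I) : (forall i, P i -> AG n (F i)) ->
  AG n (fun x => \prod_(i <- s | P i) F i x).
Proof.
move=> h; elim: s => [|i s IH].
  by apply: AG_ext1 (AG_cst n 1) => x; rewrite big_nil.
case Pi: (P i); last by apply: AG_ext1 IH => x; rewrite big_cons Pi.
by apply: AG_ext1 (AG_mul (h i Pi) IH) => x; rewrite big_cons Pi.
Qed.

Lemma AG_weaken n m f : (n <= m)%N -> AG n f -> AG m f.
Proof.
move=> nm [r [M [r0 h]]]; exists r, M; split => //; apply: A_weaken nm h; exact: ltW.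
Qed.

Lemma AG_small n f e : AG n f -> f E0 = 0 -> 0 < e ->
  exists r, 0 < r /\ forall r', 0 < r' -> r' <= r -> A n r' e f.
Proof.
move=> [r [M [r0 h]]] f0 e0.
have M0 := A_ge0 h.
pose t := e / (M + e).
have Me : 0 < M + e by lra.
have t0 : 0 < t by rewrite divr_gt0.
have t1 : t <= 1 by rewrite ler_pdivrMr // mul1r; lra.
have k := A_scaling r0 (ltW t0) t1 h f0.
exists (t * r); split => [|r' r'0 r'r]; first by rewrite mulr_gt0.
apply: (A_le (M := t * M)); first by apply: A_shrink k => //; exact: ltW.
by rewrite /t mulrAC ler_pdivrMr //; nra.
Qed.

Lemma AG_small_all n m (g : nat -> E -> K) e : (forall i, (i < m)%N -> AG n (g i)) ->
  (forall i, (i < m)%N -> g i E0 = 0) -> 0 < e ->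
  exists r, 0 < r /\ forall r', 0 < r' -> r' <= r ->
    forall i, (i < m)%N -> A n r' e (g i).
Proof.
elim: m => [|m IH] h h0 e0; first by exists 1.
have [r [r0 hr]] := IH (fun i hi => h i (ltnW hi)) (fun i hi => h0 i (ltnW hi)) e0.
have [s [s0 hs]] := AG_small (h m (ltnSn m)) (h0 m (ltnSn m)) e0.
exists (Num.min r s); rewrite lt_min r0 s0; split => // r' r'0; rewrite le_min => /andP[l1 l2] i.
rewrite ltnS leq_eqVlt => /orP[/eqP ->|]; first exact: hs.
exact: hr.
Qed.

Lemma AG_comp m n f (g : E -> E) : AG m f -> (forall i, (i < m)%N -> AG n (fun x => g x i)) ->
  (forall i, (i < m)%N -> g E0 i = 0) -> AG n (fun x => f (g x)).
Proof.
move=> [s [M [s0 h]]] hg g0.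
have [r [r0 hr]] := AG_small_all (g := fun i x => g x i) hg g0 s0.
exists r, M; split => //; apply: (A_comp r0 h) => i hi; exact: hr.
Qed.

Lemma near0_comp m n P (g : E -> E) : near0 m P ->
  (forall i, (i < m)%N -> AG n (fun x => g x i)) ->
  (forall i, (i < m)%N -> g E0 i = 0) -> near0 n (fun x => P (g x)).
Proof.
move=> [s [s0 h]] hg g0.
have [r [r0 hr]] := AG_small_all (g := fun i x => g x i) hg g0 s0.
exists r; split => // x hx; apply: h => i hi.
by apply: (A_bound (ltW r0) (hr r r0 (lexx r) i hi)).
Qed.

Lemma AG_cont n f e : AG n f -> 0 < e -> near0 n (fun x => nu (f x - f E0) < e).
Proof.
move=> h e0; have e2 : 0 < e / 2 by lra.
have := AG_small (AG_sub h (AG_cst n (f E0))) (subrr _) e2.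
move=> [r [r0 hr]]; exists r; split => // x hx.
by apply: le_lt_trans (A_bound (ltW r0) (hr r r0 (lexx r)) hx) _; lra.
Qed.

Lemma AG_bounded n f : AG n f -> exists2 C, 0 < C & near0 n (fun x => nu (f x) <= C).
Proof.
move=> [r [M [r0 h]]]; exists (M + 1); first by have := A_ge0 h; lra.
exists r; split => // x hx; have := A_bound (ltW r0) h hx; lra.
Qed.

Lemma AG_neq0 n f : AG n f -> f E0 != 0 -> near0 n (fun x => f x != 0).
Proof.
move=> h f0.
have p : 0 < nu (f E0).
  rewrite lt_neqAle nu_ge0 andbT eq_sym; apply: contraNN f0 => /eqP.
  by move/nu_eq0 ->.
apply: near0S (AG_cont h p) => x; apply: contraTneq => ->.
by rewrite sub0r nuN ltxx.
Qed.

Lemma AG_dep n f : AG n f -> exists r, 0 < r /\ forall x y, pd n r x ->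
  (forall i, (i < n)%N -> x i = y i) -> f x = f y.
Proof. by move=> [r [M [r0 h]]]; exists r; split => // x y; exact: A_dep h. Qed.

(** An instance of composition: a_i + x_i has norm at most nu (a_i) + t on the polydisc of radius
    t. *)
Lemma A_recenter n r t M f (a : E) : 0 < t -> (forall i, (i < n)%N -> nu (a i) + t <= r) ->
  A n r M f -> A n t M (fun x => f (fun i => a i + x i)).
Proof.
move=> t0 ha h; apply: (A_comp t0 h (g := fun x i => a i + x i)) => i hi.
apply: (A_le (M := nu (a i) + t)); last exact: ha.
by apply: A_add => //; [apply: A_cst => //; exact: ltW|apply: A_coord => //; exact: ltW].
Qed.

(** Dividing by x_i removes one factor r from the weight of each monomial, whence M / r. These
    quotients take the place of differentiation: first derivatives are read off from them. *)
Lemma hadamard n r M f i : 0 < r -> (i < n)%N -> A n r M f ->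
  exists f', A n r (M / r) f' /\
    forall x, pd n r x -> f x = f (upd x i 0) + x i * f' x.
Proof.
move=> r0; elim: n M f => [//|n IH] M f hi /A_inv [c [m [hc hm h]]].
have pdu x : pd n.+1 r x -> pd n.+1 r (upd x i 0).
  by move=> hx l hl; rewrite /upd; case: eqP => _; [rewrite nu0 ltW|exact: hx].
have m0 j : 0 <= m j by exact: A_ge0 (hc j).
move: hi; rewrite ltnS leq_eqVlt => /orP[/eqP ei|hi].
  subst i.
  pose b x j := c j x * x n ^+ j.
  have hcu j x : pd n r x -> c j (upd x n 0) = c j x.
    move=> hx; symmetry; apply: (A_dep (hc j) hx) => l hl.
    by rewrite /upd; case: eqP => // e; rewrite e ltnn in hl.
  have hf0 x : pd n.+1 r x -> f (upd x n 0) = c 0%N x.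
    move=> hx; apply: (cv_uniq (h _ (pdu _ hx))); apply: (@cv_unshift _ _ _ _ 1).
    apply: cv_ext (cv_cst _) => J; rewrite addn1 big_nat_recl // big1 => [|j _].
      by rewrite expr0 mulr1 addr0 hcu //; exact: pdS.
    by rewrite {2}/upd eqxx exprS mul0r mulr0.
  have hmr J : \sum_(0 <= j < J) m j.+1 * r ^+ j <= M / r.
    rewrite ler_pdivlMr // mulr_suml; apply: le_trans (hm J.+1).
    rewrite big_nat_recl //= expr0 mulr1; apply: ler_wpDl => //.
    by apply: ler_sum => j _; rewrite exprSr mulrA.
  have hl x : exists l, pd n.+1 r x -> cv (fun J => \sum_(0 <= j < J) c j.+1 x * x n ^+ j) l.
    case: (pselect (pd n.+1 r x)) => [hx|]; last by exists 0.
    have hb j : nu (c j.+1 x * x n ^+ j) <= m j.+1 * r ^+ j.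
      rewrite nuM nuX; apply: ler_pM; rewrite ?exprn_ge0 ?nu_ge0 //.
        by apply: (A_bound (ltW r0) (hc j.+1)); exact: pdS.
      by apply: lerXn2r; rewrite ?nnegrE ?nu_ge0 ?(ltW r0) ?hx.
    by have [l [hl _]] := abs_cv hb hmr; exists l.
  have [f' hf'] := choice hl.
  exists f'; split.
    by apply: (A_mk (c := fun j => c j.+1) (m := fun j => m j.+1)).
  move=> x hx; apply: (cv_uniq (h _ hx)); apply: (@cv_unshift _ _ _ _ 1).
  have := cvD (cv_cst (c 0%N x)) (cvM_l (x n) (hf' x hx)).
  rewrite hf0 //; apply: cv_ext => J; rewrite addn1 big_nat_recl // expr0 mulr1.
  by rewrite mulr_sumr; congr (_ + _); apply: eq_bigr => j _; rewrite exprS mulrCA.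
have [c' hc'] := choice (fun j => IH _ _ hi (hc j)).
have mr J : \sum_(0 <= j < J) m j / r * r ^+ j <= M / r.
  under eq_bigr do rewrite mulrAC.
  by rewrite -mulr_suml ler_wpM2r // invr_ge0 ltW.
have hl x : exists l, pd n.+1 r x -> cv (fun J => \sum_(0 <= j < J) c' j x * x n ^+ j) l.
  case: (pselect (pd n.+1 r x)) => [hx|]; last by exists 0.
  have hb j : nu (c' j x * x n ^+ j) <= m j / r * r ^+ j.
    rewrite nuM nuX; apply: ler_pM; rewrite ?exprn_ge0 ?nu_ge0 //.
      by have [k _] := hc' j; apply: (A_bound (ltW r0) k); exact: pdS.
    by apply: lerXn2r; rewrite ?nnegrE ?nu_ge0 ?(ltW r0) ?hx.
  by have [l [hl _]] := abs_cv hb mr; exists l.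
have [f' hf'] := choice hl.
exists f'; split.
  apply: (A_mk (c := c') (m := fun j => m j / r)) => // j.
  by have [] := hc' j.
move=> x hx; apply: (cv_uniq (h _ hx)).
have := cvD (h _ (pdu _ hx)) (cvM_l (x i) (hf' x hx)).
apply: cv_ext => J; rewrite mulr_sumr -big_split; apply: eq_bigr => j _ /=.
rewrite [in RHS](proj2 (hc' j) x (pdS hx)).
rewrite mulrDl mulrA; congr (_ * _ + _).
by rewrite /upd; case: eqP => // e; rewrite e ltnn in hi.
Qed.

Lemma hadamard_multi N r M f s m : 0 < r -> (s + m <= N)%N -> A N r M f ->
  exists Q : nat -> E -> K, (forall j, (j < m)%N -> A N r (M / r) (Q j)) /\
    forall x, pd N r x ->
      f x = f (fun l => if (s <= l < s + m)%N then 0 else x l)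
            + \sum_(0 <= j < m) x (s + j)%N * Q j x.
Proof.
move=> r0; elim: m => [|m IH] sN h.
  exists (fun _ _ => 0); split => // x hx; rewrite big_geq // addr0; congr f.
  apply/funext => l; rewrite addn0; case: ifP => // /andP[h1 h2].
  by have := leq_ltn_trans h1 h2; rewrite ltnn.
have [Q [hQ e]] := IH ltac:(lia) h.
have smN : (s + m < N)%N by lia.
have [f' [hf' e']] := hadamard r0 smN h.
pose z x : E := fun l => if (s <= l < s + m)%N then 0 else x l.
exists (fun j => if (j < m)%N then Q j else fun x => f' (z x)); split.
  move=> j hj; case: ifP => jm; first exact: hQ.
  apply: (A_comp r0 hf' (g := z)) => i hi; rewrite /z; case: (s <= i < s + m)%N.
    by apply: A_cst; rewrite ?nu0 ltW.
  by apply: A_coord => //; exact: ltW.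
move=> x hx; rewrite e // big_nat_recr //= ltnn.
have hz : pd N r (z x).
  by move=> i hi; rewrite /z; case: ifP => _; [rewrite nu0 ltW|exact: hx].
rewrite -/(z x) (e' _ hz) -addrA; congr (f _ + _); last first.
  rewrite addrC; congr (_ + _ * _); last first.
    by rewrite /z; case: ifP => // /andP[_]; rewrite ltnn.
  by apply: eq_big_nat => j /andP[_ ->].
apply/funext => l; rewrite /upd /z; case: eqP => [->|ne].
  by rewrite addnS leq_addr ltnSn.
by have -> : (s <= l < s + m.+1)%N = (s <= l < s + m)%N by lia.
Qed.

Lemma ps_remainder (a : nat -> K) (r M : R) s l j : 0 < r ->
  (forall J, \sum_(0 <= i < J) nu (a i) * r ^+ i <= M) -> nu s <= r ->
  cv (fun J => \sum_(0 <= i < J) a i * s ^+ i) l ->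
  nu (l - \sum_(0 <= i < j) a i * s ^+ i) <= M * (nu s / r) ^+ j.
Proof.
move=> r0 aM sr h.
have q0 : 0 <= nu s / r by rewrite divr_ge0 ?nu_ge0 // ltW.
have q1 : nu s / r <= 1 by rewrite ler_pdivrMr // mul1r.
apply: (@cv_le _ _ _ _ _ _ j h) => J jJ.
rewrite (big_cat_nat (leq0n j) jJ) /= addrAC subrr add0r.
apply: le_trans (nu_sum _ _ _) _.
apply: (@le_trans _ _ (\sum_(j <= i < J) nu (a i) * r ^+ i * (nu s / r) ^+ j)).
  apply: ler_sum_nat => i /andP[ji _]; rewrite nuM nuX -mulrA ler_wpM2l ?nu_ge0 //.
  rewrite -[i in X in X <= _](subnK ji) -[i in X in _ <= X](subnK ji) !exprD.
  have -> : r ^+ (i - j) * r ^+ j * (nu s / r) ^+ j = r ^+ (i - j) * nu s ^+ j.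
    by rewrite expr_div_n -mulrA; congr (_ * _); rewrite mulrC divfK // expf_neq0 // gt_eqF.
  by rewrite ler_wpM2r ?exprn_ge0 ?nu_ge0 // lerXn2r ?nnegrE ?nu_ge0 // ltW.
rewrite -mulr_suml ler_wpM2r ?exprn_ge0 //.
apply: le_trans (aM J); rewrite (big_cat_nat (leq0n j) jJ) /= lerDr.
by apply: sum_ge0 => i; rewrite mulr_ge0 ?nu_ge0 ?exprn_ge0 // ltW.
Qed.

(** Sets on which identities of power series can be tested: the whole field, a real half line, or
    the reals inside the complex numbers. *)
Definition accum0 (S : K -> Prop) := forall e : R, 0 < e -> exists s, S s /\ 0 < nu s < e.

(** Once the earlier coefficients vanish, a_j s^j = g(s) + O(|s|^(j+1)); flatness of order j+1 then
    gives |a_j| <= const |s| for arbitrarily small s in S. *)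
Lemma ps_flat_upto (a : nat -> K) (r M : R) (g : K -> K) (S : K -> Prop) N0 : 0 < r ->
  (forall J, \sum_(0 <= i < J) nu (a i) * r ^+ i <= M) -> accum0 S ->
  (forall s, S s -> nu s <= r -> cv (fun J => \sum_(0 <= i < J) a i * s ^+ i) (g s)) ->
  (forall N, (N <= N0)%N ->
     exists C rho, 0 < rho /\ forall s, S s -> nu s <= rho -> nu (g s) <= C * nu s ^+ N) ->
  forall j, (j < N0)%N -> a j = 0.
Proof.
move=> r0 aM Sacc hg flat; elim/ltn_ind => j IH jN0.
have [C [rho [rho0 hC]]] := flat j.+1 jN0.
apply: nu_eq0; apply/eqP; rewrite eq_le nu_ge0 andbT leNgt; apply/negP => p.
have M0 : 0 <= M by have := aM 0%N; rewrite big_geq.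
pose D := `|C| + M / r ^+ j.+1 + 1.
have Mr : 0 <= M / r ^+ j.+1 by rewrite divr_ge0 // exprn_ge0 // ltW.
have D0 : 0 < D by rewrite /D; have := normr_ge0 C; lra.
have m0 : 0 < Num.min (Num.min rho r) (nu (a j) / D) by rewrite !lt_min rho0 r0 divr_gt0.
have [s [Ss /andP[s0]]] := Sacc _ m0.
rewrite !lt_min => /andP[/andP[s1 s2] s3].
have := ps_remainder j.+1 r0 aM (ltW s2) (hg s Ss (ltW s2)).
rewrite big_nat_recr //= big_nat big1 => [|i /andP[_ hi]]; last by rewrite IH ?mul0r //; clear -hi jN0; lia.
rewrite add0r => k1; have k2 := hC s Ss (ltW s1).
have k3 : nu (a j) * nu s ^+ j <= (`|C| + M / r ^+ j.+1) * nu s ^+ j.+1.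
  rewrite -nuX -nuM -[a j * _]opprK nuN.
  have -> : - (a j * s ^+ j) = (g s - a j * s ^+ j) - g s by ring.
  apply: le_trans (nuB _ _) _; rewrite mulrDl addrC; apply: lerD.
    by apply: le_trans k2 _; rewrite ler_wpM2r ?exprn_ge0 ?nu_ge0 // ler_norm.
  by move: k1; rewrite expr_div_n mulrA mulrAC.
have k4 : nu (a j) <= (`|C| + M / r ^+ j.+1) * nu s.
  by move: k3; rewrite [nu s ^+ j.+1]exprS mulrA ler_pM2r ?exprn_gt0.
move: s3; rewrite ltr_pdivlMr // /D; nra.
Qed.

Lemma ps_flat (a : nat -> K) (r M : R) (g : K -> K) (S : K -> Prop) : 0 < r ->
  (forall J, \sum_(0 <= i < J) nu (a i) * r ^+ i <= M) -> accum0 S ->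
  (forall s, S s -> nu s <= r -> cv (fun J => \sum_(0 <= i < J) a i * s ^+ i) (g s)) ->
  (forall N, exists C rho, 0 < rho /\ forall s, S s -> nu s <= rho -> nu (g s) <= C * nu s ^+ N) ->
  forall j, a j = 0.
Proof.
move=> r0 aM Sacc hg flat j.
by apply: (ps_flat_upto r0 aM Sacc hg (fun N _ => flat N) (ltnSn j)).
Qed.

(* With S the real line this compares holomorphic functions on real points. *)
Lemma A_identity n r M f (S : K -> Prop) rho : 0 < r -> accum0 S -> 0 < rho ->
  A n r M f ->
  (forall x, pd n rho x -> (forall i, (i < n)%N -> S (x i)) -> f x = 0) ->
  forall x, pd n r x -> f x = 0.
Proof.
move=> r0 Sacc rho0 hA hz.
have : exists2 rho', 0 < rho' <= r &
    forall x, pd n rho' x -> (forall i, (i < n)%N -> S (x i)) -> f x = 0.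
  exists (Num.min rho r); first by rewrite lt_min rho0 r0 ge_min lexx orbT.
  by move=> x hx; apply: hz; apply: pd_le hx; rewrite ge_min lexx.
move=> {rho rho0 hz} [rho /andP[rho0 rhor]].
elim: n M f hA => [|n IH] M f.
  by move=> [c [cM h]] z x _; rewrite h -(h E0); apply: z.
move=> /A_inv [c [m [hc hm h]]] z x hx.
suff cz j : forall y, pd n r y -> c j y = 0.
  apply: (cv_uniq (h _ hx)); apply: cv_ext (cv_cst 0) => J.
  by rewrite big1 // => j _; rewrite cz ?mul0r //; exact: pdS.
apply: (IH _ _ (hc j)) => y hy Sy.
have hyr : pd n r y := pd_le rhor hy.
apply: (@ps_flat (fun i => c i y) r M (fun s => f (upd y n s)) (fun s => S s /\ nu s <= rho)) => //.
- move=> J; apply: le_trans (hm J); apply: ler_sum => i _.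
  by rewrite ler_wpM2r ?exprn_ge0 ?(ltW r0) //; exact: A_bound (ltW r0) (hc i) hyr.
- move=> e e0; have [|s [Ss /andP[s0]]] := Sacc (Num.min e rho); first by rewrite lt_min e0.
  by rewrite lt_min => /andP[s1 s2]; exists s; rewrite s0 s1 (ltW s2).
- move=> s [Ss s1] sr.
  have hu : pd n.+1 r (upd y n s).
    by move=> i; rewrite /upd ltnS leq_eqVlt; case: eqP => //= _ hi; exact: hyr.
  apply: cv_ext (h _ hu) => J; apply: eq_bigr => i _; rewrite {2}/upd eqxx; congr (_ * _).
  symmetry; apply: (A_dep (hc i) hyr) => l hl; rewrite /upd; case: eqP => // e.
  by rewrite e ltnn in hl.
- move=> N; exists 0, rho; split => // s [Ss s1] _; rewrite z ?nu0 ?mul0r //.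
    by move=> i; rewrite /upd ltnS leq_eqVlt; case: eqP => //= _ hi; exact: hy.
  by move=> i; rewrite /upd ltnS leq_eqVlt; case: eqP => //= _ hi; exact: Sy.
Qed.

End Germs.

(** * The implicit function theorem *)

Section Implicit.
Variables (R : realType) (K : vfield R).
Local Notation E := (nat -> K).
Local Notation E0 := (E0 K).
Implicit Types (x y : E) (f g : E -> K) (r M : R) (n : nat).

Lemma eqW_le (x y : R) : x = y -> x <= y.
Proof. by move=> ->. Qed.

Lemma cv_dom m (u : nat -> K) l (v : nat -> nat -> K) (w : nat -> K) :
  (forall j, (j < m)%N -> cv (v j) (w j)) ->
  (forall k, nu (u k - l) <= \sum_(0 <= j < m) nu (v j k - w j)) -> cv u l.
Proof.
move=> hv hu e e0.
suff : exists N, forall k, (N <= k)%N -> \sum_(0 <= j < m) nu (v j k - w j) < e.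
  by move=> [N h]; exists N => k /h; apply: le_lt_trans.
elim: m hv e e0 {hu} => [|m IH] hv e e0; first by exists 0%N => k _; rewrite big_geq.
have [N1 h1] := IH (fun j hj => hv j (ltnW hj)) (e / 2) ltac:(lra).
have [N2 h2] := hv m (ltnSn m) (e / 2) ltac:(lra).
exists (maxn N1 N2) => k; rewrite geq_max => /andP[/h1 a /h2 b].
rewrite big_nat_recr //=; lra.
Qed.

Lemma AG_bounded_at0 n f j C r : AG n f -> (j < n)%N -> 0 < r ->
  (forall t : K, nu t <= r -> nu t * nu (f (upd E0 j t)) <= C * nu t ^+ 2) -> f E0 = 0.
Proof.
move=> hf jn r0 h; apply: nu_eq0; apply/eqP; rewrite eq_le nu_ge0 andbT leNgt; apply/negP => p.
have [s [s0 hs]] := AG_cont hf (divr_gt0 p (ltr0n R 2)).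
pose t := Num.min (Num.min r s) (nu (f E0) / 2 / (`|C| + 1)).
have C1 : 0 < `|C| + 1 by have := normr_ge0 C; lra.
have t0 : 0 < t by rewrite !lt_min r0 s0 !divr_gt0.
have nt : nu (emb K t) = t by rewrite nu_emb ger0_norm // ltW.
have tr : t <= r by rewrite !ge_min lexx.
have ts : t <= s by rewrite !ge_min lexx orbT.
have tC : t <= nu (f E0) / 2 / (`|C| + 1) by rewrite !ge_min lexx orbT.
have := h (emb K t); rewrite nt => /(_ tr); rewrite expr2 mulrCA ler_pM2l // => k1.
have k2 : nu (f (upd E0 j (emb K t)) - f E0) < nu (f E0) / 2.
  apply: hs => i _; rewrite /upd; case: eqP => _; first by rewrite nt.
  by rewrite nu0 ltW.
have := nuB (f (upd E0 j (emb K t))) (f (upd E0 j (emb K t)) - f E0).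
rewrite opprB addrC subrK => k3.
have k4 : C * t <= `|C| * t by rewrite ler_wpM2r ?ler_norm // ltW.
move: tC; rewrite ler_pdivlMr // mulrDr mulr1; nra.
Qed.

(** The third hypothesis says that the derivative of H_i in w_j vanishes at 0, as a quadratic bound
    on the axis of w_j. The iteration w <- H(x, w) from 0 then contracts by 1/2 in the l1 norm
    itself, so that [A_csum] makes the limit analytic. *)
Lemma implicit n m (H : nat -> E -> K) :
  (forall i, (i < m)%N -> AG (n + m) (H i)) ->
  (forall i, (i < m)%N -> H i E0 = 0) ->
  (forall i j, (i < m)%N -> (j < m)%N -> exists C r, 0 < r /\
     forall t : K, nu t <= r -> nu (H i (upd E0 (n + j) t)) <= C * nu t ^+ 2) ->
  exists th : E -> E, [/\ forall i, (i < m)%N -> AG n (fun x => th x i),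
    forall i, (i < m)%N -> th E0 i = 0 &
    near0 n (fun x => forall i, (i < m)%N -> th x i = H i (joinE n x (th x)))].
Proof.
move=> hH H0 Hd.
(* With blocks x, w, h of lengths n, m, m, the function H_i o sh is H_i(x, w + h); Hadamard division
   in the block h gives H_i(x, w + h) - H_i(x, w) = sum_j h_j Q_ij(x, w, h). *)
pose sh y : E := fun l => if (l < n)%N then y l else if (l < n + m)%N then y l + y (l + m)%N else 0.
have hsh i : (i < m)%N -> AG (n + m + m) (fun y => H i (sh y)).
  move=> hi; apply: (AG_comp (hH i hi)) => [l hl|l hl]; rewrite /sh hl; case: ltnP => hln.
  - by apply: AG_coord; lia.
  - by apply: AG_add; apply: AG_coord; lia.
  - by [].
  - by rewrite addr0.
pose z y : E := fun l => if (n + m <= l < n + m + m)%N then 0 else y l.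
have hQ i : exists Q : nat -> E -> K, (i < m)%N ->
    (forall j, (j < m)%N -> AG (n + m + m) (Q j)) /\
    near0 (n + m + m) (fun y => H i (sh y) = H i (sh (z y)) +
        \sum_(0 <= j < m) y (n + m + j)%N * Q j y).
  case: (ltnP i m) => hi; last by exists (fun _ _ => 0).
  have [r [M [r0 h]]] := hsh i hi.
  have [Q [h1 h2]] := hadamard_multi r0 (leqnn _) h.
  exists Q => _; split; first by move=> j hj; exists r, (M / r); split => //; exact: h1.
  by exists r.
have {hQ}[Q hQ] := choice hQ.
(* On the axis of h_j the division reads t Q_ij = H_i, which is O(t^2) by [Hd]. *)
have Q0 i j : (i < m)%N -> (j < m)%N -> Q i j E0 = 0.
  move=> hi hj; have [h1 [s [s0 h2]]] := hQ i hi.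
  have [C [r [r0 hC]]] := Hd i j hi hj.
  apply: (@AG_bounded_at0 _ _ (n + m + j)%N C (Num.min r s) (h1 j hj)); first by lia.
    by rewrite lt_min r0.
  move=> t; rewrite le_min => /andP[tr ts].
  have hp : pd (n + m + m) s (upd E0 (n + m + j) t).
    by move=> l _; rewrite /upd; case: eqP => _ //; rewrite nu0 ltW.
  have := h2 _ hp.
  have -> : sh (upd E0 (n + m + j)%N t) = upd E0 (n + j)%N t.
    apply/funext => l; rewrite /sh /upd /E0.
    case: ltnP => hl.
      by case: eqP => e1; case: eqP => e2 //; lia.
    case: ltnP => hl2; last by case: eqP => // e2; lia.
    by case: eqP => e1; case: eqP => e2; case: eqP => e3 //; try lia; rewrite ?add0r ?addr0.
  have -> : sh (z (upd E0 (n + m + j)%N t)) = E0.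
    apply/funext => l; rewrite /sh /z /upd /E0.
    case: ltnP => hl.
      case: ifP => // h; case: eqP => // e; lia.
    case: ltnP => hl2 //=.
    have -> : (n + m <= l + m < n + m + m)%N by lia.
    by rewrite addr0; case: eqP => // e; lia.
  rewrite H0 // add0r (bigD1_seq j) /= ?mem_index_iota ?iota_uniq //.
  rewrite big1_seq => [|l /andP[lj]]; last first.
    by rewrite mem_index_iota => hl; rewrite /upd; case: eqP => [e|_]; [lia|rewrite mul0r].
  rewrite addr0 upd_same => e; rewrite -nuM -e; exact: hC.
(* If each Q_ij has norm at most 1 / (2 (m+1)), a sum of m products with them contracts by 1/2. *)
have m1 : 0 < (2 * m.+1%:R)^-1 :> R by rewrite invr_gt0 mulr_gt0 // ltr0n.
have [sg [sg0 [hQs hid]]] : exists sg, 0 < sg /\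
   ((forall i j, (i < m)%N -> (j < m)%N -> A (n + m + m) sg (2 * m.+1%:R)^-1 (Q i j)) /\
   forall i, (i < m)%N -> forall y, pd (n + m + m) sg y -> H i (sh y) = H i (sh (z y)) +
        \sum_(0 <= j < m) y (n + m + j)%N * Q i j y).
  have [s [s0 hs]] := @near0_all _ K (n + m + m) m _ (fun i hi => proj2 (hQ i hi)).
  have : forall k, (k <= m)%N -> exists r, 0 < r /\ forall r', 0 < r' -> r' <= r ->
     forall i j, (i < k)%N -> (j < m)%N -> A (n + m + m) r' (2 * m.+1%:R)^-1 (Q i j).
    elim=> [|k IH] km; first by exists 1.
    have [r1 [r10 h1]] := IH (ltnW km).
    have [r2 [r20 h2]] := AG_small_all (proj1 (hQ k km)) (fun j hj => Q0 k j km hj) m1.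
    exists (Num.min r1 r2); rewrite lt_min r10 r20; split => // r' r'0.
    rewrite le_min => /andP[l1 l2] i j; rewrite ltnS leq_eqVlt => /orP[/eqP ->|hi] hj.
      exact: h2.
    exact: h1.
  move=> /(_ m (leqnn m)) [r [r0 hr]].
  have t0 : 0 < Num.min r s by rewrite lt_min r0.
  exists (Num.min r s); split => //; split.
    by move=> i j hi hj; apply: hr => //; rewrite ge_min lexx.
  by move=> i hi y hy; apply: hs => //; apply: pd_le hy; rewrite ge_min lexx orbT.
pose a i x := H i (joinE n x E0).
have ha i : (i < m)%N -> AG n (a i).
  move=> hi; apply: (AG_comp (hH i hi)) => l hl; rewrite /joinE; case: ltnP => // h.
    exact: AG_coord.
  exact: AG_cst.
have join00 : joinE n E0 E0 = E0 by apply/funext => l; rewrite /joinE; case: ifP.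
have a0 i : (i < m)%N -> a i E0 = 0 by move=> hi; rewrite /a join00 H0.
have [rho1 [rho10 hrho1]] := AG_small_all ha a0 (divr_gt0 sg0 (ltr0n R 4)).
pose rho := Num.min rho1 sg.
have rho0 : 0 < rho by rewrite lt_min rho10.
have rhosg : rho <= sg by rewrite ge_min lexx orbT.
have hrho : forall i, (i < m)%N -> A n rho (sg / 4) (a i).
  by apply: hrho1 => //; rewrite ge_min lexx.
pose T x (w : E) : E := fun i => if (i < m)%N then H i (joinE n x w) else 0.
have hT x w w' : pd n sg x -> (forall j, (m <= j)%N -> w j = 0) ->
    (forall j, (m <= j)%N -> w' j = 0) -> (forall j, (j < m)%N -> nu (w j) <= sg) ->
    (forall j, (j < m)%N -> nu (w' j - w j) <= sg) -> forall i, (i < m)%N ->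
    T x w' i - T x w i = \sum_(0 <= j < m) (w' j - w j) *
      Q i j (joinE n x (joinE m w (fun l => w' l - w l))).
  move=> hx wm wm' hw hw' i hi.
  set y := joinE n x _.
  have hy : pd (n + m + m) sg y.
    move=> l hl; rewrite /y /joinE; case: ltnP => h1; first exact: hx.
    by case: ltnP => h2; [apply: hw|apply: hw']; lia.
  have := hid i hi y hy.
  have -> : H i (sh y) = T x w' i.
    rewrite /T hi; congr (H i _); apply/funext => l; rewrite /sh /y /joinE.
    case: (ltnP l n) => h1 //.
    case: (ltnP l (n + m)) => h2; last by rewrite wm' //; lia.
    have -> : (l + m < n)%N = false by lia.
    have -> : (l - n < m)%N by lia.
    have -> : (l + m - n < m)%N = false by lia.
    have -> : (l + m - n - m)%N = (l - n)%N by lia.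
    by rewrite addrC subrK.
  have -> : H i (sh (z y)) = T x w i.
    rewrite /T hi; congr (H i _); apply/funext => l; rewrite /sh /z /y /joinE.
    case: (ltnP l n) => h1 //.
      by have -> : (n + m <= l < n + m + m)%N = false by lia.
    case: (ltnP l (n + m)) => h2 /=; last by rewrite wm //; lia.
    have -> : (n + m <= l + m < n + m + m)%N by lia.
    have -> : (l - n < m)%N by lia.
    by rewrite addr0.
  move=> ->; rewrite addrAC subrr add0r; apply: eq_big_nat => j /andP[_ hj].
  congr (_ * _); rewrite /y /joinE.
  have -> : (n + m + j < n)%N = false by lia.
  have -> : (n + m + j - n < m)%N = false by lia.
  by have -> : (n + m + j - n - m)%N = j by lia.
pose th k x : E := iter k (T x) E0.
have thm k x j : (m <= j)%N -> th k x j = 0.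
  by case: k => [|k] //= mj; rewrite /th /= /T ltnNge mj.
have half k : (2^-1 : R) ^+ k.+1 = 2^-1 * 2^-1 ^+ k by rewrite exprS.
have hk0 k : 0 < (2^-1 : R) ^+ k by rewrite exprn_gt0.
(* The increments sg/4 2^-k add up to sg/2 (1 - 2^-k), which keeps the iterates in the polydisc
   where the Q_ij are controlled. *)
have main k : (forall i, (i < m)%N -> A n rho (sg / 2 * (1 - 2^-1 ^+ k)) (fun x => th k x i)) /\
   (forall i, (i < m)%N -> A n rho (sg / 4 * 2^-1 ^+ k) (fun x => th k.+1 x i - th k x i)).
  elim: k => [|k [IH1 IH2]].
    split => i hi.
      by rewrite expr0 subrr mulr0; apply: A_cst; rewrite ?nu0 // ltW.
    rewrite expr0 mulr1; apply: A_ext (hrho i hi) => x _.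
    by rewrite /th /= /T hi /a subr0.
  have B1 i : (i < m)%N -> A n rho (sg / 2 * (1 - 2^-1 ^+ k.+1)) (fun x => th k.+1 x i).
    move=> hi; apply: (@A_ext _ _ _ _ _ (fun x => (th k.+1 x i - th k x i) + th k x i)).
      by move=> x _; rewrite subrK.
    apply: (A_le (A_add rho0 (IH2 i hi) (IH1 i hi))); rewrite half; lra.
  split => // i hi.
  have bd1 j x : (j < m)%N -> pd n rho x -> nu (th k x j) <= sg.
    move=> hj hx; have := A_bound (ltW rho0) (IH1 j hj) hx; have := hk0 k; nra.
  have k1 : (2^-1 : R) ^+ k <= 1 by rewrite exprn_ile1 //; lra.
  have bd2 j x : (j < m)%N -> pd n rho x -> nu (th k.+1 x j - th k x j) <= sg.
    move=> hj hx; have := A_bound (ltW rho0) (IH2 j hj) hx; have := hk0 k; nra.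
  apply: (@A_ext _ _ _ _ _ (fun x => \sum_(0 <= j < m) (th k.+1 x j - th k x j) *
      Q i j (joinE n x (joinE m (th k x) (fun l => th k.+1 x l - th k x l))))).
    move=> x hx; rewrite -hT //.
    - exact: pd_le hx.
    - by move=> j; exact: thm.
    - by move=> j; exact: thm.
    - by move=> j hj; exact: bd1.
    - by move=> j hj; exact: bd2.
  have term j : (j < m)%N -> A n rho (sg / 4 * 2^-1 ^+ k * (2 * m.+1%:R)^-1)
      (fun x => (th k.+1 x j - th k x j) *
      Q i j (joinE n x (joinE m (th k x) (fun l => th k.+1 x l - th k x l)))).
    move=> hj; apply: A_mul => //; first exact: IH2.
    apply: (A_comp rho0 (hQs i j hi hj)) => l hl; rewrite /joinE.
    case: (ltnP l n) => h1.
      by apply: (A_le (M := rho)) => //; apply: A_coord => //; exact: ltW.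
    case: (ltnP (l - n) m) => h2.
      apply: (A_le (IH1 _ h2)); have := hk0 k; nra.
    by apply: (A_le (IH2 _ _)); [lia|have := hk0 k; nra].
  have : forall q, (q <= m)%N -> A n rho (q%:R * (sg / 4 * 2^-1 ^+ k * (2 * m.+1%:R)^-1))
      (fun x => \sum_(0 <= j < q) (th k.+1 x j - th k x j) *
      Q i j (joinE n x (joinE m (th k x) (fun l => th k.+1 x l - th k x l)))).
    elim=> [|q IHq] hq.
      apply: (@A_ext _ _ _ _ _ (fun=> 0)) => [x _|]; first by rewrite big_geq.
      by rewrite mul0r; apply: A_cst; rewrite ?nu0 // ltW.
    apply: (@A_ext _ _ _ _ _ (fun x => (\sum_(0 <= j < q) (th k.+1 x j - th k x j) *
      Q i j (joinE n x (joinE m (th k x) (fun l => th k.+1 x l - th k x l)))) +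
      (th k.+1 x q - th k x q) *
      Q i q (joinE n x (joinE m (th k x) (fun l => th k.+1 x l - th k x l))))).
      by move=> x _; rewrite big_nat_recr.
    apply: (A_le (A_add rho0 (IHq (ltnW hq)) (term q hq))).
    by apply: eqW_le; rewrite -[q.+1%:R]natr1; ring.
  move=> /(_ m (leqnn m)) h; apply: (A_le h).
  have mm : m%:R * (2 * m.+1%:R)^-1 <= (2^-1 : R).
    rewrite ler_pdivrMr ?mulr_gt0 ?ltr0n // mulKf ?pnatr_eq0 //.
    by rewrite ler_nat.
  have -> : sg / 4 * 2^-1 ^+ k.+1 = sg / 4 * 2^-1 ^+ k * 2^-1 by rewrite half; ring.
  by rewrite mulrCA ler_wpM2l // mulr_ge0 ?(ltW (hk0 k)) // divr_ge0 // ltW.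
have hsum J : \sum_(0 <= k < J) sg / 4 * 2^-1 ^+ k <= sg / 2.
  suff -> : \sum_(0 <= k < J) sg / 4 * 2^-1 ^+ k = sg / 2 * (1 - 2^-1 ^+ J).
    by have := hk0 J; nra.
  elim: J => [|J IH]; first by rewrite big_geq // expr0 subrr mulr0.
  by rewrite big_nat_recr //= IH half; lra.
have telesc k x i : \sum_(0 <= l < k) (th l.+1 x i - th l x i) = th k x i.
  elim: k => [|k IH]; first by rewrite big_geq.
  by rewrite big_nat_recr //= IH addrC subrK.
have hlim (xi : E * nat) : exists l : K, ((m <= xi.2)%N -> l = 0) /\
    ((xi.2 < m)%N -> pd n rho xi.1 -> cv (fun k => th k xi.1 xi.2) l /\ nu l <= sg / 2).
  case: xi => x i /=; case: (ltnP i m) => hi; last by exists 0; split.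
  case: (pselect (pd n rho x)) => hx; last by exists 0; split => //; lia.
  have [l [hl lM]] := abs_cv (fun k => A_bound (ltW rho0) (proj2 (main k) i hi) hx) hsum.
  exists l; split => [|_ _]; first by lia.
  by split => //; apply: cv_ext hl => k.
have [L hL] := choice hlim.
exists (fun x i => L (x, i)); split.
- move=> i hi; exists rho, (sg / 2); split => //.
  apply: (@A_csum _ _ _ _ _ (fun k x => th k.+1 x i - th k x i) (fun k => sg / 4 * 2^-1 ^+ k)) => //.
    by move=> k; exact: (proj2 (main k) i hi).
  move=> x hx; have [_ /(_ hi hx) [h _]] := hL (x, i).
  by apply: cv_ext h => k; rewrite telesc.
- move=> i hi; have [_ h] := hL (E0, i).
  have [h1 _] := h hi (@pd0 R K n rho (ltW rho0)).
  apply: (cv_uniq h1); apply: cv_ext (cv_cst 0) => k /=.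
  have -> : th k E0 = E0; last by [].
  elim: k => [|k IH] //; rewrite /th /= -/(th k E0) IH; apply/funext => l.
  by rewrite /T join00; case: ltnP => // h2; rewrite H0.
- exists rho; split => // x hx i hi.
  have Lc j : (j < m)%N -> cv (fun k => th k x j) (L (x, j)) /\ nu (L (x, j)) <= sg / 2.
    by move=> hj; have [_ /(_ hj hx)] := hL (x, j).
  have [h1 _] := Lc i hi.
  apply: (cv_uniq (cv_shift 1 h1)).
  apply: (@cv_dom m _ _ (fun j k => th k x j) (fun j => L (x, j))).
    by move=> j hj; have [] := Lc j hj.
  move=> k; have -> : th (k + 1)%N x i = T x (th k x) i by rewrite addn1.
  have -> : H i (joinE n x (fun i0 => L (x, i0))) = T x (fun j => L (x, j)) i by rewrite /T hi.
  have bd j : (j < m)%N -> nu (th k x j) <= sg / 2.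
    move=> hj; have := A_bound (ltW rho0) (proj1 (main k) j hj) hx; have := hk0 k; nra.
  rewrite nu_sym hT //.
  + apply: le_trans (nu_sum _ _ _) _; apply: ler_sum_nat => j /andP[_ hj].
    rewrite nuM nu_sym ler_piMr ?nu_ge0 //.
    apply: le_trans (A_bound (ltW sg0) (hQs i j hi hj) _) _.
      move=> l hl; rewrite /joinE; case: (ltnP l n) => h2.
        exact: le_trans (hx _ h2) rhosg.
      case: (ltnP (l - n) m) => h3; first by have := bd _ h3; lra.
      have h4 : (l - n - m < m)%N by lia.
      apply: le_trans (nuB _ _) _; have [_ a1] := Lc _ h4; have := bd _ h4; lra.
    rewrite invf_le1 ?mulr_gt0 ?ltr0n //.
    have : 1 <= m.+1%:R :> R by rewrite ler1n.
    lra.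
  + exact: pd_le hx.
  + by move=> j; exact: thm.
  + by move=> j hj; have [h2 _] := hL (x, j); exact: h2.
  + by move=> j hj; have := bd _ hj; lra.
  + move=> j hj; apply: le_trans (nuB _ _) _; have [_ a1] := Lc _ hj; have := bd _ hj; lra.
Qed.

End Implicit.

(** * The real and complex numbers as valued fields *)

Section Instances.
Variable R : realType.

Lemma real_complete (u : nat -> R) :
  (forall e, 0 < e -> exists N, forall m n, (N <= m)%N -> (N <= n)%N -> `|u m - u n| < e) ->
  exists l, forall e, 0 < e -> exists N, forall n, (N <= n)%N -> `|u n - l| < e.
Proof.
move=> hu.
have : cvg (u n @[n --> \oo]).
  apply/cauchy_cvgP/cauchyP => e e0; have [N hN] := hu e e0.
  exists (u N), N => //= n /= Nn; exact: hN.
move=> /cvg_ex [l /cvgrPdist_lt hl]; exists l => e /hl [N _ hN].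
by exists N => n Nn; rewrite distrC; exact: hN.
Qed.

Definition vR : vfield R := @VField R R (fun x => `|x|) id
  (fun x => normr_ge0 x) (fun x => @normr0_eq0 R R x) (fun x y => normrM x y)
  (fun x y => ler_normD x y) (fun t => erefl) (fun s t => erefl) (fun s t => erefl)
  erefl real_complete.

(** The norm on [R[i]] takes values in [R[i]]; a [vfield] wants a real absolute value. *)
Definition nuC (z : R[i]) : R := complex.Re `|z|.

Lemma nuCE z : `|z| = ((nuC z)%:C)%C.
Proof. by rewrite /nuC normc_def. Qed.

Lemma nuC_ge0 z : 0 <= nuC z.
Proof. by have := normr_ge0 z; rewrite nuCE ler0c. Qed.

Lemma nuC_eq0 z : nuC z = 0 -> z = 0.
Proof. by move=> h; apply/eqP; rewrite -normr_eq0 nuCE h. Qed.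

Lemma nuCM z w : nuC (z * w) = nuC z * nuC w.
Proof. by apply: complexI; rewrite rmorphM /= -!nuCE normrM. Qed.

Lemma nuCD z w : nuC (z + w) <= nuC z + nuC w.
Proof. by rewrite -lecR rmorphD /= -!nuCE ler_normD. Qed.

Lemma nuC_real t : nuC (t%:C)%C = `|t|.
Proof. by rewrite /nuC normc_def /= expr0n addr0 sqrtr_sqr. Qed.

Lemma nuC_Re z : `|complex.Re z| <= nuC z.
Proof. by rewrite -lecR -nuCE normc_ge_Re. Qed.

Lemma nuC_Im z : `|complex.Im z| <= nuC z.
Proof.
rewrite /nuC normc_def /= -sqrtr_sqr ler_wsqrtr // lerDr sqr_ge0 //.
Qed.

Lemma nuC_le z : nuC z <= `|complex.Re z| + `|complex.Im z|.
Proof.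
rewrite {1}(complexE z); apply: le_trans (nuCD _ _) _; rewrite nuCM !nuC_real.
suff -> : nuC 'i%C = 1 by rewrite mul1r.
by rewrite /nuC normc_def /= expr0n expr1n add0r sqrtr1.
Qed.

Lemma complex_complete (u : nat -> R[i]) :
  (forall e, 0 < e -> exists N, forall m n, (N <= m)%N -> (N <= n)%N -> nuC (u m - u n) < e) ->
  exists l, forall e, 0 < e -> exists N, forall n, (N <= n)%N -> nuC (u n - l) < e.
Proof.
move=> hu.
have ReB (z w : R[i]) : complex.Re (z - w) = complex.Re z - complex.Re w by case: z; case: w.
have ImB (z w : R[i]) : complex.Im (z - w) = complex.Im z - complex.Im w by case: z; case: w.
have [a ha] : exists a, forall e, 0 < e -> exists N, forall n, (N <= n)%N ->
    `|complex.Re (u n) - a| < e.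
  apply: real_complete => e /hu [N hN]; exists N => m n hm hn.
  by rewrite -ReB; apply: le_lt_trans (nuC_Re _) (hN _ _ hm hn).
have [b hb] : exists b, forall e, 0 < e -> exists N, forall n, (N <= n)%N ->
    `|complex.Im (u n) - b| < e.
  apply: real_complete => e /hu [N hN]; exists N => m n hm hn.
  by rewrite -ImB; apply: le_lt_trans (nuC_Im _) (hN _ _ hm hn).
exists (Complex a b) => e e0.
have [N1 h1] := ha (e / 2) ltac:(lra); have [N2 h2] := hb (e / 2) ltac:(lra).
exists (maxn N1 N2) => n; rewrite geq_max => /andP[/h1 k1 /h2 k2].
by apply: le_lt_trans (nuC_le _) _; rewrite ReB ImB /=; lra.
Qed.

Definition vC : vfield R := @VField R R[i] nuC (fun t => (t%:C)%C)
  nuC_ge0 nuC_eq0 nuCM nuCD nuC_real (fun s t => rmorphD _ s t)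
  (fun s t => rmorphM _ s t) erefl complex_complete.

End Instances.

(** * Partial sums by total degree *)

Section TotalDegree.

(** The sum over multi-indices of total degree at most N, as in [psum], but unfolded along the last
    exponent like the nested series of [A]. *)
Fixpoint tsum (V : nmodType) n (w : (nat -> nat) -> V) (N : nat) : V :=
  match n with
  | 0%N => w (fun=> 0%N)
  | n'.+1 => \sum_(0 <= j < N.+1)
      tsum n' (fun al => w (fun i => if i == n' then j else al i)) (N - j)%N
  end.

Lemma tsum_ext (V : nmodType) n (w w' : (nat -> nat) -> V) N :
  (forall al, (forall i, (n <= i)%N -> al i = 0%N) -> w al = w' al) ->
  tsum n w N = tsum n w' N.
Proof.
elim: n w w' N => [|n IH] w w' N h /=; first exact: h.
apply: eq_bigr => j _; apply: IH => al hal; apply: h => i hi.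
by case: eqP => [e|_]; [lia|apply: hal; lia].
Qed.

Lemma tsumMr (S : pzSemiRingType) n (w : (nat -> nat) -> S) c N :
  tsum n (fun al => w al * c) N = tsum n w N * c.
Proof.
elim: n w N => [|n IH] w N //=.
by rewrite mulr_suml; apply: eq_bigr => j _; rewrite IH.
Qed.

Lemma tsum_morph (V W : nmodType) (g : V -> W) n (w : (nat -> nat) -> V) N :
  g 0 = 0 -> (forall x y, g (x + y) = g x + g y) ->
  g (tsum n w N) = tsum n (fun al => g (w al)) N.
Proof.
move=> g0 gD; elim: n w N => [|n IH] w N //=.
rewrite (big_morph g gD g0); apply: eq_bigr => j _; exact: IH.
Qed.

Definition extI n B (al : {ffun 'I_n -> 'I_B}) : nat -> nat :=
  fun i => if insub i is Some j then (al j : nat) else 0%N.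

Lemma extI_ord n B (al : {ffun 'I_n -> 'I_B}) (i : 'I_n) : extI al i = al i.
Proof. by rewrite /extI valK. Qed.

(** The box of exponents only provides a finite index type, so any side beyond N gives the same sum.
    The bijection [glue] splits off the last exponent. *)
Lemma box_tsum (V : nmodType) n (w : (nat -> nat) -> V) N B : (N <= B)%N ->
  \sum_(al : {ffun 'I_n -> 'I_B.+1} | (\sum_i (al i : nat) <= N)%N) w (extI al)
  = tsum n w N.
Proof.
elim: n w N => [|n IH] w N NB /=.
  rewrite (big_pred1 [ffun=> ord0]) => [|al].
    by congr w; apply/funext => i; rewrite /extI insubF.
  rewrite big_ord0 leq0n; symmetry; apply/eqP/ffunP => -[i hi] //.
pose glue (p : 'I_B.+1 * {ffun 'I_n -> 'I_B.+1}) : {ffun 'I_n.+1 -> 'I_B.+1} :=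
  [ffun i => if unlift ord_max i is Some k then p.2 k else p.1].
have gl_max p : glue p ord_max = p.1 by rewrite ffunE unlift_none.
have gl_lift p k : glue p (lift ord_max k) = p.2 k by rewrite ffunE liftK.
rewrite (reindex glue) /=; last first.
  exists (fun al => (al ord_max, [ffun k => al (lift ord_max k)])).
    by move=> [j be] _; rewrite gl_max; congr pair; apply/ffunP => k; rewrite ffunE gl_lift.
  move=> al _; apply/ffunP => i; case: (unliftP ord_max i) => [k ->|->].
    by rewrite gl_lift ffunE.
  by rewrite gl_max.
have wid k : widen_ord (leqnSn n) k = lift ord_max k by apply: val_inj; rewrite /= /bump leqNgt ltn_ord.
have sumg p : (\sum_i (glue p i : nat) = \sum_k (p.2 k : nat) + p.1)%N.
  by rewrite big_ord_recr /= gl_max; congr addn; apply: eq_bigr => k _; rewrite wid gl_lift.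
rewrite (eq_bigl (fun p : 'I_B.+1 * {ffun 'I_n -> 'I_B.+1} =>
  xpredT p.1 && (\sum_k (p.2 k : nat) + p.1 <= N)%N)); last by move=> p; rewrite sumg.
rewrite -(pair_big_dep xpredT (fun (j : 'I_B.+1) (be : {ffun 'I_n -> 'I_B.+1}) =>
   (\sum_k (be k : nat) + j <= N)%N) (fun j be => w (extI (glue (j, be))))) /=.
have ext_gl j be : extI (glue (j, be)) = fun i => if i == n then (j : nat) else extI be i.
  apply/funext => i; rewrite /extI; case: (insubP _ i) => [u hu ui|hi].
    case: (unliftP ord_max u) => [k e|e].
      rewrite e gl_lift /=; have ei : i = k :> nat by rewrite -ui e -wid.
      have -> : (i == n) = false by rewrite ei; have := ltn_ord k; lia.
      by rewrite ei valK.
    by rewrite e gl_max /=; have -> : i == n by rewrite -ui e /= eqxx.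
  have -> : (i == n) = false by lia.
  by rewrite insubF //; lia.
pose G j := \sum_(be : {ffun 'I_n -> 'I_B.+1} |
  (\sum_k (be k : nat) + j <= N)%N) w (fun i => if i == n then j else extI be i).
transitivity (\sum_(0 <= j < B.+1) G j).
  rewrite big_mkord; apply: eq_bigr => j _; apply: eq_bigr => be _; by rewrite ext_gl.
have NB1 : (N.+1 <= B.+1)%N by [].
rewrite (big_cat_nat (leq0n N.+1) NB1) /= [X in _ + X]big_nat [X in _ + X]big1 ?addr0.
  apply: eq_big_nat => j /andP[_ jN].
  rewrite -IH; last by lia.
  by apply: eq_bigl => be; lia.
move=> j /andP[jN _]; apply: big_pred0 => be; lia.
Qed.

Lemma tsum_le (R : realType) n (w w' : (nat -> nat) -> R) N :
  (forall al, w al <= w' al) -> tsum n w N <= tsum n w' N.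
Proof.
elim: n w w' N => [|n IH] w w' N h /=; first exact: h.
by apply: ler_sum => j _; apply: IH.
Qed.

Lemma nu_tsum (R : realType) (K : vfield R) n (w : (nat -> nat) -> K) N :
  nu (tsum n w N) <= tsum n (fun al => nu (w al)) N.
Proof.
elim: n w N => [|n IH] w N //=.
by apply: le_trans (nu_sum _ _ _) _; apply: ler_sum => j _; apply: IH.
Qed.

End TotalDegree.

(** * Nested sums and sums by total degree *)

Section Tannery.
Variables (R : realType) (K : vfield R).

(** Dominated convergence for inner sums truncated at N - j: the summable bound b_j disposes of all
    but finitely many j, uniformly in N. *)
Lemma tannery (a : nat -> nat -> K) (b : nat -> R) M (l : nat -> K) f :
  (forall j k, nu (a j k) <= b j) -> (forall J, \sum_(0 <= j < J) b j <= M) ->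
  (forall j, cv (a j) (l j)) -> cv (fun J => \sum_(0 <= j < J) l j) f ->
  cv (fun N => \sum_(0 <= j < N.+1) a j (N - j)%N) f.
Proof.
move=> ab bM al lf e e0.
have b0 j : 0 <= b j := le_trans (nu_ge0 _) (ab j 0%N).
have e4 : 0 < e / 4 by lra.
have [N0 hN0] := bounded_tail b0 bM e4.
have lb j : nu (l j) <= b j by apply: (cv_nu_le (al j)) => k; exact: ab.
have k1 : cv (fun N => \sum_(0 <= j < N0) a j (N - j)%N) (\sum_(0 <= j < N0) l j).
  apply: cv_sum => j; apply: (@cv_unshift _ _ _ _ j); apply: cv_ext (al j) => k.
  by rewrite addnK.
have [N1 hN1] := k1 _ e4.
exists (maxn N0 N1) => N; rewrite geq_max => /andP[h0 /hN1 h1].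
rewrite (big_cat_nat (leq0n N0) (leqW h0)) /=.
have k2 : nu (f - \sum_(0 <= j < N0) l j) <= e / 4.
  apply: (@cv_le _ _ _ _ _ _ N0 lf) => J hJ.
  rewrite (big_cat_nat (leq0n N0) hJ) /= addrAC subrr add0r.
  apply: le_trans (nu_sum _ _ _) _; apply: le_trans (ltW (hN0 _ _ (leqnn _) hJ)).
  exact: ler_sum.
have k3 : nu (\sum_(N0 <= j < N.+1) a j (N - j)%N) <= e / 4.
  apply: le_trans (nu_sum _ _ _) _; apply: le_trans (ltW (hN0 _ _ (leqnn _) (leqW h0))).
  exact: ler_sum.
move: h1 k2 k3; set p := \sum_(0 <= j < N0) _; set q := \sum_(0 <= j < N0) _; set s := \sum_(_ <= _ < _) _.
move=> h1 k2 k3.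
have -> : p + s - f = (p - q) + (s - (f - q)) by ring.
have := nuD (p - q) (s - (f - q)); have := nuB s (f - q); lra.
Qed.

Definition mono n (x : nat -> K) (al : nat -> nat) : K := \prod_(0 <= i < n) x i ^+ al i.

Lemma nu_mono n x al : nu (mono n x al) = \prod_(0 <= i < n) nu (x i) ^+ al i.
Proof.
rewrite /mono; elim: n => [|n IH]; first by rewrite !big_geq // nu1.
by rewrite !big_nat_recr //= nuM nuX IH.
Qed.

Lemma nu_mono_le n r x al : 0 <= r -> pd n r x ->
  nu (mono n x al) <= \prod_(0 <= i < n) r ^+ al i.
Proof.
move=> r0; rewrite /mono; elim: n => [|n IH] hx; first by rewrite !big_geq // nu1.
rewrite !big_nat_recr //= nuM nuX; apply: ler_pM; rewrite ?exprn_ge0 ?nu_ge0 //.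
  by apply: IH; exact: pdS.
by apply: lerXn2r; rewrite ?nnegrE ?nu_ge0 ?hx.
Qed.

(** Collects the nested coefficients by multi-index. By [tannery], truncating at total degree N
    instead of letting the inner sums run to infinity does not change the limit. *)
Lemma A_tsum n r M (f : (nat -> K) -> K) : 0 < r -> A n r M f ->
  exists b : (nat -> nat) -> K,
   (forall N, tsum n (fun al => nu (b al) * \prod_(0 <= i < n) r ^+ al i) N <= M) /\
   forall x, pd n r x -> cv (fun N => tsum n (fun al => b al * mono n x al) N) (f x).
Proof.
move=> r0; elim: n M f => [|n IH] M f.
  move=> [c [cM h]]; exists (fun=> c); split => [N|x _] /=.
    by rewrite big_geq // mulr1.
  by apply: cv_ext (cv_cst _) => N; rewrite h /= /mono big_geq // mulr1.
move=> /A_inv [c [m [hc hm h]]].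
have [b hb] := choice (fun j => IH _ _ (hc j)).
exists (fun al => b (al n) (fun i => if i == n then 0%N else al i)).
have red (al : nat -> nat) j : (forall i, (n <= i)%N -> al i = 0%N) ->
    (fun i => if i == n then 0%N else if i == n then j else al i) = al.
  by move=> hal; apply/funext => i; case: eqP => // ->; rewrite hal.
have redp (S : pzSemiRingType) (y : nat -> S) al j :
    \prod_(0 <= i < n.+1) y i ^+ (if i == n then j else al i) =
    \prod_(0 <= i < n) y i ^+ al i * y n ^+ j.
  rewrite big_nat_recr //= eqxx; congr (_ * _); apply: eq_big_nat => i /andP[_ hi].
  by case: eqP => // e; rewrite e ltnn in hi.
have split1 N j : tsum n (fun al => nu (b ((fun i => if i == n then j else al i) n)
     (fun i => if i == n then 0%N else if i == n then j else al i)) *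
      \prod_(0 <= i < n.+1) r ^+ (if i == n then j else al i)) N =
   tsum n (fun al => nu (b j al) * \prod_(0 <= i < n) r ^+ al i) N * r ^+ j.
  rewrite -tsumMr; apply: tsum_ext => al hal /=; rewrite eqxx red //.
  by rewrite (redp R (fun=> r)) mulrA.
have split2 N j x : tsum n (fun al => b ((fun i => if i == n then j else al i) n)
     (fun i => if i == n then 0%N else if i == n then j else al i) *
      mono n.+1 x (fun i => if i == n then j else al i)) N =
   tsum n (fun al => b j al * mono n x al) N * x n ^+ j.
  rewrite -tsumMr; apply: tsum_ext => al hal /=; rewrite eqxx red //.
  by rewrite /mono (redp K x) mulrA.
split=> [N|x hx] /=.
  apply: le_trans (hm N.+1); apply: ler_sum => j _; rewrite split1.
  by rewrite ler_wpM2r ?exprn_ge0 ?(ltW r0) //; have [k _] := hb j; exact: k.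
have := @tannery (fun j k => tsum n (fun al => b j al * mono n x al) k * x n ^+ j)
  (fun j => m j * r ^+ j) M (fun j => c j x * x n ^+ j) (f x).
move=> T; apply: cv_ext (T _ hm _ (h x hx)).
- by move=> N; apply: eq_bigr => j _; rewrite split2.
- move=> j k; rewrite nuM nuX; apply: ler_pM; rewrite ?exprn_ge0 ?nu_ge0 //; last first.
    by apply: lerXn2r; rewrite ?nnegrE ?nu_ge0 ?(ltW r0) ?hx.
  have [k1 _] := hb j; apply: le_trans (k1 k).
  apply: le_trans (nu_tsum _ _ _) _; apply: tsum_le => al.
  by rewrite nuM ler_wpM2l ?nu_ge0 //; apply: nu_mono_le (ltW r0) (pdS hx).
- move=> j; have [_ k2] := hb j; have := cvM_l (x n ^+ j) (k2 x (pdS hx)).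
  by rewrite mulrC; apply: cv_ext => N; rewrite mulrC.
Qed.

Lemma A_sum I (s : seq I) (P : pred I) n r (M : I -> R) (F : I -> (nat -> K) -> K) : 0 < r ->
  (forall i, P i -> A n r (M i) (F i)) ->
  A n r (\sum_(i <- s | P i) M i) (fun x => \sum_(i <- s | P i) F i x).
Proof.
move=> r0 h; elim: s => [|i s IH].
  rewrite big_nil; apply: (@A_ext _ _ _ _ _ (fun=> 0)) => [x _|]; first by rewrite big_nil.
  by apply: A_cst; rewrite ?nu0 ?(ltW r0).
rewrite big_cons; case Pi: (P i); last first.
  by apply: A_ext IH => x _; rewrite big_cons Pi.
apply: (@A_ext _ _ _ _ _ (fun x => F i x + \sum_(j <- s | P j) F j x)) => [x _|].
  by rewrite big_cons Pi.
by apply: A_add => //; exact: h.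
Qed.

Lemma A_mono n r m al : 0 < r -> (m <= n)%N ->
  A n r (\prod_(0 <= i < m) r ^+ al i) (fun x => mono m x al).
Proof.
move=> r0; elim: m => [|m IH] hm.
  apply: (@A_ext _ _ _ _ _ (fun=> 1)) => [x _|]; first by rewrite /mono big_geq.
  by rewrite big_geq //; apply: A_cst; rewrite ?nu1 ?(ltW r0).
rewrite big_nat_recr //=.
apply: (@A_ext _ _ _ _ _ (fun x => mono m x al * x m ^+ al m)) => [x _|].
  by rewrite /mono big_nat_recr.
apply: A_mul => //; first by apply: IH; exact: ltnW.
by apply: A_exp => //; apply: A_coord => //; exact: ltW.
Qed.

End Tannery.

(** * Analyticity on row vectors and germs on sequences *)

Section Conversion.

Definition rowE (V : Type) n (x : nat -> V) : 'rV[V]_n := \row_i x i.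

Definition seqE (V : nmodType) n (z : 'rV[V]_n) : nat -> V :=
  fun i => if insub i is Some j then z ord0 j else 0.

Lemma seqE_ord (V : nmodType) n (z : 'rV[V]_n) (i : 'I_n) : seqE z i = z ord0 i.
Proof. by rewrite /seqE valK. Qed.

Lemma seqE_out (V : nmodType) n (z : 'rV[V]_n) i : (n <= i)%N -> seqE z i = 0.
Proof. by move=> hi; rewrite /seqE; case: insubP => // u; rewrite ltnNge hi. Qed.

Lemma seqEK (V : nmodType) n (z : 'rV[V]_n) : rowE n (seqE z) = z.
Proof. by apply/rowP => i; rewrite mxE seqE_ord. Qed.

Lemma rowEK (V : nmodType) n (x : nat -> V) i : (i < n)%N -> seqE (rowE n x) i = x i.
Proof. by move=> hi; rewrite (seqE_ord _ (Ordinal hi)) mxE. Qed.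

Lemma psum_box (V : numDomainType) n (a : ('I_n -> nat) -> V) (h : 'rV[V]_n) N B :
  (N <= B)%N ->
  psum a h N = \sum_(al : {ffun 'I_n -> 'I_B.+1} | (\sum_i (al i : nat) <= N)%N)
     a (fun i => (al i : nat)) * \prod_i (h ord0 i) ^+ (al i : nat).
Proof.
move=> NB.
pose w (al : nat -> nat) := a (fun i : 'I_n => al i) * \prod_(i < n) h ord0 i ^+ al i.
have e B' : (N <= B')%N -> \sum_(al : {ffun 'I_n -> 'I_B'.+1} | (\sum_i (al i : nat) <= N)%N)
     a (fun i => (al i : nat)) * \prod_i (h ord0 i) ^+ (al i : nat) = tsum n w N.
  move=> hB; rewrite -(box_tsum n w hB); apply: eq_bigr => al _; rewrite /w; congr (a _ * _).
    by apply/funext => i; rewrite extI_ord.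
  by apply: eq_bigr => i _; rewrite extI_ord.
by rewrite /psum !e.
Qed.

Lemma psum_tsum (V : numDomainType) n (b : (nat -> nat) -> V) (h : 'rV[V]_n) N :
  psum (fun al => b (fun i => if insub i is Some j then al j else 0%N)) h N =
  tsum n (fun al => b al * \prod_(0 <= i < n) seqE h i ^+ al i) N.
Proof.
rewrite -(box_tsum n _ (leqnn N)) /psum; apply: eq_bigr => al _; congr (_ * _).
by rewrite big_mkord; apply: eq_bigr => i _; rewrite seqE_ord extI_ord.
Qed.

Lemma pabs_tsum (V : numDomainType) n (b : (nat -> nat) -> V) (h : 'rV[V]_n) N :
  pabs (fun al => b (fun i => if insub i is Some j then al j else 0%N)) h N =
  tsum n (fun al => `|b al| * \prod_(0 <= i < n) `|seqE h i| ^+ al i) N.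
Proof.
rewrite -(box_tsum n _ (leqnn N)) /pabs; apply: eq_bigr => al _; congr (_ * _).
by rewrite big_mkord; apply: eq_bigr => i _; rewrite seqE_ord extI_ord.
Qed.

Variable R : realType.

(** The homogeneous parts are summed by [A_csum]; their norms are the increments of [pabs] at the
    diagonal point (rho, ..., rho), which rho = r/2 < r keeps inside the open polydisc of
    convergence. *)
Lemma analytic_AG n (f : 'rV[R]_n -> R) z0 : analytic_at f z0 ->
  AG (K := vR R) n (fun x => f (z0 + rowE n x)).
Proof.
move=> [a [r [r0 h]]]; pose rho := r / 2.
have rho0 : 0 < rho by rewrite /rho; lra.
have [[M hM] _] : ps_abs_conv_to a (z0 + const_mx rho - z0) (f (z0 + const_mx rho)).
  by apply: h => i; rewrite !mxE addrAC subrr add0r ger0_norm ?(ltW rho0) // /rho; lra.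
rewrite addrAC subrr add0r in hM.
have pabsE N : pabs a (const_mx rho) N =
    psum (fun al => `|a al|) (const_mx rho : 'rV_n) N.
  rewrite /pabs /psum; apply: eq_bigr => al _; congr (_ * _); apply: eq_bigr => i _.
  by rewrite !mxE ger0_norm // ltW.
pose P k := fun al : {ffun 'I_n -> 'I_k.+1} => ((\sum_i (al i : nat))%N == k).
pose m k := \sum_(al : {ffun 'I_n -> 'I_k.+1} | P k al)
   `|a (fun i => al i : nat)| * \prod_i rho ^+ (al i : nat).
pose F k (x : nat -> R) := \sum_(al : {ffun 'I_n -> 'I_k.+1} | P k al)
   a (fun i => al i : nat) * \prod_(i < n) x i ^+ (al i : nat).
have step (b : ('I_n -> nat) -> R) (x : 'rV[R]_n) k0 : psum b x k0 =
    \sum_(0 <= k < k0.+1) \sum_(al : {ffun 'I_n -> 'I_k.+1} | P k al)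
      b (fun i => al i : nat) * \prod_i x ord0 i ^+ (al i : nat).
  elim: k0 => [|k0 IH].
    by rewrite big_nat1 /psum; apply: eq_bigl => al; rewrite /P leqn0.
  rewrite big_nat_recr //= -IH (psum_box b x (leqnSn k0)) /psum.
  rewrite (bigID (fun al : {ffun 'I_n -> 'I_k0.+2} => (\sum_i (al i : nat) <= k0)%N)) /=.
  congr (_ + _); apply: eq_bigl => al; rewrite /P; move: (\sum_(i < n) al i)%N => s; lia.
exists rho, M; split => //.
apply: (@A_csum R (vR R) n rho M F m) => //.
- move=> k; apply: A_sum => // al _.
  apply: A_mul => //; first by apply: A_cst => //; exact: ltW.
  have := A_mono (vR R) (extI al) rho0 (leqnn n).
  have -> : \prod_(0 <= i < n) rho ^+ extI al i = \prod_i rho ^+ (al i : nat).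
    by rewrite big_mkord; apply: eq_bigr => i _; rewrite extI_ord.
  apply: A_ext => x _; rewrite /mono big_mkord; apply: eq_bigr => i _; by rewrite extI_ord.
- case=> [|k0].
    rewrite big_geq //; apply: le_trans (hM 0%N); rewrite /pabs sumr_ge0 // => al _.
    by rewrite mulr_ge0 // prodr_ge0 // => i _; rewrite exprn_ge0.
  apply: le_trans (hM k0); rewrite pabsE step; apply: ler_sum => k _.
  apply: ler_sum => al _; rewrite ler_wpM2l //.
  by rewrite le_eqVlt; apply/orP; left; apply/eqP; apply: eq_bigr => i _; rewrite mxE.
- move=> x hx; have [_ hc] : ps_abs_conv_to a (z0 + rowE n x - z0) (f (z0 + rowE n x)).
    apply: h => i; rewrite !mxE addrAC subrr add0r.
    by apply: le_lt_trans (hx i (ltn_ord i)) _; rewrite /rho; lra.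
  rewrite addrAC subrr add0r in hc.
  apply: (@cv_unshift _ _ _ _ 1) => e e0; have [N0 hN0] := hc e e0.
  exists N0 => k hk; have := hN0 k hk; rewrite step addn1 /=.
  apply: le_lt_trans; rewrite le_eqVlt; apply/orP; left; apply/eqP; congr (`|_ - _|).
  apply: eq_bigr => i _; apply: eq_bigr => al _; congr (_ * _); apply: eq_bigr => l _.
  by rewrite mxE.
Qed.

Lemma AG_analytic n (f : 'rV[R]_n -> R) (z0 : 'rV[R]_n) (g : (nat -> R) -> R) :
  AG (K := vR R) n g -> near0 (K := vR R) n (fun x => f (z0 + rowE n x) = g x) ->
  analytic_at f z0.
Proof.
move=> hg he; have [r [M [r0 h]]] := AG_ext (near0S (fun x e => esym e) he) hg.
have [b [hb hc]] := A_tsum r0 h.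
exists (fun al => b (fun i => if insub i is Some j then al j else 0%N)), r; split => // z hz.
have hx : pd (K := vR R) n r (seqE (z - z0)).
  by move=> i hi; rewrite (seqE_ord _ (Ordinal hi)) !mxE; apply/ltW/hz.
split.
  exists M => N; rewrite pabs_tsum; apply: le_trans (hb N); apply: tsum_le => al.
  rewrite ler_wpM2l //; apply: le_trans (nu_mono_le (K := vR R) al (ltW r0) hx).
  by rewrite nu_mono.
move=> e e0; have [N0 hN0] := hc _ hx e e0.
exists N0 => N hN; have := hN0 N hN; rewrite psum_tsum seqEK [z0 + _]addrC subrK; exact.
Qed.

Lemma AG_analyticC n (f : 'rV[R[i]]_n -> R[i]) (z0 : 'rV[R[i]]_n) (g : (nat -> R[i]) -> R[i]) :
  AG (K := vC R) n g -> near0 (K := vC R) n (fun x => f (z0 + rowE n x) = g x) ->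
  analytic_at f z0.
Proof.
move=> hg he; have [r [M [r0 h]]] := AG_ext (near0S (fun x e => esym e) he) hg.
have [b [hb hc]] := A_tsum r0 h.
exists (fun al => b (fun i => if insub i is Some j then al j else 0%N)), (r%:C)%C; split.
  by rewrite ltcR.
move=> z hz.
have hx : pd (K := vC R) n r (seqE (z - z0)).
  move=> i hi; rewrite (seqE_ord _ (Ordinal hi)) !mxE /=.
  by have := hz (Ordinal hi); rewrite nuCE ltcR => /ltW.
split.
  exists (M%:C)%C => N; rewrite pabs_tsum.
  have -> : tsum n (fun al => `|b al| * \prod_(0 <= i < n) `|seqE (z - z0) i| ^+ al i) N =
    ((tsum n (fun al => nuC (b al) * \prod_(0 <= i < n) nuC (seqE (z - z0) i) ^+ al i) N)%:C)%C.
    rewrite (@tsum_morph _ _ (fun t => (t%:C)%C)) //; last by move=> x y; rewrite rmorphD.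
    apply: tsum_ext => al _; rewrite rmorphM rmorph_prod /= nuCE; congr (_ * _).
    by apply: eq_bigr => i _; rewrite rmorphXn /= nuCE.
  rewrite lecR; apply: le_trans (hb N); apply: tsum_le => al.
  rewrite ler_wpM2l ?nuC_ge0 //; apply: le_trans (nu_mono_le (K := vC R) al (ltW r0) hx).
  by rewrite nu_mono.
move=> e e0; have eE : e = ((complex.Re e)%:C)%C.
  by rewrite RRe_real // gtr0_real.
have e0' : 0 < complex.Re e by move: e0; rewrite {1}eE ltcR.
have [N0 hN0] := hc _ hx _ e0'.
exists N0 => N hN; have := hN0 N hN; rewrite psum_tsum seqEK [z0 + _]addrC subrK /=.
by rewrite nuCE [X in _ -> _ < X]eE ltcR.
Qed.

End Conversion.

(** * Algebra of germs: expansion in the last variable, monomials *)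

Section GermAlgebra.
Variables (R : realType) (K : vfield R).
Local Notation E := (nat -> K).
Local Notation E0 := (@E0 R K).
Implicit Types (x y : E) (f g : E -> K) (r M : R) (n : nat).

(** [A] in n+1 variables with its coefficients exposed, for arguments that inspect them. *)
Definition Adata n r M f (c : nat -> E -> K) (m : nat -> R) :=
  [/\ forall j, A n r (m j) (c j),
      forall J, \sum_(0 <= j < J) m j * r ^+ j <= M &
      forall x, pd n.+1 r x -> cv (fun J => \sum_(0 <= j < J) c j x * x n ^+ j) (f x)].

Lemma Adata_A n r M f c m : Adata n r M f c m -> A n.+1 r M f.
Proof. by move=> [h1 h2 h3]; apply: A_mk h1 h2 h3. Qed.

Lemma upd_upd x n a b : upd (upd x n a) n b = upd x n b.
Proof. by apply/funext => i; rewrite /upd; case: eqP. Qed.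

Lemma upd_id x n : upd x n (x n) = x.
Proof. by apply/funext => i; rewrite /upd; case: eqP => [->|]. Qed.

Lemma upd00 n : upd E0 n 0 = E0.
Proof. exact: (upd_id E0 n). Qed.

Lemma pd_upd n r x i v : pd n r x -> nu v <= r -> pd n r (upd x i v).
Proof. by move=> hx hv l hl; rewrite /upd; case: eqP => // _; exact: hx. Qed.

Lemma A_shift n r M f c m : 0 < r -> Adata n r M f c m ->
  exists f', Adata n r (M / r) f' (fun j => c j.+1) (fun j => m j.+1) /\
    forall x, pd n.+1 r x -> f x = c 0%N x + x n * f' x.
Proof.
move=> r0 [hc hm h].
have m0 j : 0 <= m j by exact: A_ge0 (hc j).
have hmr J : \sum_(0 <= j < J) m j.+1 * r ^+ j <= M / r.
  rewrite ler_pdivlMr // mulr_suml; apply: le_trans (hm J.+1).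
  rewrite big_nat_recl //= expr0 mulr1; apply: ler_wpDl => //.
  by apply: ler_sum => j _; rewrite exprSr mulrA.
have hl x : exists l, pd n.+1 r x -> cv (fun J => \sum_(0 <= j < J) c j.+1 x * x n ^+ j) l.
  case: (pselect (pd n.+1 r x)) => [hx|]; last by exists 0.
  have hb j : nu (c j.+1 x * x n ^+ j) <= m j.+1 * r ^+ j.
    rewrite nuM nuX; apply: ler_pM; rewrite ?exprn_ge0 ?nu_ge0 //.
      by apply: (A_bound (ltW r0) (hc j.+1)); exact: pdS.
    by apply: lerXn2r; rewrite ?nnegrE ?nu_ge0 ?(ltW r0) ?hx.
  by have [l [hl _]] := abs_cv hb hmr; exists l.
have [f' hf'] := choice hl.
exists f'; split; first by split.
move=> x hx; apply: (cv_uniq (h _ hx)); apply: (@cv_unshift _ _ _ _ 1).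
have := cvD (cv_cst (c 0%N x)) (cvM_l (x n) (hf' x hx)).
apply: cv_ext => J; rewrite addn1 big_nat_recl // expr0 mulr1.
by rewrite mulr_sumr; congr (_ + _); apply: eq_bigr => j _; rewrite exprS mulrCA.
Qed.

Lemma A_taylor n r M f c m d : 0 < r -> Adata n r M f c m ->
  exists u, Adata n r (M / r ^+ d) u (fun j => c (j + d)%N) (fun j => m (j + d)%N) /\
    forall x, pd n.+1 r x ->
      f x = \sum_(0 <= j < d) c j x * x n ^+ j + x n ^+ d * u x.
Proof.
move=> r0 h; elim: d => [|d [u [hu e]]].
  exists f; split.
    rewrite expr0 divr1; case: h => h1 h2 h3; split => [j|J|x hx].
    - by rewrite addn0.
    - by under eq_bigr do rewrite addn0.
    - by apply: cv_ext (h3 x hx) => J; apply: eq_bigr => j _; rewrite addn0.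
  by move=> x _; rewrite big_geq // add0r expr0 mul1r.
have [u' [hu' e']] := A_shift r0 hu.
exists u'; split.
  have -> : M / r ^+ d.+1 = M / r ^+ d / r by rewrite exprSr invfM mulrA.
  case: hu' => h1 h2 h3; split => [j|J|x hx].
  - by rewrite addnS -addSn.
  - by apply: le_trans (h2 J); apply: eqW_le; apply: eq_bigr => j _; rewrite addnS -addSn.
  - by apply: cv_ext (h3 x hx) => J; apply: eq_bigr => j _; rewrite addnS -addSn.
move=> x hx; rewrite e // e' // big_nat_recr //= add0n mulrDr addrA.
by rewrite mulrA -exprSr mulrC.
Qed.

Lemma Adata_at0 n r M f c m x : 0 < r -> Adata n r M f c m -> pd n r x ->
  f (upd x n 0) = c 0%N x.
Proof.
move=> r0 [hc hm h] hx.
have hu : pd n.+1 r (upd x n 0).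
  move=> l; rewrite ltnS /upd; case: eqP => [_ _|ne hl]; first by rewrite nu0 ltW.
  by apply: hx; lia.
apply: (cv_uniq (h _ hu)); apply: (@cv_unshift _ _ _ _ 1).
apply: cv_ext (cv_cst _) => J; rewrite addn1 big_nat_recl // big1 => [|j _].
  rewrite expr0 mulr1 addr0; apply: (A_dep (hc 0%N) hx) => l hl.
  by rewrite upd_other //; lia.
by rewrite upd_same exprS mul0r mulr0.
Qed.

Lemma AG_restrict n f : AG n.+1 f -> AG n (fun x => f (upd x n 0)).
Proof.
move=> h; apply: (AG_comp h) => i hi; rewrite /upd; case: eqP => // ne.
  exact: AG_cst.
by apply: AG_coord; lia.
Qed.

Lemma AG_hadamard n f i : (i < n)%N -> AG n f -> exists f', AG n f' /\
  near0 n (fun x => f x = f (upd x i 0) + x i * f' x).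
Proof.
move=> hi [r [M [r0 h]]]; have [f' [hf' e]] := hadamard r0 hi h.
by exists f'; split; [exists r, (M / r)|exists r].
Qed.

Lemma AG_lip0 n f j : (j < n)%N -> AG n f -> exists C r, [/\ 0 <= C, 0 < r &
  forall t, nu t <= r -> nu (f (upd E0 j t) - f E0) <= C * nu t].
Proof.
move=> hj /(AG_hadamard hj) [f' [hf' [r [r0 e]]]].
have [C C0 [s [s0 hs]]] := AG_bounded hf'.
exists C, (Num.min r s); rewrite lt_min r0 s0 ltW //; split => // t.
rewrite le_min => /andP[tr ts].
rewrite e; last by apply: pd_upd => //; apply: pd0; exact: ltW.
rewrite upd_upd upd00 upd_same addrAC subrr add0r nuM mulrC ler_wpM2r ?nu_ge0 //.
by apply: hs; apply: pd_upd => //; apply: pd0; exact: ltW.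
Qed.

Definition nz n f := ~ near0 n (fun x => f x = 0).

Lemma nz_ext n f g : near0 n (fun x => f x = g x) -> nz n f -> nz n g.
Proof.
by move=> e h k; apply: h; apply: near0S (near0I e k) => x [-> ->].
Qed.

Lemma nz_at n f : AG n f -> f E0 != 0 -> nz n f.
Proof. by move=> h f0 k; have := near0_at k => e; rewrite e eqxx in f0. Qed.

Lemma nz_last n f : AG n.+1 f -> nz n.+1 f -> exists a c u,
  [/\ AG n c, nz n c, AG n.+1 u & near0 n.+1 (fun x => f x = x n ^+ a * (c x + x n * u x))].
Proof.
move=> [r [M [r0 /A_inv [c [m hd]]]]] fnz.
pose Z j := ~ forall x, pd n r x -> c j x = 0.
have [j0 hj0] : exists j, Z j.
  apply: contrapT => hZ; apply: fnz; exists r; split => // x hx.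
  have [hc hm h] := hd; apply: (cv_uniq (h x hx)); apply: cv_ext (cv_cst 0) => J.
  rewrite big1 // => j _.
  have -> : c j x = 0; last by rewrite mul0r.
  by apply: contrapT => k; apply: hZ; exists j => k'; apply: k; apply: k'; exact: pdS.
have ex : exists j, `[< Z j >] by exists j0; apply/asboolP.
case: (ex_minnP ex) => a /asboolP Za amin.
have low j : (j < a)%N -> forall x, pd n r x -> c j x = 0.
  move=> ja; apply: contrapT => k; have := amin j (introT (asboolP _) k); lia.
have [u [hu e]] := A_taylor a r0 hd.
have [u' [hu' e']] := A_shift r0 hu.
have [hc _ _] := hd.
exists a, (c a), u'; split.
- by exists r, (m a); split.
- move=> [s [s0 hs]]; apply: Za; apply: (@A_identity _ _ _ _ _ _ (fun=> True) s r0 _ s0 (hc a)).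
    move=> e1 e10; exists (emb K (e1 / 2)); split => //; rewrite nu_emb ger0_norm; lra.
  by move=> x hx _; exact: hs.
- by exists r, (M / r ^+ a / r); split => //; exact: Adata_A hu'.
- exists r; split => // x hx; rewrite e // big_nat big1 => [|j /andP[_ ja]].
    by rewrite add0r e' // add0n.
  by rewrite low ?mul0r //; exact: pdS.
Qed.

Lemma accumT : accum0 (fun _ : K => True).
Proof.
by move=> e e0; exists (emb K (e / 2)); split => //; rewrite nu_emb ger0_norm; lra.
Qed.

Lemma near0_upd_last n (P : E -> Prop) : near0 n.+1 P -> exists r, 0 < r /\
  forall x v, pd n r x -> nu v <= r -> P (upd x n v).
Proof.
move=> [r [r0 h]]; exists r; split => // x v hx hv; apply: h => i hi.
by rewrite /upd; case: eqP => // ne; apply: hx; lia.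
Qed.

(** If f g vanished near 0, the leading coefficients would satisfy c d = - x_n w with w bounded, for
    all small x_n != 0. Letting x_n tend to 0 with the other coordinates fixed gives c d = 0,
    against the induction hypothesis. *)
Lemma nz_mul n f g : AG n f -> AG n g -> nz n f -> nz n g -> nz n (fun x => f x * g x).
Proof.
elim: n f g => [|n IH] f g hf hg fnz gnz.
  have [r [M [r0 [c [_ hc]]]]] := hf; have [s [M' [s0 [d [_ hd]]]]] := hg.
  apply: nz_at; first exact: AG_mul.
  rewrite hc hd mulf_neq0 //; apply/eqP => z; [apply: fnz|apply: gnz]; apply: near0T => x.
    by rewrite hc.
  by rewrite hd.
have [a [c [u [hc cnz hu e]]]] := nz_last hf fnz.
have [b [d [v [hd dnz hv e']]]] := nz_last hg gnz.
move=> z; apply: (IH _ _ hc hd cnz dnz).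
have hc' := AG_weaken (leqnSn n) hc; have hd' := AG_weaken (leqnSn n) hd.
pose w x := c x * v x + u x * d x + x n * (u x * v x).
have hw : AG n.+1 w.
  apply: AG_add; last by apply: AG_mul; [exact: AG_coord|exact: AG_mul].
  by apply: AG_add; exact: AG_mul.
have [C C0 hC] := AG_bounded hw.
have [r [r0 hr]] := near0_upd_last (near0I (near0I e e') (near0I z hC)).
have [r1 [r10 dep1]] := AG_dep hc; have [r2 [r20 dep2]] := AG_dep hd.
exists (Num.min r (Num.min r1 r2)); rewrite !lt_min r0 r10 r20; split => // x hx.
have hx0 : pd n r x by apply: pd_le hx; rewrite ge_min lexx.
have hx1 : pd n r1 x by apply: pd_le hx; rewrite !ge_min lexx orbT.
have hx2 : pd n r2 x by apply: pd_le hx; rewrite !ge_min lexx !orbT.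
apply: nu_eq0; apply/eqP; rewrite eq_le nu_ge0 andbT leNgt; apply/negP => p.
pose t := Num.min r (nu (c x * d x) / (2 * C)).
have t0 : 0 < t by rewrite lt_min r0 divr_gt0 // mulr_gt0.
have nt : nu (emb K t) = t by rewrite nu_emb ger0_norm // ltW.
have tr : nu (emb K t) <= r by rewrite nt ge_min lexx.
have [[k1 k2] [k3 k4]] := hr x (emb K t) hx0 tr.
have tn0 : emb K t != 0 by apply/eqP => q; move: t0; rewrite -nt q nu0 ltxx.
move: k3; rewrite k1 k2 !upd_same.
have cE : c (upd x n (emb K t)) = c x.
  by symmetry; apply: dep1 => // i hi; rewrite upd_other //; clear -hi; lia.
have dE : d (upd x n (emb K t)) = d x.
  by symmetry; apply: dep2 => // i hi; rewrite upd_other //; clear -hi; lia.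
move: k4; rewrite /w !upd_same cE dE; set U := u _; set V := v _ => k4.
rewrite mulrACA -exprD => /eqP; rewrite mulf_eq0 expf_eq0 (negbTE tn0) andbF /= => /eqP k3.
have k5 : c x * d x = - (emb K t * (c x * V + U * d x + emb K t * (U * V))).
  by apply/eqP; rewrite -subr_eq0 opprK -[X in _ == X]k3; apply/eqP; ring.
have k6 : nu (c x * d x) <= t * C.
  by rewrite k5 nuN nuM nt ler_wpM2l // ltW.
have : t <= nu (c x * d x) / (2 * C) by rewrite ge_min lexx orbT.
rewrite ler_pdivlMr ?mulr_gt0 //; nra.
Qed.

Lemma germ_cancel n f g h : AG n f -> AG n g -> AG n h -> nz n f ->
  near0 n (fun x => f x * g x = f x * h x) -> near0 n (fun x => g x = h x).
Proof.
move=> hf hg hh fnz e; apply: contrapT => k.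
have : nz n (fun x => f x * (g x - h x)).
  apply: nz_mul => //; first exact: AG_sub.
  by move=> k'; apply: k; apply: near0S k' => x /eqP; rewrite subr_eq0 => /eqP.
by apply; apply: near0S e => x e; rewrite mulrBr e subrr.
Qed.

Local Notation mn := (@mono R K).

Lemma monoD n x al be : mn n x (fun i => al i + be i)%N = mn n x al * mn n x be.
Proof. by rewrite /mono -big_split; apply: eq_bigr => i _; rewrite exprD. Qed.

Lemma mono_ext n x y al be : (forall i, (i < n)%N -> x i = y i /\ al i = be i) ->
  mn n x al = mn n y be.
Proof. by move=> h; apply: eq_big_nat => i /andP[_ /h [-> ->]]. Qed.

Lemma monoX n x al k : mn n x (fun i => al i * k)%N = mn n x al ^+ k.
Proof. by rewrite /mono -prodrXl; apply: eq_bigr => i _; rewrite exprM. Qed.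

Lemma mono0 n x al : (forall i, (i < n)%N -> al i = 0%N) -> mn n x al = 1.
Proof. by move=> h; rewrite /mono big_nat big1 // => i /andP[_ /h ->]. Qed.

Lemma mono_D1 n x al i : (i < n)%N ->
  mn n x al = x i ^+ al i * \prod_(0 <= l < n | l != i) x l ^+ al l.
Proof.
by move=> hi; rewrite /mono (bigD1_seq i) ?mem_index_iota ?iota_uniq.
Qed.

Lemma mono_eq0 n x al i : (i < n)%N -> (0 < al i)%N -> x i = 0 -> mn n x al = 0.
Proof.
move=> hi ai xi; rewrite (mono_D1 _ _ hi) xi expr0n.
by case: (al i) ai => //= k _; rewrite mul0r.
Qed.

Lemma mono_neq0 n x al : (forall i, (i < n)%N -> x i = 0 -> al i = 0%N) -> mn n x al != 0.
Proof.
move=> h; rewrite /mono prodf_seq_neq0; apply/allP => i; rewrite mem_index_iota => hi.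
apply/implyP => _; rewrite expf_eq0; apply/negP => /andP[ai /eqP xi].
by rewrite (h i) // in ai; lia.
Qed.

Lemma mono_single n x i k : (i < n)%N -> mn n x (fun l => if l == i then k else 0%N) = x i ^+ k.
Proof.
move=> hi; rewrite (mono_D1 _ _ hi) eqxx big1 ?mulr1 // => l /negbTE ->.
by rewrite expr0.
Qed.

Lemma AG_mono n m al : (m <= n)%N -> AG n (fun x => mn m x al).
Proof. by move=> hm; exists 1; eexists; split => //; apply: A_mono. Qed.

(** The normal crossings form of a germ, the goal of the substitutions made along the
    ultrafilter. *)
Definition NCf n f := exists al u, [/\ AG n u, u E0 != 0 &
  near0 n (fun x => f x = mn n x al * u x)].

Lemma NCf_AG n f : NCf n f -> AG n f.
Proof.
move=> [al [u [hu u0 e]]]; apply: AG_ext (near0S (fun x => esym) e) _.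
by apply: AG_mul => //; exact: AG_mono.
Qed.

Lemma emb_neq0 (r : R) : 0 < r -> emb K r != 0.
Proof. by move=> r0; apply/eqP => k; have := nu_emb K r; rewrite k nu0 ger0_norm ?ltW //; lra. Qed.

Lemma near0_nonzero n (P : E -> Prop) : near0 n P -> exists x, P x /\ forall i, x i != 0.
Proof.
move=> [r [r0 h]]; exists (fun=> emb K r); split; first by apply: h => i _; rewrite nu_emb ger0_norm // ltW.
by move=> _; exact: emb_neq0.
Qed.

Lemma mono_nz n al : nz n (fun x => mn n x al).
Proof.
move=> /near0_nonzero [x [e hx]].
have : mn n x al != 0 by apply: mono_neq0 => i _ /eqP; rewrite (negbTE (hx i)).
by rewrite e eqxx.
Qed.

Lemma NCf_nz n f : NCf n f -> nz n f.
Proof.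
move=> [al [u [hu u0 e]]]; apply: nz_ext (near0S (fun x => esym) e) _.
by apply: nz_mul; [exact: AG_mono|exact: hu|exact: mono_nz|exact: nz_at].
Qed.

Lemma NCf_ext n f g : near0 n (fun x => f x = g x) -> NCf n f -> NCf n g.
Proof.
move=> e [al [u [hu u0 e']]]; exists al, u; split => //.
by apply: near0S (near0I e e') => x [<- <-].
Qed.

Lemma NCf_mul n f g : NCf n f -> NCf n g -> NCf n (fun x => f x * g x).
Proof.
move=> [al [u [hu u0 e]]] [be [v [hv v0 e']]].
exists (fun i => al i + be i)%N, (fun x => u x * v x); split; first exact: AG_mul.
  by rewrite mulf_neq0.
by apply: near0S (near0I e e') => x [-> ->]; rewrite monoD; ring.
Qed.

Lemma NCf_unit n u : AG n u -> u E0 != 0 -> NCf n u.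
Proof.
move=> hu u0; exists (fun=> 0%N), u; split => //; apply: near0T => x.
by rewrite mono0 // mul1r.
Qed.

Lemma NCf_mono n m al : (m <= n)%N -> NCf n (fun x => mn m x al).
Proof.
move=> mn; exists (fun i => if (i < m)%N then al i else 0%N), (fun=> 1); split.
- exact: AG_cst.
- exact: oner_neq0.
- apply: near0T => x; rewrite mulr1 /mono [RHS](big_cat_nat (leq0n m) mn) /=.
  rewrite [X in _ * X]big_nat [X in _ * X]big1 ?mulr1 => [|i /andP[mi _]].
    by apply: eq_big_nat => i /andP[_ ->].
  by rewrite ltnNge mi expr0.
Qed.

Lemma NCf_coordX n i k : (i < n)%N -> NCf n (fun x => x i ^+ k).
Proof.
move=> hi; apply: NCf_ext (NCf_mono (fun l => if l == i then k else 0%N) (leqnn n)).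
by apply: near0T => x; rewrite mono_single.
Qed.

Lemma NCf_weaken n m f : (n <= m)%N -> NCf n f -> NCf m f.
Proof.
move=> nm [al [u [hu u0 e]]].
have h : NCf m (fun x => mn n x al * u x).
  apply: NCf_mul; first exact: NCf_mono.
  by apply: NCf_unit => //; exact: AG_weaken hu.
by apply: NCf_ext h; apply: near0_weaken nm _; apply: near0S e => x.
Qed.

(* If x_i divides a product of germs it divides a factor, since the germs restricted to
   x_i = 0 form a domain. *)
Lemma NCf_factor n f g : AG n f -> AG n g -> NCf n (fun x => f x * g x) -> NCf n f.
Proof.
move=> hf hg [al [w [hw w0 e]]].
have [s hs] : exists s, (\sum_(0 <= i < n) al i = s)%N by eexists.
elim: s al f g hf hg e hs => [|s IH] al f g hf hg e hs.
  apply: NCf_unit => //; have := near0_at e; rewrite mono0 ?mul1r => [k|i hi].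
    by apply: contraNneq w0 => f0; rewrite -k f0 mul0r.
  by move: hs; rewrite (bigD1_seq i) ?mem_index_iota ?iota_uniq //=; lia.
have [i hi ai] : exists2 i, (i < n)%N & (0 < al i)%N.
  apply: contrapT => k; move: hs; rewrite big_nat big1 // => i /andP[_ hi].
  by apply/eqP; rewrite -leqn0 leqNgt; apply/negP => ai; apply: k; exists i.
pose al' l := if l == i then (al i).-1 else al l.
have moE x : mn n x al = x i * mn n x al'.
  rewrite !(mono_D1 _ _ hi) /al' eqxx mulrA -exprS prednK //; congr (_ * _).
  by apply: eq_bigr => l /negbTE ->.
have hs' : (\sum_(0 <= l < n) al' l = s)%N.
  move: hs; rewrite !(bigD1_seq i (r := index_iota 0 n)) ?mem_index_iota ?iota_uniq //= /al' eqxx.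
  rewrite [X in _ -> (_ + X)%N = _](eq_bigr al); last by move=> l /negbTE ->.
  lia.
have hxi : AG n (fun x : E => x i) by exact: AG_coord.
have xinz : nz n (fun x : E => x i).
  apply: (nz_ext _ (@mono_nz n (fun l => if l == i then 1%N else 0%N))).
  by apply: near0T => x; rewrite mono_single.
have AGr (h : E -> K) : AG n h -> AG n (fun x => h (upd x i 0)).
  move=> hh; apply: (AG_comp hh) => l hl; rewrite /upd; case: eqP => // _; first exact: AG_cst.
  exact: AG_coord.
have zero : near0 n (fun x => f (upd x i 0) * g (upd x i 0) = 0).
  move: e => [r [r0 h]]; exists r; split => // x hx; rewrite h.
    by rewrite (mono_eq0 hi ai) ?mul0r // upd_same.
  by apply: pd_upd => //; rewrite nu0 ltW.
have key (f1 g1 : E -> K) : AG n f1 -> AG n g1 ->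
   near0 n (fun x => f1 (upd x i 0) = 0) -> near0 n (fun x => f1 x * g1 x = mn n x al * w x) ->
   exists f', [/\ AG n f', near0 n (fun x => f1 x = x i * f' x) &
                  near0 n (fun x => f' x * g1 x = mn n x al' * w x)].
  move=> hf1 hg1 z1 e1; have [f' [hf' e']] := AG_hadamard hi hf1.
  have e2 : near0 n (fun x => f1 x = x i * f' x).
    by apply: near0S (near0I e' z1) => x [-> ->]; rewrite add0r.
  exists f'; split => //.
  apply: (germ_cancel hxi) => //; first exact: AG_mul.
    by apply: AG_mul => //; exact: AG_mono.
  by apply: near0S (near0I e1 e2) => x [h1 h2]; rewrite mulrA -h2 h1 moE mulrA.
case: (pselect (near0 n (fun x => f (upd x i 0) = 0))) => zf.
  have [f' [hf' e2 e3]] := key f g hf hg zf e.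
  have := IH al' f' g hf' hg e3 hs'.
  move=> /(NCf_mul (NCf_coordX 1 hi)); apply: NCf_ext.
  by apply: near0S e2 => x ->; rewrite expr1.
case: (pselect (near0 n (fun x => g (upd x i 0) = 0))) => zg.
  have e' : near0 n (fun x => g x * f x = mn n x al * w x).
    by apply: near0S e => x <-; rewrite mulrC.
  have [g' [hg' e2 e3]] := key g f hg hf zg e'.
  apply: (IH al' f g' hf hg' _ hs'); by apply: near0S e3 => x <-; rewrite mulrC.
by have := nz_mul (AGr _ hf) (AGr _ hg) zf zg.
Qed.

Lemma NCf_factor_prod n (I : eqType) (s : seq I) (F : I -> E -> K) :
  (forall i, AG n (F i)) -> NCf n (fun x => \prod_(i <- s) F i x) ->
  forall i, i \in s -> NCf n (F i).
Proof.
move=> hF; elim: s => [//|j s IH] h i.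
have h' : NCf n (fun x => F j x * \prod_(i <- s) F i x).
  by apply: NCf_ext h; apply: near0T => x; rewrite big_cons.
have hp : AG n (fun x => \prod_(i <- s) F i x) by apply: AG_prod.
rewrite inE => /orP[/eqP ->|si]; first exact: NCf_factor (hF j) hp h'.
apply: IH => //; apply: NCf_factor hp (hF j) _.
by apply: NCf_ext h'; apply: near0T => x; rewrite mulrC.
Qed.

(* Comparing growth along the i-th axis with the other coordinates frozen. *)
Lemma mono_dvd n al be u f : AG n u -> u E0 != 0 -> AG n f ->
  near0 n (fun x => mn n x al * u x = mn n x be * f x) ->
  forall i, (i < n)%N -> (be i <= al i)%N.
Proof.
move=> hu u0 hf e i hi; rewrite leqNgt; apply/negP => lt.
have [C C0 hC] := AG_bounded hf.
have p : 0 < nu (u E0) / 2.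
  rewrite divr_gt0 // lt_neqAle nu_ge0 andbT eq_sym; apply: contraNN u0 => /eqP.
  by move/nu_eq0 ->.
have hU := AG_cont hu p.
have [r [r0 h]] := near0I (near0I e hC) hU.
pose a := \prod_(0 <= l < n | l != i) r ^+ al l.
pose b := \prod_(0 <= l < n | l != i) r ^+ be l.
have a0 : 0 < a by apply: prodr_gt0 => l _; rewrite exprn_gt0.
have b0 : 0 < b by apply: prodr_gt0 => l _; rewrite exprn_gt0.
pose q := a * (nu (u E0) / 2) / (b * C).
have q0 : 0 < q by rewrite divr_gt0 // ?(mulr_gt0 a0 p) ?(mulr_gt0 b0 C0).
pose t := Num.min (Num.min r 1) (q / 2).
have t0 : 0 < t by rewrite !lt_min r0 ltr01 divr_gt0.
have tr : t <= r by rewrite !ge_min lexx.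
have t1 : t <= 1 by rewrite !ge_min lexx orbT.
have tq : t <= q / 2 by rewrite !ge_min lexx orbT.
pose x : E := upd (fun=> emb K r) i (emb K t).
have nr : nu (emb K r) = r by rewrite nu_emb ger0_norm // ltW.
have nt : nu (emb K t) = t by rewrite nu_emb ger0_norm // ltW.
have hx : pd n r x by apply: pd_upd; [move=> l _; rewrite nr|rewrite nt].
have [[h1 h2] h3] := h x hx.
have nm ga : nu (mn n x ga) = t ^+ ga i * \prod_(0 <= l < n | l != i) r ^+ ga l.
  rewrite nu_mono (bigD1_seq i) ?mem_index_iota ?iota_uniq //= {1}/x upd_same nt; congr (_ * _).
  by apply: eq_bigr => l li; rewrite /x upd_other // nr.
have k1 : nu (u E0) / 2 <= nu (u x).
  have := nuD (u x) (u E0 - u x); rewrite addrC subrK (nu_sym (u E0)); lra.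
have := congr1 (@nu R K) h1; rewrite !nuM !nm -/a -/b => k2.
have k3 : t ^+ al i * (a * (nu (u E0) / 2)) <= t ^+ be i * (b * C).
  apply: (@le_trans _ _ (t ^+ al i * a * nu (u x))).
    by rewrite -[X in _ <= X]mulrA ler_pM2l ?exprn_gt0 // ler_pM2l.
  by rewrite k2 -mulrA ler_pM2l ?exprn_gt0 // ler_pM2l.
have k4 : t ^+ be i <= t ^+ al i * t.
  by rewrite -exprSr; apply: ler_wiXn2l => //; exact: ltW.
have k5 : q <= t.
  rewrite ler_pdivrMr ?mulr_gt0 //.
  have tp : 0 < t ^+ al i by rewrite exprn_gt0.
  rewrite -(ler_pM2l tp); apply: le_trans k3 _.
  by rewrite [X in _ <= X]mulrA ler_wpM2r // mulr_ge0 ?(ltW b0) ?(ltW C0).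
lra.
Qed.

Lemma not_all_leq n (al be : nat -> nat) : ~ (forall i, (i < n)%N -> (al i <= be i)%N) ->
  exists2 i, (i < n)%N & (be i < al i)%N.
Proof.
move=> h; apply: contrapT => k; apply: h => i hi; rewrite leqNgt; apply/negP => lt.
by apply: k; exists i.
Qed.

(** Suppose neither exponent dominates and divide out the common monomial: both remaining terms then
    vanish at 0, so their difference F is not a unit. If F has normal crossings it is divisible by
    some x_i, whereas x_i divides at most one of the two terms. *)
Lemma mono_comparable n al be u v f : AG n u -> u E0 != 0 -> AG n v -> v E0 != 0 ->
  near0 n (fun x => mn n x al * u x - mn n x be * v x = f x) ->
  near0 n (fun x => f x = 0) \/ NCf n f ->
  (forall i, (i < n)%N -> (al i <= be i)%N) \/ (forall i, (i < n)%N -> (be i <= al i)%N).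
Proof.
move=> hu u0 hv v0 e; case=> [z|[de [w [hw w0 e']]]].
  right; apply: (mono_dvd hu u0 hv); apply: near0S (near0I e z) => x [h1 h2].
  by apply/eqP; rewrite -subr_eq0 h1 h2.
apply: contrapT => /not_orP [/not_all_leq [k kn ak] /not_all_leq [l ln al_]].
pose m i := minn (al i) (be i).
pose a' i := (al i - m i)%N; pose b' i := (be i - m i)%N.
have alE x : mn n x al = mn n x m * mn n x a'.
  by rewrite -monoD; apply: mono_ext => i _; split => //; rewrite /a' /m; lia.
have beE x : mn n x be = mn n x m * mn n x b'.
  by rewrite -monoD; apply: mono_ext => i _; split => //; rewrite /b' /m; lia.
pose F x := mn n x a' * u x - mn n x b' * v x.
have hF : AG n F by apply: AG_sub; apply: AG_mul => //; exact: AG_mono.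
have e1 : near0 n (fun x => mn n x de * w x = mn n x m * F x).
  by apply: near0S (near0I e e') => x [h1 h2]; rewrite -h2 -h1 alE beE /F; ring.
have dm := mono_dvd hw w0 hF e1.
pose d' i := (de i - m i)%N.
have e2 : near0 n (fun x => mn n x d' * w x = F x).
  apply: (germ_cancel (AG_mono m (leqnn n))) => //.
  - by apply: AG_mul => //; exact: AG_mono.
  - exact: mono_nz.
  - apply: near0S e1 => x <-; rewrite mulrA -monoD; congr (_ * _).
    by apply: mono_ext => i hi; split => //; have := dm i hi; rewrite /d'; lia.
have ak' : (0 < a' k)%N by rewrite /a' /m; lia.
have bk' : b' k = 0%N by rewrite /b' /m; lia.
have al' : a' l = 0%N by rewrite /a' /m; lia.
have bl' : (0 < b' l)%N by rewrite /b' /m; lia.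
have [i hi di] : exists2 i, (i < n)%N & (0 < d' i)%N.
  apply: contrapT => q; have := near0_at e2.
  rewrite /F (mono_eq0 kn ak') // (mono_eq0 ln bl') // !mul0r subr0 mono0 ?mul1r => [w00|i hi].
    by rewrite w00 eqxx in w0.
  by apply/eqP; rewrite -leqn0 leqNgt; apply/negP => di; apply: q; exists i.
have [r [r0 h]] := near0I e2 (near0I (AG_neq0 hu u0) (AG_neq0 hv v0)).
have nr : nu (emb K r) = r by rewrite nu_emb ger0_norm // ltW.
have rn0 : emb K r != 0 by apply/eqP => q; move: r0; rewrite -nr q nu0 ltxx.
(* Vanishing in coordinate i kills F; vanishing in k or l kills one of the two terms and, for the
   right choice, leaves the other nonzero. *)
pose x k' : E := fun j => if (j == i) || (j == k') then 0 else emb K r.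
have hx k' : pd n r (x k').
  by move=> j _; rewrite /x; case: ifP => _; rewrite ?nu0 ?nr // ltW.
have [ai0|bi0] : a' i = 0%N \/ b' i = 0%N by rewrite /a' /b' /m; lia.
  have [h1 [h2 h3]] := h (x l) (hx l); move: h1.
  rewrite (mono_eq0 hi di) ?mul0r; last by rewrite /x eqxx.
  rewrite /F (mono_eq0 ln bl') ?mul0r ?subr0; last by rewrite /x eqxx orbT.
  move=> /esym/eqP; rewrite mulf_eq0 (negbTE h2) orbF; apply/negP.
  apply: mono_neq0 => j _; rewrite /x; case: ifP => [/orP[/eqP ->|/eqP ->] //|_ /eqP].
  by rewrite (negbTE rn0).
have [h1 [h2 h3]] := h (x k) (hx k); move: h1.
rewrite (mono_eq0 hi di) ?mul0r; last by rewrite /x eqxx.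
rewrite /F (mono_eq0 kn ak') ?mul0r ?sub0r; last by rewrite /x eqxx orbT.
move=> /esym/eqP; rewrite oppr_eq0 mulf_eq0 (negbTE h3) orbF; apply/negP.
apply: mono_neq0 => j _; rewrite /x; case: ifP => [/orP[/eqP ->|/eqP ->] //|_ /eqP].
by rewrite (negbTE rn0).
Qed.

Lemma AG_sum_nat n d (F : nat -> E -> K) : (forall i, (i < d)%N -> AG n (F i)) ->
  AG n (fun x => \sum_(0 <= i < d) F i x).
Proof.
elim: d => [|d IH] h; first by apply: AG_ext1 (AG_cst n 0) => x; rewrite big_geq.
apply: AG_ext1 (AG_add (IH (fun i hi => h i (ltnW hi))) (h d (ltnSn d))) => x.
by rewrite big_nat_recr.
Qed.

(* [reg n d g]: g(0, x_n) has a zero of order at most d at 0. *)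
Definition reg n d g := exists c u, [/\ forall j, (j < d)%N -> AG n (c j),
  AG n.+1 u, u E0 != 0 &
  near0 n.+1 (fun x => g x = \sum_(0 <= j < d) c j x * x n ^+ j + x n ^+ d * u x)].

Lemma reg_lower n d g (c : nat -> E -> K) u j : (forall j, (j < d)%N -> AG n (c j)) ->
  AG n.+1 u ->
  near0 n.+1 (fun x => g x = \sum_(0 <= j < d) c j x * x n ^+ j + x n ^+ d * u x) ->
  (j < d)%N -> c j E0 != 0 -> reg n j g.
Proof.
move=> hc hu e jd cj.
exists c, (fun x => \sum_(0 <= i < d - j) c (i + j)%N x * x n ^+ i + x n ^+ (d - j) * u x); split.
- by move=> i ij; apply: hc; lia.
- apply: AG_add.
    apply: AG_sum_nat => i hi; apply: AG_mul; last by apply: AG_exp; exact: AG_coord.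
    by apply: (AG_weaken (leqnSn n)); apply: hc; lia.
  by apply: AG_mul => //; apply: AG_exp; exact: AG_coord.
- have [k ->] : exists k, (d - j = k.+1)%N by exists (d - j).-1; lia.
  rewrite big_nat_recl // big1 => [|i _]; first by rewrite add0n expr0 mulr1 exprS !mul0r !addr0.
  by rewrite exprS mul0r mulr0.
- apply: near0S e => x ->; rewrite (big_cat_nat (leq0n j) (ltnW jd)) /= -addrA; congr (_ + _).
  have -> : x n ^+ d = x n ^+ j * x n ^+ (d - j) by rewrite -exprD subnKC // ltnW.
  rewrite mulrDr mulrA; congr (_ + _).
  rewrite -{1}[j]add0n big_addn mulr_sumr; apply: eq_bigr => i _.
  by rewrite exprD; ring.
Qed.

(** If the first D coefficients in x_n all vanished at 0, g would be O(y^D) on the last axis. Finite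
    order is asked for as a failure of flatness because it is verified in that form. *)
Lemma reg_crit n (D : nat) g : AG n.+1 g ->
  ~ (exists C r, 0 < r /\ forall y : K, nu y <= r -> nu (g (upd E0 n y)) <= C * nu y ^+ D) ->
  exists2 d, (d < D)%N & reg n d g.
Proof.
move=> [r [M [r0 /A_inv [c [m hd]]]]] nflat.
have [hc _ _] := hd.
have [j jD cj] : exists2 j, (j < D)%N & c j E0 != 0.
  apply: contrapT => k; apply: nflat.
  have cz j : (j < D)%N -> c j E0 = 0.
    by move=> jD; apply/eqP; apply: contrapT => /negP q; apply: k; exists j.
  have [u [hu e]] := A_taylor D r0 hd.
  exists (M / r ^+ D), r; split => // y yr.
  have hp : pd n.+1 r (upd E0 n y) by apply: pd_upd => //; apply: pd0; exact: ltW.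
  rewrite e // big_nat big1 => [|j /andP[_ jD]].
    rewrite add0r upd_same nuM nuX mulrC ler_wpM2r ?exprn_ge0 ?nu_ge0 //.
    exact: (A_bound (ltW r0) (Adata_A hu)).
  have -> : c j (upd E0 n y) = c j E0; last by rewrite cz // mul0r.
  symmetry; apply: (A_dep (hc j)); first by apply: pd0; exact: ltW.
  by move=> i hi; rewrite upd_other //; lia.
have [u [hu e]] := A_taylor j r0 hd.
exists j => //; exists c, u; split.
- by move=> i _; exists r, (m i).
- by exists r, (M / r ^+ j); split => //; exact: Adata_A hu.
- by have := Adata_at0 r0 hu (@pd0 R K n r (ltW r0)); rewrite upd00 add0n => ->.
- by exists r; split.
Qed.

(** Substitution of x_n + x_(n+1) for x_n, by a Horner induction on d. The relation C_d = c_d + x_n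
    e with e(0) = (d+1) u(0) makes C_d = 0 solvable for the shift x_n when u is a unit: this is the
    Tschirnhaus transformation, which removes the term of degree d. *)
Lemma translate n d (c : nat -> E -> K) u : (forall j, (j < d.+1)%N -> AG n (c j)) ->
  AG n.+1 u -> exists C e U,
  [/\ forall j, (j < d.+1)%N -> AG n.+1 (C j), AG n.+1 e, AG n.+2 U &
      [/\ e E0 = d.+1%:R * u E0, U E0 = u E0,
          near0 n.+1 (fun x => C d x = c d x + x n * e x) &
          near0 n.+2 (fun x => \sum_(0 <= j < d.+1) c j x * (x n + x n.+1) ^+ j
              + (x n + x n.+1) ^+ d.+1 * u (upd x n (x n + x n.+1)) =
            \sum_(0 <= j < d.+1) C j x * x n.+1 ^+ j + x n.+1 ^+ d.+1 * U x)]].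
Proof.
move=> hc hu; elim: d c hc => [|d IH] c hc.
  pose W x := u (upd x n (x n + x n.+1)).
  have hW : AG n.+2 W.
    apply: (AG_comp hu) => i hi; rewrite /upd; case: eqP => [_|ne].
    - by apply: AG_add; exact: AG_coord.
    - by apply: AG_coord; lia.
    - by rewrite addr0.
    - by [].
  have [W' [hW' eW]] := AG_hadamard (ltnSn n.+1) hW.
  have eu : near0 n.+2 (fun x => W (upd x n.+1 0) = u x).
    have [r [r0 dep]] := AG_dep hu; exists r; split => // x hx; symmetry; apply: dep.
      exact: pdS.
    move=> i hi; rewrite /upd eqxx; have -> : (n == n.+1) = false by lia.
    by rewrite addr0; case: eqP => [->//|ne]; case: eqP => // e2; lia.
  exists (fun _ x => c 0%N x + x n * u x), u, (fun x => W x + x n * W' x); split => //.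
  - move=> j _; apply: AG_add; first by apply: (AG_weaken (leqnSn n)); exact: hc.
    by apply: AG_mul => //; exact: AG_coord.
  - apply: AG_add => //; apply: AG_mul => //; exact: AG_coord.
  - split.
    + by rewrite mul1r.
    + by rewrite mul0r addr0 /W addr0 upd00.
    + exact: near0T.
    + apply: near0S (near0I eW eu) => x [h1 h2]; rewrite !big_nat1 !expr0 !expr1 !mulr1.
      by rewrite -/(W x) h1 h2; ring.
have [B [e' [w [hB he' hw [e'0 w0 eB eS]]]]] := IH (fun j => c j.+1) (fun j hj => hc j.+1 hj).
have [w' [hw' ew]] := AG_hadamard (ltnSn n.+1) hw.
pose v x := w (upd x n.+1 0).
have hv : AG n.+1 v by exact: AG_restrict.
exists (fun j x => (if j == 0%N then c 0%N x else B j.-1 x) + x n * (if j == d.+1 then v x else B j x)),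
  (fun x => e' x + v x), (fun x => w x + x n * w' x); split.
- move=> j hj; apply: AG_add.
    case: eqP => [e|ne]; first by apply: (AG_weaken (leqnSn n)); exact: hc.
    by apply: hB; lia.
  apply: AG_mul; first exact: AG_coord.
  by case: eqP => [//|ne]; apply: hB; lia.
- exact: AG_add.
- by apply: AG_add => //; apply: AG_mul => //; exact: AG_coord.
- split.
  + by rewrite e'0 /v upd00 w0 -[d.+2%:R]natr1; ring.
  + by rewrite mul0r addr0.
  + by apply: near0S eB => x eB; rewrite eqxx /= eB; ring.
  + apply: near0S (near0I ew eS) => x [h1 h2].
    have sumC : \sum_(0 <= j < d.+2) ((if j == 0%N then c 0%N x else B j.-1 x) +
        x n * (if j == d.+1 then v x else B j x)) * x n.+1 ^+ j =
        (c 0%N x + \sum_(0 <= j < d.+1) B j x * x n.+1 ^+ j * x n.+1) +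
        x n * (\sum_(0 <= j < d.+1) B j x * x n.+1 ^+ j + v x * x n.+1 ^+ d.+1).
      under eq_bigr do rewrite mulrDl.
      rewrite big_split /=; congr (_ + _).
        rewrite big_nat_recl //= expr0 mulr1; congr (_ + _); apply: eq_bigr => j _.
        by rewrite exprSr mulrA.
      rewrite big_nat_recr //= eqxx mulrDr mulrA mulr_sumr; congr (_ + _).
      apply: eq_big_nat => j /andP[_ hj].
      have -> : (j == d.+1) = false by lia.
      by rewrite mulrA.
    rewrite sumC -mulr_suml.
    have -> : \sum_(0 <= j < d.+2) c j x * (x n + x n.+1) ^+ j +
       (x n + x n.+1) ^+ d.+2 * u (upd x n (x n + x n.+1)) =
       c 0%N x + (x n + x n.+1) * (\sum_(0 <= j < d.+1) c j.+1 x * (x n + x n.+1) ^+ j +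
         (x n + x n.+1) ^+ d.+1 * u (upd x n (x n + x n.+1))).
      rewrite big_nat_recl // expr0 mulr1 -addrA; congr (_ + _).
      rewrite mulrDr mulr_sumr [_ ^+ d.+2]exprS mulrA; congr (_ + _); apply: eq_bigr => j _.
      by rewrite exprS mulrCA.
    rewrite h2; move: h1; rewrite -/(v x) => h1.
    set S := \sum_(0 <= j < d.+1) _.
    by rewrite [x n.+1 ^+ d.+2]exprS h1; ring.
Qed.

End GermAlgebra.

(** * Normal crossings along an ultrafilter *)

Section PolyFlat.
Variable R : realType.

Lemma coef_XsubC_pred (a : R) n : (('X - a%:P) ^+ n.+1)`_n = - a *+ n.+1.
Proof.
elim: n => [|n IH]; first by rewrite expr1 coefB coefX coefC /= sub0r mulr1n.
have mon : (('X - a%:P) ^+ n.+1)`_n.+1 = 1.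
  have := monic_exp n.+1 (monicXsubC a); rewrite monicE lead_coefE size_exp_XsubC /=.
  by move/eqP.
rewrite exprSr mulrBr coefB coefMX /= IH mulrC coefCM mon mulr1.
by rewrite [RHS]mulrSr.
Qed.

(** There is no term of degree D in c + y, so the coefficient of y^D is (D+1) c u0, which is
    nonzero, whereas flatness of order D+1 would kill it. Hence, after the Tschirnhaus
    transformation, a blow-up lowers the order at every point with c != 0. *)
Lemma poly_not_flat D (a : nat -> R) u0 c : u0 != 0 -> c != 0 ->
  ~ exists C r, 0 < r /\ forall y : R, `|y| <= r ->
    `|\sum_(0 <= j < D) a j * (c + y) ^+ j + (c + y) ^+ D.+1 * u0| <= C * `|y| ^+ D.+1.
Proof.
move=> u00 c0 [C [r [r0 h]]].
pose T : {poly R} := \sum_(0 <= j < D) a j *: ('X - (- c)%:P) ^+ j + u0 *: ('X - (- c)%:P) ^+ D.+1.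
have TE y : T.[y] = \sum_(0 <= j < D) a j * (c + y) ^+ j + (c + y) ^+ D.+1 * u0.
  rewrite hornerD hornerZ horner_exp !hornerE opprK [y + c]addrC [u0 * _]mulrC; congr (_ + _).
  rewrite horner_sum; apply: eq_bigr => j _.
  by rewrite hornerZ horner_exp !hornerE opprK [y + c]addrC.
have TD : T`_D = u0 * (c *+ D.+1).
  rewrite coefD coefZ coef_XsubC_pred opprK coef_sum big_nat big1 ?add0r // => j /andP[_ jD].
  by rewrite coefZ nth_default ?mulr0 // size_exp_XsubC.
have : T`_D = 0.
  pose M := \sum_(0 <= i < size T) `|T`_i| * 1 ^+ i.
  apply: (@ps_flat_upto R (vR R) (fun i => T`_i) 1 M (fun s => T.[s]) (fun=> True) D.+1) => //.
  - move=> J; have [hJ|hJ] := leqP J (size T).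
      by apply: sum_mono hJ => j; apply: mulr_ge0; [exact: normr_ge0|apply: exprn_ge0; exact: ler01].
    rewrite (big_cat_nat (leq0n (size T)) (ltnW hJ)) /= [X in _ + X]big_nat [X in _ + X]big1 ?addr0 //.
    by move=> i /andP[hi _]; rewrite nth_default // normr0 mul0r.
  - exact: accumT.
  - move=> s _ _; apply: (@cv_unshift _ _ _ _ (size T)); apply: cv_ext (cv_cst _) => J.
    rewrite (big_cat_nat (leq0n (size T)) (leq_addl J _)) /= [X in _ + X]big_nat [X in _ + X]big1 ?addr0.
      by rewrite horner_coef big_mkord.
    by move=> i /andP[hi _]; rewrite nth_default // mul0r.
  - move=> N ND; exists `|C|, (Num.min r 1); rewrite lt_min r0 ltr01; split => // s _.
    rewrite le_min => /andP[sr s1] /=; rewrite TE; apply: le_trans (h s sr) _.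
    apply: (@le_trans _ _ (`|C| * `|s| ^+ D.+1)).
      by rewrite ler_wpM2r ?exprn_ge0 // ler_norm.
    by rewrite ler_wpM2l //; apply: ler_wiXn2l.
by rewrite TD => /eqP; rewrite mulf_eq0 (negbTE u00) mulrn_eq0 (negbTE c0).
Qed.

End PolyFlat.

(** * Substitutions that lift an ultrafilter *)

Section NC.
Variables (R : realType) (Om : Type) (U : set_system Om).
Context {UF : UltraFilter U}.
Local Notation E := (nat -> R).
Local Notation E0 := (@E0 R (vR R)).
Local Notation AGr := (@AG R (vR R)).
Local Notation nearr := (@near0 R (vR R)).
Local Notation NCr := (@NCf R (vR R)).
Local Notation nzr := (@nz R (vR R)).
Local Notation regr := (@reg R (vR R)).
Local Notation mn := (@mono R (vR R)).
Local Notation updr := (@upd R (vR R)).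
Implicit Types (p q : Om -> E) (f g h k : E -> R) (n d : nat).

Definition infl (s : Om -> R) := forall e, 0 < e -> U [set w | `|s w| < e].

Lemma ae_not (P : Om -> Prop) : U [set w | P w] \/ U [set w | ~ P w].
Proof. exact: in_ultra_setVsetC [set w | P w] UF. Qed.

Lemma ae_false : ~ U [set w | False].
Proof. by move=> h; have [w []] := filter_ex h. Qed.

Lemma ae_all n (P : nat -> Om -> Prop) : (forall i, (i < n)%N -> U [set w | P i w]) ->
  U [set w | forall i, (i < n)%N -> P i w].
Proof.
elim: n => [|n IH] h; first by apply: filterS filterT.
apply: filterS (filterI (IH (fun i hi => h i (ltnW hi))) (h n (ltnSn n))) => w [/= h1 h2] i; rewrite ltnS leq_eqVlt => /orP[/eqP -> //|]; exact: h1.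
Qed.

Lemma ae_exists n (P : nat -> Om -> Prop) : U [set w | exists2 i, (i < n)%N & P i w] ->
  exists2 i, (i < n)%N & U [set w | P i w].
Proof.
move=> h; apply: contrapT => k.
have : forall i, (i < n)%N -> U [set w | ~ P i w].
  move=> i hi; have [q|//] := ae_not (P i).
  by exfalso; apply: k; exists i.
move=> /ae_all h'; apply: ae_false; apply: filterS (filterI h h') => w [[i hi Pi] /= q].
exact: q i hi Pi.
Qed.

Lemma ulim_exists (s : Om -> R) C : U [set w | `|s w| <= C] ->
  exists l, infl (fun w => s w - l).
Proof.
move=> hC; pose S := [set t | U [set w | t <= s w]].
have hS : has_sup S.
  split.
    by exists (- C); apply: filterS hC => w /=; rewrite ler_norml => /andP[].
  exists C => t ht; rewrite leNgt; apply/negP => lt; apply: ae_false.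
  apply: filterS (filterI hC ht) => w [/=]; rewrite ler_norml => /andP[_ h1] h2.
  by have := le_lt_trans (le_trans h2 h1) lt; rewrite ltxx.
exists (sup S) => e e0.
have [t ht lt] := sup_adherent e0 hS.
have [h|h] := ae_not (fun w => sup S + e <= s w).
  have : S (sup S + e) by [].
  by move=> /(sup_upper_bound hS); lra.
apply: filterS (filterI ht h) => w [/= h1 /negP]; rewrite -ltNge => h2.
by rewrite ltr_norml; apply/andP; split; lra.
Qed.

Lemma infl_ae (P : E -> Prop) n p : nearr n P -> (forall i, (i < n)%N -> infl (fun w => p w i)) ->
  U [set w | P (p w)].
Proof.
move=> [r [r0 h]] hp.
have : U [set w | forall i, (i < n)%N -> `|p w i| < r] by apply: ae_all => i hi; exact: hp.
by apply: filterS => w /= hw; apply: h => i hi; exact/ltW/hw.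
Qed.

Lemma infl_AG n f p : AGr n f -> f E0 = 0 -> (forall i, (i < n)%N -> infl (fun w => p w i)) ->
  infl (fun w => f (p w)).
Proof.
move=> hf f0 hp e e0; have := infl_ae (AG_cont hf e0) hp.
by apply: filterS => w /=; rewrite f0 subr0.
Qed.

Lemma infl_ext (s t : Om -> R) : U [set w | s w = t w] -> infl s -> infl t.
Proof. by move=> h hs e e0; apply: filterS (filterI h (hs e e0)) => w [/= <-]. Qed.

(** The points [p], tending to 0 along [U], factor almost everywhere through the germ [phi], and the
    lifts [q] again tend to 0. Blow-up charts, power maps and coordinate changes all take this
    form. *)
Definition lifts n p (phi : E -> E) q := [/\ forall i, (i < n)%N -> AGr n (fun x => phi x i),
  forall i, (i < n)%N -> phi E0 i = 0, forall i, (i < n)%N -> infl (fun w => q w i) &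
  U [set w | forall i, (i < n)%N -> phi (q w) i = p w i]].

Definition NCable n h p := exists phi q, lifts n p phi q /\ NCr n (fun x => h (phi x)).

Lemma lifts_id n p : (forall i, (i < n)%N -> infl (fun w => p w i)) -> lifts n p id p.
Proof.
move=> hp; split => //; first by move=> i hi; exact: AG_coord.
by apply: filterS filterT.
Qed.

Lemma lifts_comp n p phi q psi s : lifts n p phi q -> lifts n q psi s ->
  lifts n p (fun x => phi (psi x)) s.
Proof.
move=> [h1 h2 h3 h4] [k1 k2 k3 k4]; split => //.
- by move=> i hi; apply: (AG_comp (h1 i hi)).
- move=> i hi; have [r [r0 dep]] := AG_dep (h1 i hi).
  rewrite -(h2 i hi); symmetry; apply: dep; first by apply: pd0; exact: ltW.
  by move=> l hl; rewrite k2.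
- have : U [set w | forall i, (i < n)%N -> phi (psi (s w)) i = phi (q w) i].
    apply: ae_all => i hi; have [r [r0 dep]] := AG_dep (h1 i hi).
    have nb : nearr n (fun x => pd (K := vR R) n r x) by exists r.
    apply: filterS (filterI (infl_ae nb h3) k4) => w [/= a b].
    by symmetry; apply: dep => // l hl; rewrite b.
  move=> h5; apply: filterS (filterI h4 h5) => w [/= a b] i hi.
  by rewrite b // a.
Qed.

Lemma NC_step n p phi q h : lifts n p phi q -> NCable n (fun x => h (phi x)) q -> NCable n h p.
Proof.
move=> l1 [psi [s [l2 nc]]]; exists (fun x => phi (psi x)), s; split => //.
exact: lifts_comp l1 l2.
Qed.

Lemma NCable_ext n p f g : nearr n (fun x => f x = g x) -> NCable n f p -> NCable n g p.
Proof.
move=> e [phi [q [l nc]]]; exists phi, q; split => //; apply: NCf_ext nc.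
by case: l => h1 h2 _ _; exact: near0_comp e h1 h2.
Qed.

Lemma NCable_id n p f : (forall i, (i < n)%N -> infl (fun w => p w i)) -> NCr n f -> NCable n f p.
Proof. by move=> hp nc; exists id, p; split => //; exact: lifts_id. Qed.

Definition extl n (phi : E -> E) (x : E) : E := fun i => if (i < n)%N then phi x i else x i.

Lemma lifts_ext n p phi q : lifts n p phi q -> infl (fun w => p w n) ->
  lifts n.+1 p (extl n phi) (fun w i => if (i < n)%N then q w i else p w i).
Proof.
move=> [h1 h2 h3 h4] pn; split.
- move=> i hi; rewrite /extl; case: ltnP => h; last exact: AG_coord.
  by apply: (AG_weaken (leqnSn n)); exact: h1.
- by move=> i hi; rewrite /extl; case: ltnP => h //; exact: h2.
- move=> i hi; case: ltnP => h; first exact: h3.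
  by have -> : i = n by lia.
- have : U [set w | forall i, (i < n)%N -> phi (fun i => if (i < n)%N then q w i else p w i) i = phi (q w) i].
    apply: ae_all => i hi; have [r [r0 dep]] := AG_dep (h1 i hi).
    have nb : nearr n (fun x => pd (K := vR R) n r x) by exists r.
    apply: filterS (infl_ae nb h3) => w /= a.
    by symmetry; apply: dep => // l hl; rewrite hl.
  move=> h5; apply: filterS (filterI h4 h5) => w [/= a b] i hi.
  by rewrite /extl; case: ltnP => h //; rewrite b // a.
Qed.

(** The ultrafilter fixes the sign of each coordinate; a D-th root of the absolute value then lifts
    the point. *)
Lemma lifts_pow n p D : (0 < D)%N -> (forall i, (i < n)%N -> infl (fun w => p w i)) ->
  exists (sg : nat -> R) q, (forall i, sg i != 0) /\
    lifts n p (fun x i => sg i * x i ^+ D) q.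
Proof.
move=> D0 hp.
have [sg hsg] : {sg : nat -> R & forall i, (sg i = 1 /\ U [set w | 0 <= p w i]) \/
     (sg i = -1 /\ U [set w | ~ (0 <= p w i)])}.
  apply: (@choice _ _ (fun i s => (s = 1 /\ U [set w | 0 <= p w i]) \/
     (s = -1 /\ U [set w | ~ (0 <= p w i)]))) => i; have [h|h] := ae_not (fun w => 0 <= p w i).
    by exists 1; left.
  by exists (-1); right.
pose q w i := `|p w i| `^ (D%:R^-1).
have qD w i : q w i ^+ D = `|p w i|.
  rewrite /q -powR_mulrn ?powR_ge0 // -powRrM mulVf ?pnatr_eq0 ?lt0n_neq0 //.
  by rewrite powRr1.
exists sg, q; split.
  by move=> i; case: (hsg i) => -[-> _]; rewrite ?oppr_eq0 oner_neq0.
split.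
- move=> i hi; apply: AG_mul; first exact: AG_cst.
  by apply: AG_exp; exact: AG_coord.
- by move=> i hi; rewrite expr0n eqn0Ngt D0 mulr0.
- move=> i hi e e0; apply: filterS (hp i hi (e ^+ D) (exprn_gt0 _ e0)) => w /= h.
  rewrite ger0_norm ?powR_ge0 // ltNge; apply/negP => le.
  suff : e ^+ D <= `|p w i| by rewrite leNgt h.
  by rewrite -qD; apply: lerXn2r; rewrite ?nnegrE ?powR_ge0 ?(ltW e0).
- apply: ae_all => i hi; case: (hsg i) => -[-> h]; apply: filterS h => w /= h; rewrite qD.
    by rewrite mul1r ger0_norm.
  by move/negP: h; rewrite -ltNge => h; rewrite mulN1r ltr0_norm // opprK.
Qed.

Lemma mono_upd_last n x v al : mn n (updr x n v) al = mn n x al.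
Proof. by apply: mono_ext => i hi; split => //; rewrite upd_other //; lia. Qed.

(** The claim for order at most [d] in the last variable. The factor [k] in the other variables
    accumulates what has been divided out on the way. *)
Definition Pnd n d := forall k g p, AGr n k -> nzr n k -> regr n d g ->
  (forall i, (i < n.+1)%N -> infl (fun w => p w i)) -> NCable n.+1 (fun x => k x * g x) p.

(** Provides the centre of a blow-up chart: a bounded quotient has a limit along [U]. The convention
    1/0 = 0 does no harm, as s vanishes almost everywhere that t does. *)
Lemma infl_ratio (s t : Om -> R) C : U [set w | `|s w| <= C * `|t w|] ->
  exists l, infl (fun w => s w / t w - l) /\ U [set w | s w = t w * (s w / t w)].
Proof.
move=> h.
have h1 : U [set w | s w = t w * (s w / t w)].
  apply: filterS h => w /= h; have [t0|t0] := eqVneq (t w) 0.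
    move: h; rewrite t0 normr0 mulr0 normr_le0 => /eqP ->; by rewrite mul0r.
  by rewrite mulrC divfK.
have [|l hl] := @ulim_exists (fun w => s w / t w) `|C|; last by exists l.
apply: filterS h => w /= h; have [t0|t0] := eqVneq (t w) 0.
  by rewrite t0 invr0 mulr0 normr0.
rewrite normrM normfV ler_pdivrMr ?normr_gt0 //; apply: le_trans h _.
by rewrite ler_wpM2r // ler_norm.
Qed.

(** Induction on the total exponent s of [be]. Each step blows up x_n = x_i = 0 with be_i > 0 and
    divides by the (D+1)-st power of the exceptional coordinate: either be_i drops by 1, or the
    order in x_n drops, or the quotient is a unit. For s = 0 the unit c_j0 already bounds the order
    by j0. *)
Lemma blowup n D (IHd : forall d', (d' < D.+1)%N -> Pnd n d') :
  forall s (be : nat -> nat), (\sum_(0 <= i < n) be i = s)%N ->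
  forall k (c : nat -> E -> R) u p j0, NCr n k -> (forall j, (j < D)%N -> AGr n (c j)) ->
  AGr n.+1 u -> u E0 != 0 -> (j0 < D)%N -> c j0 E0 != 0 ->
  (forall i, (i < n.+1)%N -> infl (fun w => p w i)) ->
  NCable n.+1 (fun x => k x * (\sum_(0 <= j < D)
     mn n x (fun i => be i * (D.+1 - j))%N * c j x * x n ^+ j + x n ^+ D.+1 * u x)) p.
Proof.
elim=> [|s IHs] be hbe k c u p j0 hk hc hu u0 j0D cj0 hp.
  have be0 i : (i < n)%N -> be i = 0%N.
    move=> hi; move: hbe; rewrite (bigD1_seq i) ?mem_index_iota ?iota_uniq //=; lia.
  apply: (IHd j0) => //; first by lia.
  - exact: NCf_AG.
  - exact: NCf_nz.
  - apply: (@reg_lower R (vR R) n D.+1 _ (fun j x => if (j < D)%N then c j x else 0) u).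
    + by move=> j hj; case: ltnP => h; [exact: hc|exact: AG_cst].
    + exact: hu.
    + apply: near0T => x; rewrite big_nat_recr //= ltnn mul0r addr0; congr (_ + _).
      apply: eq_big_nat => j /andP[_ ->]; rewrite mono0 ?mul1r // => i hi.
      by rewrite be0.
    + by lia.
    + by rewrite j0D.
have [i hi bi] : exists2 i, (i < n)%N & (0 < be i)%N.
  apply: contrapT => q; move: hbe; rewrite big_nat big1 // => i /andP[_ hi].
  by apply/eqP; rewrite -leqn0 leqNgt; apply/negP => ai; apply: q; exists i.
have hin : (i < n.+1)%N by lia.
have ine : n != i by lia.
pose be' l := if l == i then (be i).-1 else be l.
have moE x m : mn n x (fun l => be l * m)%N = x i ^+ m * mn n x (fun l => be' l * m)%N.
  rewrite !(mono_D1 _ _ hi) /be' eqxx mulrA -exprD; congr (_ ^+ _ * _).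
    by rewrite -mulSn prednK.
  by apply: eq_bigr => l /negbTE ->.
have hbe' : (\sum_(0 <= l < n) be' l = s)%N.
  move: hbe; rewrite !(bigD1_seq i (r := index_iota 0 n)) ?mem_index_iota ?iota_uniq //= /be' eqxx.
  rewrite [X in _ -> (_ + X)%N = _](eq_bigr be); last by move=> l /negbTE ->.
  lia.
(* Either x_n is dominated by x_i, giving the chart x_n = x_i (ys + x_n') with ys the limit of the
   quotient, or x_i / x_n tends to 0, giving the chart x_i = x_n x_i'. *)
case: (pselect (exists C, U [set w | `|p w n| <= C * `|p w i|])) => [[C hC]|noC].
  have [ys [hys hs]] := infl_ratio hC.
  pose phi (x : E) := updr x n (x i * (ys + x n)).
  pose q w := updr (p w) n (p w n / p w i - ys).
  have lph : lifts n.+1 p phi q.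
    split.
    - move=> l hl; rewrite /phi /upd; case: eqP => _; last exact: AG_coord.
      apply: AG_mul; first exact: AG_coord.
      by apply: AG_add; [exact: AG_cst|exact: AG_coord].
    - by move=> l hl; rewrite /phi /upd; case: eqP => // _; rewrite mul0r.
    - move=> l hl; rewrite /q /upd; case: eqP => // _; exact: hp.
    - apply: filterS hs => w /= hs l hl; rewrite /phi /q /upd; case: eqP => [->|//].
      rewrite eqxx (negbTE (_ : i != n)) 1?eq_sym // addrC subrK.
      by rewrite -hs.
  have hup : AGr n.+1 (fun x => u (phi x)) by case: lph => h1 h2 _ _; apply: (AG_comp hu).
  have phi0 : phi E0 = E0 by rewrite /phi mul0r; exact: upd00.
  have cphi : nearr n.+1 (fun x => forall j, (j < D)%N -> c j (phi x) = c j x).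
    apply: near0_all => j hj; have [r [r0 dep]] := AG_dep (hc j hj).
    exists r; split => // x hx; symmetry; apply: dep; first exact: pdS.
    by move=> l hl; rewrite /phi upd_other //; lia.
  have kphi : nearr n.+1 (fun x => k (phi x) = k x).
    have [r [r0 dep]] := AG_dep (NCf_AG hk).
    exists r; split => // x hx; symmetry; apply: dep; first exact: pdS.
    by move=> l hl; rewrite /phi upd_other //; lia.
  pose g' x := \sum_(0 <= j < D) mn n x (fun l => be' l * (D.+1 - j))%N * c j x * (ys + x n) ^+ j
      + (ys + x n) ^+ D.+1 * u (phi x).
  have fact : nearr n.+1 (fun x => k x * x i ^+ D.+1 * g' x =
     k (phi x) * (\sum_(0 <= j < D) mn n (phi x) (fun i => be i * (D.+1 - j))%N * c j (phi x) * phi x n ^+ j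
       + phi x n ^+ D.+1 * u (phi x))).
    apply: near0S (near0I cphi kphi) => x [e1 e2]; rewrite e2 -mulrA; congr (_ * _).
    have -> : phi x n = x i * (ys + x n) by rewrite /phi upd_same.
    rewrite /g' mulrDr exprMn mulrA; congr (_ + _); rewrite mulr_sumr.
    apply: eq_big_nat => j /andP[_ jD]; rewrite e1 // /phi mono_upd_last moE exprMn.
    have -> : x i ^+ D.+1 = x i ^+ (D.+1 - j) * x i ^+ j by rewrite -exprD subnK //; lia.
    by ring.
  have hkx : NCr n (fun x => k x * x i ^+ D.+1) by apply: NCf_mul => //; exact: NCf_coordX.
  have hq : forall l, (l < n.+1)%N -> infl (fun w => q w l) by case: lph.
  apply: (NC_step lph); apply: (NCable_ext fact).
  have [ys0|ysn0] := eqVneq ys 0.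
    apply: (@NCable_ext _ _ (fun x => k x * x i ^+ D.+1 * (\sum_(0 <= j < D)
        mn n x (fun l => be' l * (D.+1 - j))%N * c j x * x n ^+ j + x n ^+ D.+1 * u (phi x)))).
      by apply: near0T => x; rewrite /g' ys0 add0r; congr (_ * (_ + _)); apply: eq_bigr => j _; rewrite add0r.
    by apply: (IHs be' hbe' (fun x => k x * x i ^+ D.+1) c (fun x => u (phi x)) q j0) => //; rewrite phi0.
  have hg' : AGr n.+1 g'.
    have hyx : AGr n.+1 (fun x => ys + x n) by apply: AG_add; [exact: AG_cst|exact: AG_coord].
    apply: AG_add; last by apply: AG_mul => //; exact: AG_exp.
    apply: AG_sum_nat => j hj; apply: AG_mul; last exact: AG_exp.
    apply: AG_mul; first by apply: AG_mono; exact: leqnSn.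
    by apply: (AG_weaken (leqnSn n)); exact: hc.
  (* [phi] sends the axis of x_n to 0, so on it the coefficients of g' are frozen at 0 and g' is the
     polynomial of [poly_not_flat] with c = ys. *)
  have [d' d'D hreg] : exists2 d', (d' < D.+1)%N & regr n d' g'.
    apply: reg_crit => // -[C1 [r [r0 hfl]]].
    apply: (@poly_not_flat R D (fun j => mn n E0 (fun l => be' l * (D.+1 - j))%N * c j E0) (u E0) ys) => //.
    have cE y j : (j < D)%N -> c j (updr E0 n y) = c j E0.
      move=> hj; have [r1 [r10 dep]] := AG_dep (hc j hj); symmetry; apply: dep.
        by apply: pd0; exact: ltW.
      by move=> l hl; rewrite upd_other //; clear -hl; lia.
    exists C1, r; split => // y yr.
    have := hfl y yr; rewrite /g'.
    have -> : phi (updr E0 n y) = E0.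
      rewrite /phi upd_upd upd_other; last by rewrite eq_sym.
      by rewrite mul0r; exact: upd00.
    rewrite upd_same; apply: le_trans; apply: eqW_le; congr (`|_ + _|).
    by apply: eq_big_nat => j /andP[_ jD]; rewrite mono_upd_last cE.
  by apply: (IHd d' d'D) => //; [exact: NCf_AG|exact: NCf_nz].
have noC' C : U [set w | C * `|p w i| < `|p w n|].
  have [h|h] := ae_not (fun w => `|p w n| <= C * `|p w i|).
    by exfalso; apply: noC; exists C.
  by apply: filterS h => w /negP; rewrite -ltNge.
have pn0 : U [set w | p w n != 0].
  by apply: filterS (noC' 0) => w /=; rewrite mul0r normr_gt0.
pose phi (x : E) := updr x i (x n * x i).
pose q w := updr (p w) i (p w i / p w n).
have lph : lifts n.+1 p phi q.
  split.
  - move=> l hl; rewrite /phi /upd; case: eqP => _; last exact: AG_coord.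
    by apply: AG_mul; exact: AG_coord.
  - by move=> l hl; rewrite /phi /upd; case: eqP => // _; rewrite mul0r.
  - move=> l hl; rewrite /q /upd; case: eqP => [_|_]; last exact: hp.
    move=> e e0; apply: filterS (filterI pn0 (noC' e^-1)) => w [/= h1 h2].
    by rewrite normrM normfV ltr_pdivrMr ?normr_gt0 // mulrC -ltr_pdivrMr // mulrC.
  - apply: filterS pn0 => w /= h l hl; rewrite /phi /q /upd; case: eqP => [->|//].
    by rewrite eqxx (negbTE ine) mulrC divfK.
apply: (NC_step lph); apply: NCable_id; first by case: lph.
have [h1 h2 _ _] := lph.
have mophi x m : mn n (phi x) m = mn n x m * x n ^+ m i.
  rewrite !(mono_D1 _ _ hi) /phi upd_same exprMn (eq_bigr (fun l => x l ^+ m l)); first by ring.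
  by move=> l li; rewrite upd_other.
apply: NCf_mul.
  have [ka [ku [hku ku0 ek]]] := hk.
  have hk' : NCr n.+1 (fun x => mn n x ka * x n ^+ ka i * ku (phi x)).
    apply: NCf_mul; last first.
      apply: NCf_unit; first by apply: (AG_comp (AG_weaken (leqnSn n) hku)).
      by have -> : phi E0 = E0 by rewrite /phi mul0r; exact: upd00.
    by apply: NCf_mul; [apply: NCf_mono; exact: leqnSn|exact: NCf_coordX].
  apply: NCf_ext hk'.
  by apply: near0S (near0_comp (near0_weaken (leqnSn n) ek) h1 h2) => x ->; rewrite mophi.
have phin x : phi x n = x n by rewrite /phi upd_other.
(* All terms but the last keep a positive power of x_i, so V(0) = u(0). *)
pose V x := \sum_(0 <= j < D) mn n x (fun l => be l * (D.+1 - j))%N *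
     x n ^+ ((be i).-1 * (D.+1 - j)) * c j (phi x) + u (phi x).
apply: (@NCf_ext R (vR R) _ (fun x => x n ^+ D.+1 * V x)).
  apply: near0T => x; rewrite /V mulrDr phin; congr (_ + _); rewrite mulr_sumr.
  apply: eq_big_nat => j /andP[_ jD]; rewrite mophi.
  have -> : x n ^+ (be i * (D.+1 - j)) = x n ^+ (D.+1 - j) * x n ^+ ((be i).-1 * (D.+1 - j)).
    by rewrite -exprD -mulSn prednK.
  have -> : x n ^+ D.+1 = x n ^+ (D.+1 - j) * x n ^+ j by rewrite -exprD subnK //; lia.
  by ring.
apply: NCf_mul; first exact: NCf_coordX.
apply: NCf_unit.
  apply: AG_add; last by apply: (AG_comp hu).
  apply: AG_sum_nat => j hj; apply: AG_mul.
    apply: AG_mul; first by apply: AG_mono; exact: leqnSn.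
    by apply: AG_exp; exact: AG_coord.
  by apply: (AG_comp (AG_weaken (leqnSn n) (hc j hj))).
have phi0 : phi E0 = E0 by rewrite /phi mul0r; exact: upd00.
rewrite /V phi0 big_nat big1 ?add0r // => j /andP[_ jD].
by rewrite (mono_eq0 hi) ?mul0r // muln_gt0 bi; lia.
Qed.

Lemma ext_agree n f p phi q : AGr n f -> lifts n p phi q ->
  nearr n.+1 (fun x => f (extl n phi x) = f (phi x)).
Proof.
move=> hf [h1 h2 _ _]; have [r [r0 dep]] := AG_dep hf.
have nb : nearr n (fun x => pd (K := vR R) n r x) by exists r.
have := near0_weaken (leqnSn n) (near0_comp nb h1 h2).
apply: near0S => x hx; symmetry; apply: dep => // i hi; by rewrite /extl hi.
Qed.

Lemma nz_prod n (I : eqType) (s : seq I) (F : I -> E -> R) : (forall i, AGr n (F i)) ->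
  (forall i, nzr n (F i)) -> nzr n (fun x => \prod_(i <- s) F i x).
Proof.
move=> hF nF; elim: s => [|i s IH].
  apply: (@nz_ext R (vR R) n (fun=> 1)); last by apply: nz_at; [exact: AG_cst|exact: oner_neq0].
  by apply: near0T => x; rewrite big_nil.
apply: nz_ext (nz_mul (hF i) _ (nF i) IH); last exact: AG_prod.
by apply: near0T => x; rewrite big_cons.
Qed.

(** Turns zero germs into 1, so that a product over a whole family of germs remains nonzero. *)
Definition nzp n f : E -> R := if `[< nearr n (fun x => f x = 0) >] then fun=> 1 else f.

Lemma nzp_AG n f : AGr n f -> AGr n (nzp n f).
Proof. by rewrite /nzp; case: ifP => // _ _; exact: AG_cst. Qed.

Lemma nzp_nz n f : nzr n (nzp n f).
Proof.
rewrite /nzp; case: ifP => [_|/asboolP //].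
by apply: nz_at; [exact: AG_cst|exact: oner_neq0].
Qed.

Lemma mono_pow n (sg : nat -> R) D x al : mn n (fun i => sg i * x i ^+ D) al =
  mn n sg al * mn n x (fun i => al i * D)%N.
Proof.
rewrite /mono -big_split; apply: eq_bigr => i _ /=.
by rewrite exprMn -exprM mulnC.
Qed.

Lemma NCf_pow n f (sg : nat -> R) D : (0 < D)%N -> (forall i, sg i != 0) -> NCr n f ->
  NCr n (fun x => f (fun i => sg i * x i ^+ D)).
Proof.
move=> D0 hsg [al [u [hu u0 e]]].
have h1 i : (i < n)%N -> AGr n (fun x => sg i * x i ^+ D).
  move=> hi; apply: AG_mul; first exact: AG_cst.
  by apply: AG_exp; exact: AG_coord.
have z0 i : sg i * E0 i ^+ D = 0 by rewrite expr0n eqn0Ngt D0 mulr0.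
exists (fun i => al i * D)%N, (fun x => mn n sg al * u (fun i => sg i * x i ^+ D)); split.
- apply: AG_mul; first exact: AG_cst.
  by apply: (AG_comp hu).
- rewrite mulf_neq0 //; first by apply: mono_neq0 => i _ /eqP; rewrite (negbTE (hsg i)).
  by have -> : (fun i => sg i * E0 i ^+ D) = E0 by apply/funext => i; rewrite z0.
- apply: near0S (@near0_comp R (vR R) n n _ (fun x i => sg i * x i ^+ D) e h1 (fun i _ => z0 i)) => x ->.
  by rewrite mono_pow; ring.
Qed.

Lemma sum_squeeze n (a b : nat -> nat) : (forall i, (i < n)%N -> (b i <= a i)%N) ->
  (\sum_(0 <= i < n) a i <= \sum_(0 <= i < n) b i)%N -> forall i, (i < n)%N -> (a i <= b i)%N.
Proof.
move=> h hs i hi; rewrite leqNgt; apply/negP => lt; move: hs.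
rewrite !(bigD1_seq i (r := index_iota 0 n)) ?mem_index_iota ?iota_uniq //= leqNgt.
move=> /negP; apply; rewrite -addSn leq_add //.
rewrite big_nat_cond [X in (_ <= X)%N]big_nat_cond.
by apply: leq_sum => l /andP[/andP[_ hl] _]; exact: h.
Qed.

(** The term of degree D is absent, as [poly_not_flat] requires. Resolving, in n variables, the
    product of k, the nonzero c_j and the nonzero differences of the powers c_i^(e_i) makes these
    powers monomials totally ordered by divisibility; the least one supplies the exponent [be] of
    [blowup]. *)
Lemma reduced n D (NCn : forall h p, AGr n h -> nzr n h ->
    (forall i, (i < n)%N -> infl (fun w => p w i)) -> NCable n h p)
  (IHd : forall d', (d' < D.+1)%N -> Pnd n d') k (c : nat -> E -> R) u p :
  AGr n k -> nzr n k -> (forall j, AGr n (c j)) -> AGr n.+1 u -> u E0 != 0 ->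
  (forall i, (i < n.+1)%N -> infl (fun w => p w i)) ->
  NCable n.+1 (fun x => k x * (\sum_(0 <= j < D) c j x * x n ^+ j + x n ^+ D.+1 * u x)) p.
Proof.
move=> hk knz hc hu u0 hp.
have hp' : forall i, (i < n)%N -> infl (fun w => p w i) by move=> i hi; apply: hp; lia.
pose Z j := nearr n (fun x => c j x = 0).
case: (pselect (forall j, (j < D)%N -> Z j)) => [allZ|allZ].
  have [phi [q [l nc]]] := NCn k p hk knz hp'.
  have l' := lifts_ext l (hp n (ltnSn n)).
  apply: (NC_step l'); apply: NCable_id; first by case: l'.
  have [h1 h2 _ _] := l'.
  apply: NCf_mul.
    apply: NCf_ext (NCf_weaken (leqnSn n) nc).
    by apply: near0S (ext_agree hk l) => x ->.
  apply: (@NCf_ext R (vR R) _ (fun x => x n ^+ D.+1 * u (extl n phi x))).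
    have zz : nearr n.+1 (fun x => forall j, (j < D)%N -> c j x = 0).
      by apply: near0_all => j hj; apply: near0_weaken (leqnSn n) _; exact: allZ.
    apply: near0S (near0_comp zz h1 h2) => x hx; rewrite big_nat big1 ?add0r => [|j /andP[_ jD]].
      by have -> : extl n phi x n = x n by rewrite /extl ltnn.
    by rewrite hx // mul0r.
  apply: NCf_mul; first exact: NCf_coordX.
  apply: NCf_unit; first by apply: (AG_comp hu).
  have [r [r0 dep]] := AG_dep hu; rewrite -(dep E0) //; first by apply: pd0; exact: ltW.
  by move=> i hi; rewrite h2.
have [j1 j1D nz1] : exists2 j, (j < D)%N & ~ Z j.
  by apply: contrapT => h; apply: allZ => j jD; apply: contrapT => nZ; apply: h; exists j.
(* The natural quantities to compare are c_j^(1/(D+1-j)); raising them to the power (D+1)! gives the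
   integral exponents e_j. *)
pose e j := (D.+1`! %/ (D.+1 - j))%N.
have eE j : (j < D)%N -> ((D.+1 - j) * e j = D.+1`!)%N.
  by move=> jD; rewrite mulnC /e divnK //; apply: dvdn_fact; lia.
pose dif i j (x : E) := c i x ^+ e i - c j x ^+ e j.
have hdif i j : AGr n (dif i j) by apply: AG_sub; exact: AG_exp.
pose F (t : nat * nat) := if t.1 == t.2 then nzp n (c t.1) else nzp n (dif t.1 t.2).
have hF t : AGr n (F t) by rewrite /F; case: ifP => _; exact: nzp_AG.
have nF t : nzr n (F t) by rewrite /F; case: ifP => _; exact: nzp_nz.
pose s := [seq (i, j) | i <- iota 0 D, j <- iota 0 D].
have ms i j : (i < D)%N -> (j < D)%N -> (i, j) \in s.
  by move=> hi hj; apply/allpairsP; exists (i, j); rewrite !mem_iota.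
have hP : AGr n (fun x => \prod_(t <- s) F t x) by apply: AG_prod.
have [phi [q [l nc]]] := NCn (fun x => k x * \prod_(t <- s) F t x) p
  (AG_mul hk hP) (nz_mul hk hP knz (nz_prod hF nF)) hp'.
have [f1 f2 f3 _] := l.
have cAG f : AGr n f -> AGr n (fun x => f (phi x)) by move=> hf; apply: (AG_comp hf).
have nck : NCr n (fun x => k (phi x)) := NCf_factor (cAG _ hk) (cAG _ hP) nc.
have ncF t : t \in s -> NCr n (fun x => F t (phi x)).
  apply: (@NCf_factor_prod R (vR R) n _ s (fun t x => F t (phi x))) => [i|]; first exact: cAG.
  apply: NCf_factor (cAG _ hP) (cAG _ hk) _.
  by apply: NCf_ext nc; apply: near0T => x; rewrite mulrC.
have ncc j : (j < D)%N -> ~ Z j -> NCr n (fun x => c j (phi x)).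
  move=> jD nZ; have := ncF (j, j) (ms _ _ jD jD).
  by rewrite /F /= eqxx /nzp; case: ifP => [/asboolP //|_].
have ncd i j : (i < D)%N -> (j < D)%N -> i != j ->
   nearr n (fun x => dif i j (phi x) = 0) \/ NCr n (fun x => dif i j (phi x)).
  move=> iD jD ij; have := ncF (i, j) (ms _ _ iD jD).
  rewrite /F /= (negbTE ij) /nzp; case: ifP => [/asboolP z _|_ h]; last by right.
  by left; exact: near0_comp z f1 f2.
have [ga hga] : {ga : nat -> (nat -> nat) * (E -> R) & forall j, (j < D)%N -> ~ Z j ->
    [/\ AGr n (ga j).2, (ga j).2 E0 != 0 &
      nearr n (fun x => c j (phi x) = mn n x (ga j).1 * (ga j).2 x)]}.
  apply: (@choice _ _ (fun j (t : (nat -> nat) * (E -> R)) => (j < D)%N -> ~ Z j ->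
    [/\ AGr n t.2, t.2 E0 != 0 & nearr n (fun x => c j (phi x) = mn n x t.1 * t.2 x)])) => j.
  case: (pselect ((j < D)%N /\ ~ Z j)) => [[jD nZ]|no].
    by have [al [v [a1 a2 a3]]] := ncc j jD nZ; exists (al, v).
  by exists ((fun=> 0%N), fun=> 0) => a1 a2; exfalso; apply: no.
pose be j i := ((ga j).1 i * e j)%N.
have cmp i j : (i < D)%N -> ~ Z i -> (j < D)%N -> ~ Z j ->
   (forall l, (l < n)%N -> (be i l <= be j l)%N) \/ (forall l, (l < n)%N -> (be j l <= be i l)%N).
  move=> iD nZi jD nZj; have [->|ij] := eqVneq i j; first by left.
  have [a1 a2 a3] := hga i iD nZi; have [b1 b2 b3] := hga j jD nZj.
  apply: (@mono_comparable R (vR R) n (be i) (be j) (fun x => (ga i).2 x ^+ e i)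
     (fun x => (ga j).2 x ^+ e j) (fun x => dif i j (phi x))).
  - exact: AG_exp.
  - by rewrite expf_neq0.
  - exact: AG_exp.
  - by rewrite expf_neq0.
  - by apply: near0S (near0I a3 b3) => x [a b]; rewrite /dif a b !exprMn /be !monoX.
  - exact: ncd.
(* Minimal total degree together with comparability gives a coordinatewise least exponent. *)
pose Q m := `[< exists j, [/\ (j < D)%N, ~ Z j & (\sum_(0 <= i < n) be j i)%N = m] >].
have exQ : exists m, Q m by exists (\sum_(0 <= i < n) be j1 i)%N; apply/asboolP; exists j1.
case: (ex_minnP exQ) => m0 /asboolP [j0 [j0D nZ0 sm0]] minm0.
have minb j : (j < D)%N -> ~ Z j -> forall l, (l < n)%N -> (be j0 l <= be j l)%N.
  move=> jD nZ; have [//|h] := cmp j0 j j0D nZ0 jD nZ.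
  apply: sum_squeeze => //; rewrite sm0; apply: minm0; apply/asboolP; by exists j.
have l1 := lifts_ext l (hp n (ltnSn n)).
set q1 := (fun w i => _) in l1.
have hq1 : forall i, (i < n.+1)%N -> infl (fun w => q1 w i) by case: l1.
have fD : (0 < D.+1`!)%N by exact: fact_gt0.
(* Powers of order (D+1)! turn the exponent of c_j into be_j (D+1-j), which is at least be_j0
   (D+1-j) in every coordinate. *)
have [sg [q2 [hsg l2]]] := lifts_pow fD (fun i hi => hq1 i (ltnW hi)).
have l3 := lifts_ext l2 (hq1 n (ltnSn n)).
set pw := (fun (x : E) i => sg i * x i ^+ D.+1`!) in l2 l3.
have l4 := lifts_comp l1 l3.
apply: (NC_step l4).
have [g1 g2 g3 _] := l2; have [i1 i2 i3 _] := l3; have [k1 k2 k3 _] := l4.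
pose ch j x := if `[< Z j >] then 0 else
  mn n sg (ga j).1 * mn n x (fun i => (be j i - be j0 i) * (D.+1 - j))%N * (ga j).2 (pw x).
pose Psi x := extl n phi (extl n pw x).
have pw0 : pw E0 = E0 by apply/funext => i; rewrite /pw expr0n eqn0Ngt fD mulr0.
have Psi_dep f : AGr n f -> nearr n.+1 (fun x => f (Psi x) = f (phi (pw x))).
  move=> hf.
  have a1 := near0_comp (ext_agree hf l) i1 i2.
  have a2 := ext_agree (cAG _ hf) l2.
  by apply: near0S (near0I a1 a2) => x [e1 e2]; rewrite /Psi e1.
have cE j : (j < D)%N -> nearr n.+1 (fun x => c j (Psi x) =
     mn n x (fun i => be j0 i * (D.+1 - j))%N * ch j x).
  move=> jD; have a1 := Psi_dep _ (hc j).
  rewrite /ch; case: (asboolP (Z j)) => [z|nZ].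
    have a2 := near0_weaken (leqnSn n) (near0_comp (near0_comp z f1 f2) g1 g2).
    by apply: near0S (near0I a1 a2) => x [-> ->]; rewrite mulr0.
  have [_ _ a3] := hga j jD nZ.
  have a2 := near0_weaken (leqnSn n) (near0_comp a3 g1 g2).
  apply: near0S (near0I a1 a2) => x [-> ->]; rewrite mono_pow.
  rewrite -(_ : mn n x (fun i => be j0 i * (D.+1 - j))%N *
     mn n x (fun i => (be j i - be j0 i) * (D.+1 - j))%N = mn n x (fun i => (ga j).1 i * D.+1`!)%N).
    by ring.
  rewrite -monoD; apply: mono_ext => i hi; split => //.
  rewrite -mulnDl subnKC; last exact: minb.
  by rewrite /be -mulnA [(e j * _)%N]mulnC eE.
apply: (@NCable_ext _ _ (fun x => k (phi (pw x)) * (\sum_(0 <= j < D)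
     mn n x (fun i => be j0 i * (D.+1 - j))%N * ch j x * x n ^+ j + x n ^+ D.+1 * u (Psi x)))).
  apply: near0S (near0I (Psi_dep _ hk) (near0_all cE)) => x [e1 e2].
  rewrite -/(Psi x) e1; congr (_ * _).
  have -> : Psi x n = x n by rewrite /Psi /extl !ltnn.
  by congr (_ + _); apply: eq_big_nat => j /andP[_ jD]; rewrite e2.
apply: (blowup IHd (erefl _) (j0 := j0)) => //.
- exact: (NCf_pow fD hsg nck).
- move=> j jD; rewrite /ch; case: (asboolP (Z j)) => [_|nZ]; first exact: AG_cst.
  have [a1 _ _] := hga j jD nZ.
  apply: AG_mul; last by apply: (AG_comp a1).
  by apply: AG_mul; [exact: AG_cst|exact: AG_mono].
- by apply: (AG_comp hu).
- have [r [r0 dep]] := AG_dep hu; rewrite -(dep E0) //; first by apply: pd0; exact: ltW.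
  by move=> i hi; rewrite /Psi k2.
- rewrite /ch; case: ifPn => [/asboolP //|_].
  have [_ a2 _] := hga j0 j0D nZ0.
  rewrite pw0 mulf_neq0 // mulf_neq0 //; apply: mono_neq0 => i _.
    by move=> /eqP; rewrite (negbTE (hsg i)).
  by rewrite subnn.
Qed.

(** Order 0 means that g is a unit. In order D+1, a coefficient that is a unit lowers the order;
    otherwise a shift ta(x) of x_n with C_D(x, ta(x)) = 0 removes the term of degree D and [reduced]
    applies. *)
Lemma Pnd_all n (NCn : forall h p, AGr n h -> nzr n h ->
    (forall i, (i < n)%N -> infl (fun w => p w i)) -> NCable n h p) d : Pnd n d.
Proof.
elim/ltn_ind: d => d IH k g p hk knz [c [u [hc hu u0 e]]] hp.
have hp' : forall i, (i < n)%N -> infl (fun w => p w i) by move=> i hi; apply: hp; lia.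
case: d IH hc e => [|D] IH hc e.
  have [phi [q [l nc]]] := NCn k p hk knz hp'.
  have l' := lifts_ext l (hp n (ltnSn n)).
  apply: (NC_step l'); apply: NCable_id; first by case: l'.
  have [h1 h2 _ _] := l'.
  apply: NCf_mul.
    apply: NCf_ext (NCf_weaken (leqnSn n) nc).
    by apply: near0S (ext_agree hk l) => x ->.
  apply: (@NCf_ext R (vR R) _ (fun x => u (extl n phi x))).
    by apply: near0S (near0_comp e h1 h2) => x ->; rewrite big_geq // add0r expr0 mul1r.
  apply: NCf_unit; first by apply: (AG_comp hu).
  have [r [r0 dep]] := AG_dep hu; rewrite -(dep E0) //; first by apply: pd0; exact: ltW.
  by move=> i hi; rewrite h2.
case: (pselect (exists2 j, (j < D.+1)%N & c j E0 != 0)) => [[j jD cj]|noj].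
  exact: IH jD k g p hk knz (reg_lower hc hu e jD cj) hp.
have cD0 : c D E0 = 0.
  by apply/eqP; apply: contrapT => /negP q; apply: noj; exists D.
have [C [e' [V [hC he' hV [e'0 V0 eC eS]]]]] := translate hc hu.
have a0 : e' E0 != 0 by rewrite e'0 mulf_neq0 // pnatr_eq0.
(* C_D = 0 as a fixed point equation: division by e'(0), the derivative of C_D in x_n at 0, cancels
   the linear term. *)
pose H (i : nat) (x : E) := x n - C D x / e' E0.
have hH : AGr n.+1 (H 0%N).
  apply: AG_sub; first exact: AG_coord.
  by apply: AG_mul; [exact: hC|exact: AG_cst].
have CD0 : C D E0 = 0 by have := near0_at eC; rewrite cD0 add0r mul0r.
have [th [th1 th2 th3]] : exists th : E -> E, [/\ forall i, (i < 1)%N -> AGr n (fun x => th x i),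
    forall i, (i < 1)%N -> th E0 i = 0 &
    nearr n (fun x => forall i, (i < 1)%N -> th x i = H i (joinE (K := vR R) n x (th x)))].
  apply: (@implicit R (vR R) n 1 H).
  - by move=> i _; rewrite addn1.
  - by move=> i _; rewrite /H CD0 mul0r subr0.
  - move=> i j _; rewrite ltnS leqn0 => /eqP ->; rewrite addn0.
    have [C1 [r1 [C10 r10 lip]]] := AG_lip0 (ltnSn n) he'.
    have [r2 [r20 h2]] := eC.
    have [r3 [r30 dep]] := AG_dep (hc D (ltnSn D)).
    exists (C1 / `|e' E0|), (Num.min r1 r2); rewrite lt_min r10 r20; split => // t.
    rewrite le_min => /andP[tr1 tr2] /=.
    have hpd : pd (K := vR R) n.+1 r2 (updr E0 n t) by apply: pd_upd => //; apply: pd0; exact: ltW.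
    have cz : c D (updr E0 n t) = 0.
      rewrite -cD0; symmetry; apply: dep; first by apply: pd0; exact: ltW.
      by move=> l hl; rewrite upd_other //; clear -hl; lia.
    rewrite /H h2 // cz add0r !upd_same.
    have -> : t - t * e' (updr E0 n t) / e' E0 = - (t * (e' (updr E0 n t) - e' E0) / e' E0).
      by rewrite mulrBr mulrBl (mulfK a0) opprB.
    have q := lip t tr1; rewrite normrN !normrM normfV.
    have -> : C1 / `|e' E0| * `|t| ^+ 2 = `|t| * (C1 * `|t|) / `|e' E0| by ring.
    by apply: ler_wpM2r; [rewrite invr_ge0|apply: ler_wpM2l].
pose ta x := th x 0%N.
have hta : AGr n ta by exact: th1.
have ta0 : ta E0 = 0 by exact: th2.
pose phi x := updr x n (x n + ta x).
pose q w := updr (p w) n (p w n - ta (p w)).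
have htw := AG_weaken (leqnSn n) hta.
have [rt [rt0 dept]] := AG_dep hta.
have lph : lifts n.+1 p phi q.
  split.
  - move=> l hl; rewrite /phi /upd; case: eqP => _; last exact: AG_coord.
    by apply: AG_add => //; exact: AG_coord.
  - by move=> l hl; rewrite /phi /upd; case: eqP => // _; rewrite ta0 addr0.
  - move=> l hl; rewrite /q /upd; case: eqP => _; last exact: hp.
    apply: (@infl_AG n.+1 (fun x => x n - ta x)) => //; last by rewrite ta0 subr0.
    by apply: AG_sub => //; exact: AG_coord.
  - have nb : nearr n (fun x => pd (K := vR R) n rt x) by exists rt.
    apply: filterS (infl_ae nb hp') => w /= a l hl; rewrite /phi /q.
    have -> : ta (updr (p w) n (p w n - ta (p w))) = ta (p w).
      by symmetry; apply: dept => // i hi; rewrite upd_other //; lia.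
    by rewrite upd_upd upd_same subrK upd_id.
have [p1 p2 p3 _] := lph.
(* The point at which the identity of [translate] is used: coordinate n holds the shift, coordinate
   n+1 the new last variable. *)
pose Y x : E := fun i => if (i < n)%N then x i else if i == n then ta x else if i == n.+1 then x n else 0.
have Y1 i : (i < n.+2)%N -> AGr n.+1 (fun x => Y x i).
  move=> hi; rewrite /Y; case: ltnP => h; first by apply: AG_coord; lia.
  case: eqP => // _; case: eqP => _; first exact: AG_coord.
  exact: AG_cst.
have Y0 : Y E0 = E0.
  by apply/funext => i; rewrite /Y ta0; case: ltnP => // _; case: eqP => // _; case: eqP.
have Yn x : Y x n = ta x by rewrite /Y ltnn eqxx.
have Yn1 x : Y x n.+1 = x n.
  by rewrite /Y; case: ltnP => h; [lia|case: eqP => h2; [lia|rewrite eqxx]].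
have Ydep f : AGr n f -> nearr n.+1 (fun x => f (Y x) = f (phi x)).
  move=> hf; have [r [r0 dep]] := AG_dep hf; exists r; split => // x hx.
  transitivity (f x); last first.
    by apply: dep; [exact: pdS|move=> i hi; rewrite /phi upd_other //; lia].
  by symmetry; apply: dep; [exact: pdS|move=> i hi; rewrite /Y hi].
have Yu : nearr n.+1 (fun x => u (updr (Y x) n (Y x n + Y x n.+1)) = u (phi x)).
  have [r [r0 dep]] := AG_dep hu.
  have nb : nearr n.+1 (fun x => pd (K := vR R) n.+1 r x) by exists r.
  apply: near0S (near0_comp nb p1 p2) => x hx; symmetry; apply: dep => // i hi.
  rewrite /phi /upd; case: eqP => [_|ne]; first by rewrite Yn Yn1 addrC.
  by rewrite /Y; have -> : (i < n)%N by lia.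
have CD : nearr n.+1 (fun x => C D (Y x) = 0).
  have [r [r0 dep]] := AG_dep (hC D (ltnSn D)).
  have nb : nearr n.+1 (fun x => pd (K := vR R) n.+1 r x) by exists r.
  have y1 i : (i < n.+1)%N -> AGr n.+1 (fun x => Y x i) by move=> hi; apply: Y1; lia.
  have y2 i : (i < n.+1)%N -> Y E0 i = 0 by rewrite Y0.
  apply: near0S (near0I (near0_comp nb y1 y2) (near0_weaken (leqnSn n) th3)) => x [h1 h2].
  have := h2 0%N (ltnSn 0%N); rewrite /H /joinE ltnn subnn -/(ta x).
  rewrite -(dep (Y x)) //; last first.
    move=> i hi; rewrite /Y; case: ltnP => // h; have -> : i = n by lia.
    by rewrite eqxx subnn.
  move=> /eqP; rewrite -subr_eq0 opprB addrC subrK mulf_eq0 invr_eq0 (negbTE a0) orbF.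
  by move/eqP.
have fact : nearr n.+1 (fun x => k (phi x) * (\sum_(0 <= j < D) C j (Y x) * x n ^+ j + x n ^+ D.+1 * V (Y x)) =
    k (phi x) * g (phi x)).
  have s1 := near0_comp eS Y1 (fun i _ => congr1 (fun y : E => y i) Y0).
  have s2 := near0_comp e p1 p2.
  have s3 : nearr n.+1 (fun x => forall j, (j < D.+1)%N -> c j (Y x) = c j (phi x)).
    by apply: near0_all => j hj; apply: Ydep; exact: hc.
  apply: near0S (near0I (near0I s1 s2) (near0I s3 (near0I Yu CD))) => x [[a1 a2] [a3 [a4 a5]]].
  congr (_ * _); rewrite a2.
  have <- : Y x n + Y x n.+1 = phi x n by rewrite Yn Yn1 /phi upd_same addrC.
  rewrite -a4; transitivity (\sum_(0 <= j < D.+1) c j (Y x) * (Y x n + Y x n.+1) ^+ j +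
     (Y x n + Y x n.+1) ^+ D.+1 * u (updr (Y x) n (Y x n + Y x n.+1))); last first.
    by congr (_ + _); apply: eq_big_nat => j /andP[_ jD]; rewrite a3.
  by rewrite a1 big_nat_recr //= a5 mul0r addr0 Yn1.
apply: (NC_step lph); apply: (NCable_ext fact).
have kphi : nearr n.+1 (fun x => k (phi x) = k x).
  have [r [r0 dep]] := AG_dep hk; exists r; split => // x hx; symmetry; apply: dep.
    exact: pdS.
  by move=> i hi; rewrite /phi upd_other //; lia.
pose c2 j x := if (j < D)%N then C j (joinE (K := vR R) n x (fun=> ta x)) else 0.
have c2E : nearr n.+1 (fun x => forall j, (j < D)%N -> C j (Y x) = c2 j x).
  apply: near0_all => j jD; have [r [r0 dep]] := AG_dep (hC j (ltnW jD)).
  have nb : nearr n.+1 (fun x => pd (K := vR R) n.+1 r x) by exists r.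
  have y1 i : (i < n.+1)%N -> AGr n.+1 (fun x => Y x i) by move=> hi; apply: Y1; lia.
  have y2 i : (i < n.+1)%N -> Y E0 i = 0 by rewrite Y0.
  apply: near0S (near0_comp nb y1 y2) => x hx; rewrite /c2 jD; apply: dep => // i hi.
  by rewrite /Y /joinE; case: ltnP => // h; have -> : i == n by lia.
apply: (@NCable_ext _ _ (fun x => k x * (\sum_(0 <= j < D) c2 j x * x n ^+ j + x n ^+ D.+1 * V (Y x)))).
  apply: near0S (near0I kphi c2E) => x [-> h]; congr (_ * (_ + _)).
  by apply: eq_big_nat => j /andP[_ jD]; rewrite h.
apply: (reduced NCn IH hk knz) => //.
- move=> j; rewrite /c2; case: ltnP => jD; last exact: AG_cst.
  apply: (AG_comp (hC j (ltnW jD))) => i hi; rewrite /joinE; case: ltnP => // h.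
  exact: AG_coord.
- by apply: (AG_comp hV) => // i hi; rewrite Y0.
- by rewrite Y0 V0.
Qed.

(** A shear sends the last axis to the line through a point v with h(v) != 0. There h has finite
    order: flatness of every order would annihilate its expansion on the line, hence h(v). [Pnd_all]
    treats finite order. *)
Theorem normal_crossings n h p : AGr n h -> nzr n h ->
  (forall i, (i < n)%N -> infl (fun w => p w i)) -> NCable n h p.
Proof.
elim: n h p => [|n IH] h p hh hnz hp.
  apply: NCable_id => //; apply: NCf_unit => //.
  have [r [M [r0 [c [_ hc]]]]] := hh.
  by apply/eqP => z; apply: hnz; apply: near0T => x; rewrite hc -(hc E0).
have hx : AGr n.+1 (fun x : E => x n) by exact: AG_coord.
have xnz : nzr n.+1 (fun x : E => x n).
  apply: (nz_ext _ (NCf_nz (NCf_coordX (vR R) 1 (ltnSn n)))).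
  by apply: near0T => x; rewrite expr1.
have prod_nz := nz_mul hh hx hnz xnz.
have [r [M [r0 hA]]] := hh.
(* The germ of h x_n is nonzero, so v can also satisfy v_n != 0, which the shear requires. *)
have [v [hv hvn]] : exists v, pd (K := vR R) n.+1 r v /\ h v * v n != 0.
  apply: contrapT => k; apply: prod_nz; exists r; split => // x hx'.
  by apply/eqP; apply: contrapT => /negP q; apply: k; exists x.
have [hv0 vn0] : h v != 0 /\ v n != 0 by move: hvn; rewrite mulf_eq0 negb_or => /andP.
pose phi (x : E) : E := fun i => if (i < n)%N then x i + v i / v n * x n else x i.
pose q w : E := fun i => if (i < n)%N then p w i - v i / v n * p w n else p w i.
have lph : lifts n.+1 p phi q.
  split.
  - move=> i hi; rewrite /phi; case: ltnP => k; last exact: AG_coord.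
    apply: AG_add; first exact: AG_coord.
    by apply: AG_mul; [exact: AG_cst|exact: AG_coord].
  - by move=> i hi; rewrite /phi; case: ltnP => // _; rewrite mulr0 addr0.
  - move=> i hi; rewrite /q; case: ltnP => k; last exact: hp.
    apply: (@infl_AG n.+1 (fun x => x i - v i / v n * x n)) => //; last by rewrite mulr0 subr0.
    apply: AG_sub; first exact: AG_coord.
    by apply: AG_mul; [exact: AG_cst|exact: AG_coord].
  - apply: filterS filterT => w _ i hi /=; rewrite /phi /q ltnn; case: ltnP => // _.
    by rewrite subrK.
have [f1 f2 f3 _] := lph.
have hph : AGr n.+1 (fun x => h (phi x)) by apply: (AG_comp hh).
apply: (NC_step lph).
have [D hD] : exists D : nat, ~ (exists C r, 0 < r /\ forall y : R, `|y| <= r ->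
    `|h (phi (updr E0 n y))| <= C * `|y| ^+ D).
  apply: contrapT => k.
  have flat (D : nat) : exists C r, 0 < r /\ forall y : R, `|y| <= r ->
      `|h (phi (updr E0 n y))| <= C * `|y| ^+ D.
    by apply: contrapT => k'; apply: k; exists D.
  pose w (y : E) := h (fun i => y 0%N * v i).
  have hw : A (K := vR R) 1 1 M w.
    apply: (A_comp (K := vR R) ltr01 hA (g := fun y i => y 0%N * v i)) => i hi.
    apply: (A_le (M := 1 * `|v i|)); last by rewrite mul1r; exact: hv.
    apply: (A_mul ltr01); first exact: A_coord.
    by apply: A_cst.
  have [c [m [hc hm hcv]]] := A_inv hw.
  have cst j : exists c0 : R, `|c0| <= m j /\ forall x, c j x = c0 by exact: hc j.
  have cz j : c j E0 = 0.
    apply: (@ps_flat R (vR R) (fun j => c j E0) 1 M (fun s => w (fun=> s)) (fun=> True)) => //.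
    - move=> J; apply: le_trans (hm J); apply: ler_sum => i _ /=.
      by have [c0 [c1 ->]] := cst i; rewrite ler_wpM2r ?exprn_ge0.
    - exact: accumT.
    - move=> s _ s1; have hp1 : pd (K := vR R) 1 1 (fun=> s) by move=> i _.
      apply: cv_ext (hcv _ hp1) => J; apply: eq_bigr => i _; congr (_ * _).
      by have [c0 [_ h0]] := cst i; rewrite !h0.
    - move=> N; have [C [rho [rho0 hC]]] := flat N.
      have [rd [rd0 dep]] := AG_dep hh.
      have nvn : 0 < `|v n| by rewrite normr_gt0.
      pose B := \sum_(0 <= i < n.+1) `|v i| + 1.
      have B0 : 0 < B by rewrite /B ltr_wpDl // sumr_ge0.
      exists (`|C| * `|v n| ^+ N), (Num.min (rho / `|v n|) (rd / B)).
      rewrite lt_min !divr_gt0 //; split => // s _; rewrite le_min => /andP[s1 s2] /=.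
      have -> : w (fun=> s) = h (phi (updr E0 n (s * v n))).
        apply: dep => [i hi|i hi].
          rewrite /= normrM; apply: (@le_trans _ _ (`|s| * B)); last by move: s2; rewrite ler_pdivlMr.
          rewrite ler_wpM2l // /B; apply: ler_wpDr => //.
          by rewrite (bigD1_seq i) ?mem_index_iota ?iota_uniq //= lerDl sumr_ge0.
        rewrite /phi /upd eqxx; case: ltnP => k1.
          have -> : (i == n) = false by rewrite ltn_eqF.
          by rewrite add0r mulrA -mulrA [_ / _ * _]mulrC; field.
        have -> : i = n by clear -hi k1; lia.
        by rewrite eqxx.
      apply: le_trans (hC (s * v n) _) _; first by rewrite /= normrM -ler_pdivlMr.
      rewrite /= normrM exprMn mulrA mulrAC ler_wpM2r ?exprn_ge0 //.
      by rewrite mulrC [X in _ <= X]mulrC ler_wpM2l ?exprn_ge0 // ler_norm.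
  move/eqP: hv0; apply.
  have hp1 : pd (K := vR R) 1 1 (fun=> 1) by move=> i _ /=; rewrite normr1.
  have := hcv _ hp1; rewrite /w.
  have -> : (fun i => 1 * v i) = v by apply/funext => i; rewrite mul1r.
  move=> k1; apply: (cv_uniq k1); apply: cv_ext (cv_cst 0) => J.
  rewrite big1 // => j _.
  have [c0 [_ h0]] := cst j; rewrite h0 -(h0 E0) cz mul0r //.
have [d dD hreg] := reg_crit hph hD.
apply: (@NCable_ext _ _ (fun x => 1 * h (phi x))); first by apply: near0T => x; rewrite mul1r.
apply: (Pnd_all IH) hreg f3; first exact: AG_cst.
by apply: nz_at; [exact: AG_cst|exact: oner_neq0].
Qed.

End NC.

(** * Uniformization along an ultrafilter *)

Section Box.
Variable R : realType.

Lemma nbhs_box n (z : 'rV[R]_n) B : nbhs z B ->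
  exists2 e, 0 < e & forall y : 'rV[R]_n, (forall i, `|y ord0 i - z ord0 i| < e) -> B y.
Proof.
move=> /nbhs_ballP [e /= e0 h]; exists e => // y hy; apply: h; split => // i j.
by rewrite !ord1 /ball /= distrC; exact: hy.
Qed.

Lemma open_box n (B : set 'rV[R]_n) (z : 'rV[R]_n) : open B -> B z ->
  exists2 e, 0 < e & forall y : 'rV[R]_n, (forall i, `|y ord0 i - z ord0 i| < e) -> B y.
Proof. by move=> oB Bz; apply: nbhs_box; apply: open_nbhs_nbhs. Qed.

Lemma box_nbhs n (z : 'rV[R]_n) e : 0 < e ->
  nbhs z [set y : 'rV[R]_n | forall i, `|y ord0 i - z ord0 i| < e].
Proof.
move=> e0; apply/nbhs_ballP; exists e => //= y [_ hy] i.
by have := hy ord0 i; rewrite /ball /= distrC.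
Qed.

Lemma closed_box n (X : set 'rV[R]_n) (z : 'rV[R]_n) : closed X ->
  (forall e, 0 < e -> exists2 y, X y & forall i, `|y ord0 i - z ord0 i| < e) -> X z.
Proof.
move=> cX h; apply: cX => B /nbhs_box [e e0 hB].
by have [y Xy hy] := h e e0; exists y; split => //; exact: hB.
Qed.

Lemma compact_coord n (S : set 'rV[R]_n) : compact (closure S) ->
  exists C, forall (z : 'rV[R]_n) i, S z -> `|z ord0 i| <= C.
Proof.
move=> /compact_bounded [C [Cr hC]]; exists (C + 2) => z i Sz.
have CC : C < C + 1 by lra.
have h1 := hC _ CC z (subset_closure Sz).
have C0 : 0 <= C + 1 by apply: le_trans h1.
have : ball (0 : 'rV[R]_n) (C + 2) z.
  by rewrite -ball_normE /ball_ /= sub0r normrN; apply: le_lt_trans h1 _; lra.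
move=> [_ h2]; have := h2 ord0 i; rewrite /ball /= mxE sub0r normrN => h3.
exact: ltW.
Qed.

End Box.

Lemma AG_pos (R : realType) n (f : (nat -> R) -> R) : AG (K := vR R) n f ->
  0 < f (@E0 R (vR R)) -> near0 (K := vR R) n (fun x => 0 < f x).
Proof.
move=> hf f0; apply: near0S (AG_cont hf f0) => x /=.
by rewrite ltr_norml => /andP[h _]; lra.
Qed.

(** * Analytic charts that carry an ultrafilter *)

Section Unif.
Variables (R : realType) (Om : Type) (U : set_system Om).
Context {UF : UltraFilter U}.
Local Notation E := (nat -> R).
Local Notation E0 := (@E0 R (vR R)).
Local Notation AGr := (@AG R (vR R)).
Local Notation nearr := (@near0 R (vR R)).
Local Notation NCr := (@NCf R (vR R)).
Local Notation nzr := (@nz R (vR R)).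
Local Notation mn := (@mono R (vR R)).
Local Notation infl := (infl U).

Lemma infl_uniq (s : Om -> R) l l' : infl (fun w => s w - l) -> infl (fun w => s w - l') -> l = l'.
Proof.
move=> h h'; apply/eqP; rewrite -subr_eq0 -normr_eq0 eq_le normr_ge0 andbT leNgt.
apply/negP => p; have p2 : 0 < `|l - l'| / 2 by lra.
have := filter_ex (filterI (h _ p2) (h' _ p2)) => -[w [/= h1 h2]].
have := ler_normB (s w - l') (s w - l).
have -> : s w - l' - (s w - l) = l - l' by ring.
by lra.
Qed.

Lemma ae_existsI k (P : 'I_k -> Om -> Prop) : U [set w | exists i, P i w] ->
  exists i, U [set w | P i w].
Proof.
move=> h; have [|i hi] := @ae_exists _ U UF k (fun i w => exists2 p : 'I_k, p = i :> nat & P p w).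
  by apply: filterS h => w [p Pp]; exists (p : nat) => //; exists p.
move=> h'; exists (Ordinal hi); apply: filterS h' => w [p e].
by have -> : Ordinal hi = p by apply/val_inj.
Qed.

Lemma ae_allI (I : finType) (P : I -> Om -> Prop) : (forall i, U [set w | P i w]) ->
  U [set w | forall i, P i w].
Proof.
move=> h.
have : U [set w | forall i, (i < #|I|)%N -> forall p : 'I_#|I|, p = i :> nat -> P (enum_val p) w].
  apply: (@ae_all _ U UF #|I| (fun i w => forall p : 'I_#|I|, p = i :> nat -> P (enum_val p) w)) => i hi.
  apply: filterS (h (enum_val (Ordinal hi))) => w Pw p pi.
  by have -> : p = Ordinal hi by apply/val_inj.
apply: filterS => w k i; have := k _ (ltn_ord (enum_rank i)) (enum_rank i) erefl.
by rewrite enum_rankK.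
Qed.

(** A germ of analytic maps into X, centred at x0, through which the points [y] factor along [U].
    The number N of variables is unconstrained here and will be minimized. *)
Definition unif d (X : set 'rV[R]_d) (x0 : 'rV[R]_d) (y : Om -> 'rV[R]_d) N (Phi : E -> E) (q : Om -> E) :=
  [/\ forall i, (i < d)%N -> AGr N (fun x => Phi x i), forall i, (i < d)%N -> Phi E0 i = 0,
      forall i, (i < N)%N -> infl (fun w => q w i),
      nearr N (fun x => X (x0 + rowE d (Phi x))) &
      U [set w | y w = x0 + rowE d (Phi (q w))]].

(** A point with zero coordinates is a limit of points without: give the vanishing coordinates a
    small value [dl] and use that X is closed. *)
Lemma closed_near d (X : set 'rV[R]_d) (x0 : 'rV[R]_d) N (Phi : E -> E) : closed X ->
  (forall i, (i < d)%N -> AGr N (fun x => Phi x i)) ->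
  nearr N (fun x => (forall i, (i < N)%N -> x i != 0) -> X (x0 + rowE d (Phi x))) ->
  nearr N (fun x => X (x0 + rowE d (Phi x))).
Proof.
move=> cX hP [r [r0 hr]].
have [s [s0 hs]] : exists s, 0 < s /\ forall i, (i < d)%N -> exists M, A (K := vR R) N s M (fun x => Phi x i).
  elim: d X x0 cX hP hr => [|n IH] X x0 cX hP hr; first by exists 1.
  have [s [s0 hs]] : exists s, 0 < s /\ forall i, (i < n)%N -> exists M, A (K := vR R) N s M (fun x => Phi x i).
    by apply: (IH setT 0); [exact: closedT|by move=> i hi; apply: hP; lia|].
  have [t [M [t0 ht]]] := hP n (ltnSn n).
  exists (Num.min s t); rewrite lt_min s0 t0; split => // i.
  rewrite ltnS leq_eqVlt => /orP[/eqP ->|hi].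
    by exists M; apply: A_shrink ht; rewrite ?le_min ?(ltW s0) ?(ltW t0) // ge_min lexx orbT.
  have [M' hM'] := hs i hi.
  by exists M'; apply: A_shrink hM'; rewrite ?le_min ?(ltW s0) ?(ltW t0) // ge_min lexx.
exists (Num.min (s / 2) (r / 2)); split; first by rewrite lt_min; apply/andP; split; lra.
move=> x hx; apply: closed_box => // e e0.
have s20 : 0 < s / 2 by lra.
have hc i : (i < d)%N -> nearr N (fun h => `|Phi (fun j => x j + h j) i - Phi x i| < e).
  move=> hi; have [M hM] := hs i hi.
  have : A (K := vR R) N (s / 2) M (fun h => Phi (fun j => x j + h j) i).
    apply: (A_recenter (a := x) s20 _ hM) => j hj; have := hx j hj.
    by rewrite /= le_min => /andP[h1 _]; lra.
  move=> hA; have hAG : AGr N (fun h => Phi (fun j => x j + h j) i) by exists (s / 2), M.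
  have := AG_cont hAG e0; apply: near0S => h /=.
  by have -> : (fun j => x j + E0 j) = x by apply/funext => j; rewrite addr0.
have [t [t0 ht]] := near0_all hc.
pose dl := Num.min t (r / 2).
have dl0 : 0 < dl by rewrite lt_min t0; lra.
pose h : E := fun j => if x j == 0 then dl else 0.
exists (x0 + rowE d (Phi (fun j => x j + h j))).
  apply: hr => [i hi|i hi].
    rewrite /=; apply: le_trans (ler_normD _ _) _; have := hx i hi.
    rewrite /= le_min => /andP[_ h1]; rewrite /h; case: ifP => _; last by rewrite normr0; lra.
    have : dl <= r / 2 by rewrite ge_min lexx orbT.
    by rewrite (gtr0_norm dl0); lra.
  rewrite /h; have [k|k] := eqVneq (x i) 0; last by rewrite addr0.
  by rewrite k add0r gt_eqF.
move=> i; rewrite !mxE opprD addrACA subrr add0r; apply: ht => // j hj.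
rewrite /= /h; case: ifP => _; last by rewrite normr0 ltW.
by rewrite (gtr0_norm dl0) ge_min lexx.
Qed.

(** With squares substituted, the monomial is a constant times a square, so G o phi keeps one sign
    off the coordinate hyperplanes, and the ultrafilter tells which. Entries sg_i = 0 are allowed: a
    monomial killed by them would contradict positivity along [U]. *)
Lemma sign_lift n (G : E -> R) phi (sg : nat -> R) (q1 q2 : Om -> E) : NCr n (fun x => G (phi x)) ->
  (forall i, (i < n)%N -> infl (fun w => q1 w i)) -> (forall i, (i < n)%N -> infl (fun w => q2 w i)) ->
  U [set w | forall i, (i < n)%N -> sg i * q2 w i ^+ 2 = q1 w i] ->
  U [set w | 0 < G (phi (q1 w))] ->
  nearr n (fun x => (forall i, (i < n)%N -> x i != 0) -> 0 < G (phi (fun i => sg i * x i ^+ 2))).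
Proof.
move=> [be [v [hv v0 e]]] hq1 hq2 hq hG.
have hPsi i : (i < n)%N -> AGr n (fun x => sg i * x i ^+ 2).
  by move=> hi; apply: AG_mul; [exact: AG_cst|apply: AG_exp; exact: AG_coord].
have Psi0 i : (i < n)%N -> sg i * E0 i ^+ 2 = 0 by move=> _; rewrite /E0 expr0n mulr0.
have e' := near0_comp e hPsi Psi0.
have hv' : AGr n (fun x => v (fun i => sg i * x i ^+ 2)) := AG_comp hv hPsi Psi0.
have v00 : v (fun i => sg i * E0 i ^+ 2) = v E0.
  by congr v; apply/funext => i; rewrite expr0n mulr0.
have formula x : mn n (fun i => sg i * x i ^+ 2) be = mn n sg be * mn n x be ^+ 2.
  by rewrite mono_pow monoX.
pose k0 := mn n sg be.
have [kv|kv] := ltP 0 (k0 * v E0).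
  have hk : nearr n (fun x => 0 < k0 * v (fun i => sg i * x i ^+ 2)).
    by apply: AG_pos; [apply: AG_mul => //; exact: AG_cst|rewrite v00].
  apply: near0S (near0I e' hk) => x [-> h1] hx; rewrite formula mulrAC.
  apply: mulr_gt0 => //; rewrite exprn_even_gt0 //=; apply: mono_neq0 => i hi xi.
  by have := hx i hi; rewrite xi eqxx.
exfalso; apply: (@ae_false _ U).
have hc : nearr n (fun x => k0 * v x <= 0).
  move: kv; rewrite le_eqVlt mulf_eq0 (negbTE v0) orbF => /orP[/eqP ->|kv].
    by apply: near0T => x; rewrite mul0r.
  have hk : nearr n (fun x => 0 < - (k0 * v x)).
    apply: AG_pos; last by rewrite oppr_gt0.
    by apply: AG_opp; apply: AG_mul => //; exact: AG_cst.
  by apply: near0S hk => x; rewrite oppr_gt0 => /ltW.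
apply: filterS (filterI (filterI (infl_ae hc hq1) (infl_ae e hq1)) (filterI hq hG)) => w [[/= h1 h2] [/= h3 h4]].
move: h4; rewrite h2.
have -> : mn n (q1 w) be = k0 * mn n (q2 w) be ^+ 2.
  by rewrite /k0 -formula; apply: mono_ext => i hi; rewrite h3.
by rewrite mulrAC ltNge mulr_le0_ge0 // sqr_ge0.
Qed.

(** A monomial times a unit vanishes only on finitely many coordinate hyperplanes, and the
    ultrafilter selects one of them. *)
Lemma zero_lift n (F : E -> R) phi (q1 : Om -> E) : NCr n (fun x => F (phi x)) ->
  (forall i, (i < n)%N -> infl (fun w => q1 w i)) ->
  U [set w | F (phi (q1 w)) = 0] ->
  exists2 i, (i < n)%N & U [set w | q1 w i = 0] /\
    nearr n (fun x => x i = 0 -> F (phi x) = 0).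
Proof.
move=> [al [u [hu u0 e]]] hq1 hF.
have : U [set w | exists2 i, (i < n)%N & (0 < al i)%N /\ q1 w i = 0].
  apply: filterS (filterI hF (filterI (infl_ae (AG_neq0 hu u0) hq1) (infl_ae e hq1))) => w [/= k1 [/= k2 k3]].
  apply: contrapT => k; have : mn n (q1 w) al != 0.
    apply: mono_neq0 => i hi xi; apply/eqP; rewrite -leqn0 leqNgt; apply/negP => ai.
    by apply: k; exists i.
  move=> k4; move: k1; rewrite k3 => /eqP.
  by rewrite mulf_eq0 (negbTE k4) (negbTE k2).
move=> /ae_exists [i hi h]; exists i => //; split; first by apply: filterS h => w [].
have [w [ai _]] := filter_ex h.
by apply: near0S e => x -> xi; rewrite (mono_eq0 hi ai xi) mul0r.
Qed.

(* Lift the points to the semianalytic set and make the product of its defining functions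
   monomial.  The coordinates that vanish along the ultrafilter are set to 0 and the
   others replaced by signed squares, so that the strict inequalities hold as soon as no
   coordinate is 0. *)
Lemma unif_exists d (X : set 'rV[R]_d) (x0 : 'rV[R]_d) (y : Om -> 'rV[R]_d) :
  closed X -> subanalytic X -> (forall i, infl (fun w => y w ord0 i - x0 ord0 i)) ->
  U [set w | X (y w)] -> exists N Phi q, unif X x0 y N Phi q.
Proof.
move=> cX sX hy Xy; have [W [oW [Wx0 [m [A0 [semi [cpt XW]]]]]]] := sX x0.
have hW : U [set w | W (y w)].
  have [e e0 he] := open_box oW Wx0.
  have : U [set w | forall i, `|y w ord0 i - x0 ord0 i| < e] by apply: ae_allI => i; exact: hy.
  by apply: filterS => w /= h; apply: he.
have [a ha] : {a : Om -> 'rV[R]_(d + m) & forall w, X (y w) -> W (y w) -> A0 (a w) /\ lsubmx (a w) = y w}.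
  apply: (@choice _ _ (fun w z => X (y w) -> W (y w) -> A0 z /\ lsubmx z = y w)) => w.
  have [h|h] := pselect (X (y w) /\ W (y w)); last first.
    by exists 0 => h1 h2; case: h.
  by have : (X `&` W) (y w) by []; rewrite XW => -[z A0z <-]; exists z.
have haU : U [set w | A0 (a w) /\ lsubmx (a w) = y w].
  by apply: filterS (filterI Xy hW) => w [h1 h2]; apply: ha.
(* Boundedness makes the lifted points converge along [U]. The limit may lie outside [A0], but a
   semianalytic set is described near every point of the space. *)
have [C hC] := compact_coord cpt.
have [l hl] : {l : 'I_(d + m) -> R & forall i, infl (fun w => a w ord0 i - l i)}.
  apply: (@choice _ _ (fun i l => infl (fun w => a w ord0 i - l))) => i.
  by apply: (@ulim_exists _ _ U UF _ C); apply: filterS haU => w [h _] /=; exact: hC.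
pose ai : 'rV[R]_(d + m) := \row_i l i.
have aix0 : lsubmx ai = x0.
  apply/rowP => i; rewrite !mxE; apply: infl_uniq (hl _) _.
  apply: infl_ext (hy i); apply: filterS haU => w [_ e] /=.
  by rewrite -e mxE.
have [V [oV [Vai [k [q0 [f [g [hf [hg SV]]]]]]]]] := semi ai.
have [ev ev0 hev] := open_box oV Vai.
have hV : U [set w | V (a w)].
  have : U [set w | forall i, `|a w ord0 i - ai ord0 i| < ev].
    by apply: ae_allI => i; rewrite mxE; exact: hl.
  by apply: filterS => w /= h; apply: hev.
have [p hp] : exists p, U [set w | f p (a w) = 0 /\ forall q, 0 < g p q (a w)].
  apply: ae_existsI; apply: filterS (filterI haU hV) => w [[h1 _] h2].
  by have : (A0 `&` V) (a w) by []; rewrite SV => -[].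
pose N := (d + m)%N.
pose F0 : E -> R := fun x => f p (ai + rowE N x).
pose G q : E -> R := fun x => g p q (ai + rowE N x).
have hF0 : AGr N F0 by apply: analytic_AG; exact: hf.
have hG q : AGr N (G q) by apply: analytic_AG; exact: hg.
pose pt w : E := seqE (a w - ai).
have ptE w : ai + rowE N (pt w) = a w by rewrite seqEK addrC subrK.
have hpt i : (i < N)%N -> infl (fun w => pt w i).
  move=> hi; apply: infl_ext (hl (Ordinal hi)); apply: filterS filterT => w _ /=.
  by rewrite /pt (seqE_ord _ (Ordinal hi)) !mxE.
pose Fs (o : option 'I_q0) : E -> R := if o is Some q then G q else F0.
have hFs o : AGr N (Fs o) by case: o.
pose h x := \prod_(o <- enum {: option 'I_q0}) nzp N (Fs o) x.
have hh : AGr N h by apply: AG_prod => o _; exact: nzp_AG.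
have hnz : nzr N h by apply: nz_prod => o; [exact: nzp_AG|exact: nzp_nz].
have [phi [q1 [[l1 l2 l3 l4] nc]]] := normal_crossings hh hnz hpt.
have hNC o : nzr N (Fs o) -> NCr N (fun x => Fs o (phi x)).
  move=> no; have -> : Fs o = nzp N (Fs o) by rewrite /nzp; case: asboolP.
  apply: (@NCf_factor_prod R (vR R) N (option 'I_q0) (enum {: option 'I_q0}) (fun o x => nzp N (Fs o) (phi x))) => //.
    by move=> o'; apply: (AG_comp _ l1 l2); exact: nzp_AG.
  by rewrite mem_enum.
have hdep (f' : E -> R) : AGr N f' -> U [set w | f' (phi (q1 w)) = f' (pt w)].
  move=> /AG_dep [r [r0 dep]].
  have u1 : U [set w | forall i, (i < N)%N -> `|pt w i| < r] by apply: ae_all => i hi; exact: hpt.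
  apply: filterS (filterI l4 u1) => w [/= h1 h2]; apply/esym/dep => i hi; last by rewrite h1.
  exact/ltW/h2.
have [sg [q2 [sg0 [k1 k2 k3 k4]]]] := @lifts_pow _ _ U UF N q1 2 isT l3.
pose ka i := if `[< U [set w | q1 w i = 0] >] then 0 else sg i.
have hka : U [set w | forall i, (i < N)%N -> ka i * q2 w i ^+ 2 = q1 w i].
  apply: ae_all => i hi; rewrite /ka; case: asboolP => hz.
    by apply: filterS hz => w /= ->; rewrite mul0r.
  by apply: filterS k4 => w; apply.
have hPsi i : (i < N)%N -> AGr N (fun x => ka i * x i ^+ 2).
  by move=> hi; apply: AG_mul; [exact: AG_cst|apply: AG_exp; exact: AG_coord].
have Psi0 i : (i < N)%N -> ka i * E0 i ^+ 2 = 0 by move=> _; rewrite /E0 expr0n mulr0.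
have eF0 : nearr N (fun x => F0 (phi (fun i => ka i * x i ^+ 2)) = 0).
  have [z|no] := pselect (nearr N (fun x => F0 x = 0)).
    exact: near0_comp (near0_comp z l1 l2) hPsi Psi0.
  have [|i hi [zi ei]] := zero_lift (hNC None no) l3.
    apply: filterS (filterI (hdep _ hF0) hp) => w [/= -> [hw _]].
    by rewrite /F0 ptE.
  apply: near0S (near0_comp ei hPsi Psi0) => x; apply.
  by rewrite /ka; case: asboolP => // _; rewrite mul0r.
have eG : nearr N (fun x => (forall i, (i < N)%N -> x i != 0) -> forall q, 0 < G q (phi (fun i => ka i * x i ^+ 2))).
  have : nearr N (fun x => forall j, (j < q0)%N -> forall q : 'I_q0, q = j :> nat ->
      (forall i, (i < N)%N -> x i != 0) -> 0 < G q (phi (fun i => ka i * x i ^+ 2))).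
    apply: near0_all => j hj.
    have hpos : U [set w | 0 < G (Ordinal hj) (phi (q1 w))].
      apply: filterS (filterI (hdep _ (hG (Ordinal hj))) hp) => w [/= -> [_ hw]].
      by rewrite /G ptE.
    have no : nzr N (G (Ordinal hj)).
      move=> z; apply: (@ae_false _ U).
      apply: filterS (filterI hpos (infl_ae (near0_comp z l1 l2) l3)) => w [/= h1 h2].
      by move: h1; rewrite h2 ltxx.
    apply: near0S (sign_lift (hNC (Some (Ordinal hj)) no) l3 k3 hka hpos) => x hx q qj.
    by have -> : q = Ordinal hj by apply/val_inj.
  by apply: near0S => x hx nx q; apply: hx.
have eV : nearr N (fun x => V (ai + rowE N (phi (fun i => ka i * x i ^+ 2)))).
  have : nearr N (fun x => V (ai + rowE N x)).
    exists (ev / 2); split; first by lra.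
    move=> x hx; apply: hev => i; rewrite !mxE [X in `|X|](_ : _ = x i); last by ring.
    by apply: le_lt_trans (hx _ (ltn_ord i)) _; lra.
  by move=> hv; exact: near0_comp (near0_comp hv l1 l2) hPsi Psi0.
pose Phi x := phi (fun i => ka i * x i ^+ 2).
have hPhi i : (i < d)%N -> AGr N (fun x => Phi x i).
  move=> hi; have hiN : (i < N)%N by rewrite /N; lia.
  exact: (AG_comp (l1 i hiN) hPsi Psi0).
have xPhi x : x0 + rowE d (Phi x) = lsubmx (ai + rowE N (Phi x)).
  by rewrite -aix0; apply/rowP => i; rewrite !mxE.
exists N, Phi, q2; split => //.
- move=> i hi; rewrite /Phi; have -> : (fun i => ka i * E0 i ^+ 2) = E0.
    by apply/funext => j; rewrite /E0 expr0n mulr0.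
  by apply: l2; rewrite /N; lia.
- apply: closed_near => //; apply: near0S (near0I eV (near0I eF0 eG)) => x [h1 [h2 h3]] hx.
  suff : (X `&` W) (x0 + rowE d (Phi x)) by case.
  rewrite XW xPhi; exists (ai + rowE N (Phi x)) => //.
  suff : (A0 `&` V) (ai + rowE N (Phi x)) by case.
  by rewrite SV; split => //; exists p; split => // q; apply: h3.
- have [r [r0 dep]] : exists r, 0 < r /\ forall x x' : E, pd (K := vR R) N r x -> 
      (forall i, (i < N)%N -> x i = x' i) -> forall i, (i < N)%N -> phi x i = phi x' i.
    have : forall n, (n <= N)%N -> exists r, 0 < r /\ forall x x' : E, pd (K := vR R) N r x -> 
      (forall i, (i < N)%N -> x i = x' i) -> forall i, (i < n)%N -> phi x i = phi x' i.
      elim=> [|n IH] hn; first by exists 1.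
      have [r [r0 hr]] := IH (ltnW hn); have [s [s0 hs]] := AG_dep (l1 n hn).
      exists (Num.min r s); rewrite lt_min r0 s0; split => // x x' hx xx i.
      rewrite ltnS leq_eqVlt => /orP[/eqP ->|].
        by apply: hs => // j hj; apply: le_trans (hx j hj) _; rewrite ge_min lexx orbT.
      by apply: hr => // j hj; apply: le_trans (hx j hj) _; rewrite ge_min lexx.
    by apply.
  have u1 : U [set w | forall i, (i < N)%N -> `|q1 w i| < r] by apply: ae_all => i hi; exact: l3.
  apply: filterS (filterI (filterI haU u1) (filterI hka l4)) => w [[/= [h1 h2] h3] [/= h4 h5]].
  rewrite xPhi -h2; congr lsubmx; rewrite -(ptE w); congr (_ + _).
  apply/rowP => i; rewrite !mxE -h5 //; apply: dep => //.
    by move=> j hj; exact/ltW/h3.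
  by move=> j hj; rewrite h4.
Qed.

End Unif.

(** * Fibre cutting *)

Section Calculus.
Variables (R : realType) (K : vfield R).
Local Notation E := (nat -> K).
Local Notation E0 := (@E0 R K).

(** The supremum of the t up to which h vanishes can be passed, by the identity theorem at that
    point, unless it is 1. The parameter t is real even when K is complex, so complex functions can
    be continued along real segments. *)
Lemma line_identity (h : K -> K) :
  (forall t : R, 0 <= t <= 1 -> AG 1 (fun x : E => h (emb K t + x 0%N))) ->
  (exists2 e : R, 0 < e & forall t : R, 0 <= t <= e -> h (emb K t) = 0) -> h 1 = 0.
Proof.
move=> hA [e e0 he].
pose S : set R := [set t : R | 0 <= t <= 1 /\ forall s : R, 0 <= s <= t -> h (emb K s) = 0].
have Se : S (Num.min e 1).
  rewrite /S /= le_min ler01 (ltW e0) ge_min lexx orbT; split => // s /andP[s0].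
  by rewrite le_min => /andP[s1 _]; apply: he; rewrite s0.
have hS : has_sup S by split; [exists (Num.min e 1)|exists 1 => t [/andP[]]].
have s1 : 0 < sup S.
  have le := sup_upper_bound hS Se.
  by apply: lt_le_trans le; rewrite lt_min e0 ltr01.
have s2 : sup S <= 1 by apply: ge_sup; [case: hS|move=> t [/andP[]]].
have below u : 0 <= u < sup S -> h (emb K u) = 0.
  move=> /andP[u0 us]; have us' : 0 < sup S - u by lra.
  have [t [_ ht] lt] := sup_adherent us' hS.
  by apply: ht; rewrite u0 /=; lra.
have [|r [M [r0 hr]]] := hA (sup S); first by rewrite ltW.
(* Points to the left of the supremum, where h is already known to vanish, accumulate at it. *)
pose Sg := fun z : K => exists2 u : R, 0 < u & z = emb K (- u).
have acc : accum0 Sg.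
  move=> e' e'0; exists (emb K (- (e' / 2))); rewrite nu_emb normrN ger0_norm; last by lra.
  by split; [exists (e' / 2) => //; lra|lra].
have zero := A_identity r0 acc s1 hr _.
have {}zero x : pd 1 r x -> h (emb K (sup S) + x 0%N) = 0.
  apply: zero => z hz /(_ 0%N isT) [u u0 ez]; rewrite ez -embD; apply: below.
  by have := hz 0%N isT; rewrite ez nu_emb normrN gtr0_norm // => us; lra.
have zr v : `|v| <= r -> h (emb K (sup S + v)) = 0.
  by move=> hv; rewrite embD; apply: (zero (fun=> emb K v)) => i _; rewrite nu_emb.
have [lt|ge] := ltP (sup S) 1; last first.
  have e1 : sup S = 1 by apply/eqP; rewrite eq_le s2 ge.
  by have := zr 0; rewrite normr0 (ltW r0) addr0 e1 emb1 => ->.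
pose v := Num.min r (1 - sup S).
have v0 : 0 < v by rewrite lt_min r0; lra.
have : S (sup S + v).
  have v1 : v <= 1 - sup S by rewrite ge_min lexx orbT.
  split; first by apply/andP; split; lra.
  move=> s /andP[h1 h2]; have [h3|h3] := ltP s (sup S); first by apply: below; rewrite h1.
  have -> : s = sup S + (s - sup S) by ring.
  apply: zr; rewrite ger0_norm; last by lra.
  have : v <= r by rewrite ge_min lexx.
  lra.
by move=> /(sup_upper_bound hS) k; exfalso; lra.
Qed.

Lemma AG_common_all N d (Phi : E -> E) : (forall i, (i < d)%N -> AG N (fun x => Phi x i)) ->
  exists s, 0 < s /\ exists M, forall i, (i < d)%N -> A N s M (fun x => Phi x i).
Proof.
elim: d => [|d IH] h; first by exists 1; split => //; exists 0.
have [s [s0 [M hM]]] := IH (fun i hi => h i (ltnW hi)).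
have [t [M' [t0 ht]]] := h d (ltnSn d).
exists (Num.min s t); rewrite lt_min s0 t0; split => //; exists (Num.max M M') => i.
rewrite ltnS leq_eqVlt => /orP[/eqP ->|hi].
  apply: (@A_le _ _ _ _ M'); last by rewrite le_max lexx orbT.
  by apply: A_shrink ht; rewrite ?le_min ?(ltW s0) ?(ltW t0) // ge_min lexx orbT.
apply: (@A_le _ _ _ _ M); last by rewrite le_max lexx.
by apply: A_shrink (hM i hi); rewrite ?le_min ?(ltW s0) ?(ltW t0) // ge_min lexx.
Qed.

Lemma AG_dep_all N d (Phi : E -> E) : (forall i, (i < d)%N -> AG N (fun x => Phi x i)) ->
  exists r, 0 < r /\ forall x y, pd N r x -> (forall i, (i < N)%N -> x i = y i) ->
    forall i, (i < d)%N -> Phi x i = Phi y i.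
Proof.
move=> /AG_common_all [r [r0 [M h]]]; exists r; split => // x y hx xy i hi.
exact: A_dep (h i hi) hx xy.
Qed.

Lemma pd_join N M r (x y : E) : pd N r x -> pd M r y -> pd (N + M) r (joinE N x y).
Proof.
by move=> hx hy i hi; rewrite /joinE; case: ltnP => h; [exact: hx|apply: hy; lia].
Qed.

(** Two Hadamard divisions of f(x + h) in the block h: [D j] is the partial derivative, and the
    [S j k] carry the second-order remainder. They live on the fixed radius r/2, so that base points
    can move. *)
Lemma A_expand2 N r M f : 0 < r -> A N r M f ->
  exists (D : nat -> E -> K) (S : nat -> nat -> E -> K) M2,
  [/\ forall j, (j < N)%N -> A N (r / 2) M2 (D j),
      forall j k, (j < N)%N -> (k < N)%N -> A (N + N) (r / 2) M2 (S j k) &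
      forall x h, pd N (r / 2) x -> pd N (r / 2) h ->
        f (fun i => x i + h i) = f x +
          \sum_(0 <= j < N) h j * (D j x + \sum_(0 <= k < N) h k * S j k (joinE N x h))].
Proof.
move=> r0 hf; set s := r / 2; have s0 : 0 < s by rewrite /s; lra.
pose g (z : E) := f (fun i => z i + z (N + i)%N).
have hg : A (N + N) s M g.
  apply: (A_comp s0 hf (g := fun z i => z i + z (N + i)%N)) => i hi.
  have -> : r = s + s by rewrite /s; lra.
  by apply: A_add => //; apply: A_coord; [exact: ltW|lia|exact: ltW|lia].
have [Q [hQ eQ]] := hadamard_multi s0 (leqnn (N + N)) hg.
have := fun j (hj : (j < N)%N) => hadamard_multi s0 (leqnn (N + N)) (hQ j hj).
move=> hS0.
have [S hS] : {S : nat -> nat -> E -> K & forall j, (j < N)%N ->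
    (forall k, (k < N)%N -> A (N + N) s (M / s / s) (S j k)) /\
    forall x, pd (N + N) s x -> Q j x = Q j (fun l => if (N <= l < N + N)%N then 0 else x l)
      + \sum_(0 <= k < N) x (N + k)%N * S j k x}.
  apply: (@choice _ _ (fun j S => (j < N)%N ->
    (forall k, (k < N)%N -> A (N + N) s (M / s / s) (S k)) /\
    forall x, pd (N + N) s x -> Q j x = Q j (fun l => if (N <= l < N + N)%N then 0 else x l)
      + \sum_(0 <= k < N) x (N + k)%N * S k x)) => j.
  by have [hj|hj] := ltnP j N; [have [T hT] := hS0 j hj; exists T|exists (fun _ => fun=> 0)].
pose z0 x : E := fun l => if (l < N)%N then x l else 0.
exists (fun j x => Q j (z0 x)), S, (Num.max (M / s) (M / s / s)); split.
- move=> j hj; apply: (@A_le _ _ _ _ (M / s)); last by rewrite le_max lexx.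
  apply: (A_comp s0 (hQ j hj) (g := z0)) => i hi; rewrite /z0; case: ltnP => h.
    by apply: A_coord => //; exact: ltW.
  by apply: A_cst; rewrite ?nu0 ltW.
- move=> j k hj hk; apply: (@A_le _ _ _ _ (M / s / s)); last by rewrite le_max lexx orbT.
  exact: (hS j hj).1.
move=> x h hx hh.
have hj := pd_join hx hh.
have pr : pd N r (fun i => x i + h i).
  move=> i hi; apply: le_trans (nuD _ _) _; have := hx i hi; have := hh i hi.
  by rewrite /s; lra.
have -> : f (fun i => x i + h i) = g (joinE N x h).
  apply: (A_dep hf) => // i hi; rewrite /joinE hi.
  have -> : (N + i < N)%N = false by lia.
  by rewrite addKn.
rewrite (eQ _ hj); congr (_ + _).
  rewrite /g; apply/esym/(A_dep hf) => [i hi|i hi].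
    by apply: le_trans (hx i hi) _; rewrite /s; lra.
  have -> : (N <= i < N + N)%N = false by lia.
  have -> : (N <= N + i < N + N)%N by lia.
  by rewrite /joinE hi addr0.
have xN (k : nat) : (joinE N x h) (N + k)%N = h k.
  rewrite /joinE; have -> : (N + k < N)%N = false by lia.
  by rewrite addKn.
apply: eq_big_nat => j /andP[_ hjN]; rewrite xN; congr (_ * _).
rewrite ((hS j hjN).2 _ hj); congr (_ + _).
  apply/esym/(A_dep (hQ j hjN)) => [i hi|i hi].
    by rewrite /z0; case: ltnP => hiN; [exact: hx|rewrite nu0 ltW].
  rewrite /z0 /joinE; case: ltnP => hiN.
    by [].
  by rewrite hi.
by apply: eq_bigr => k _; rewrite xN.
Qed.

Lemma A_expand2_all d N r M (Phi : E -> E) : 0 < r -> (forall i, (i < d)%N -> A N r M (fun x => Phi x i)) ->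
  exists (D : nat -> nat -> E -> K) (S : nat -> nat -> nat -> E -> K) (m : nat -> R), forall i, (i < d)%N ->
  [/\ forall j, (j < N)%N -> A N (r / 2) (m i) (D i j),
      forall j k, (j < N)%N -> (k < N)%N -> A (N + N) (r / 2) (m i) (S i j k) &
      forall x h, pd N (r / 2) x -> pd N (r / 2) h ->
        Phi (fun l => x l + h l) i = Phi x i +
          \sum_(0 <= j < N) h j * (D i j x + \sum_(0 <= k < N) h k * S i j k (joinE N x h))].
Proof.
move=> r0 hP; pose T := ((nat -> E -> K) * (nat -> nat -> E -> K) * R)%type.
have [F hF] : {F : nat -> T & forall i, (i < d)%N ->
  [/\ forall j, (j < N)%N -> A N (r / 2) (F i).2 ((F i).1.1 j),
      forall j k, (j < N)%N -> (k < N)%N -> A (N + N) (r / 2) (F i).2 ((F i).1.2 j k) &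
      forall x h, pd N (r / 2) x -> pd N (r / 2) h ->
        Phi (fun l => x l + h l) i = Phi x i +
          \sum_(0 <= j < N) h j * ((F i).1.1 j x + \sum_(0 <= k < N) h k * (F i).1.2 j k (joinE N x h))]}.
  apply: (@choice _ _ (fun i (F : T) => (i < d)%N ->
  [/\ forall j, (j < N)%N -> A N (r / 2) F.2 (F.1.1 j),
      forall j k, (j < N)%N -> (k < N)%N -> A (N + N) (r / 2) F.2 (F.1.2 j k) &
      forall x h, pd N (r / 2) x -> pd N (r / 2) h ->
        Phi (fun l => x l + h l) i = Phi x i +
          \sum_(0 <= j < N) h j * (F.1.1 j x + \sum_(0 <= k < N) h k * F.1.2 j k (joinE N x h))])) => i.
  have [hi|hi] := ltnP i d; last by exists (fun _ _ => 0, fun _ _ _ => 0, 0).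
  by have [D [S [m hD]]] := A_expand2 r0 (hP i hi); exists (D, S, m).
by exists (fun i => (F i).1.1), (fun i => (F i).1.2), (fun i => (F i).2).
Qed.

Lemma partial_expand N r (f : E -> K) (D : nat -> E -> K) (S : nat -> nat -> E -> K) k :
  (forall x h, pd N (r / 2) x -> pd N (r / 2) h -> f (fun l => x l + h l) = f x +
    \sum_(0 <= j < N) h j * (D j x + \sum_(0 <= k < N) h k * S j k (joinE N x h))) ->
  (k < N)%N -> 0 < r -> forall x t, pd N (r / 2) x -> nu t <= r / 2 ->
    f (upd x k (x k + t)) = f x + t * (D k x + t * S k k (joinE N x (upd E0 k t))).
Proof.
move=> e hk r0 x t hx ht.
have r20 : 0 <= r / 2 by lra.
have := e x (upd E0 k t) hx (pd_upd k (@pd0 R K N _ r20) ht).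
have -> : (fun l => x l + upd E0 k t l) = upd x k (x k + t).
  by apply/funext => l; rewrite /upd; case: eqP => [->//|_]; rewrite addr0.
move=> ->; congr (_ + _).
have single (G : nat -> K) : \sum_(0 <= j < N) upd E0 k t j * G j = t * G k.
  rewrite (bigD1_seq k) ?mem_index_iota ?iota_uniq //= big1 ?addr0 ?upd_same // => j jk.
  by rewrite upd_other // mul0r.
by rewrite !single.
Qed.

(** Forgets the bound but keeps the radius, which [AG] would lose. *)
Definition AR N r (f : E -> K) := exists M, A N r M f.

Lemma AR_cst N r c : 0 < r -> AR N r (fun=> c).
Proof. by move=> r0; exists (nu c); apply: A_cst => //; exact: ltW. Qed.

Lemma AR_coord N r i : 0 < r -> (i < N)%N -> AR N r (fun x => x i).
Proof. by move=> r0 hi; exists r; apply: A_coord => //; exact: ltW. Qed.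

Lemma AR_add N r f g : 0 < r -> AR N r f -> AR N r g -> AR N r (fun x => f x + g x).
Proof. by move=> r0 [M hf] [M' hg]; exists (M + M'); exact: A_add. Qed.

Lemma AR_mul N r f g : 0 < r -> AR N r f -> AR N r g -> AR N r (fun x => f x * g x).
Proof. by move=> r0 [M hf] [M' hg]; exists (M * M'); exact: A_mul. Qed.

Lemma AR_sub N r f g : 0 < r -> AR N r f -> AR N r g -> AR N r (fun x => f x - g x).
Proof.
move=> r0 hf [M hg]; apply: AR_add => //; exists (nu (-1 : K) * M).
by apply: (@A_ext _ _ _ _ _ (fun x => -1 * g x)) => [x _|]; [rewrite mulN1r|exact: A_scale].
Qed.

Lemma AR_exp N r f k : 0 < r -> AR N r f -> AR N r (fun x => f x ^+ k).
Proof. by move=> r0 [M hf]; exists (M ^+ k); exact: A_exp. Qed.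

Lemma AR_sum I (s : seq I) (P : pred I) N r (F : I -> E -> K) : 0 < r ->
  (forall i, P i -> AR N r (F i)) -> AR N r (fun x => \sum_(i <- s | P i) F i x).
Proof.
move=> r0 h; elim: s => [|i s [M hM]].
  by exists 0; apply: (@A_ext _ _ _ _ _ (fun=> 0)) => [x _|]; [rewrite big_nil|apply: A_cst; [exact: ltW|rewrite nu0]].
case Pi : (P i); last by exists M; apply: A_ext hM => x _; rewrite big_cons Pi.
have [M' hM'] := AR_add r0 (h i Pi) (ex_intro _ M hM : AR _ _ _).
by exists M'; apply: A_ext hM' => x _; rewrite big_cons Pi.
Qed.

Lemma AR_prod I (s : seq I) (P : pred I) N r (F : I -> E -> K) : 0 < r ->
  (forall i, P i -> AR N r (F i)) -> AR N r (fun x => \prod_(i <- s | P i) F i x).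
Proof.
move=> r0 h; elim: s => [|i s [M hM]].
  by exists 1; apply: (@A_ext _ _ _ _ _ (fun=> 1)) => [x _|]; [rewrite big_nil|apply: A_cst; [exact: ltW|rewrite nu1]].
case Pi : (P i); last by exists M; apply: A_ext hM => x _; rewrite big_cons Pi.
have [M' hM'] := AR_mul r0 (h i Pi) (ex_intro _ M hM : AR _ _ _).
by exists M'; apply: A_ext hM' => x _; rewrite big_cons Pi.
Qed.

Lemma AR_det n N r (F : E -> 'M[K]_n) : 0 < r -> (forall i j, AR N r (fun x => F x i j)) ->
  AR N r (fun x => \det (F x)).
Proof.
move=> r0 h; apply: AR_sum => // s _; apply: AR_mul => //; first exact: AR_cst.
by apply: AR_prod.
Qed.

Lemma AR_le N r s f : 0 < s -> s <= r -> AR N r f -> AR N s f.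
Proof. by move=> s0 sr [M h]; exists M; apply: A_shrink h => //; exact: ltW. Qed.

Lemma AR_recenter N r rho t f (a : E) : 0 < t -> rho + t <= r -> pd N rho a ->
  AR N r f -> AR N t (fun x => f (fun i => a i + x i)).
Proof.
move=> t0 rt ha [M h]; exists M; apply: (A_recenter (a := a) t0 _ h) => i hi.
by have := ha i hi; lra.
Qed.

Lemma AR_AG N r f : 0 < r -> AR N r f -> AG N f.
Proof. by move=> r0 [M h]; exists r, M. Qed.

End Calculus.

(** * Minors and row spaces *)

Section MatrixRank.
Variable F : fieldType.

Lemma minor_exists m n (A : 'M[F]_(m, n)) : exists (f : 'I_(\rank A) -> 'I_m) (h : 'I_(\rank A) -> 'I_n),
  \det (mxsub f h A) != 0.
Proof.
pose f := maxrankfun A; have hB : row_free (rowsub f A) := maxrowsub_free A.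
pose B := rowsub f A.
have hBt : row_full B^T by rewrite /row_full mxrank_tr; exact: hB.
exists f, (fullrankfun hBt).
have := fullrowsub_unit hBt; rewrite unitmxE unitfE -det_tr; apply: contraNN => /eqP <-.
by apply/eqP; congr (\det _); apply/matrixP => i j; rewrite !mxE.
Qed.

(** The rows picked by f span the row space. A combination of them equal to the j-th unit vector
    vanishes on the columns h, so its coefficients are 0 by invertibility of the minor. *)
Lemma minor_span m n r (A : 'M[F]_(m, n)) (f : 'I_r -> 'I_m) (h : 'I_r -> 'I_n) j :
  (\rank A <= r)%N -> \det (mxsub f h A) != 0 -> (forall k, h k != j) ->
  ~~ (delta_mx (ord0 : 'I_1) j <= A)%MS.
Proof.
move=> rA dA hj; apply/negP => sub.
have un : mxsub f h A \in unitmx by rewrite unitmxE unitfE.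
have sA : (rowsub f A <= A)%MS by rewrite rowsubE submxMl.
have rB : \rank (rowsub f A) = r.
  apply/eqP; rewrite eqn_leq rank_leq_row /=.
  rewrite -[X in (X <= _)%N](mxrank_unit un).
  have -> : mxsub f h A = rowsub f A *m (colsub h 1%:M) by rewrite mulmx_colsub mulmx1; apply/matrixP => a b; rewrite !mxE.
  exact: mxrankM_maxl.
have sB : (A <= rowsub f A)%MS by rewrite -(mxrank_leqif_sup sA).2 rB eqn_leq rA -rB mxrankS.
have /submxP [c ec] := submx_trans sub sB.
have : c *m mxsub f h A = 0.
  have -> : mxsub f h A = colsub h (rowsub f A) by apply/matrixP => a b; rewrite !mxE.
  rewrite mulmx_colsub -ec; apply/matrixP => a b; rewrite !mxE ord1 eqxx /=.
  by rewrite (negbTE (hj b)).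
move=> /(congr1 (mulmx^~ (invmx (mxsub f h A)))); rewrite mul0mx mulmxK // => c0.
move: ec; rewrite c0 mul0mx => /matrixP /(_ ord0 j); rewrite !mxE !eqxx => /eqP.
by rewrite oner_eq0.
Qed.

Lemma missed_col r n (h : 'I_r -> 'I_n) : (r < n)%N -> exists j, forall k, h k != j.
Proof.
move=> rn; apply: contrapT => no.
have : (#|'I_n| <= #|'I_r|)%N.
  have : [set: 'I_n]%SET \subset [set h k | k in 'I_r]%SET.
    apply/fintype.subsetP => j _; apply: contrapT => nj; apply: no; exists j => k.
    by apply/eqP => e; apply: nj; apply/imsetP; exists k.
  move=> /subset_leq_card; rewrite cardsT => k; apply: leq_trans k _.
  exact: leq_imset_card.
by rewrite !card_ord leqNgt rn.
Qed.

End MatrixRank.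

(** * Ultrafilter limits in a box *)

Section UltraLimits.
Variables (R : realType) (Om : Type) (U : set_system Om).
Context {UF : UltraFilter U}.
Local Notation E := (nat -> R).
Local Notation Ar := (@A R (vR R)).
Local Notation AGr := (@AG R (vR R)).
Local Notation pdr := (@pd R (vR R)).
Local Notation infl := (infl U).

Lemma box_ulim N (rho : R) (s : Om -> E) : U [set w | pdr N rho (s w)] ->
  exists p, pdr N rho p /\ forall i, (i < N)%N -> infl (fun w => s w i - p i).
Proof.
move=> hs.
have [p hp] : {p : E & forall i, (i < N)%N -> infl (fun w => s w i - p i)}.
  apply: (@choice _ _ (fun i l => (i < N)%N -> infl (fun w => s w i - l))) => i.
  have [hi|hi] := ltnP i N; last by exists 0.
  have [|l hl] := @ulim_exists _ _ U UF (fun w => s w i) rho; last by exists l.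
  by apply: filterS hs => w; apply.
exists p; split => // i hi /=; rewrite leNgt; apply/negP => lt.
have e0 : 0 < `|p i| - rho by lra.
have := filter_ex (filterI (hp i hi _ e0) hs) => -[w [/= h1 h2]].
have := h2 i hi => /= h3; have := ler_normB (s w i) (s w i - p i).
have -> : s w i - (s w i - p i) = p i by ring.
by lra.
Qed.

Lemma A_ulim N (r M : R) (f : E -> R) (rho : R) (s : Om -> E) p : rho < r -> Ar N r M f -> pdr N rho p ->
  (forall i, (i < N)%N -> infl (fun w => s w i - p i)) -> infl (fun w => f (s w) - f p).
Proof.
move=> rr hf hp hs.
have t0 : 0 < r - rho by lra.
have hA : Ar N (r - rho) M (fun h => f (fun i => p i + h i)).
  by apply: (A_recenter (a := p) t0 _ hf) => i hi; have /= := hp i hi; lra.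
have hAG : AGr N (fun h => f (fun i => p i + h i)) by exists (r - rho), M.
move=> e e0; apply: filterS (infl_ae (AG_cont hAG e0) hs) => w /=.
have -> : (fun i => p i + (s w i - p i)) = s w by apply/funext => i; rewrite addrC subrK.
by have -> : (fun i => p i + E0 (R:=R) (vR R) i) = p by apply/funext => i; rewrite addr0.
Qed.

End UltraLimits.

(** * Minima of analytic functions on a box *)

Section Minimum.
Variable R : realType.
Local Notation E := (nat -> R).
Local Notation Ar := (@A R (vR R)).
Local Notation pdr := (@pd R (vR R)).

Lemma nat_ultra : exists2 U : set_system nat, UltraFilter U & forall n, U [set k | (n <= k)%N].
Proof.
have [U [UF hU]] := ultraFilterLemma eventually_filter.
by exists U => // n; apply: hU; exists n.
Qed.

Lemma small_inv (e : R) : 0 < e -> exists n : nat, forall k, (n <= k)%N -> (k.+1%:R)^-1 < e.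
Proof.
move=> e0; have i0 : 0 < e^-1 by rewrite invr_gt0.
exists (Num.bound e^-1) => k hk; rewrite invf_plt ?posrE //.
have := archi_boundP (ltW i0) => h; apply: lt_le_trans h _.
by rewrite ler_nat; lia.
Qed.

Lemma A_min N (r M : R) (f : E -> R) (rho : R) : 0 < rho -> rho < r -> Ar N r M f ->
  exists2 p, pdr N rho p & forall x, pdr N rho x -> f p <= f x.
Proof.
move=> rho0 rr hf.
pose S : set R := [set t | exists2 x, pdr N rho x & f x = t].
have hS : has_inf S.
  split; first by exists (f (fun=> 0)); exists (fun=> 0) => // i _ /=; rewrite normr0 ltW.
  exists (- M) => t [x hx <-].
  have : `|f x| <= M.
    by apply: (A_bound (K := vR R) (r := r) _ hf) => [|i hi]; [lra|apply: le_trans (hx i hi) _; exact: ltW].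
  by rewrite ler_norml => /andP[].
have [s hs] : {s : nat -> E & forall k, pdr N rho (s k) /\ f (s k) < inf S + (k.+1%:R)^-1}.
  apply: (@choice _ _ (fun k x => pdr N rho x /\ f x < inf S + (k.+1%:R)^-1)) => k.
  have k0 : 0 < (k.+1%:R : R)^-1 by rewrite invr_gt0.
  by have [t [x hx <-] lt] := inf_adherent k0 hS; exists x.
have [U UF hU] := nat_ultra.
have [|p [hp hl]] := @box_ulim R nat U UF N rho s.
  by apply: filterS filterT => k _; exact: (hs k).1.
exists p => // x hx; apply: (@le_trans _ _ (inf S)); last first.
  by apply: ge_inf; [case: hS|exists x].
rewrite leNgt; apply/negP => lt.
have e0 : 0 < (f p - inf S) / 2 by lra.
have [n hn] := small_inv e0.
have := filter_ex (filterI (A_ulim rr hf hp hl e0) (hU n)) => -[k [/= h1 h2]].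
have h3 := (hs k).2; have h4 := hn k h2; move: h1; rewrite ltr_norml => /andP[h5 h6].
by move: h3 h4; set c := (_^-1); lra.
Qed.

(** Test a small increment of sign opposite to a: the linear term -t |a| outweighs the quadratic
    one. *)
Lemma crit_zero (a B t0 : R) (b : R -> R) : 0 < t0 ->
  (forall t, `|t| <= t0 -> `|b t| <= B /\ 0 <= t * a + t ^+ 2 * b t) -> a = 0.
Proof.
move=> t00 h; apply/eqP; rewrite -normr_eq0 eq_le normr_ge0 andbT leNgt; apply/negP => a0.
pose t := Num.min t0 (`|a| / (2 * (`|B| + 1))).
have B0 : 0 < `|B| + 1 by rewrite ltr_wpDl.
have tp : 0 < t by rewrite lt_min t00 divr_gt0 // mulr_gt0.
have tt : t <= t0 by rewrite ge_min lexx.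
have tB : t * (`|B| + 1) <= `|a| / 2.
  have : t <= `|a| / (2 * (`|B| + 1)) by rewrite ge_min lexx orbT.
  rewrite ler_pdivlMr; last by rewrite mulr_gt0.
  by lra.
pose u := - Num.sg a * t.
have ua : u * a = - (t * `|a|) by rewrite /u [`|a|]normrEsg; ring.
have u2 : u ^+ 2 = t ^+ 2.
  have : Num.sg a ^+ 2 = 1 by rewrite sqr_sg -normr_gt0 a0.
  by rewrite /u exprMn sqrrN => ->; rewrite mul1r.
have un : `|u| <= t0.
  have <- : `|t| = `|u| by apply/eqP; rewrite -(@eqrXn2 _ 2) // !real_normK ?num_real // u2.
  by rewrite gtr0_norm.
have [h1 h2] := h u un; move: h2; rewrite ua u2.
have : b u <= `|B|.
  by apply: le_trans (ler_norm _) _; apply: le_trans h1 _; exact: ler_norm.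
have t2 : 0 < t ^+ 2 by rewrite exprn_gt0.
move=> h3 h4; have : t ^+ 2 * b u <= t ^+ 2 * `|B| by rewrite ler_pM2l.
move=> h5; have : t * (t * (`|B| + 1)) <= t * (`|a| / 2) by rewrite ler_pM2l.
have : 0 < t * `|a| by rewrite mulr_gt0.
by rewrite expr2 in h5 t2 *; nra.
Qed.

End Minimum.

(** * Points of a fibre where a minor vanishes *)

Section CritMinor.
Variable R : realType.
Local Notation E := (nat -> R).
Local Notation E0 := (@E0 R (vR R)).
Local Notation Ar := (@A R (vR R)).
Local Notation ARr := (@AR R (vR R)).
Local Notation pdr := (@pd R (vR R)).
Local Notation joinr := (@joinE R (vR R)).
Local Notation updr := (@upd R (vR R)).
Implicit Types (Phi : E -> E) (D : nat -> nat -> E -> R) (S : nat -> nat -> nat -> E -> R).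

Definition jac d N D (x : E) : 'M[R]_(d, N) := \matrix_(i, j) D i j x.

(** On the box it vanishes exactly on the boundary. Multiplied by a minor, it covers the minima that
    are attained on the boundary. *)
Definition boxfun N (rho : R) (x : E) : R := \prod_(i < N) (rho ^+ 2 - x i ^+ 2).

Lemma boxfun_neq0 N (rho : R) x : (forall i, (i < N)%N -> `|x i| < rho) -> boxfun N rho x != 0.
Proof.
move=> h; apply/prodf_neq0 => i _.
rewrite subr_eq0; apply/eqP => e; have := h i (ltn_ord i).
have rho0 := le_lt_trans (normr_ge0 _) (h i (ltn_ord i)).
by rewrite -(@ltr_pXn2r _ 2) ?nnegrE ?(ltW rho0) // real_normK ?num_real // e ltxx.
Qed.

Lemma boxfun_interior N (rho : R) x : pdr N rho x -> boxfun N rho x != 0 ->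
  forall i, (i < N)%N -> `|x i| < rho.
Proof.
move=> hx /prodf_neq0 hb i hi; rewrite lt_neqAle (hx i hi) andbT; apply/eqP => e.
have := hb (Ordinal hi) isT; rewrite /= -e real_normK ?num_real //.
by rewrite subrr eqxx.
Qed.

Definition second_order d N (r : R) Phi D S (m : nat -> R) := forall i, (i < d)%N ->
  [/\ forall j, (j < N)%N -> Ar N (r / 2) (m i) (D i j),
      forall j k, (j < N)%N -> (k < N)%N -> Ar (N + N) (r / 2) (m i) (S i j k) &
      forall x h, pdr N (r / 2) x -> pdr N (r / 2) h ->
        Phi (fun l => x l + h l) i = Phi x i +
          \sum_(0 <= j < N) h j * (D i j x + \sum_(0 <= k < N) h k * S i j k (joinr N x h))].

(** Criticality in direction k reads sum_i 2 c_i D_ik = e delta_kj with c = Phi(p) - v; so the j-th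
    unit row is (2/e) c^T times the Jacobian. *)
Lemma penalty_crit d N (r rho e : R) Phi D S m (v : nat -> R) (j : 'I_N) p : 0 < rho -> rho < r / 2 ->
  second_order d N r Phi D S m -> (forall i, (i < N)%N -> `|p i| < rho) -> e != 0 ->
  (forall x, pdr N rho x ->
     \sum_(0 <= i < d) (Phi p i - v i) ^+ 2 - e * p j <= \sum_(0 <= i < d) (Phi x i - v i) ^+ 2 - e * x j) ->
  (delta_mx (ord0 : 'I_1) j <= jac d N D p)%MS.
Proof.
move=> rho0 rr so hp e0 hmin; have r0 : 0 < r by lra.
have hp2 : pdr N (r / 2) p by move=> i hi /=; have := hp i hi; lra.
pose c i := Phi p i - v i.
have crit (k : 'I_N) : \sum_(0 <= i < d) 2 * c i * D i k p - e * (k == j)%:R = 0.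
  pose Sk i (t : R) := S i k k (joinr N p (updr E0 k t)).
  pose b (t : R) := \sum_(0 <= i < d) (2 * c i * Sk i t + (D i k p + t * Sk i t) ^+ 2).
  pose B := \sum_(0 <= i < d) (2 * `|c i| * m i + (m i + r / 2 * m i) ^+ 2).
  apply: (@crit_zero R _ B (Num.min (rho - `|p k|) (r / 2)) b).
    by rewrite lt_min; apply/andP; split; [have := hp k (ltn_ord k); lra|lra].
  move=> t; rewrite le_min => /andP[t1 t2]; split.
    rewrite /b /B; apply: le_trans (ler_norm_sum _ _ _) _; apply: ler_sum_nat => i /andP[_ hi].
    have [h1 h2 _] := so i hi.
    have hS : `|Sk i t| <= m i.
      apply: (A_bound (K := vR R) (r := r / 2) _ (h2 k k (ltn_ord k) (ltn_ord k))); first by lra.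
      apply: pd_join => //; apply: pd_upd => //; apply: pd0; lra.
    have hD : `|D i k p| <= m i by apply: (A_bound (K := vR R) (r := r / 2) _ (h1 k (ltn_ord k))) => //; lra.
    apply: le_trans (ler_normD _ _) _; apply: lerD.
      by rewrite !normrM ger0_norm // ler_wpM2l // mulr_ge0.
    rewrite normrX; apply: lerXn2r; rewrite ?nnegrE //.
      by apply: addr_ge0; [exact: le_trans hD|apply: mulr_ge0; [lra|exact: le_trans hD]].
    by apply: le_trans (ler_normD _ _) _; apply: lerD => //; rewrite normrM ler_pM.
  have := hmin (updr p k (p k + t)) _; set x := updr p k (p k + t).
  have px : pdr N rho x.
    apply: pd_upd => [i hi|] /=; first by exact/ltW/hp.
    by apply: le_trans (ler_normD _ _) _; lra.
  move=> /(_ px).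
  have xj : x j = p j + (k == j)%:R * t.
    rewrite /x /upd; have [->|ne] := eqVneq k j; first by rewrite eqxx mul1r.
    have -> : ((j : nat) == k) = false by apply/negbTE; rewrite eq_sym.
    by rewrite mul0r addr0.
  have eP i : (i < d)%N -> Phi x i - v i = c i + t * (D i k p + t * Sk i t).
    move=> hi; have [_ _ h3] := so i hi.
    by rewrite /x (@partial_expand R (vR R) N r (fun x => Phi x i) (D i) (S i) k h3 (ltn_ord k) r0 p t hp2 t2) /c /Sk; ring.
  have -> : \sum_(0 <= i < d) (Phi x i - v i) ^+ 2 =
     \sum_(0 <= i < d) (Phi p i - v i) ^+ 2 + t * \sum_(0 <= i < d) 2 * c i * D i k p + t ^+ 2 * b t.
    rewrite !mulr_sumr -!big_split /=; apply: eq_big_nat => i /andP[_ hi].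
    by rewrite eP // /c; ring.
  rewrite xj; move: (\sum_(0 <= i < d) 2 * _ * _) => a.
  by move: (b t) (\sum_(0 <= i < d) _) => b' s; nra.
have -> : delta_mx ord0 j = (\row_(i < d) (e^-1 * 2 * c i)) *m jac d N D p.
  apply/rowP => k; rewrite !mxE eqxx /=.
  under eq_bigr do rewrite !mxE.
  have := crit k; rewrite big_mkord => /eqP; rewrite subr_eq0 => /eqP h.
  apply: (mulfI e0); rewrite -h mulr_sumr; apply: eq_bigr => i _.
  by field.
exact: submxMl.
Qed.

(* Minimise |Phi - v|^2 - e x_j over the box and let e tend to 0: at an interior minimum
   the j-th unit vector lies in the row space of the Jacobian, which is impossible where
   a minor of maximal size avoiding the column j is nonzero. *)
Lemma fibre_minor d N (r rho M : R) Phi D S m r0 (f : 'I_r0 -> 'I_d) (h : 'I_r0 -> 'I_N) (j : 'I_N) (v : nat -> R) q :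
  0 < rho -> rho < r / 2 -> (forall i, (i < d)%N -> Ar N r M (fun x => Phi x i)) ->
  second_order d N r Phi D S m ->
  (forall x, (forall i, (i < N)%N -> `|x i| < rho) -> (\rank (jac d N D x) <= r0)%N) ->
  (forall k, h k != j) -> pdr N rho q -> (forall i, (i < d)%N -> Phi q i = v i) ->
  exists p, [/\ pdr N rho p, forall i, (i < d)%N -> Phi p i = v i &
    \det (mxsub f h (jac d N D p)) * boxfun N rho p = 0].
Proof.
move=> rho0 rr hPhi so hr hj hq hqv; have rpos : 0 < r by lra.
pose G p := \det (mxsub f h (jac d N D p)) * boxfun N rho p.
have hG : ARr N (r / 2) G.
  have r20 : 0 < r / 2 by lra.
  apply: (@AR_mul R (vR R)) => //.
    apply: (@AR_det R (vR R)) => // a b.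
    have [h1 _ _] := so (f a) (ltn_ord _).
    exists (m (f a)); apply: A_ext (h1 (h b) (ltn_ord _)) => x _.
    by rewrite !mxE.
  apply: (@AR_prod R (vR R) _ _ predT _ _ (fun (i : 'I_N) x => rho ^+ 2 - x i ^+ 2)) => // i _.
  apply: (@AR_sub R (vR R)) => //; first exact: AR_cst.
  by apply: (@AR_exp R (vR R)) => //; exact: AR_coord.
(* Comparison with q, where the squared distance is 0, bounds it at the minimum by e (p_j - q_j) <=
   2 rho e. *)
have step (e : R) : 0 < e -> exists2 p, pdr N rho p &
    G p = 0 /\ \sum_(0 <= i < d) (Phi p i - v i) ^+ 2 <= e * (2 * rho).
  move=> e0; pose phi x := \sum_(i < d) (Phi x i - v i) ^+ 2 - e * x j.
  have [M' hphi] : ARr N r phi.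
    apply: (@AR_sub R (vR R)) => //.
      apply: (@AR_sum R (vR R) _ _ predT _ _ (fun (i : 'I_d) x => (Phi x i - v i) ^+ 2)) => // i _.
      apply: (@AR_exp R (vR R)) => //; apply: (@AR_sub R (vR R)) => //; last exact: AR_cst.
      by exists M; apply: hPhi.
    by apply: (@AR_mul R (vR R)) => //; [exact: AR_cst|exact: AR_coord].
  have rr' : rho < r by lra.
  have [p hp hmin] := A_min rho0 rr' hphi.
  exists p => //; split.
    apply/eqP; apply: contrapT => /negP; rewrite mulf_eq0 negb_or => /andP[g1 g2].
    have hin := boxfun_interior hp g2.
    have := minor_span (hr p hin) g1 hj; move/negP; apply.
    apply: (@penalty_crit d N r rho e Phi D S m v j p) => //; first by rewrite gt_eqF.
    by move=> x hx; rewrite !big_mkord; exact: hmin.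
  have := hmin q hq; rewrite /phi [X in _ <= X - _]big1; last by move=> i _; rewrite hqv // subrr expr0n.
  rewrite big_mkord; have /= := hp j (ltn_ord j); have /= := hq j (ltn_ord j).
  rewrite !ler_norml => /andP[a1 a2] /andP[b1 b2].
  move: (\sum_(i < d) _) => s; nra.
have [s hs] : {s : nat -> E & forall k, pdr N rho (s k) /\ (G (s k) = 0 /\
    \sum_(0 <= i < d) (Phi (s k) i - v i) ^+ 2 <= (k.+1%:R)^-1 * (2 * rho))}.
  apply: (@choice _ _ (fun k x => pdr N rho x /\ (G x = 0 /\
    \sum_(0 <= i < d) (Phi x i - v i) ^+ 2 <= (k.+1%:R)^-1 * (2 * rho)))) => k.
  have k0 : 0 < (k.+1%:R : R)^-1 by rewrite invr_gt0.
  by have [p hp hp2] := step _ k0; exists p.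
have [U UF hU] := nat_ultra.
have [|p [hp hl]] := @box_ulim R nat U UF N rho s.
  by apply: filterS filterT => k _; exact: (hs k).1.
exists p; split => //.
  move=> i hi; have rr' : rho < r by lra.
  have lim := A_ulim rr' (hPhi i hi) hp hl.
  apply/eqP; rewrite -subr_eq0 -normr_eq0 eq_le normr_ge0 andbT leNgt; apply/negP => lt.
  pose e := `|Phi p i - v i| / 2; have e0 : 0 < e by rewrite /e; lra.
  have e1 : 0 < e ^+ 2 / (2 * rho) by rewrite divr_gt0 ?exprn_gt0 // mulr_gt0.
  have [n hn] := small_inv e1.
  have := filter_ex (filterI (lim UF e e0) (hU n)) => -[k [/= h1 h2]].
  have := hn k h2; rewrite ltr_pdivlMr ?mulr_gt0 // => h3.
  have h4 : (Phi (s k) i - v i) ^+ 2 < e ^+ 2.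
    apply: le_lt_trans h3; apply: le_trans (hs k).2.2.
    rewrite (bigD1_seq i) ?mem_index_iota ?iota_uniq //= lerDl sumr_ge0 // => l _.
    exact: sqr_ge0.
  have h5 : `|Phi (s k) i - v i| < e.
    by rewrite -(@ltr_pXn2r _ 2) ?nnegrE ?(ltW e0) // real_normK ?num_real.
  have := ler_normB (Phi (s k) i - v i) (Phi (s k) i - Phi p i).
  have -> : Phi (s k) i - v i - (Phi (s k) i - Phi p i) = Phi p i - v i by ring.
  by rewrite /e in h1 h5; lra.
have [MG hMG] := hG; have lim := A_ulim rr hMG hp hl.
apply/eqP; rewrite -normr_eq0 eq_le normr_ge0 andbT leNgt; apply/negP => lt.
have := filter_ex (lim UF _ lt) => -[k /=].
by rewrite (hs k).2.1 sub0r normrN ltxx.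
Qed.

End CritMinor.

(** * Lowering the number of variables of a chart *)

Section FibreCut.
Variables (R : realType) (Om : Type) (U : set_system Om).
Context {UF : UltraFilter U}.
Local Notation E := (nat -> R).
Local Notation E0 := (@E0 R (vR R)).
Local Notation Ar := (@A R (vR R)).
Local Notation ARr := (@AR R (vR R)).
Local Notation AGr := (@AG R (vR R)).
Local Notation nzr := (@nz R (vR R)).
Local Notation nearr := (@near0 R (vR R)).
Local Notation pdr := (@pd R (vR R)).
Local Notation infl := (infl U).

(** If the germ of G at p were zero, continuation along the segment from p to p1 would give G(p1) =
    0. *)
Lemma nz_recenter N (r rho t : R) (G : E -> R) (p p1 : E) : 0 < rho -> 0 < t -> rho + t <= r ->
  ARr N r G -> pdr N rho p -> pdr N rho p1 -> G p1 != 0 -> nzr N (fun h => G (fun i => p i + h i)).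
Proof.
move=> rho0 t0 rt hG hp hp1 G1 [s [s0 hs]].
pose l (u : R) : E := fun i => p i + u * (p1 i - p i).
suff : G (l 1) = 0.
  have -> : l 1 = p1 by apply/funext => i; rewrite /l mul1r addrC subrK.
  by move/eqP; rewrite (negbTE G1).
apply: (@line_identity R (vR R) (fun u => G (l u))) => [u /andP[u0 u1]|].
  have hl : pdr N rho (l u).
    move=> i hi /=; have -> : l u i = (1 - u) * p i + u * p1 i by rewrite /l; ring.
    apply: le_trans (ler_normD _ _) _; rewrite !normrM (ger0_norm u0) (ger0_norm (x := 1 - u)); last by lra.
    have /= := hp i hi; have /= := hp1 i hi; move: `|p i| `|p1 i| => a b; nra.
  have hAG := AR_AG t0 (AR_recenter t0 rt hl hG).
  have k1 i : (i < N)%N -> AGr 1 (fun x => x 0%N * (p1 i - p i)).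
    by move=> hi; apply: AG_mul; [exact: AG_coord|exact: AG_cst].
  have k2 i : (i < N)%N -> E0 0%N * (p1 i - p i) = 0 by rewrite /E0 mul0r.
  apply: AG_ext1 (AG_comp hAG k1 k2) => x.
  by congr G; apply/funext => i; rewrite /l /=; ring.
exists (s / (2 * rho)); first by rewrite divr_gt0 // mulr_gt0.
move=> u /= /andP[u0]; rewrite ler_pdivlMr ?mulr_gt0 // => u1.
apply: hs => i hi /=; rewrite normrM (ger0_norm u0); apply: le_trans u1; rewrite ler_wpM2l //.
by apply: le_trans (ler_normB _ _) _; have /= := hp i hi; have /= := hp1 i hi; lra.
Qed.

(** If the maximal rank on the box is below N, every q(w) is moved inside its fibre to a zero p(w)
    of one nonzero function G. Resolving G makes a new coordinate vanish along [U]; dropping it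
    lowers N without changing the image points. *)
Lemma fibre_cut d (X : set 'rV[R]_d) (x0 : 'rV[R]_d) (y : Om -> 'rV[R]_d) N Phi q :
  unif U X x0 y N Phi q ->
  (exists N' Phi' q', (N' < N)%N /\ unif U X x0 y N' Phi' q') \/
  (exists r M D S m p1, [/\ 0 < r, forall i, (i < d)%N -> Ar N r M (fun x => Phi x i),
     second_order d N r Phi D S m, forall x, pdr N r x -> X (x0 + rowE d (Phi x)) &
     pdr N (r / 4) p1 /\ \rank (jac d N D p1) = N]).
Proof.
move=> [u1 u2 u3 [rX [rX0 u4]] u5].
have [s [s0 [M hs]]] := AG_common_all u1.
pose r := Num.min s rX; have r0 : 0 < r by rewrite lt_min s0.
have hPhi i : (i < d)%N -> Ar N r M (fun x => Phi x i).
  by move=> hi; apply: A_shrink (hs i hi); [exact: ltW|rewrite ge_min lexx].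
have hX x : pdr N r x -> X (x0 + rowE d (Phi x)).
  by move=> hx; apply: u4; apply: pd_le hx; rewrite ge_min lexx orbT.
have [D [S [m so]]] := A_expand2_all r0 hPhi.
pose rho := r / 4; have rho0 : 0 < rho by rewrite /rho; lra.
have rr : rho < r / 2 by rewrite /rho; lra.
pose ob (x : E) := forall i, (i < N)%N -> `|x i| < rho.
pose P k := `[< exists x, ob x /\ \rank (jac d N D x) = k >].
have exP : exists k, P k.
  exists (\rank (jac d N D E0)); apply/asboolP; exists E0; split => // i _.
  by rewrite /E0 normr0.
have bdP k : P k -> (k <= N)%N by move=> /asboolP [x [_ <-]]; exact: rank_leq_col.
case: (ex_maxnP exP bdP) => k0 /asboolP [p1 [op1 rp1]] kmax.
have [kN|kN] := eqVneq k0 N.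
  right; exists r, M, D, S, m, p1; split => //; split; last by rewrite rp1.
  by move=> i hi; exact/ltW/op1.
have {}kN : (k0 < N)%N by rewrite ltn_neqAle kN bdP //; apply/asboolP; exists p1.
left; rewrite -rp1 in kN kmax.
have [f [h fh]] := minor_exists (jac d N D p1).
have [j hj] := missed_col h kN.
pose G p := \det (mxsub f h (jac d N D p)) * boxfun N rho p.
have r20 : 0 < r / 2 by lra.
have hG : ARr N (r / 2) G.
  apply: (@AR_mul R (vR R)) => //.
    apply: (@AR_det R (vR R)) => // a b.
    have [h1 _ _] := so (f a) (ltn_ord _).
    exists (m (f a)); apply: A_ext (h1 (h b) (ltn_ord _)) => x _.
    by rewrite !mxE.
  apply: (@AR_prod R (vR R) _ _ predT _ _ (fun (i : 'I_N) x => rho ^+ 2 - x i ^+ 2)) => // i _.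
  apply: (@AR_sub R (vR R)) => //; first exact: AR_cst.
  by apply: (@AR_exp R (vR R)) => //; exact: AR_coord.
have G1 : G p1 != 0 by rewrite mulf_neq0 // boxfun_neq0.
have [p hp] : {p : Om -> E & forall w, pdr N rho (q w) ->
    [/\ pdr N rho (p w), forall i, (i < d)%N -> Phi (p w) i = Phi (q w) i & G (p w) = 0]}.
  apply: (@choice _ _ (fun w p => pdr N rho (q w) ->
    [/\ pdr N rho p, forall i, (i < d)%N -> Phi p i = Phi (q w) i & G p = 0])) => w.
  have [hq|hq] := pselect (pdr N rho (q w)); last by exists E0.
  have [||p hp] := @fibre_minor R d N r rho M Phi D S m _ f h j (fun i => Phi (q w) i) (q w) rho0 rr hPhi so _ hj hq.
  - by move=> x ox; apply: kmax; apply/asboolP; exists x.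
  - by [].
  - by exists p.
have hqU : U [set w | pdr N rho (q w)].
  have : U [set w | forall i, (i < N)%N -> `|q w i| < rho] by apply: ae_all => i hi; exact: u3.
  by apply: filterS => w hw i hi; exact/ltW/hw.
(* The moved points may tend to some pi != 0, so the chart is recentred there; Phi(pi) = 0 persists
   because Phi(p(w)) = Phi(q(w)) tends to 0. *)
have [|pi [hpi hl]] := @box_ulim R Om U UF N rho p.
  by apply: filterS hqU => w /hp [].
have rho4 : rho + rho <= r / 2 by rewrite /rho; lra.
pose Gh (x : E) := G (fun i => pi i + x i).
have hGh : AGr N Gh := AR_AG rho0 (AR_recenter rho0 rho4 hpi hG).
have nGh : nzr N Gh.
  by apply: (nz_recenter rho0 rho0 rho4 hG hpi (p1 := p1)) => // i hi; exact/ltW/op1.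
pose dp w : E := fun i => p w i - pi i.
have [phi [q1 [[l1 l2 l3 l4] nc]]] := normal_crossings hGh nGh (hl : forall i, (i < N)%N -> infl (fun w => dp w i)).
have zG : U [set w | Gh (phi (q1 w)) = 0].
  have [rd [rd0 dep]] := AG_dep hGh.
  have v1 : U [set w | forall i, (i < N)%N -> `|dp w i| < rd] by apply: ae_all => i hi; exact: hl.
  apply: filterS (filterI (filterI hqU v1) l4) => w [[/= h1 h2] h3].
  have [_ _ <-] := hp w h1.
  have -> : G (p w) = Gh (dp w).
    by rewrite /Gh; congr G; apply/funext => i; rewrite /dp addrC subrK.
  apply/esym/dep => i hi; last by rewrite h3.
  exact/ltW/h2.
have [i hi [zi _]] := zero_lift nc l3 zG.
have hr i' : (i' < d)%N -> AGr N (fun x => Phi (fun l => pi l + x l) i').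
  move=> hi'; apply: (AR_AG rho0); apply: (@AR_recenter R (vR R) N r rho rho (fun x => Phi x i') pi) => //; first by lra.
  by exists M; exact: hPhi.
(* Reinserts a 0 at position i, undoing the deletion of that coordinate. *)
pose ins (x : E) : E := fun l => if (l < i)%N then x l else if l == i then 0 else x l.-1.
have hins l : (l < N)%N -> AGr N.-1 (fun x => ins x l).
  move=> hlN; rewrite /ins; case: ltnP => h1; first by apply: AG_coord; clear -hi h1; lia.
  case: eqP => h2; first exact: AG_cst.
  by apply: AG_coord; clear -h1 h2 hlN; lia.
have ins0 : ins E0 = E0 by apply/funext => l; rewrite /ins /E0; case: ifP => //; case: ifP.
have ins0' l : (l < N)%N -> ins E0 l = 0 by rewrite ins0.
have hpi2 l : (l < N)%N -> AGr N.-1 (fun x => phi (ins x) l).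
  by move=> hlN; exact: (AG_comp (l1 l hlN) hins ins0').
have hpi0 l : (l < N)%N -> phi (ins E0) l = 0 by move=> hlN; rewrite ins0; exact: l2.
have pdpi x : (forall l, (l < N)%N -> `|x l| <= rho) -> pdr N r (fun l => pi l + x l).
  move=> hx l hlN /=; apply: le_trans (ler_normD _ _) _.
  by have /= := hpi l hlN; have := hx l hlN; rewrite /rho; lra.
exists N.-1, (fun x => Phi (fun l => pi l + phi (ins x) l)), (fun w l => if (l < i)%N then q1 w l else q1 w l.+1).
split; first by clear -hi; lia.
split.
- by move=> k hk; exact: (AG_comp (hr k hk) hpi2 hpi0).
- move=> k hk; have -> : Phi (fun l => pi l + phi (ins E0) l) k = Phi pi k.
    apply: (A_dep (hPhi k hk)) => [|l hlN]; last by rewrite hpi0 // addr0.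
    by apply: pdpi => l hlN; rewrite hpi0 // normr0 ltW.
  apply: (@infl_uniq R Om U UF (fun w => Phi (p w) k)).
    apply: (@A_ulim R Om U UF N r M (fun x => Phi x k) rho p pi) => //; last exact: hPhi.
    by lra.
  apply: infl_ext (infl_AG (u1 k hk) (u2 k hk) u3); apply: filterS hqU => w /hp [_ e _] /=.
  by rewrite subr0 e.
- by move=> l hlN; case: (ltnP l i) => h1; apply: l3; clear -hi h1 hlN; lia.
- have : nearr N (fun x => X (x0 + rowE d (Phi (fun l => pi l + x l)))).
    by exists rho; split => // x hx; apply: hX; apply: pdpi.
  by move=> hn; exact: near0_comp hn hpi2 hpi0.
- have [rd [rd0 dep]] := AG_dep_all l1.
  have v1 : U [set w | forall i, (i < N)%N -> `|q1 w i| < rd] by apply: ae_all => k hk; exact: l3.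
  apply: filterS (filterI (filterI (filterI u5 hqU) (filterI v1 l4)) zi) => w [[[/= -> h1] [/= h2 h3]] h4].
  congr (_ + _); apply/rowP => k; rewrite !mxE.
  have [h5 <- // _] := hp w h1.
  apply: (A_dep (hPhi k (ltn_ord k))) => [l hlN|l hlN].
    by apply: le_trans (h5 l hlN) _; rewrite /rho; lra.
  rewrite -(dep (q1 w)) //; first by rewrite h3 // /dp addrC subrK.
    by move=> l' hl'; exact/ltW/h2.
  move=> l' hl'; rewrite /ins; case: ltnP => h6 //.
  case: eqP => [->//|h7].
  have -> : (l'.-1 < i)%N = false by clear -h6 h7; lia.
  by congr (q1 w _); clear -h6 h7; lia.
Qed.

End FibreCut.

(** * A horn inside the set *)

Section NowhereDense.
Variables (R : realType) (d : nat).
Implicit Types (z x y : 'rV[R]_d) (S : set 'rV[R]_d).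
Local Notation E := (nat -> R).
Local Notation pdr := (@pd R (vR R)).

Definition cube z (e : R) : set 'rV[R]_d := [set x | forall i, `|x ord0 i - z ord0 i| < e].

Definition nwd S := forall z (e : R), 0 < e -> exists z' (e' : R), [/\ 0 < e',
  cube z' e' `<=` cube z e & forall x, cube z' e' x -> ~ S x].

Lemma nwd0 : nwd set0.
Proof. by move=> z e e0; exists z, e; split => // x _ []. Qed.

Lemma nwdU S S' : nwd S -> nwd S' -> nwd (S `|` S').
Proof.
move=> h h' z e e0; have [z1 [e1 [e10 s1 n1]]] := h z e e0.
have [z2 [e2 [e20 s2 n2]]] := h' z1 e1 e10; exists z2, e2; split => //.
  by move=> x /s2 /s1.
by move=> x hx [k|k]; [exact: n1 (s2 _ hx) k|exact: n2 k].
Qed.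

Lemma cell_exists (T : nat) (rho u : R) : 0 < rho -> (0 < T)%N -> `|u| <= rho ->
  exists k : 'I_T.+1, `|u + rho - k%:R * (2 * rho / T%:R)| <= 2 * rho / T%:R.
Proof.
move=> rho0 T0; rewrite ler_norml => /andP[u1 u2].
have T0' : 0 < T%:R :> R by rewrite ltr0n.
pose a := (u + rho) * T%:R / (2 * rho).
have a0 : 0 <= a by rewrite /a divr_ge0 ?mulr_ge0 // ?(ltW rho0) ?(ltW T0') //; lra.
have aT : a <= T%:R.
  rewrite /a ler_pdivrMr; last by lra.
  by rewrite mulrC ler_wpM2l ?(ltW T0') //; lra.
have /andP[k1 k2] := truncn_itv a0.
have kT : (Num.truncn a < T.+1)%N by rewrite ltnS -(ler_nat R); exact: le_trans aT.
exists (Ordinal kT) => /=.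
have -> : u + rho = a * (2 * rho / T%:R) by rewrite /a; field; rewrite gt_eqF //= gt_eqF.
rewrite -mulrBl normrM (ger0_norm (x := 2 * rho / T%:R)); last by rewrite divr_ge0 ?(ltW T0') //; lra.
rewrite ger_pMl; last by rewrite divr_gt0 //; lra.
by rewrite ler_norml; move: k2; rewrite -natr1; lra.
Qed.

(** Pigeonhole: if the image met every subcube, K^d disjoint subcubes would inject into the (T+1)^N
    cells of the parameter box, which are so fine that one cell reaches at most one subcube. *)
Lemma lipschitz_nwd N (rho L : R) (Phi : E -> E) (x0 : 'rV[R]_d) : (N < d)%N -> 0 < rho -> 0 < L ->
  (forall (x y : E) (dl : R), 0 <= dl -> pdr N rho x -> pdr N rho y -> (forall l, (l < N)%N -> `|x l - y l| <= dl) ->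
     forall i, (i < d)%N -> `|Phi x i - Phi y i| <= L * dl) ->
  nwd [set x0 + rowE d (Phi x) | x in [set x | pdr N rho x]].
Proof.
move=> Nd rho0 L0 hL z e e0; apply: contrapT => no.
set S := (X in ~ exists z' e', [/\ _, _ & forall x, _ -> ~ X x]) in no.
have meet z' (e' : R) : 0 < e' -> cube z' e' `<=` cube z e -> exists2 x, pdr N rho x & cube z' e' (x0 + rowE d (Phi x)).
  move=> e'0 sub; apply: contrapT => k; apply: no; exists z', e'; split => // x hx [u hu ux].
  by apply: k; exists u => //; rewrite ux.
pose c := (Num.bound (4 * L * rho / e)).+1.
have hc : 4 * L * rho / e < c%:R.
  apply: lt_le_trans (archi_boundP _) _; last by rewrite ler_nat /c.
  by rewrite divr_ge0 ?(ltW e0) // !mulr_ge0 // ltW.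
(* The choice of c gives L 4 rho / (c K) < e / K; since K > (c+1)^N, also (T+1)^N <= ((c+1) K)^N <
   K^(N+1) <= K^d. *)
pose K := (c.+1 ^ N).+1; pose T := (c * K)%N.
have K0 : 0 < K%:R :> R by rewrite ltr0n.
have T0 : (0 < T)%N by rewrite /T muln_gt0.
pose zg (g : {ffun 'I_d -> 'I_K}) : 'rV[R]_d := \row_i (z ord0 i - e + (2 * (g i)%:R + 1) * (e / K%:R)).
(* Half of the half-width of a grid cell, so that points of distinct subcubes are more than e / K
   apart in some coordinate. *)
pose e1 := e / K%:R / 2.
have eK0 : 0 < e / K%:R by rewrite divr_gt0.
have sub g : cube (zg g) e1 `<=` cube z e.
  move=> x hx i; have := hx i; rewrite !mxE; set a := (g i)%:R.
  have a0 : 0 <= a :> R by rewrite ler0n.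
  have a1 : a + 1 <= K%:R :> R by rewrite natr1 ler_nat ltn_ord.
  have : (a + 1) * (e / K%:R) <= e.
    by rewrite mulrA ler_pdivrMr // mulrC ler_wpM2l // ltW.
  rewrite !ltr_norml /e1; move: (x ord0 i) (z ord0 i) => x' z'.
  have : 0 <= a * (e / K%:R) by rewrite mulr_ge0 // ltW.
  rewrite mulrDl mul1r [(2 * a + 1) * _]mulrDl mul1r -[2 * a * _]mulrA.
  by move: (a * (e / K%:R)) (e / K%:R) eK0 => b b' b'0 h1 h2 /andP[h3 h4]; apply/andP; split; lra.
have e10 : 0 < e1 by rewrite /e1; lra.
have [s hs] : {s : {ffun 'I_d -> 'I_K} -> E & forall g, pdr N rho (s g) /\ cube (zg g) e1 (x0 + rowE d (Phi (s g)))}.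
  apply: (@choice _ _ (fun (g : {ffun 'I_d -> 'I_K}) (x : E) => pdr N rho x /\ cube (zg g) e1 (x0 + rowE d (Phi x)))) => g.
  by have [x hx cx] := meet _ _ e10 (sub g); exists x.
have [cl hcl] : {cl : R -> 'I_T.+1 & forall u, `|u| <= rho -> `|u + rho - (cl u)%:R * (2 * rho / T%:R)| <= 2 * rho / T%:R}.
  apply: (@choice _ _ (fun u (k : 'I_T.+1) => `|u| <= rho -> `|u + rho - k%:R * (2 * rho / T%:R)| <= 2 * rho / T%:R)) => u.
  have [h|h] := leP `|u| rho; last by exists ord0.
  by have [k hk] := cell_exists rho0 T0 h; exists k.
pose code g : {ffun 'I_N -> 'I_T.+1} := [ffun l : 'I_N => cl (s g l)].
have inj : injective code.
  move=> g g' eg; apply/ffunP => i; apply/eqP; apply/negPn/negP => ne.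
  have [p1 c1] := hs g; have [p2 c2] := hs g'.
  have close l : (l < N)%N -> `|s g l - s g' l| <= 4 * rho / T%:R.
    move=> hl; have := hcl _ (p1 l hl); have := hcl _ (p2 l hl).
    have := congr1 (fun f : {ffun 'I_N -> 'I_T.+1} => f (Ordinal hl)) eg; rewrite !ffunE /= => ->.
    move: (_%:R * _) => b; have -> : 4 * rho / T%:R = 2 * rho / T%:R + 2 * rho / T%:R :> R by lra.
    rewrite !ler_norml => /andP[h1 h2] /andP[h3 h4]; apply/andP; split; lra.
  have T0' : 0 <= 4 * rho / T%:R by rewrite divr_ge0 // mulr_ge0 // ltW.
  have := hL _ _ _ T0' p1 p2 close i (ltn_ord i).
  have : L * (4 * rho / T%:R) < e / K%:R.
    have c0 : 0 < c%:R :> R by rewrite ltr0n.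
    have -> : L * (4 * rho / T%:R) = 4 * L * rho / c%:R / K%:R.
      by rewrite /T natrM; field; rewrite !gt_eqF.
    rewrite ltr_pM2r ?invr_gt0 // ltr_pdivrMr //.
    by move: hc; rewrite ltr_pdivrMr // [_ * e]mulrC.
  have := c1 i; have := c2 i; rewrite !mxE /e1.
  have : 1 <= `|(g i)%:R - (g' i)%:R| :> R.
    have [h|h|h] := ltngtP (g i) (g' i).
    - by rewrite distrC ger0_norm -?natrB ?(ltnW h) // ?ler1n ?subn_gt0.
    - by rewrite ger0_norm -?natrB ?(ltnW h) // ?ler1n ?subn_gt0.
    - by case/eqP: ne; apply/val_inj.
  rewrite -[X in X <= _]mul1r; move=> hg.
  have : e / K%:R <= `|((g i)%:R - (g' i)%:R) * (e / K%:R)|.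
    by rewrite normrM (gtr0_norm eK0) ler_peMl // ?(ltW eK0) //; rewrite mul1r in hg.
  have -> : ((g i)%:R - (g' i)%:R) * (e / K%:R) = (g i)%:R * (e / K%:R) - (g' i)%:R * (e / K%:R) by ring.
  rewrite [(2 * (g i)%:R + 1) * _]mulrDl mul1r -[2 * (g i)%:R * _]mulrA.
  rewrite [(2 * (g' i)%:R + 1) * _]mulrDl mul1r -[2 * (g' i)%:R * _]mulrA.
  move: ((g i)%:R * (e / K%:R)) ((g' i)%:R * (e / K%:R)) (e / K%:R) (Phi (s g) i) (Phi (s g') i) (L * _) eK0 => a b k P P' LL k0.
  rewrite !ltr_norml !ler_norml => h1 /andP[h2 h3] /andP[h4 h5] h6 /andP[h7 h8].
  by move: h1; rewrite ler_normr => /orP[]; lra.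
have := leq_card code inj; rewrite !card_ffun !card_ord => h.
have h1 : (T.+1 ^ N <= (c.+1 * K) ^ N)%N by case: (N) => // n; rewrite leq_exp2r //= /T; lia.
have := leq_trans h h1; rewrite expnMn leqNgt => /negP; apply.
apply: (@leq_trans (K ^ N.+1)); last by rewrite leq_pexp2l.
by rewrite expnS ltn_pmul2r ?expn_gt0.
Qed.

End NowhereDense.

(** * A chart with d variables and nonzero Jacobian *)

Section GoodChart.
Variables (R : realType) (d : nat).
Local Notation E := (nat -> R).
Local Notation E0 := (@E0 R (vR R)).
Local Notation Ar := (@A R (vR R)).
Local Notation pdr := (@pd R (vR R)).

Lemma second_order_lip N (r : R) (Phi : E -> E) D S m : 0 < r -> second_order d N r Phi D S m ->
  exists2 L : R, 0 < L & forall (x y : E) (dl : R), 0 <= dl -> pdr N (r / 4) x -> pdr N (r / 4) y ->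
    (forall l, (l < N)%N -> `|x l - y l| <= dl) ->
    forall i, (i < d)%N -> `|Phi x i - Phi y i| <= L * dl.
Proof.
move=> r0 so; have r20 : 0 <= r / 2 by lra.
pose Li i := \sum_(0 <= j < N) (`|m i| + \sum_(0 <= k < N) r / 2 * `|m i|).
have Li0 i : 0 <= Li i.
  by apply: sumr_ge0 => j _; apply: addr_ge0 => //; apply: sumr_ge0 => k _; exact: mulr_ge0.
exists (\sum_(0 <= i < d) Li i + 1) => [|x y dl dl0 hx hy hxy i hi].
  by apply: ltr_wpDl => //; exact: sumr_ge0.
have [h1 h2 h3] := so i hi.
have hy2 : pdr N (r / 2) y by move=> l hl; apply: le_trans (hy l hl) _; lra.
pose h l := x l - y l.
have hh : pdr N (r / 2) h.
  move=> l hl; apply: le_trans (ler_normB _ _) _.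
  by have /= := hx l hl; have /= := hy l hl; lra.
have := h3 y h hy2 hh.
have -> : (fun l => y l + h l) = x by apply/funext => l; rewrite /h addrC subrK.
move=> ->; rewrite addrC addKr; apply: (@le_trans _ _ (Li i * dl)); last first.
  rewrite ler_wpM2r // (bigD1_seq i) ?mem_index_iota ?iota_uniq //= -addrA lerDl addr_ge0 //.
  by apply: sumr_ge0.
rewrite /Li mulr_suml; apply: le_trans (ler_norm_sum _ _ _) _; apply: ler_sum_nat => j /andP[_ hj].
rewrite normrM mulrC ler_pM ?hxy // ?normr_ge0 //; apply: le_trans (ler_normD _ _) _; apply: lerD.
  apply: le_trans (ler_norm (m i)).
  exact: (A_bound (K := vR R) r20 (h1 j hj) hy2).
apply: le_trans (ler_norm_sum _ _ _) _; apply: ler_sum_nat => k /andP[_ hk].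
rewrite normrM ler_pM ?normr_ge0 //; first exact: hh.
apply: le_trans (ler_norm (m i)).
by apply: (A_bound (K := vR R) r20 (h2 j k hj hk)); apply: pd_join.
Qed.

(** Sets containing the interior of X near x0 up to a nowhere dense set form a filter; it is proper
    because x0 lies in the closure of the interior. *)
Lemma thick_ultra (X : set 'rV[R]_d) (x0 : 'rV[R]_d) : fat X -> X x0 ->
  exists2 U : set_system 'rV[R]_d, UltraFilter U & (forall e : R, 0 < e -> U (cube x0 e)) /\
    U X /\ forall S, nwd S -> U (~` S).
Proof.
move=> [_ [cX eX]] Xx0.
pose F : set_system 'rV[R]_d := [set Q | exists e : R, exists S, [/\ 0 < e, nwd S &
  forall y, cube x0 e y -> interior X y -> ~ S y -> Q y]].
have PF : ProperFilter F.
  apply: Build_ProperFilter.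
    move=> [e [S [e0 nS h]]].
    have e20 : 0 < e / 2 by lra.
    move: Xx0; rewrite eX => /(_ _ (box_nbhs x0 e20)) [y1 [iX hy1]].
    have [e1 e10 he1] := open_box (@open_interior _ X) iX.
    have m0 : 0 < Num.min e1 (e / 2) by rewrite lt_min e10.
    have [z' [e' [e'0 sub no]]] := nS y1 _ m0.
    have cz : cube z' e' z' by move=> i; rewrite subrr normr0.
    apply: (h z' _ _ (no _ cz)).
      move=> i; have := sub _ cz i; rewrite lt_min => /andP[_ k1]; have := hy1 i => /= k2.
      rewrite [X in `|X|](_ : _ = (z' ord0 i - y1 ord0 i) + (y1 ord0 i - x0 ord0 i)); last by ring.
      by apply: le_lt_trans (ler_normD _ _) _; lra.
    by apply: he1 => i; have := sub _ cz i; rewrite lt_min => /andP[].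
  apply: Build_Filter.
  - by exists 1, set0; split => //; exact: nwd0.
  - move=> P Q [e [S [e0 nS h]]] [e' [S' [e'0 nS' h']]].
    exists (Num.min e e'), (S `|` S'); split; [by rewrite lt_min e0|exact: nwdU|].
    move=> y hy iy ny; split.
      apply: h => // [i|k]; first by have := hy i; rewrite lt_min => /andP[].
      by apply: ny; left.
    apply: h' => // [i|k]; first by have := hy i; rewrite lt_min => /andP[].
    by apply: ny; right.
  - by move=> P Q PQ [e [S [e0 nS h]]]; exists e, S; split => // y h1 h2 h3; apply/PQ/h.
have [U [UF hU]] := ultraFilterLemma PF.
exists U => //; split; last split.
- by move=> e e0; apply: hU; exists e, set0; split => //; exact: nwd0.
- apply: hU; exists 1, set0; split => //; first exact: nwd0.
  by move=> y _ iy _; exact: interior_subset iy.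
- by move=> S nS; apply: hU; exists 1, S; split.
Qed.

(** For minimal N, [fibre_cut] produces a d x N Jacobian of rank N, so N <= d; if N < d, almost all
    points would lie in a nowhere dense image, which the ultrafilter avoids. *)
Lemma good_chart (X : set 'rV[R]_d) (x0 : 'rV[R]_d) : fat X -> subanalytic X -> X x0 ->
  exists r M Phi D S m p1, [/\ 0 < r, forall i, (i < d)%N -> Ar d r M (fun x => Phi x i),
    second_order d d r Phi D S m, forall x, pdr d r x -> X (x0 + rowE d (Phi x)) &
    [/\ forall i, (i < d)%N -> Phi E0 i = 0, pdr d (r / 4) p1 & \det (jac d d D p1) != 0]].
Proof.
move=> fX sX Xx0; have [U UF [Ux0 [UX Un]]] := thick_ultra fX Xx0.
have [_ [cX _]] := fX.
have [||N0 [P0 [q0 un0]]] := @unif_exists R _ U UF d X x0 id cX sX.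
- by move=> i e e0; apply: filterS (Ux0 e e0) => w; apply.
- exact: UX.
pose P N := `[< exists Phi q, unif U X x0 id N Phi q >].
have exP : exists N, P N by exists N0; apply/asboolP; exists P0, q0.
case: (ex_minnP exP) => N /asboolP [Phi [q un]] Nmin.
have [[N' [Phi' [q' [lt un']]]]|] := fibre_cut un.
  have : P N' by apply/asboolP; exists Phi', q'.
  by move=> /Nmin; rewrite leqNgt lt.
move=> [r [M [D [S [m [p1 [r0 hP so hX [hp1 rk]]]]]]]].
have Nd : (N <= d)%N by rewrite -rk rank_leq_row.
have [lt|ge] := ltnP N d.
  exfalso; have r40 : 0 < r / 4 by lra.
  have [L L0 hL] := second_order_lip r0 so.
  have := Un _ (lipschitz_nwd x0 lt r40 L0 hL) => h.
  case: un => u1 u2 u3 u4 u5.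
  have v1 : U [set w | forall i, (i < N)%N -> `|q w i| < r / 4] by apply: ae_all => i hi; exact: u3.
  apply: (@ae_false _ U); apply: filterS (filterI h (filterI v1 u5)) => w [/= h1 [/= h2 h3]].
  by apply: h1; exists (q w) => // i hi; exact/ltW/h2.
have eN : N = d by apply/eqP; rewrite eqn_leq Nd.
subst N; exists r, M, Phi, D, S, m, p1; split => //; split => //; first by case: un.
have : row_full (jac d d D p1) by rewrite /row_full rk.
by rewrite row_full_unit unitmxE unitfE.
Qed.

End GoodChart.

(** * Inversion of the chart along a line *)

Section Horn.
Variables (R : realType) (d : nat).
Local Notation E := (nat -> R).
Local Notation E0 := (@E0 R (vR R)).
Local Notation AGr := (@AG R (vR R)).
Local Notation nearr := (@near0 R (vR R)).
Local Notation pdr := (@pd R (vR R)).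
Local Notation joinr := (@joinE R (vR R)).

Lemma solve_lin (F : fieldType) (e e0 w c : F) : e0 != 0 ->
  w = w * (1 - e / e0) + e0^-1 * c -> e * w = c.
Proof.
move=> e00 h; have -> : c = e0 * (w * (1 - e / e0) + e0^-1 * c) - w * (e0 - e) by field.
by rewrite -h; ring.
Qed.

Lemma AG_det N n (F : E -> 'M[R]_n) : (forall i j, AGr N (fun x => F x i j)) ->
  AGr N (fun x => \det (F x)).
Proof.
move=> h; apply: (@AG_sum R (vR R) _ _ _ _ predT) => s _; apply: AG_mul; first exact: AG_cst.
by apply: (@AG_prod R (vR R) _ _ _ _ predT).
Qed.

(* With det (D Phi (t p1)) = t^k e(t) and e(0) <> 0, the equation
   Phi (t p1 + t^(k+1) w) = Phi (t p1) + t^(2k+1) z becomes, after multiplication by the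
   adjugate and division by a power of t, e w = adj z - t adj S(t, w), which the implicit
   function theorem solves for w. *)
Lemma horn (X : set 'rV[R]_d) (x0 : 'rV[R]_d) : fat X -> subanalytic X -> X x0 ->
  exists (c : E -> E) N (dl : R), [/\ (0 < N)%N, 0 < dl, forall i, (i < d)%N -> AGr 1 (fun x => c x i),
    forall i, (i < d)%N -> c E0 i = 0 &
    forall t z : E, `|t 0%N| <= dl -> (forall i, (i < d)%N -> `|z i| <= dl) ->
      X (x0 + rowE d (fun i => c t i + t 0%N ^+ N * z i))].
Proof.
move=> fX sX Xx0; have [r [M [Phi [D [S [m [p1 [r0 hP so hX [P0 hp1 det1]]]]]]]]] := good_chart fX sX Xx0.
have r20 : 0 < r / 2 by lra. have r40 : 0 < r / 4 by lra.
pose J (x : E) := jac d d D x.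
have hD i j : (i < d)%N -> (j < d)%N -> @AR R (vR R) d (r / 2) (D i j).
  by move=> hi hj; have [h1 _ _] := so i hi; exists (m i); exact: h1.
have hJ : @AR R (vR R) d (r / 2) (fun x => \det (J x)).
  apply: (@AR_det R (vR R)) => // a b; have [Mb hb] := hD a b (ltn_ord _) (ltn_ord _).
  by exists Mb; apply: A_ext hb => x _; rewrite mxE.
pose pt (x : E) : E := fun l => x 0%N * p1 l.
have hpt n l : (0 < n)%N -> AGr n (fun x => pt x l).
  by move=> n0; apply: AG_mul; [exact: AG_coord|exact: AG_cst].
have pt0 l : pt E0 l = 0 by rewrite /pt /E0 mul0r.
pose dt x := \det (J (pt x)).
have hdt : AGr 1 dt by apply: (AG_comp (AR_AG r20 hJ)) => l _ //; exact: hpt.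
(* A determinant vanishing near 0 on this line would vanish at p1 by continuation; so its order k at
   0 is finite. *)
have nzdt : nz (K := vR R) 1 dt.
  move=> [s [s0 hs]]; move/eqP: det1; apply.
  have -> : p1 = pt (fun=> 1) by apply/funext => l; rewrite /pt mul1r.
  apply: (@line_identity R (vR R) (fun u => dt (fun=> u))) => [t /andP[t0 t1]|]; last first.
    by exists s => // t /andP[t0 t1]; apply: hs => i _ /=; rewrite ger0_norm.
  have hpd : pdr d (r / 4) (pt (fun=> t)).
    move=> l hl /=; rewrite /pt normrM (ger0_norm t0); apply: le_trans (hp1 l hl).
    by rewrite ler_piMl.
  have r44 : r / 4 + r / 4 <= r / 2 by lra.
  have hAG := AR_AG r40 (AR_recenter r40 r44 hpd hJ).
  apply: AG_ext1 (AG_comp hAG (fun l _ => hpt 1%N l isT) (fun l _ => pt0 l)) => x.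
  by rewrite /dt; congr (\det (J _)); apply/funext => l; rewrite /pt /= mulrDl.
have [k [e0f [u [hc nzc hu edt]]]] := nz_last hdt nzdt.
pose e x := e0f x + x 0%N * u x.
have he : AGr 1 e.
  apply: AG_add; first exact: AG_weaken hc.
  by apply: AG_mul => //; exact: AG_coord.
pose e0 := e E0.
have e00 : e0 != 0.
  rewrite /e0 /e /E0 mul0r addr0; apply/eqP => k0; apply: nzc.
  have [rc [Mc [_ [cc [_ hcc]]]]] := hc.
  by apply: near0T => x; rewrite hcc -(hcc E0).
(* The unknown w is solved for in terms of the d+1 variables t, z; sequences hold t, z, w in blocks
   of lengths 1, d, d. *)
pose n := d.+1.
pose ww (x : E) : E := fun j => x (n + j)%N.
pose zz (x : E) : E := fun j => x j.+1.
pose aj (x : E) := \adj (J (pt x)).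
pose hh (x w : E) : E := fun a => x 0%N ^+ k.+1 * w a.
pose Sv (x w : E) (i : 'I_d) := \sum_(a < d) w a * \sum_(b < d) w b * S i a b (joinr d (pt x) (hh x w)).
(* The equation e w = c is written w = w (1 - e/e0) + c/e0, which has no linear term in w at the
   origin; [solve_lin] undoes this. *)
pose Hm (i : 'I_d) (x : E) : R := ww x i * (1 - e x / e0)
  + e0^-1 * (\sum_(j < d) aj x i j * zz x j - x 0%N * \sum_(j < d) aj x i j * Sv x (ww x) j).
pose H (i : nat) x := if insub i is Some o then Hm o x else 0.
have HE i (hi : (i < d)%N) x : H i x = Hm (Ordinal hi) x by rewrite /H insubT.
have hww j : (j < d)%N -> AGr (n + d) (fun x => ww x j) by move=> hj; apply: AG_coord; rewrite /n; lia.
have haj (i j : 'I_d) : AGr (n + d) (fun x => aj x i j).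
  apply: AG_ext1 (_ : AGr (n + d) (fun x => cofactor (J (pt x)) j i)) => [x|]; first by rewrite mxE.
  apply: AG_mul; first exact: AG_cst.
  apply: AG_det => a b.
  apply: AG_ext1 (_ : AGr (n + d) (fun x => D (lift j a) (lift i b) (pt x))) => [x|]; first by rewrite !mxE.
  by apply: (AG_comp (AR_AG r20 (hD _ _ (ltn_ord _) (ltn_ord _)))) => l _ //; exact: hpt.
have hSv i : AGr (n + d) (fun x => Sv x (ww x) i).
  apply: (@AG_sum R (vR R) _ _ _ _ predT) => a _; apply: AG_mul; first exact: hww.
  apply: (@AG_sum R (vR R) _ _ _ _ predT) => b _; apply: AG_mul; first exact: hww.
  have [_ h2 _] := so i (ltn_ord i).
  have hS : AGr (d + d) (S i a b) by exists (r / 2), (m i); split => //; exact: h2.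
  apply: (AG_comp hS) => l hl; rewrite /joinE; case: ltnP => h.
  - exact: hpt.
  - apply: AG_mul; first by apply: AG_exp; exact: AG_coord.
    by apply: hww; lia.
  - exact: pt0.
  - by rewrite /hh /E0 exprS mul0r mul0r.
have hH i : (i < d)%N -> AGr (n + d) (H i).
  move=> hi; apply: (@AG_ext1 R (vR R) _ (Hm (Ordinal hi))) => [x|]; first by rewrite HE.
  apply: AG_add; first apply: AG_mul; first exact: hww.
    apply: AG_sub; first exact: AG_cst.
    by apply: AG_mul; [apply: AG_weaken he; rewrite /n; lia|exact: AG_cst].
  apply: AG_mul; first exact: AG_cst.
  apply: AG_sub.
    apply: (@AG_sum R (vR R) _ _ _ _ predT) => j _; apply: AG_mul; first exact: haj.
    by apply: AG_coord; rewrite /n; have := ltn_ord j; lia.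
  apply: AG_mul; first exact: AG_coord.
  by apply: (@AG_sum R (vR R) _ _ _ _ predT) => j _; apply: AG_mul; [exact: haj|exact: hSv].
(* The right-hand side vanishes for t = z = 0 whatever w is, which settles the quadratic bound
   demanded by [implicit]. *)
have H00 (x : E) i : (forall l, (l < n)%N -> x l = 0) -> (i < d)%N -> H i x = 0.
  move=> hx hi; rewrite HE /Hm hx // mul0r subr0.
  rewrite big1 ?mulr0 ?addr0; last by move=> j _; rewrite /zz hx ?mulr0 // /n; have := ltn_ord j; lia.
  have -> : e x = e0; last by rewrite divff // subrr mulr0.
  have [rd [rd0 dep]] := AG_dep he; apply/esym/dep; first exact: pd0 (ltW rd0).
  by move=> l hl; rewrite hx // /n; lia.
have [||th [t1 t2 t3]] := @implicit R (vR R) n d H hH.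
- by move=> i hi; apply: H00.
- move=> i j hi hj; exists 1, 1; split => // t _; rewrite H00 // ?nu0 ?mul1r ?sqr_ge0 //.
  by move=> l hl; rewrite upd_other //; lia.
have eneq := AG_neq0 he e00.
pose cc x := Phi (pt x).
have near_w : nearr n (fun x => forall i, (i < d)%N -> `|th x i| < 1).
  apply: near0_all => i hi; apply: near0S (AG_cont (t1 i hi) (ltr01)) => x /=.
  by rewrite t2 // subr0.
have [s1 [s10 hs1]] := near0I t3 near_w.
have [s2 [s20 hs2]] := near0I edt eneq.
have [rd [rd0 depe]] := AG_dep he.
pose dl := Num.min (Num.min s1 s2) (Num.min (Num.min 1 rd) (r / 2)).
have dl0 : 0 < dl by rewrite !lt_min s10 s20 ltr01 rd0 r20.
have [ds1 ds2 d1 [drd dr]] : [/\ dl <= s1, dl <= s2, dl <= 1 & dl <= rd /\ dl <= r / 2].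
  by split; [..|split]; rewrite !ge_min lexx ?orbT.
(* k+1 comes from the displacement t^(k+1) w and k from the order of the determinant. *)
exists cc, (k.+1 + k)%N, dl; split => //.
- move=> i hi; have hPi : AGr d (fun x => Phi x i) by exists r, M; split => //; exact: hP.
  by apply: (AG_comp hPi) => l _ //; exact: hpt.
- have ptE : pt E0 = E0 by apply/funext => l; rewrite pt0.
  by move=> i hi; rewrite /cc ptE P0.
move=> t z ht hz.
pose x : E := fun l => if l == 0%N then t 0%N else z l.-1.
have hx : pdr n dl x.
  by move=> [|l] hl //=; rewrite /x /=; apply: hz.
have [ht3 hw] := hs1 x (pd_le ds1 hx).
pose w := th x.
have ht1 : `|t 0%N| <= 1 := le_trans ht d1.
have pdp : pdr d (r / 4) (pt t).
  move=> l hl /=; rewrite /pt normrM; apply: le_trans (hp1 l hl); rewrite ler_piMl //.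
have pdp2 : pdr d (r / 2) (pt t) by apply: pd_le pdp; lra.
have pdh : pdr d (r / 2) (hh t w).
  move=> l hl /=; rewrite /hh normrM normrX exprS -mulrA; apply: le_trans dr; apply: le_trans ht.
  by rewrite ler_piMr // mulr_ile1 ?exprn_ge0 ?exprn_ile1 // ltW // hw.
have pdr' : pdr d r (fun l => pt t l + hh t w l).
  move=> l hl /=; apply: le_trans (ler_normD _ _) _.
  by have /= := pdp2 l hl; have /= := pdh l hl; lra.
have key : forall i, (i < d)%N -> Phi (fun l => pt t l + hh t w l) i = cc t i + t 0%N ^+ (k.+1 + k) * z i.
  (* Cancelling the adjugate requires a nonzero determinant, hence t != 0; at t = 0 both sides are
     compared directly. *)
  have [t0|t0] := eqVneq (t 0%N) 0.
    move=> i hi; rewrite addSn t0 exprS !mul0r addr0 /cc; apply/esym/(A_dep (hP i hi)).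
      by apply: pd_le pdp; lra.
    by move=> l hl; rewrite /hh t0 exprS !mul0r addr0.
  have pt1 : pdr 1 s2 t by case=> // _; exact: le_trans ht ds2.
  have [edt' et0] := hs2 t pt1.
  have detn : \det (J (pt t)) != 0.
    by have := edt'; rewrite /dt => ->; rewrite mulf_neq0 ?expf_neq0.
  pose W : 'cV[R]_d := \col_i w i; pose Z : 'cV[R]_d := \col_i z i.
  pose SV : 'cV[R]_d := \col_i Sv t w i.
  have eqW : e t *: W = aj t *m Z - t 0%N *: (aj t *m SV).
    apply/colP => i; rewrite !mxE.
    have := ht3 i (ltn_ord i); rewrite HE.
    have -> : Ordinal (ltn_ord i) = i by apply/val_inj.
    pose Y := joinr n x w.
    have Y0 : Y 0%N = t 0%N by [].
    have YW : ww Y = w.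
      apply/funext => j; rewrite /ww /Y /joinE; have -> : (n + j < n)%N = false by rewrite ltnNge leq_addr.
      by rewrite addKn.
    have YZ (j : 'I_d) : zz Y j = z j.
      by rewrite /zz /Y /joinE; have -> : (j.+1 < n)%N by rewrite /n ltnS ltn_ord.
    have Yp : pt Y = pt t by [].
    have Ye : e Y = e t.
      by apply/esym/depe => l; case: l => //= _; exact: le_trans ht drd.
    rewrite -/w -/Y /Hm YW Y0 Ye /aj Yp.
    under eq_bigr do rewrite YZ.
    have -> : Sv Y w = Sv t w by [].
    move=> h.
    have -> : \sum_j (\adj (J (pt t))) i j * Z j 0 = \sum_(j < d) (\adj (J (pt t))) i j * z j.
      by apply: eq_bigr => j _; rewrite [X in _ * X]mxE.
    have -> : \sum_j (\adj (J (pt t))) i j * SV j 0 = \sum_(j < d) (\adj (J (pt t))) i j * Sv t w j.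
      by apply: eq_bigr => j _; rewrite [X in _ * X]mxE.
    exact: solve_lin e00 h.
  pose T := t 0%N.
  pose V : 'cV[R]_d := J (pt t) *m W + T ^+ k.+1 *: SV - T ^+ k *: Z.
  have aV : aj t *m V = 0.
    rewrite /V mulmxBr mulmxDr mulmxA /aj mul_adj_mx mul_scalar_mx -!scalemxAr.
    have -> : \det (J (pt t)) = T ^+ k * e t by have := edt'; rewrite /dt => ->.
    rewrite -scalerA eqW exprSr -scalerA scalerBr subrK.
    by rewrite subrr.
  have V0 : V = 0.
    have := congr1 (mulmx (J (pt t))) aV; rewrite mulmxA /aj mul_mx_adj mulmx0 mul_scalar_mx => /eqP.
    by rewrite scaler_eq0 (negbTE detn) => /eqP.
  move=> i hi; have [_ _ h3] := so i hi; rewrite (h3 _ _ pdp2 pdh) /cc; congr (_ + _).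
  have := congr1 (fun v : 'cV[R]_d => v (Ordinal hi) ord0) V0; rewrite !mxE => /eqP; rewrite subr_eq0 => /eqP h.
  rewrite exprD -mulrA -h mulrDr mulr_sumr big_mkord /Sv !mulr_sumr -big_split /=.
  apply: eq_bigr => j _; rewrite !mxE big_mkord /hh.
  have -> : \sum_(k0 < d) t 0%N ^+ k.+1 * w k0 * S i j k0 (joinr d (pt t) (hh t w)) =
     T ^+ k.+1 * \sum_(b < d) w b * S i j b (joinr d (pt t) (hh t w)).
    by rewrite mulr_sumr; apply: eq_bigr => b _; rewrite mulrA.
  by move: (\sum_(b < d) _) => q; rewrite /T; ring.
have -> : rowE d (fun i => cc t i + t 0%N ^+ (k.+1 + k) * z i) = rowE d (Phi (fun l => pt t l + hh t w l)).
  by apply/rowP => i; rewrite !mxE key.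
exact: hX.
Qed.

End Horn.

(** * Restriction to analytic curves *)

(** With a = f(0) and 1/f = 1/a + w, inversion becomes a fixed point equation for w whose right-hand
    side vanishes at x = 0 for every w. *)
Lemma AG_inv (R : realType) (K : vfield R) n (f : (nat -> K) -> K) : AG n f -> f (@E0 R K) != 0 ->
  AG n (fun x => (f x)^-1).
Proof.
move=> hf f0; set a := f _ in f0.
pose H (i : nat) (x : nat -> K) := - ((f x - a) / a + x n * (f x - a)) / a.
have hf1 : AG (n + 1) f by apply: AG_weaken hf; exact: leq_addr.
have hH i : (i < 1)%N -> AG (n + 1) (H i).
  move=> _; apply: AG_mul; last exact: AG_cst.
  apply: AG_opp; apply: AG_add.
    by apply: AG_mul; [apply: AG_sub => //; exact: AG_cst|exact: AG_cst].
  by apply: AG_mul; [apply: AG_coord; lia|apply: AG_sub => //; exact: AG_cst].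
have [rd [rd0 dep]] := AG_dep hf.
have fa (x : nat -> K) : (forall i, (i < n)%N -> x i = 0) -> f x = a.
  by move=> hx; apply/esym/dep => [|i hi]; [exact: pd0 (ltW rd0)|rewrite hx].
have H0 x i : (forall i, (i < n)%N -> x i = 0) -> H i x = 0.
  by move=> /fa h; rewrite /H h subrr mul0r mulr0 addr0 oppr0 mul0r.
have [||th [t1 t2 t3]] := @implicit R K n 1 H hH.
- by move=> i _; apply: H0.
- move=> i j _ hj; exists 1, 1; split => // t _; rewrite H0 ?nu0 ?mul1r ?sqr_ge0 //.
  by move=> l hl; rewrite upd_other //; lia.
have : AG n (fun x => a^-1 + th x 0%N) by apply: AG_add; [exact: AG_cst|exact: t1].
apply: AG_ext; have hr : near0 n (fun x : nat -> K => pd n rd x) by exists rd.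
apply: near0S (near0I (near0I t3 hr) (AG_neq0 hf f0)) => x [[h1 h2] h3].
have := h1 0%N isT; rewrite /H.
have -> : f (joinE n x (th x)) = f x by apply/esym/dep => // i hi; rewrite /joinE hi.
have -> : joinE n x (th x) n = th x 0%N by rewrite /joinE ltnn subnn.
move=> h; have h4 : (a^-1 + th x 0%N) * f x = 1.
  have : a * th x 0%N = - ((f x - a) / a + th x 0%N * (f x - a)) by rewrite {1}h; field.
  move=> h5; have -> : f x = a + (f x - a) by ring.
  rewrite mulrDr [(a^-1 + _) * a]mulrDl mulVf // [th x _ * a]mulrC h5; field.
  exact: f0.
by apply: (mulIf h3); rewrite h4 mulVf.
Qed.

Section Curves.
Variables (R : realType) (d : nat).
Local Notation E := (nat -> R).
Local Notation E0 := (@E0 R (vR R)).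
Local Notation ARr := (@AR R (vR R)).
Local Notation AGr := (@AG R (vR R)).
Local Notation pdr := (@pd R (vR R)).
Local Notation cvr := (@cv R (vR R)).

(* Maps the line into [-1, 1], fixing 0 and 1: this turns germs of curves into curves
   defined on the whole line. *)
Definition sg (t : R) : R := 2 * t / (1 + t ^+ 2).

Lemma sg_den (t : R) : 0 < 1 + t ^+ 2.
Proof. by have := sqr_ge0 t; lra. Qed.

Lemma sg_le1 t : `|sg t| <= 1.
Proof.
rewrite /sg ler_norml ler_pdivrMr ?sg_den // ler_pdivlMr ?sg_den //.
by have := sqr_ge0 (t - 1); have := sqr_ge0 (t + 1); rewrite sqrrB sqrrD; lra.
Qed.

Lemma sg1 : sg 1 = 1.
Proof. by rewrite /sg expr1n mulr1 divff. Qed.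

Lemma sg0 : sg 0 = 0.
Proof. by rewrite /sg mulr0 mul0r. Qed.

Lemma sg_bounds t : 0 <= t <= 1 -> t <= sg t <= 2 * t.
Proof.
move=> /andP[t0 t1]; rewrite /sg ler_pdivrMr ?sg_den // ler_pdivlMr ?sg_den //.
by apply/andP; split; nra.
Qed.

Lemma AG_sg t : AGr 1 (fun x => sg (t + x 0%N)).
Proof.
have h : AGr 1 (fun x => t + x 0%N) by apply: AG_add; [exact: AG_cst|exact: AG_coord].
apply: AG_mul; first by apply: AG_mul; [exact: AG_cst|exact: h].
apply: AG_inv; first by apply: AG_add; [exact: AG_cst|exact: AG_exp].
by rewrite gt_eqF // sg_den.
Qed.

Lemma AG_sgcurve n (r rho : R) (f : E -> R) p t : 0 < rho -> rho < r -> ARr n r f -> pdr n rho p ->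
  AGr 1 (fun x => f (fun i => p i * sg (t + x 0%N))).
Proof.
move=> rho0 rr hf hp.
have hpd : pdr n rho (fun i => p i * sg t).
  move=> i hi /=; rewrite normrM; apply: le_trans (hp i hi); rewrite ler_piMr //.
  exact: sg_le1.
have t0 : 0 < r - rho by lra.
have rt : rho + (r - rho) <= r by lra.
have hAG := AR_AG t0 (AR_recenter t0 rt hpd hf).
have k1 i : (i < n)%N -> AGr 1 (fun x => p i * (sg (t + x 0%N) - sg t)).
  move=> hi; apply: AG_mul; first exact: AG_cst.
  by apply: AG_sub; [exact: AG_sg|exact: AG_cst].
have k2 i : (i < n)%N -> p i * (sg (t + E0 0%N) - sg t) = 0.
  by move=> _; rewrite /E0 addr0 subrr mulr0.
apply: AG_ext1 (AG_comp hAG k1 k2) => x.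
by congr f; apply/funext => i; ring.
Qed.

Definition curve_analytic (X : set 'rV[R]_d) (f : 'rV[R]_d -> R) :=
  forall c : R -> 'rV[R]_d, real_analytic_curve c -> (forall t, X (c t)) ->
     forall t : R, analytic_at (fun s : 'rV[R]_1 => f (c (s ord0 ord0))) (const_mx t).

Lemma curve_f (X : set 'rV[R]_d) f (x0 : 'rV[R]_d) n (r rho : R) (Phi : E -> E) p :
  curve_analytic X f -> 0 < rho -> rho < r -> (forall i, (i < d)%N -> ARr n r (fun x => Phi x i)) ->
  pdr n rho p -> (forall u : R, `|u| <= 1 -> X (x0 + rowE d (Phi (fun i => p i * u)))) ->
  forall t : R, AGr 1 (fun x => f (x0 + rowE d (Phi (fun i => p i * sg (t + x 0%N))))).
Proof.
move=> hf rho0 rr hP hp hX t.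
pose c (u : R) := x0 + rowE d (Phi (fun i => p i * sg u)).
have hc : real_analytic_curve c.
  move=> i u; have h := AG_sgcurve u rho0 rr (hP i (ltn_ord i)) hp.
  have h2 : AGr 1 (fun x => x0 ord0 i + Phi (fun l => p l * sg (u + x 0%N)) i).
    by apply: AG_add; [exact: AG_cst|exact: h].
  apply: (@AG_analytic R 1 _ (const_mx u) _ h2).
  by apply: near0T => x; rewrite !mxE.
have := analytic_AG (hf c hc (fun u => hX _ (sg_le1 u)) t).
by apply: AG_ext1 => x; rewrite !mxE.
Qed.

(** Radius and bound are merged into a single integer C, so that the conditions on coefficients form
    a countable family suited to a Baire argument. *)
Lemma AG_coefs (g : E -> R) : AGr 1 g -> exists C0 : nat, forall C : nat, (C0 <= C)%N ->
  exists b : nat -> R, (forall k, `|b k| <= C%:R ^+ k.+1) /\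
    forall t : R, `|t| <= (2 * C%:R)^-1 -> cvr (fun J => \sum_(0 <= k < J) b k * t ^+ k) (g (fun=> t)).
Proof.
move=> [r [M [r0 /A_inv [c [m [hc hm h]]]]]].
have c0 j : exists a : R, `|a| <= m j /\ forall x, c j x = a by have [a [h1 h2]] := hc j; exists a.
have [b hb] := choice c0.
have M0 : 0 <= M by have := hm 0%N; rewrite big_geq.
exists (maxn (Num.bound M) (Num.bound r^-1)).+1 => C hC.
have C1 : M <= C%:R.
  by apply: ltW; apply: lt_le_trans (archi_boundP M0) _; rewrite ler_nat; lia.
have C2 : r^-1 <= C%:R.
  have ri : 0 <= r^-1 by rewrite invr_ge0 ltW.
  by apply: ltW; apply: lt_le_trans (archi_boundP ri) _; rewrite ler_nat; lia.
have Cp : 0 < C%:R :> R by rewrite ltr0n; lia.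
exists b; split.
  move=> k; have m0 j : 0 <= m j by apply: le_trans (hb j).1.
  have hk : m k * r ^+ k <= M.
    apply: le_trans (hm k.+1); rewrite big_nat_recr //= lerDr sumr_ge0 // => j _.
    by rewrite mulr_ge0 // exprn_ge0 // ltW.
  apply: le_trans (hb k).1 _; apply: (@le_trans _ _ (M * r^-1 ^+ k)).
    by rewrite exprVn ler_pdivlMr ?exprn_gt0.
  by rewrite exprS ler_pM // ?exprn_ge0 ?invr_ge0 ?(ltW r0) // lerXn2r ?nnegrE ?invr_ge0 ?(ltW r0) ?(ltW Cp).
move=> t ht; have tr : `|t| <= r.
  apply: le_trans ht _; rewrite invf_ple ?posrE ?mulr_gt0 //; lra.
have := h (fun=> t) (fun i _ => tr); apply: cv_ext => J.
by apply: eq_bigr => j _; rewrite (hb j).2.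
Qed.

End Curves.

(** * A Baire category argument in a cube *)

Section Baire.
Variables (R : realType) (d : nat).
Implicit Types (z : 'rV[R]_d).

(** Nested cubes are built so that their doubles avoid the S_k one after another. The limit of the
    centres, taken along an ultrafilter, lies in the closed cubes and hence in all the open
    doubles. *)
Lemma cube_baire (S : nat -> set 'rV[R]_d) z0 (e0 : R) : 0 < e0 ->
  (forall k z, (forall e : R, 0 < e -> exists2 y, S k y & cube z e y) -> S k z) ->
  (forall z, cube z0 e0 z -> exists k, S k z) ->
  exists k z (e : R), 0 < e /\ cube z e `<=` S k.
Proof.
move=> e00 clS cov; apply: contrapT => no.
have step (k : nat) (ze : 'rV[R]_d * R) : exists ze' : 'rV[R]_d * R, 0 < ze.2 ->
    [/\ 0 < ze'.2, cube ze'.1 (2 * ze'.2) `<=` cube ze.1 ze.2 &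
        forall y, cube ze'.1 (2 * ze'.2) y -> ~ S k y].
  case: ze => z e; have [e_gt0|] := pselect (0 < e); last by move=> ne; exists (z, e).
  have e2 : 0 < e / 2 by lra.
  have : exists2 y, cube z (e / 2) y & ~ S k y.
    apply: contrapT => k1; apply: no; exists k, z, (e / 2); split => // y hy.
    by apply: contrapT => k2; apply: k1; exists y.
  move=> [y hy nS].
  have [e' e'0 dis] : exists2 e' : R, 0 < e' & forall u, cube y e' u -> ~ S k u.
    apply: contrapT => k1; apply: nS; apply: clS => e' e'0.
    apply: contrapT => k2; apply: k1; exists e' => // u hu Su.
    by apply: k2; exists u.
  pose m := Num.min (e' / 2) (e / 4).
  have m1 : m <= e' / 2 by rewrite ge_min lexx.
  have m2 : m <= e / 4 by rewrite ge_min lexx orbT.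
  exists (y, m) => /= _; split.
  - by rewrite lt_min; apply/andP; split; lra.
  - move=> u hu i; have := hu i; have := hy i => /= h1 h2.
    rewrite [X in `|X|](_ : _ = (u ord0 i - y ord0 i) + (y ord0 i - z ord0 i)); last by ring.
    by apply: le_lt_trans (ler_normD _ _) _; lra.
  - by move=> u hu; apply: dis => i; apply: lt_le_trans (hu i) _; lra.
have [nx hnx] := choice (fun p : nat * ('rV[R]_d * R) => step p.1 p.2).
pose fix seqz k : 'rV[R]_d * R := if k is k'.+1 then nx (k', seqz k') else (z0, e0).
have pos k : 0 < (seqz k).2.
  by elim: k => [//|k IH]; have [] := hnx (k, seqz k) IH.
have sub k : cube (seqz k.+1).1 (2 * (seqz k.+1).2) `<=` cube (seqz k).1 (seqz k).2.
  by have [] := hnx (k, seqz k) (pos k).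
have avoid k y : cube (seqz k.+1).1 (2 * (seqz k.+1).2) y -> ~ S k y.
  by have [_ _ h] := hnx (k, seqz k) (pos k); exact: h.
have nest (k j : nat) : cube (seqz (k + j)%N).1 (seqz (k + j)%N).2 `<=` cube (seqz k).1 (seqz k).2.
  elim: j => [|j IH]; first by rewrite addn0.
  rewrite addnS => y hy; apply: IH; apply: sub => i.
  by apply: lt_le_trans (hy i) _; have := pos (k + j).+1%N; lra.
have ctr (k j : nat) : cube (seqz k).1 (seqz k).2 (seqz (k + j)%N).1.
  by apply: (nest k j) => i; rewrite subrr normr0.
have [U UF hU] := nat_ultra.
have [l hl] : {l : 'I_d -> R & forall i, infl U (fun w => (seqz w).1 ord0 i - l i)}.
  apply: (@choice _ _ (fun i l => infl U (fun w => (seqz w).1 ord0 i - l))) => i.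
  apply: (@ulim_exists _ _ U UF _ (`|z0 ord0 i| + e0)).
  apply: filterS filterT => w _ /=; have := ctr 0%N w i; rewrite add0n /= => h.
  rewrite [X in `|X|](_ : _ = z0 ord0 i + ((seqz w).1 ord0 i - z0 ord0 i)); last by ring.
  by apply: le_trans (ler_normD _ _) _; lra.
pose y : 'rV[R]_d := \row_i l i.
have yin k i : `|y ord0 i - (seqz k).1 ord0 i| <= (seqz k).2.
  rewrite mxE leNgt; apply/negP => lt.
  set g := `|_| in lt; have g0 : 0 < g - (seqz k).2 by lra.
  have := filter_ex (filterI (hl i _ g0) (hU k)) => -[w [/= h1 h2]].
  have := ctr k (w - k)%N i; rewrite subnKC // => h3.
  have := ler_normB ((seqz w).1 ord0 i - (seqz k).1 ord0 i) ((seqz w).1 ord0 i - l i).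
  have -> : (seqz w).1 ord0 i - (seqz k).1 ord0 i - ((seqz w).1 ord0 i - l i) = l i - (seqz k).1 ord0 i by ring.
  by rewrite -/g; lra.
have yin2 k : cube (seqz k.+1).1 (2 * (seqz k.+1).2) y.
  by move=> i; apply: le_lt_trans (yin k.+1 i) _; have := pos k.+1; lra.
have [k Sk] := cov y (sub 0%N y (yin2 0%N)).
exact: avoid k y (yin2 k) Sk.
Qed.

End Baire.

(** * Ultrafilter limits of power series *)

Section UltraSeries.
Variables (R : realType) (Om : Type) (U : set_system Om).
Context {UF : UltraFilter U}.
Local Notation infl := (infl U).
Local Notation cvr := (@cv R (vR R)).

Lemma inflD (s t : Om -> R) : infl s -> infl t -> infl (fun w => s w + t w).
Proof.
move=> hs ht e e0; have e2 : 0 < e / 2 by lra.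
apply: filterS (filterI (hs _ e2) (ht _ e2)) => w [/= h1 h2].
by apply: le_lt_trans (ler_normD _ _) _; lra.
Qed.

Lemma inflZ (s : Om -> R) c : infl s -> infl (fun w => c * s w).
Proof.
move=> hs e e0; have c0 : 0 < `|c| + 1 by rewrite ltr_wpDl.
apply: filterS (hs _ (divr_gt0 e0 c0)) => w /=; rewrite ltr_pdivlMr // normrM => h.
by have := normr_ge0 (s w); have := normr_ge0 c; nra.
Qed.

Lemma infl_sum J (s : nat -> Om -> R) : (forall k, infl (s k)) -> infl (fun w => \sum_(0 <= k < J) s k w).
Proof.
move=> h; elim: J => [|J IH].
  by move=> e e0; apply: filterS filterT => w _ /=; rewrite big_geq // normr0.
apply: infl_ext (inflD IH (h J)); apply: filterS filterT => w _ /=.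
by rewrite big_nat_recr.
Qed.

Lemma half_sum J L : \sum_(J <= k < L) (2^-1 : R) ^+ k <= 2 * 2^-1 ^+ J.
Proof.
have [hJL|hJL] := leqP J L; last first.
  by rewrite big_geq ?(ltnW hJL) // mulr_ge0 // exprn_ge0 // invr_ge0.
suff : \sum_(J <= k < L) (2^-1 : R) ^+ k + 2 * 2^-1 ^+ L = 2 * 2^-1 ^+ J.
  have : 0 <= 2 * (2^-1 : R) ^+ L by rewrite mulr_ge0 // exprn_ge0 // invr_ge0.
  lra.
rewrite -(subnKC hJL); elim: (L - J)%N => [|n IH]; first by rewrite addn0 big_geq // add0r.
rewrite addnS big_nat_recr ?leq_addr //= -IH -addrA; congr (_ + _).
by rewrite exprS; field.
Qed.

Lemma half_small (e : R) : 0 < e -> exists J : nat, forall L, (J <= L)%N -> (2^-1 : R) ^+ L < e.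
Proof.
move=> e0; have [n hn] := small_inv e0; exists n => L hL.
apply: le_lt_trans (hn L hL); rewrite exprVn lef_pV2 ?posrE ?exprn_gt0 // -natrX ler_nat.
exact: ltn_expl.
Qed.

Lemma series_tail (C t g : R) (b : nat -> R) J : 0 < C -> (forall k, `|b k| <= C ^+ k.+1) ->
  `|t| <= (2 * C)^-1 -> cvr (fun J => \sum_(0 <= k < J) b k * t ^+ k) g ->
  `|g - \sum_(0 <= k < J) b k * t ^+ k| <= C * (2 * 2^-1 ^+ J).
Proof.
move=> C0 hb ht hg; apply: (@cv_le R (vR R) _ g _ _ J hg) => L hL /=.
rewrite (big_cat_nat (leq0n J) hL) /= [X in X - _]addrC addrK.
apply: le_trans (ler_norm_sum _ _ _) _; apply: (@le_trans _ _ (\sum_(J <= k < L) C * 2^-1 ^+ k)).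
  apply: ler_sum => k _; rewrite normrM normrX.
  have -> : C * 2^-1 ^+ k = C ^+ k.+1 * (2 * C)^-1 ^+ k.
    by rewrite invfM exprMn exprS -mulrA [C ^+ k * _]mulrC -mulrA -exprMn mulVf ?gt_eqF // expr1n mulr1.
  by rewrite ler_pM ?exprn_ge0 // lerXn2r ?nnegrE ?invr_ge0 ?mulr_ge0 ?(ltW C0).
by rewrite -mulr_sumr ler_pM2l // half_sum.
Qed.

(** The uniform bound makes all tails from J on at most 2 C 2^-J, so only finitely many coefficient
    limits enter at a given precision. *)
Lemma ultra_series (C t : R) (b : Om -> nat -> R) (be : nat -> R) (g : Om -> R) (g0 : R) : 0 < C ->
  (forall w k, `|b w k| <= C ^+ k.+1) -> `|t| <= (2 * C)^-1 ->
  (forall w, cvr (fun J => \sum_(0 <= k < J) b w k * t ^+ k) (g w)) ->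
  (forall k, infl (fun w => b w k - be k)) -> infl (fun w => g w - g0) ->
  cvr (fun J => \sum_(0 <= k < J) be k * t ^+ k) g0.
Proof.
move=> C0 hb ht hg hbe hg0 e e0.
have e1 : 0 < e / (4 * C) by rewrite divr_gt0 // mulr_gt0.
have [J0 hJ0] := half_small e1; exists J0 => J hJ /=.
have h1 : infl (fun w => (g w - g0) - \sum_(0 <= k < J) t ^+ k * (b w k - be k)).
  apply: infl_ext (inflD hg0 (inflZ (-1) (@infl_sum J (fun k w => t ^+ k * (b w k - be k)) (fun k => inflZ _ (hbe k))))).
  by apply: filterS filterT => w _ /=; rewrite mulN1r.
have e2 : 0 < e / 2 by lra.
have := filter_ex (h1 _ e2) => -[w /= hw].
have := series_tail J C0 (hb w) ht (hg w) => h2.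
have := hJ0 J hJ; rewrite ltr_pdivlMr ?mulr_gt0 // => h3.
have -> : \sum_(0 <= k < J) be k * t ^+ k - g0 =
   (g w - g0 - \sum_(0 <= k < J) t ^+ k * (b w k - be k)) - (g w - \sum_(0 <= k < J) b w k * t ^+ k).
  have -> : \sum_(0 <= k < J) t ^+ k * (b w k - be k) =
      \sum_(0 <= k < J) b w k * t ^+ k - \sum_(0 <= k < J) be k * t ^+ k.
    by rewrite -sumrB; apply: eq_bigr => k _; ring.
  by move: (\sum_(0 <= k < J) _) (\sum_(0 <= k < J) _) => A B; ring.
by apply: le_lt_trans (ler_normB _ _) _; move: h3 h2 hw; move: `|_| `|_| (2^-1 ^+ J) => a1 a2 a3; nra.
Qed.

End UltraSeries.

(** * Uniform Taylor bounds on the curves of the horn *)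

Section HornBounds.
Variables (R : realType) (d : nat).
Local Notation E := (nat -> R).
Local Notation E0 := (@E0 R (vR R)).
Local Notation ARr := (@AR R (vR R)).
Local Notation AGr := (@AG R (vR R)).
Local Notation pdr := (@pd R (vR R)).
Local Notation cvr := (@cv R (vR R)).

Definition hpath (c : E -> E) N (s : R) (z : 'rV[R]_d) : 'rV[R]_d :=
  rowE d (c (fun=> s)) + s ^+ N *: z.

Lemma hpathE c N s z (i : 'I_d) : hpath c N s z ord0 i = c (fun=> s) i + s ^+ N * z ord0 i.
Proof. by rewrite !mxE. Qed.

(** The Baire sets consist of the z whose curve has coefficients bounded with a given integer
    constant. They are closed because coefficients converge along an ultrafilter and values do so by
    continuity of the local extension F; they cover a cube because F = f on the curves. *)
Lemma horn_bounds (X : set 'rV[R]_d) f F (x0 : 'rV[R]_d) (e : R) : fat X -> subanalytic X -> X x0 ->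
  curve_analytic X f -> 0 < e ->
  (forall y, cube x0 e y -> forall eps : R, 0 < eps -> exists2 dl : R, 0 < dl &
     forall y', cube y dl y' -> `|F y' - F y| < eps) ->
  (forall y, cube x0 e y -> X y -> F y = f y) ->
  exists (c : E -> E) N (rho : R) z0 (h0 C : R), [/\ (0 < N)%N, 0 < rho <= 1, 0 < h0, 0 < C &
    [/\ forall i, (i < d)%N -> AGr 1 (fun x => c x i), forall i, (i < d)%N -> c E0 i = 0 &
      forall z, cube z0 h0 z -> (forall i, `|z ord0 i| <= 1) /\
        exists b : nat -> R, (forall k, `|b k| <= C ^+ k.+1) /\
          forall t : R, `|t| <= (2 * C)^-1 ->
            cvr (fun J => \sum_(0 <= k < J) b k * t ^+ k) (F (x0 + hpath c N (rho * sg t) z))]].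
Proof.
move=> fX sX Xx0 hf e0 Fc Ff.
have [c [N [dl1 [N0 dl10 hc c0 hX]]]] := horn fX sX Xx0.
have [r [r0 [M hM]]] := AG_common_all hc.
have e20 : 0 < e / 2 by lra.
have [s1 [s10 hs1]] : near0 (K := vR R) 1 (fun x => forall i, (i < d)%N -> `|c x i| < e / 2).
  apply: near0_all => i hi; apply: near0S (AG_cont (hc i hi) e20) => x /=.
  by rewrite c0 // subr0.
pose dl := Num.min dl1 1; have dl0 : 0 < dl by rewrite lt_min dl10 ltr01.
have dl_1 : dl <= 1 by rewrite ge_min lexx orbT.
have dl_l : dl <= dl1 by rewrite ge_min lexx.
pose rho := Num.min (Num.min dl1 (r / 2)) (Num.min s1 (Num.min 1 (e / 2))).
have rho0 : 0 < rho by rewrite !lt_min dl10 s10 ltr01 e20 !andbT /=; lra.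
have [q1 q2 q3 [q4 q5]] : [/\ rho <= dl1, rho <= r / 2, rho <= s1 & rho <= 1 /\ rho <= e / 2].
  by split; [..|split]; rewrite !ge_min lexx ?orbT.
have rr : rho < r by lra.
have inX s (z : 'rV[R]_d) : `|s| <= rho -> (forall i, `|z ord0 i| <= dl) -> X (x0 + hpath c N s z).
  move=> hs hz; have -> : hpath c N s z = rowE d (fun i => c (fun=> s) i + (fun=> s) 0%N ^+ N * seqE z i).
    by apply/rowP => i; rewrite !mxE seqE_ord.
  apply: hX => [|i hi]; first exact: le_trans q1.
  by rewrite (seqE_ord _ (Ordinal hi)); apply: le_trans dl_l; exact: hz.
have inC s (z : 'rV[R]_d) : `|s| <= rho -> (forall i, `|z ord0 i| <= 1) -> cube x0 e (x0 + hpath c N s z).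
  move=> hs hz i; rewrite mxE hpathE [X in `|X|](_ : _ = c (fun=> s) i + s ^+ N * z ord0 i); last by ring.
  apply: le_lt_trans (ler_normD _ _) _.
  have h1 : `|c (fun=> s) i| < e / 2 by apply: hs1 => // j _; exact: le_trans q3.
  have h2 : `|s ^+ N * z ord0 i| <= rho.
    rewrite normrM normrX; apply: (@le_trans _ _ (`|s| * 1)); last by rewrite mulr1.
    apply: ler_pM => //; rewrite -{2}[`|s|]expr1; apply: ler_wiXn2l => //.
    exact: le_trans q4.
  lra.
have sgr t : `|rho * sg t| <= rho by rewrite normrM (gtr0_norm rho0) ler_piMr ?(ltW rho0) ?sg_le1.
pose S (k : nat) : set 'rV[R]_d := [set z : 'rV[R]_d | (forall i, `|z ord0 i| <= dl) /\
  exists b : nat -> R, (forall j, `|b j| <= k.+1%:R ^+ j.+1) /\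
    forall t : R, `|t| <= (2 * k.+1%:R)^-1 ->
      cvr (fun J => \sum_(0 <= j < J) b j * t ^+ j) (F (x0 + hpath c N (rho * sg t) z))].
have clS k z : (forall e : R, 0 < e -> exists2 y, S k y & cube z e y) -> S k z.
  move=> hz.
  have [y hy] : {y : nat -> 'rV[R]_d & forall n, S k (y n) /\ cube z (n.+1%:R)^-1 (y n)}.
    apply: (@choice _ _ (fun n y => S k y /\ cube z (n.+1%:R)^-1 y)) => n.
    have n0 : 0 < (n.+1%:R : R)^-1 by rewrite invr_gt0.
    by have [y Sy cy] := hz _ n0; exists y.
  have [b hb] : {b : nat -> nat -> R & forall n, (forall j, `|b n j| <= k.+1%:R ^+ j.+1) /\
    forall t : R, `|t| <= (2 * k.+1%:R)^-1 ->
      cvr (fun J => \sum_(0 <= j < J) b n j * t ^+ j) (F (x0 + hpath c N (rho * sg t) (y n)))}.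
    apply: (@choice _ _ (fun n b => (forall j, `|b j| <= k.+1%:R ^+ j.+1) /\
    forall t : R, `|t| <= (2 * k.+1%:R)^-1 ->
      cvr (fun J => \sum_(0 <= j < J) b j * t ^+ j) (F (x0 + hpath c N (rho * sg t) (y n))))) => n.
    by have [[_ [b hb]] _] := hy n; exists b.
  have zd i : `|z ord0 i| <= dl.
    rewrite leNgt; apply/negP => lt; have g0 : 0 < `|z ord0 i| - dl by lra.
    have [n hn] := small_inv g0; have [[h1 _] h2] := hy n.
    have := h1 i; have := h2 i; have := hn n (leqnn n) => k1 k2 k3.
    have := ler_normB (y n ord0 i) (y n ord0 i - z ord0 i).
    have -> : y n ord0 i - (y n ord0 i - z ord0 i) = z ord0 i by ring.
    by move: k1 k2; set a := (_^-1); lra.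
  have [U UF hU] := nat_ultra.
  have [be hbe] : {be : nat -> R & forall j, infl U (fun n => b n j - be j)}.
    apply: (@choice _ _ (fun j l => infl U (fun n => b n j - l))) => j.
    by apply: (@ulim_exists _ _ U UF _ (k.+1%:R ^+ j.+1)); apply: filterS filterT => n _; exact: (hb n).1.
  split => //; exists be; split.
    move=> j; rewrite leNgt; apply/negP => lt.
    have g0 : 0 < `|be j| - k.+1%:R ^+ j.+1 by lra.
    have := filter_ex (hbe j _ g0) => -[n /= h1]; have := (hb n).1 j => h2.
    have := ler_normB (b n j) (b n j - be j).
    have -> : b n j - (b n j - be j) = be j by ring.
    by move: h1 h2; move: (k.+1%:R ^+ j.+1) => a; lra.
  move=> t ht; have k0 : 0 < k.+1%:R :> R by rewrite ltr0n.
  apply: (@ultra_series R nat U UF k.+1%:R t b be (fun n => F (x0 + hpath c N (rho * sg t) (y n)))) => //.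
  - by move=> n; exact: (hb n).1.
  - by move=> n; apply: (hb n).2.
  - move=> eps eps0.
    have zin : cube x0 e (x0 + hpath c N (rho * sg t) z).
      by apply: inC => // i; apply: le_trans (zd i) dl_1.
    have [de de0 hde] := Fc _ zin eps eps0.
    have [n hn] := small_inv de0.
    apply: filterS (hU n) => w /= hw; apply: hde => i; rewrite !mxE.
    rewrite [X in `|X|](_ : _ = (rho * sg t) ^+ N * (y w ord0 i - z ord0 i)); last by ring.
    rewrite normrM; apply: le_lt_trans (hn w hw); have := (hy w).2 i => h1.
    rewrite -[X in _ <= X]mul1r ler_pM //; last exact: ltW.
    by rewrite normrX exprn_ile1 //; apply: le_trans (sgr t) q4.
have cov z : cube 0 dl z -> exists k, S k z.
  move=> hz; have zd i : `|z ord0 i| <= dl by have := hz i; rewrite mxE subr0 => /ltW.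
  pose Phi (x : E) : E := fun i => c x i + x 0%N ^+ N * seqE z i.
  have PhiE s : rowE d (Phi (fun=> s)) = hpath c N s z.
    by apply/rowP => i; rewrite !mxE /Phi seqE_ord.
  have hP i : (i < d)%N -> ARr 1 r (fun x => Phi x i).
    move=> hi; apply: (@AR_add R (vR R)) => //; first by exists M; exact: hM.
    apply: (@AR_mul R (vR R)) => //; last exact: AR_cst.
    by apply: (@AR_exp R (vR R)) => //; exact: AR_coord.
  have hp : pdr 1 rho (fun=> rho) by move=> i _ /=; rewrite gtr0_norm.
  have hXu (u : R) : `|u| <= 1 -> X (x0 + rowE d (Phi (fun=> rho * u))).
    by move=> hu; rewrite PhiE; apply: inX => //; rewrite normrM (gtr0_norm rho0) ler_piMr ?(ltW rho0).
  have [C0 hC0] := AG_coefs (curve_f hf rho0 rr hP hp hXu 0).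
  exists C0; split => //.
  have [b [hb1 hb2]] := hC0 C0.+1 (leqnSn C0); exists b; split => // t ht.
  have := hb2 t ht; rewrite add0r PhiE.
  by rewrite -Ff //; [apply: inC => // i; exact: le_trans dl_1|apply: inX].
have [k [z0 [h0 [h00 hsub]]]] := cube_baire dl0 clS cov.
exists c, N, rho, z0, h0, k.+1%:R; split => //; first by rewrite rho0.
split => // z /hsub [h1 h2]; split => // i.
exact: le_trans (h1 i) dl_1.
Qed.

End HornBounds.

(** * Mixed finite differences *)

Section Differences.
Variables (R : realType) (d : nat).
Implicit Types (u z x : 'rV[R]_d) (l : seq 'I_d) (Gs : seq 'I_d -> 'rV[R]_d -> R).
Local Notation ev := (unitv R).
Local Notation cvr := (@cv R (vR R)).

(** A function with its iterated partial derivatives, indexed by lists of directions. Recording only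
    the one-step relation makes translates and differences of families again families. *)
Definition pfam z (e : R) Gs := forall l i u, cube z e u -> is_derive u (ev i) (Gs l) (Gs (i :: l) u).

Lemma is_derive_line u (v : 'rV[R]_d) (G : 'rV[R]_d -> R) (t df : R) : is_derive (u + t *: v) v G df ->
  is_derive t 1 (fun t => G (u + t *: v)) df.
Proof.
move=> [h1 h2].
have e : (fun h : R => h^-1 *: (((fun t => G (u + t *: v)) \o shift t) (h *: 1) - G (u + t *: v))) =
  (fun h : R => h^-1 *: ((G \o shift (u + t *: v)) (h *: v) - G (u + t *: v))).
  apply/funext => h /=; congr (_ *: (G _ - _)).
  by rewrite [h *: 1]mulr1 scalerDl addrCA addrA.
by split; rewrite /derivable /derive e.
Qed.

Lemma is_derive_shift u (v a : 'rV[R]_d) (G : 'rV[R]_d -> R) (df : R) : is_derive (u + a) v G df ->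
  is_derive u v (fun x => G (x + a)) df.
Proof.
move=> [h1 h2].
have e : (fun h : R => h^-1 *: (((fun x => G (x + a)) \o shift u) (h *: v) - G (u + a))) =
  (fun h : R => h^-1 *: ((G \o shift (u + a)) (h *: v) - G (u + a))).
  by apply/funext => h /=; rewrite addrA.
by split; rewrite /derivable /derive e.
Qed.

Lemma mvt_line u (v : 'rV[R]_d) (G G' : 'rV[R]_d -> R) (t : R) : 0 < t ->
  (forall s : R, 0 <= s <= t -> is_derive (u + s *: v) v G (G' (u + s *: v))) ->
  exists2 s : R, 0 <= s <= t & G (u + t *: v) - G u = t * G' (u + s *: v).
Proof.
move=> t0 h; pose f (s : R) := G (u + s *: v).
have hd (s : R) : s \in `[0, t]%R -> is_derive s 1 f (G' (u + s *: v)).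
  by rewrite in_itv /= => hs; apply: is_derive_line; exact: h.
have h1 (s : R) : s \in `]0, t[%R -> is_derive s 1 f (G' (u + s *: v)).
  by move=> hs; apply: hd; move: hs; rewrite !in_itv /= => /andP[h1 h2]; rewrite (ltW h1) (ltW h2).
have h2 : {within `[0, t], continuous f}.
  by apply: derivable_within_continuous => s hs; have [] := hd s hs.
have [s hs e] := MVT_segment (ltW t0) h1 h2.
exists s; first by move: hs; rewrite in_itv.
by move: e; rewrite /f scale0r addr0 subr0 mulrC.
Qed.

Fixpoint dif l (h : R) (G : 'rV[R]_d -> R) u : R :=
  if l is i :: l' then dif l' h (fun v => G (v + h *: ev i) - G v) u else G u.

Lemma dif_ext l h G G' u : (forall v, G v = G' v) -> dif l h G u = dif l h G' u.
Proof. by move=> e; have -> : G = G' by apply/funext. Qed.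

Lemma ev_coord (i j : 'I_d) : ev i ord0 j = (j == i)%:R.
Proof. by rewrite mxE eqxx. Qed.

Lemma ev_le (h : R) (i j : 'I_d) : 0 <= h -> `|(h *: ev i) ord0 j| <= h.
Proof.
move=> h0; rewrite mxE ev_coord; case: eqP => _; rewrite ?mulr1 ?mulr0 ?normr0 //.
by rewrite ger0_norm.
Qed.

Lemma cube_shift z u (h a : R) i : 0 <= h -> cube z a u -> cube z (a + h) (u + h *: ev i).
Proof.
move=> h0 hu j; rewrite mxE addrAC; apply: le_lt_trans (ler_normD _ _) _.
by have := hu j; have := ev_le i j h0; lra.
Qed.

Lemma mixed_mvt l z (e h : R) Gs u : 0 < h -> pfam z e Gs -> cube z (e - (size l)%:R * h) u ->
  exists2 x : 'rV[R]_d, (forall j, `|x ord0 j - u ord0 j| <= (size l)%:R * h) &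
    dif l h (Gs [::]) u = h ^+ size l * Gs l x.
Proof.
move=> h0; elim: l e Gs u => [|i l IH] e Gs u hG hu.
  by exists u => [j|]; rewrite ?subrr ?normr0 ?mul0r // expr0 mul1r.
pose Gs' l v := Gs l (v + h *: ev i) - Gs l v.
have hG' : pfam z (e - h) Gs'.
  move=> l' j v hv; apply: is_deriveB; last by apply: hG => k; apply: lt_le_trans (hv k) _; lra.
  by apply: is_derive_shift; apply: hG => k; have := cube_shift i (ltW h0) hv k; rewrite subrK.
have hu' : cube z (e - h - (size l)%:R * h) u.
  by move=> k; have := hu k; rewrite /= -natr1 mulrDl mul1r; lra.
have [x hx ex] := IH _ _ _ hG' hu'.
have hxz : cube z (e - h) x.
  move=> k; have := hu' k; have := hx k => h1 h2.
  rewrite [X in `|X|](_ : _ = (x ord0 k - u ord0 k) + (u ord0 k - z ord0 k)); last by ring.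
  by apply: le_lt_trans (ler_normD _ _) _; lra.
have hd (s : R) : 0 <= s <= h -> is_derive (x + s *: ev i) (ev i) (Gs l) (Gs (i :: l) (x + s *: ev i)).
  case/andP => s0 s1; apply: hG => k; have h1 := cube_shift i s0 hxz k.
  by apply: lt_le_trans h1 _; lra.
have [s /andP[s0 s1] es] := mvt_line h0 hd.
exists (x + s *: ev i).
  move=> j; rewrite mxE /= -natr1 mulrDl mul1r addrAC.
  by apply: le_trans (ler_normD _ _) _; have := hx j; have := ev_le i j s0; lra.
by rewrite /= ex /Gs' es exprSr -mulrA.
Qed.

Lemma dif_scale l (a h : R) (G : 'rV[R]_d -> R) x z :
  dif l (a * h) G (x + a *: z) = dif l h (fun v => G (x + a *: v)) z.
Proof.
elim: l G => [//|i l IH] G /=; rewrite IH; apply: dif_ext => v.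
by rewrite scalerDr scalerA addrA.
Qed.

(** Each difference subtracts two expansions with the same bound, so it at most doubles the
    constant. *)
Lemma dif_expansion l (h : R) (g : 'rV[R]_d -> R -> R) z (e M C tau : R) u : 0 < h ->
  (forall v, cube z e v -> exists b : nat -> R, (forall k, `|b k| <= M * C ^+ k) /\
     forall t : R, `|t| <= tau -> cvr (fun J => \sum_(0 <= k < J) b k * t ^+ k) (g v t)) ->
  cube z (e - (size l)%:R * h) u ->
  exists b : nat -> R, (forall k, `|b k| <= 2 ^+ size l * M * C ^+ k) /\
     forall t : R, `|t| <= tau ->
       cvr (fun J => \sum_(0 <= k < J) b k * t ^+ k) (dif l h (fun v => g v t) u).
Proof.
move=> h0; elim: l e M g => [|i l IH] e M g hg hu.
  have [|b [h1 h2]] := hg u; first by move=> k; have := hu k; rewrite /= mul0r subr0.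
  by exists b; split => // k; rewrite expr0 mul1r.
have [||b [h1 h2]] := IH (e - h) (2 * M) (fun v t => g (v + h *: ev i) t - g v t).
- move=> v hv.
  have [|b1 [p1 p2]] := hg v; first by move=> k; apply: lt_le_trans (hv k) _; lra.
  have [|b2 [p3 p4]] := hg (v + h *: ev i).
    by move=> k; have := cube_shift i (ltW h0) hv k; rewrite subrK.
  exists (fun k => b2 k - b1 k); split.
    by move=> k; apply: le_trans (ler_normB _ _) _; have := p1 k; have := p3 k; move: (C ^+ k) => c; lra.
  move=> t ht; apply: cv_ext (cvB (p4 t ht) (p2 t ht)) => J.
  by rewrite -sumrB; apply: eq_bigr => k _; rewrite mulrBl.
- by move=> k; have := hu k; rewrite /= -natr1 mulrDl mul1r; lra.
by exists b; split => // k; rewrite exprSr -(mulrA _ 2).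
Qed.

(* Apply the mixed difference in z to the functions t |-> Gs [::] (x0 + hpath c N s z) with
   s = rho * sg t: by the mean value theorem it is (s^N h)^m Gs l (x), x near x0, so its
   t^(N m)-coefficient controls Gs l x0. *)
Lemma deriv_bound x0 (e : R) Gs (c : (nat -> R) -> nat -> R) N (rho : R) z0 (h0 C : R) : 0 < e -> pfam x0 e Gs ->
  (forall l (eps : R), 0 < eps -> exists2 dl : R, 0 < dl & forall y, cube x0 dl y -> `|Gs l y - Gs l x0| < eps) ->
  (0 < N)%N -> 0 < rho <= 1 -> 0 < h0 -> 0 < C ->
  (forall i, (i < d)%N -> AG (K := vR R) 1 (fun v : nat -> R => c v i)) -> (forall i, (i < d)%N -> c (@E0 R (vR R)) i = 0) ->
  (forall z, cube z0 h0 z -> (forall i, `|z ord0 i| <= 1) /\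
        exists b : nat -> R, (forall k, `|b k| <= C ^+ k.+1) /\
          forall t : R, `|t| <= (2 * C)^-1 ->
            cvr (fun J => \sum_(0 <= k < J) b k * t ^+ k) (Gs [::] (x0 + hpath c N (rho * sg t) z))) ->
  forall l, rho ^+ (N * size l) * (h0 / (size l).+1%:R) ^+ size l * `|Gs l x0| <= 2 ^+ size l * C * C ^+ (N * size l).
Proof.
move=> e0 hG hcont N0 /andP[rho0 rho1] h00 C0 hc c0 hz l.
(* The step h0 / (m+1) leaves room for m shifts inside the cube; its m-th power is where the
   factorial of the final bound comes from. *)
set m := size l; set h := h0 / m.+1%:R; set q := (N * m)%N.
have m10 : 0 < m.+1%:R :> R by rewrite ltr0n.
have h_gt0 : 0 < h by rewrite divr_gt0.
have hm : h0 - m%:R * h = h.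
  by rewrite /h -natr1; field; rewrite natr1 gt_eqF.
clearbody h.
have hz' v : cube z0 h0 v -> exists b : nat -> R, (forall k, `|b k| <= C * C ^+ k) /\
    forall t : R, `|t| <= (2 * C)^-1 ->
      cvr (fun J => \sum_(0 <= k < J) b k * t ^+ k) (Gs [::] (x0 + hpath c N (rho * sg t) v)).
  by move=> hv; have [_ [b [h1 h2]]] := hz v hv; exists b; split => // k; rewrite -exprS.
have z0in : cube z0 (h0 - m%:R * h) z0 by move=> k; rewrite subrr normr0 hm.
have [b [hb1 hb2]] := dif_expansion h_gt0 hz' z0in.
have z0c : cube z0 h0 z0 by move=> k; rewrite subrr normr0.
have [z01 _] := hz z0 z0c.
rewrite leNgt; apply/negP => lt.
set a : R := rho ^+ q * h ^+ m in lt; set L : R := `|Gs l x0| in lt; set be : R := 2 ^+ m * C * C ^+ q in lt.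
have a0 : 0 < a by rewrite mulr_gt0 ?exprn_gt0.
(* Half of the assumed excess, in units of |Gs l x0|: a (L - eps) is still larger than [be]. *)
pose eps := (a * L - be) / (2 * a).
have eps0 : 0 < eps by apply: divr_gt0; [rewrite subr_gt0|apply: mulr_gt0].
have [dl1 dl10 hdl1] := hcont l eps eps0.
pose dl := Num.min dl1 e; have dl0 : 0 < dl by rewrite lt_min dl10.
have dl_1 : dl <= dl1 by rewrite ge_min lexx.
have dl_e : dl <= e by rewrite ge_min lexx orbT.
have dl3 : 0 < dl / 3 by lra.
have [s1 [s10 hs1]] : near0 (K := vR R) 1 (fun v => forall i, (i < d)%N -> `|c v i| < dl / 3).
  apply: near0_all => i hi; apply: near0S (AG_cont (hc i hi) dl3) => v /=.
  by rewrite c0 // subr0.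
set r := (2 * C)^-1 in hb2; have r0 : 0 < r by rewrite invr_gt0 mulr_gt0.
pose D (t : R) := dif l h (fun z => Gs [::] (x0 + hpath c N (rho * sg t) z)) z0.
pose B := 1 + m%:R * h; have B0 : 0 < B by rewrite ltr_wpDr // mulr_ge0 // ltW.
pose t1 := Num.min (Num.min 1 r) (Num.min (s1 / 2) (dl / 3 / (2 * B))).
have t10 : 0 < t1 by rewrite !lt_min ltr01 r0 !divr_gt0 // mulr_gt0.
have [k1 k2 k3 k4] : [/\ t1 <= 1, t1 <= r, t1 <= s1 / 2 & t1 <= dl / 3 / (2 * B)].
  by split; rewrite !ge_min lexx ?orbT.
have key (t : R) : 0 < t -> t <= t1 -> exists2 x : 'rV[R]_d, `|Gs l x - Gs l x0| < eps &
    D t = ((rho * sg t) ^+ N * h) ^+ m * Gs l x.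
  move=> t0 tt; have t01 : 0 <= t <= 1 by rewrite ltW //= (le_trans tt).
  have /andP[sg1 sg2] := sg_bounds t01.
  pose s := rho * sg t; have s_gt0 : 0 < s by rewrite mulr_gt0 // (lt_le_trans t0).
  have s2t : s <= 2 * t by rewrite /s; apply: le_trans sg2; rewrite ler_piMl // (le_trans (ltW t0)).
  have ss1 : s <= s1 by apply: le_trans s2t _; lra.
  have sle1 : s <= 1.
    rewrite /s mulr_ile1 ?(ltW rho0) ?(le_trans (ltW t0)) //.
    by have := sg_le1 t; rewrite ler_norml => /andP[].
  have sN : s ^+ N <= s by rewrite -{2}[s]expr1; apply: ler_wiXn2l => //; exact: ltW.
  have sN0 : 0 < s ^+ N by rewrite exprn_gt0.
  have sB : s * B <= dl / 3.
    move: k4; rewrite ler_pdivlMr ?mulr_gt0 // => k4.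
    have h1 : s * B <= 2 * t * B by rewrite ler_pM2r.
    have h2 : t * (2 * B) <= t1 * (2 * B) by rewrite ler_pM2r // mulr_gt0.
    lra.
  have mh : m%:R * (s ^+ N * h) <= m%:R * h * s.
    rewrite mulrCA [X in _ <= X]mulrC ler_wpM2r //; apply: mulr_ge0 => //; exact: ltW.
  have hp i : `|hpath c N s z0 ord0 i| < dl / 3 + s.
    rewrite hpathE; apply: le_lt_trans (ler_normD _ _) _.
    have : `|c (fun=> s) i| < dl / 3 by apply: hs1 => // j _ /=; rewrite gtr0_norm.
    have : `|s ^+ N * z0 ord0 i| <= s.
      rewrite normrM (gtr0_norm sN0); apply: le_trans sN.
      by rewrite ler_piMr ?(ltW sN0).
    lra.
  have sBE : s * B = s + m%:R * h * s by rewrite /B; ring.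
  have hu : cube x0 (e - (size l)%:R * (s ^+ N * h)) (x0 + hpath c N s z0).
    move=> i; rewrite mxE [X in `|X|](_ : _ = hpath c N s z0 ord0 i); last by ring.
    by apply: lt_le_trans (hp i) _; rewrite -/m; lra.
  have hpos : 0 < s ^+ N * h by rewrite mulr_gt0.
  have [x hx ex] := mixed_mvt hpos hG hu.
  exists x; last first.
    by rewrite -/s -ex /D; rewrite /hpath addrA dif_scale; apply: dif_ext => v; rewrite addrA.
  apply: hdl1 => i; have := hx i; rewrite mxE -/m => h1.
  rewrite [X in `|X|](_ : _ = (x ord0 i - (x0 ord0 i + hpath c N s z0 ord0 i)) + hpath c N s z0 ord0 i); last by ring.
  by apply: le_lt_trans (ler_normD _ _) _; have := hp i; lra.
pose M1 := 2 ^+ m * C * 2.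
have hM1 J : \sum_(0 <= i < J) `|b i| * r ^+ i <= M1.
  apply: (@le_trans _ _ (\sum_(0 <= i < J) 2 ^+ m * C * 2^-1 ^+ i)).
    apply: ler_sum => i _; have -> : (2^-1 : R) ^+ i = C ^+ i * r ^+ i.
      by rewrite -exprMn /r invfM mulrCA mulfV ?gt_eqF // mulr1.
    by rewrite mulrA ler_wpM2r ?exprn_ge0 ?(ltW r0).
  rewrite -mulr_sumr /M1 ler_wpM2l ?mulr_ge0 ?exprn_ge0 ?(ltW C0) //.
  by have := half_sum R 0 J; rewrite expr0 mulr1.
have hcv t : 0 < t -> t <= t1 -> cvr (fun J => \sum_(0 <= k < J) b k * t ^+ k) (D t).
  by move=> t0 tt; apply: hb2; rewrite gtr0_norm // (le_trans tt).
(* As (s^N h)^m times a bounded derivative, D(t) is O(t^q), so its expansion starts with b_q t^q;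
   the bound on b_q is then compared with the lower estimate of |D(t)|. *)
have flat (t : R) : 0 < t -> t <= t1 -> `|D t| <= (2 ^+ N * h) ^+ m * (L + eps) * t ^+ q.
  move=> t0 tt; have [x hx ->] := key t t0 tt.
  have t01 : 0 <= t <= 1 by rewrite ltW //= (le_trans tt).
  have /andP[sg1 sg2] := sg_bounds t01.
  have s_gt0 : 0 < rho * sg t by rewrite mulr_gt0 // (lt_le_trans t0).
  rewrite normrM normrX (gtr0_norm (mulr_gt0 (exprn_gt0 N s_gt0) h_gt0)).
  have -> : (2 ^+ N * h) ^+ m * (L + eps) * t ^+ q = ((2 * t) ^+ N * h) ^+ m * (L + eps).
    by rewrite /q exprM !exprMn; ring.
  apply: ler_pM => //.
  - by rewrite exprn_ge0 // mulr_ge0 ?exprn_ge0 ?(ltW s_gt0) // ltW.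
  - rewrite lerXn2r ?nnegrE ?mulr_ge0 ?exprn_ge0 ?(ltW s_gt0) ?(ltW h_gt0) ?(ltW t0) ?mulr_ge0 ?(ltW t0) //.
    rewrite ler_wpM2r ?(ltW h_gt0) // lerXn2r ?nnegrE ?(ltW s_gt0) ?mulr_ge0 ?(ltW t0) //.
    by apply: le_trans sg2; rewrite ler_piMl // (le_trans (ltW t0)).
  - rewrite -(subrK (Gs l x0) (Gs l x)); apply: le_trans (ler_normD _ _) _.
    by rewrite addrC lerD2l ltW.
have bz j : (j < q)%N -> b j = 0.
  move=> hj; apply: (@ps_flat_upto R (vR R) b t1 M1 D (fun t => 0 < t) q) => //.
  - move=> J; apply: le_trans (hM1 J); apply: ler_sum => i _ /=.
    by rewrite ler_wpM2l // lerXn2r ?nnegrE ?(ltW t10) ?(ltW r0).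
  - by move=> e' e'0; exists (e' / 2) => /=; rewrite gtr0_norm; lra.
  - by move=> t t0 /=; rewrite gtr0_norm // => tt; exact: hcv.
  move=> N' hN'; exists ((2 ^+ N * h) ^+ m * (L + eps)), t1; split => // t t0 /=; rewrite gtr0_norm // => tt.
  apply: le_trans (flat t t0 tt) _; rewrite ler_wpM2l //.
    rewrite mulr_ge0 ?exprn_ge0 ?mulr_ge0 ?exprn_ge0 ?(ltW h_gt0) //.
    by rewrite addr_ge0 ?normr_ge0 ?(ltW eps0).
  by apply: ler_wiXn2l => //; [exact: ltW|exact: le_trans k1].
pose M2 := M1 / r ^+ q.+1.
have M20 : 0 <= M2 by rewrite divr_ge0 ?exprn_ge0 ?(ltW r0) // !mulr_ge0 ?exprn_ge0 ?(ltW C0).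
pose gap := (a * L - be) / 2; have gap0 : 0 < gap by rewrite /gap; lra.
pose t := Num.min t1 (gap / (2 * (M2 + 1))).
have M210 : 0 < 2 * (M2 + 1) by lra.
have t0 : 0 < t by rewrite lt_min t10 divr_gt0.
have tt : t <= t1 by rewrite ge_min lexx.
have tg : t * (2 * (M2 + 1)) <= gap by rewrite -ler_pdivlMr // ge_min lexx orbT.
have [x hx eD] := key t t0 tt.
have t01 : 0 <= t <= 1 by rewrite ltW //= (le_trans tt).
have /andP[sg1 sg2] := sg_bounds t01.
have trn : `|t| <= r by rewrite gtr0_norm // (le_trans tt).
have := @ps_remainder R (vR R) b r M1 t (D t) q.+1 r0 hM1 trn (hcv t t0 tt).
rewrite big_nat_recr //= big_nat big1 ?add0r; last by move=> j /andP[_ hj]; rewrite bz // mul0r.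
rewrite (gtr0_norm t0) expr_div_n mulrA => rem.
have tq : 0 < t ^+ q by rewrite exprn_gt0.
have up : `|D t| <= be * t ^+ q + M2 * t * t ^+ q.
  rewrite -(subrK (b q * t ^+ q) (D t)); apply: le_trans (ler_normD _ _) _; rewrite addrC; apply: lerD.
    by rewrite normrM (gtr0_norm tq) ler_pM2r //; exact: hb1.
  by apply: le_trans rem _; rewrite exprS /M2; apply: eqW_le; ring.
have low : a * t ^+ q * (L - eps) <= `|D t|.
  have Le : L - eps <= `|Gs l x|.
    have := ler_normB (Gs l x) (Gs l x - Gs l x0).
    have -> : Gs l x - (Gs l x - Gs l x0) = Gs l x0 by ring.
    by rewrite -/L; lra.
  have rt0 : 0 < rho * t by rewrite mulr_gt0.
  have st : rho * t <= rho * sg t by rewrite ler_pM2l.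
  have eqa : a * t ^+ q = ((rho * t) ^+ N * h) ^+ m.
    by rewrite exprMn -exprM -/q exprMn /a; ring.
  apply: (@le_trans _ _ (a * t ^+ q * `|Gs l x|)).
    by rewrite ler_pM2l // mulr_gt0.
  rewrite eD normrM; apply: ler_wpM2r => //; rewrite eqa ger0_norm; last first.
    by rewrite exprn_ge0 // mulr_ge0 ?exprn_ge0 ?(ltW h_gt0) // (le_trans (ltW rt0)).
  rewrite lerXn2r ?nnegrE ?mulr_ge0 ?exprn_ge0 ?(ltW h_gt0) ?(ltW rt0) //; last first.
    by rewrite ler_wpM2r ?(ltW h_gt0) // lerXn2r ?nnegrE ?(ltW rt0) // (le_trans (ltW rt0)).
  exact: le_trans (ltW rt0) st.
have ea : a * eps = gap by rewrite /eps /gap; field; rewrite gt_eqF.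
have := le_trans low up.
have -> : a * t ^+ q * (L - eps) = (a * L - a * eps) * t ^+ q by ring.
rewrite -mulrDl ler_pM2r // ea => fin.
have : 0 < t * (M2 + 1) by rewrite mulr_gt0 //; lra.
by move: fin; rewrite /gap in tg *; nra.
Qed.

End Differences.

(** * Taylor series *)

Section TaylorSeries.
Variable R : realType.
Local Notation E := (nat -> R).
Local Notation EC := (nat -> R[i]).
Local Notation pdr := (@pd R (vR R)).
Local Notation mi := (nat -> nat).

Definition updn (al : mi) n j : mi := fun i => if i == n then j else al i.

(** Truncates every exponent separately at J, because both the power series and the smooth function
    are expanded one variable at a time. *)
Fixpoint tpoly n J (T : mi -> R) (x : E) : R :=
  if n is n'.+1 then \sum_(0 <= j < J) tpoly n' J (fun al => T (updn al n' j)) x * x n' ^+ j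
  else T (fun=> 0%N).

Lemma tpoly_scale n J (T : mi -> R) c x : tpoly n J (fun al => c * T al) x = c * tpoly n J T x.
Proof.
elim: n T => [//|n IH] T /=; rewrite mulr_sumr; apply: eq_bigr => j _.
by rewrite IH mulrA.
Qed.

Lemma sum_updn n al j : (\sum_(0 <= i < n.+1) updn al n j i = \sum_(0 <= i < n) al i + j)%N.
Proof.
rewrite big_nat_recr //= /updn eqxx; congr (_ + _)%N; apply: eq_big_nat => i /andP[_ hi].
by rewrite ltn_eqF.
Qed.

Lemma cv_real_complex (u : nat -> R) l : cv (K := vR R) u l -> cv (K := vC R) (fun k => (u k)%:C%C) (l%:C)%C.
Proof.
move=> h e e0; have [N hN] := h e e0; exists N => k hk.
by rewrite /= -rmorphB /= nuC_real; exact: hN.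
Qed.

(** Real and complex sums arise by one recursion from the same coefficients, whence their agreement
    at real points. Radius 1/(2B) gives geometric series of ratio 1/2, and one factor 2 per
    variable. *)
Lemma ps_exists n : forall (T : mi -> R) (M B : R), 0 < B ->
  (forall al, `|T al| <= M * B ^+ (\sum_(0 <= i < n) al i)) ->
  exists (F : E -> R) (Fc : EC -> R[i]),
  [/\ A (K := vR R) n (2 * B)^-1 (2 ^+ n * M) F, A (K := vC R) n (2 * B)^-1 (2 ^+ n * M) Fc,
      forall x, pdr n (2 * B)^-1 x -> Fc (fun i => (x i)%:C%C) = ((F x)%:C)%C &
      forall J, exists C : R, forall (dl : R) (x : E), 0 <= dl <= (2 * B)^-1 -> pdr n dl x ->
        `|F x - tpoly n J T x| <= C * dl ^+ J].
Proof.
elim: n => [|n IH] T M B B0 hT.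
  have h0 : `|T (fun=> 0%N)| <= M by have := hT (fun=> 0%N); rewrite big_geq // mulr1.
  exists (fun=> T (fun=> 0%N)), (fun=> (T (fun=> 0%N))%:C%C); split => //.
  - by exists (T (fun=> 0%N)); rewrite expr0 mul1r.
  - by exists (T (fun=> 0%N))%:C%C; rewrite expr0 mul1r /= nuC_real.
  - move=> J; exists 0 => dl x _ _; by rewrite subrr normr0 mul0r.
set r := (2 * B)^-1; have r0 : 0 < r by rewrite invr_gt0 mulr_gt0.
have M0 : 0 <= M.
  by have := hT (fun=> 0%N); rewrite big1 // expr0 mulr1; exact: le_trans.
have hTj j al : `|T (updn al n j)| <= M * B ^+ j * B ^+ (\sum_(0 <= i < n) al i).
  by have := hT (updn al n j); rewrite sum_updn exprD [B ^+ _ * _]mulrC mulrA.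
pose Q j (FF : (E -> R) * (EC -> R[i])) :=
  [/\ A (K := vR R) n r (2 ^+ n * (M * B ^+ j)) FF.1, A (K := vC R) n r (2 ^+ n * (M * B ^+ j)) FF.2,
      forall x, pdr n r x -> FF.2 (fun i => (x i)%:C%C) = ((FF.1 x)%:C)%C &
      forall J, exists C, forall (dl : R) (x : E), 0 <= dl <= r -> pdr n dl x ->
        `|FF.1 x - tpoly n J (fun al => T (updn al n j)) x| <= C * dl ^+ J].
have [FF hFF] : {FF : nat -> (E -> R) * (EC -> R[i]) & forall j, Q j (FF j)}.
  apply: (@choice _ _ Q) => j; have [F [Fc hF]] := IH _ _ _ B0 (hTj j).
  by exists (F, Fc).
pose m j : R := 2 ^+ n * (M * B ^+ j).
have m0 j : 0 <= m j by rewrite /m !mulr_ge0 ?exprn_ge0 ?(ltW B0).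
have mr J : \sum_(0 <= j < J) m j * r ^+ j <= 2 ^+ n.+1 * M.
  have -> : \sum_(0 <= j < J) m j * r ^+ j = 2 ^+ n * M * \sum_(0 <= j < J) 2^-1 ^+ j.
    rewrite mulr_sumr; apply: eq_bigr => j _; rewrite /m -!mulrA; congr (_ * (_ * _)).
    by rewrite -exprMn /r invfM mulrCA mulfV ?gt_eqF // mulr1.
  have -> : 2 ^+ n.+1 * M = 2 ^+ n * M * 2 by rewrite exprSr; ring.
  rewrite ler_wpM2l ?mulr_ge0 ?exprn_ge0 //.
  by have := half_sum R 0 J; rewrite expr0 mulr1.
have limR (x : E) : exists l : R, pdr n.+1 r x ->
    cv (K := vR R) (fun J => \sum_(0 <= j < J) (FF j).1 x * x n ^+ j) l.
  have [hx|hx] := pselect (pdr n.+1 r x); last by exists 0.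
  have [|l [hl _]] := @abs_cv R (vR R) (fun j => (FF j).1 x * x n ^+ j) (fun j => m j * r ^+ j) _ _ mr; last by exists l.
  move=> j; have [h1 _ _ _] := hFF j; rewrite /= normrM normrX; apply: ler_pM => //.
    by apply: (A_bound (K := vR R) (ltW r0) h1); exact: pdS.
  by rewrite lerXn2r ?nnegrE ?(ltW r0) //; exact: hx.
have limC (x : EC) : exists l : R[i], pd (K := vC R) n.+1 r x ->
    cv (K := vC R) (fun J => \sum_(0 <= j < J) (FF j).2 x * x n ^+ j) l.
  have [hx|hx] := pselect (pd (K := vC R) n.+1 r x); last by exists 0.
  have [|l [hl _]] := @abs_cv R (vC R) (fun j => (FF j).2 x * x n ^+ j) (fun j => m j * r ^+ j) _ _ mr; last by exists l.
  move=> j; have [_ h1 _ _] := hFF j.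
  rewrite (@nuM R (vC R)) (@nuX R (vC R)); apply: ler_pM; rewrite ?exprn_ge0 ?(@nu_ge0 R (vC R)) //.
    by apply: (A_bound (K := vC R) (ltW r0) h1); exact: pdS.
  by rewrite lerXn2r ?nnegrE ?(ltW r0) ?(@nu_ge0 R (vC R)) //; exact: hx.
have [F hF] := choice limR; have [Fc hFc] := choice limC.
have dF : Adata (K := vR R) n r (2 ^+ n.+1 * M) F (fun j => (FF j).1) m.
  by split => // j; have [] := hFF j.
exists F, Fc; split.
- exact: Adata_A dF.
- by apply: (@A_mk R (vC R) n r _ Fc (fun j => (FF j).2) m) => // j; have [] := hFF j.
- move=> x hx.
  have hx' : pd (K := vC R) n.+1 r (fun i => (x i)%:C%C).
    by move=> i hi; rewrite /= nuC_real; exact: hx.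
  apply: (cv_uniq (hFc _ hx')); apply: cv_ext (cv_real_complex (hF x hx)) => J.
  rewrite rmorph_sum /=; apply: eq_bigr => j _; have [_ _ h _] := hFF j.
  by rewrite h ?rmorphM ?rmorphXn //; exact: pdS.
- move=> J; have [u [[hu1 hu2 hu3] eu]] := A_taylor J r0 dF.
  have hu := A_mk hu1 hu2 hu3.
  have [Cj hCj] : {Cj : nat -> R & forall j, forall (dl : R) (x : E), 0 <= dl <= r -> pdr n dl x ->
        `|(FF j).1 x - tpoly n J (fun al => T (updn al n j)) x| <= Cj j * dl ^+ J}.
    apply: (@choice _ _ (fun j C => forall (dl : R) (x : E), 0 <= dl <= r -> pdr n dl x ->
        `|(FF j).1 x - tpoly n J (fun al => T (updn al n j)) x| <= C * dl ^+ J)) => j.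
    by have [_ _ _ h] := hFF j; have [C hC] := h J; exists C.
  exists (\sum_(0 <= j < J) `|Cj j| * r ^+ j + 2 ^+ n.+1 * M / r ^+ J) => dl x /andP[dl0 dlr] hx.
  have hxr : pdr n.+1 r x := pd_le dlr hx.
  rewrite (eu x hxr) /= addrAC -sumrB mulrDl; apply: le_trans (ler_normD _ _) _; apply: lerD.
    apply: le_trans (ler_norm_sum _ _ _) _; rewrite mulr_suml; apply: ler_sum => j _.
    rewrite -mulrBl normrM normrX mulrAC; apply: ler_pM => //; rewrite ?exprn_ge0 //.
      apply: le_trans (hCj j dl x _ (pdS hx)) _; first by rewrite dl0.
      by rewrite ler_wpM2r ?exprn_ge0 // ler_norm.
    by rewrite lerXn2r ?nnegrE ?(ltW r0) //; exact: hxr.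
  rewrite normrM normrX mulrC; apply: ler_pM => //; rewrite ?exprn_ge0 //.
    exact: (A_bound (K := vR R) (ltW r0) hu hxr).
  by rewrite lerXn2r ?nnegrE //; exact: hx.
Qed.

Lemma bin_le_exp2 n m : ('C(n, m) <= 2 ^ n)%N.
Proof.
elim: n m => [|n IH] [|m]; rewrite ?bin0n ?bin0 ?expn_gt0 //.
by rewrite binS expnS mul2n -addnn leq_add.
Qed.

(** A multinomial coefficient is a product of binomial coefficients, each at most a power of 2. *)
Lemma fact_multi n (al : mi) :
  ((\sum_(0 <= i < n) al i)`! <= 2 ^ (n * \sum_(0 <= i < n) al i) * \prod_(0 <= i < n) (al i)`!)%N.
Proof.
elim: n => [|n IH]; first by rewrite !big_geq // mul0n.
rewrite !big_nat_recr //=; set S := (\sum_(0 <= i < n) al i)%N in IH *.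
set P := (\prod_(0 <= i < n) (al i)`!)%N in IH *.
have := bin_fact (leq_addl S (al n)); rewrite addnK => <-.
have h1 := bin_le_exp2 (S + al n) (al n).
apply: leq_trans (_ : (2 ^ (S + al n) * ((al n)`! * (2 ^ (n * S) * P)) <= _)%N).
  by rewrite leq_mul // leq_mul.
rewrite mulSn expnD [((al n)`! * _)%N]mulnC -[(_ * P * _)%N]mulnA mulnA leq_mul //.
by rewrite -!expnD leq_pexp2l // leq_add2l leq_mul // leq_addr.
Qed.

(** The single term x^m / m! of the exponential series at x = m+1. *)
Lemma exp_fact (m : nat) : (m.+1%:R : R) ^+ m <= expR m.+1%:R * m`!%:R.
Proof.
case: m => [|m]; first by rewrite expr0 mulr1 -expR0 ler_expR.
have m0 : 0 < (m.+1)`!%:R :> R by rewrite ltr0n fact_gt0.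
rewrite -ler_pdivrMr //; apply: le_trans (expR_ge1Dxn m _); last by rewrite ler0n.
by rewrite lerDr.
Qed.

End TaylorSeries.

(** * Taylor expansion of smooth functions *)

Section SmoothTaylor.
Variables (R : realType) (d : nat).
Implicit Types (u y z : 'rV[R]_d) (l : seq 'I_d) (Gs : seq 'I_d -> 'rV[R]_d -> R) (o : 'I_d).
Local Notation E := (nat -> R).
Local Notation ev := (unitv R).
Local Notation pdr := (@pd R (vR R)).
Local Notation mi := (nat -> nat).

Lemma mvt0 (f df : R -> R) (t : R) : (forall s : R, `|s| <= `|t| -> is_derive s 1 f (df s)) ->
  exists2 s : R, `|s| <= `|t| & f t - f 0 = df s * t.
Proof.
move=> h.
have [t0|t0] := leP 0 t.
  have hd (s : R) : s \in `[0, t]%R -> is_derive s 1 f (df s).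
    by rewrite in_itv /= => /andP[h1 h2]; apply: h; rewrite !ger0_norm.
  have h1 (s : R) : s \in `]0, t[%R -> is_derive s 1 f (df s).
    by move=> hs; apply: hd; move: hs; rewrite !in_itv /= => /andP[h1 h2]; rewrite (ltW h1) (ltW h2).
  have h2 : {within `[0, t], continuous f}.
    by apply: derivable_within_continuous => s hs; have [] := hd s hs.
  have [s hs e] := MVT_segment t0 h1 h2; exists s; last by rewrite e subr0.
  by move: hs; rewrite in_itv /= => /andP[k1 k2]; rewrite !ger0_norm.
have hd (s : R) : s \in `[t, 0]%R -> is_derive s 1 f (df s).
  by rewrite in_itv /= => /andP[h1 h2]; apply: h; rewrite (ler0_norm h2) (ltr0_norm t0) lerN2.
have h1 (s : R) : s \in `]t, 0[%R -> is_derive s 1 f (df s).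
  by move=> hs; apply: hd; move: hs; rewrite !in_itv /= => /andP[h1 h2]; rewrite (ltW h1) (ltW h2).
have h2 : {within `[t, 0], continuous f}.
  by apply: derivable_within_continuous => s hs; have [] := hd s hs.
have [s hs e] := MVT_segment (ltW t0) h1 h2; exists s; last first.
  by rewrite -opprB e sub0r mulrN opprK.
by move: hs; rewrite in_itv /= => /andP[k1 k2]; rewrite (ler0_norm k2) (ltr0_norm t0) lerN2.
Qed.

Lemma nseq_rot o j l : nseq j o ++ o :: l = nseq j.+1 o ++ l.
Proof. by elim: j => //= j ->. Qed.

(** The derivative of the remainder of order J+1 is the remainder of order J of the derivative. Only
    the power of |t| matters later, so the factor 1/J! is given away. *)
Lemma taylor1 z (e : R) Gs o J : pfam z e Gs -> forall l y (t B : R),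
  (forall s : R, `|s| <= `|t| -> cube z e (y + s *: ev o) /\ `|Gs (nseq J o ++ l) (y + s *: ev o)| <= B) ->
  `|Gs l (y + t *: ev o) - \sum_(0 <= j < J) Gs (nseq j o ++ l) y / j`!%:R * t ^+ j| <= B * `|t| ^+ J.
Proof.
move=> hG; elim: J => [|J IH] l y t B h.
  by rewrite big_geq // subr0 expr0 mulr1; exact: (h t (lexx _)).2.
pose p : {poly R} := \poly_(j < J.+1) (Gs (nseq j o ++ l) y / j`!%:R).
pose q : {poly R} := \poly_(j < J) (Gs (nseq j o ++ o :: l) y / j`!%:R).
have pq : deriv p = q.
  apply/polyP => i; rewrite coef_deriv !coef_poly ltnS; case: ifP => // _; last by rewrite mul0rn.
  rewrite nseq_rot factS -mulr_natr natrM; field.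
  by rewrite pnatr_eq0 -lt0n fact_gt0 addrC natr1 pnatr_eq0.
pose f (s : R) := Gs l (y + s *: ev o) - p.[s].
have hd (s : R) : `|s| <= `|t| -> is_derive s 1 f (Gs (o :: l) (y + s *: ev o) - q.[s]).
  move=> hs; apply: is_deriveB; last by rewrite -pq; exact: is_derive_poly.
  by apply: is_derive_line; apply: hG; exact: (h s hs).1.
have [s hs es] := mvt0 hd.
have f0 : f 0 = 0.
  rewrite /f scale0r addr0 horner_poly big_ord_recl /= fact0 divr1 expr0 mulr1 big1 ?addr0 ?subrr //.
  by move=> i _; rewrite expr0n mulr0.
have -> : Gs l (y + t *: ev o) - \sum_(0 <= j < J.+1) Gs (nseq j o ++ l) y / j`!%:R * t ^+ j = f t.
  by rewrite /f horner_poly big_mkord.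
move: es; rewrite f0 subr0 => ->; rewrite normrM exprSr mulrA ler_wpM2r //.
have := IH (o :: l) y s B; rewrite horner_poly big_mkord => ih.
apply: le_trans (ih _) _.
  by move=> s' hs'; rewrite nseq_rot; apply: h; exact: le_trans hs.
have B0 : 0 <= B by apply: le_trans (h 0 _).2; rewrite ?normr0.
by rewrite ler_wpM2l // lerXn2r ?nnegrE.
Qed.

Definition nseqo (n k : nat) : seq 'I_d := if insub n is Some o then nseq k o else [::].

(** The order is the one in which [taylor_smooth] produces derivatives: the last variable is
    expanded, hence differentiated, first, and partial derivatives are never permuted. *)
Fixpoint lst n (al : mi) : seq 'I_d := if n is n'.+1 then lst n' al ++ nseqo n' (al n') else [::].

Lemma lst_ext n (al be : mi) : (forall i, (i < n)%N -> al i = be i) -> lst n al = lst n be.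
Proof.
elim: n => [//|n IH] h /=; rewrite IH ?h // => i hi; apply: h; lia.
Qed.

Lemma size_lst n al : (n <= d)%N -> size (lst n al) = (\sum_(0 <= i < n) al i)%N.
Proof.
elim: n => [|n IH] hn; first by rewrite big_geq.
by rewrite /= size_cat IH 1?ltnW // big_nat_recr //= /nseqo insubT /= size_nseq.
Qed.

Lemma fin_radius J (P : nat -> R -> R -> Prop) :
  (forall j C (dl dl' : R), dl' <= dl -> P j C dl -> P j C dl') ->
  (forall j, exists C dl : R, 0 < dl /\ P j C dl) ->
  exists (C : nat -> R) (dl : R), 0 < dl /\ forall j, (j < J)%N -> P j (C j) dl.
Proof.
move=> mono h; have h' j : exists Cd : R * R, 0 < Cd.2 /\ P j Cd.1 Cd.2.
  by have [C [dl hC]] := h j; exists (C, dl).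
have [Cd hCd] := choice h'; exists (fun j => (Cd j).1).
elim: J => [|J [dl [dl0 hdl]]]; first by exists 1.
exists (Num.min dl (Cd J).2); rewrite lt_min dl0 (hCd J).1; split => // j.
rewrite ltnS leq_eqVlt => /orP[/eqP ->|hj].
  by apply: mono (hCd J).2; rewrite ge_min lexx orbT.
by apply: mono (hdl j hj); rewrite ge_min lexx.
Qed.

Definition trunc n (x : E) : E := fun i => if (i < n)%N then x i else 0.

(** Expand in the last variable by [taylor1] at the truncated point, then each of the J resulting
    derivatives in the remaining variables by induction. *)
Lemma taylor_smooth z (e : R) Gs J : 0 < e -> pfam z e Gs ->
  (forall l, exists B dl : R, 0 < dl /\ forall y, cube z dl y -> `|Gs l y| <= B) ->
  forall n, (n <= d)%N -> forall l, exists C dl0 : R, 0 < dl0 /\ forall (dl : R) (x : E), 0 <= dl <= dl0 -> pdr n dl x ->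
    `|Gs l (z + rowE d (trunc n x)) -
      tpoly n J (fun al => Gs (lst n al ++ l) z / (\prod_(0 <= i < n) (al i)`!)%:R) x| <= C * dl ^+ J.
Proof.
move=> e0 hG hB; elim=> [|n IH] hn l.
  exists 0, 1; split => // dl x _ _ /=.
  have -> : rowE d (trunc 0 x) = 0 by apply/rowP => i; rewrite !mxE.
  by rewrite addr0 big_geq // divr1 subrr normr0 mul0r.
pose o := Ordinal hn.
pose T l' al := Gs (lst n al ++ l') z / (\prod_(0 <= i < n) (al i)`!)%:R.
pose P j (C dl0 : R) := forall (dl : R) (x : E), 0 <= dl <= dl0 -> pdr n dl x ->
    `|Gs (nseq j o ++ l) (z + rowE d (trunc n x)) - tpoly n J (T (nseq j o ++ l)) x| <= C * dl ^+ J.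
have Pm j C (dl dl' : R) : dl' <= dl -> P j C dl -> P j C dl'.
  by move=> hd h dl1 x /andP[h1 h2]; apply: h; rewrite h1 (le_trans h2).
have [C [dl0 [dl00 hC]]] := fin_radius J Pm (fun j => IH (ltnW hn) (nseq j o ++ l)).
have [B [dB [dB0 hBd]]] := hB (nseq J o ++ l).
pose D0 := Num.min dl0 (Num.min dB e / 2).
have D1 : D0 <= dl0 by rewrite ge_min lexx.
have dBe : 0 < Num.min dB e by rewrite lt_min dB0.
have D2 : D0 <= Num.min dB e / 2 by rewrite ge_min lexx orbT.
have D00 : 0 < D0 by rewrite lt_min dl00; lra.
exists (\sum_(0 <= j < J) `|C j| * D0 ^+ j + `|B|), D0; split => // dl x /andP[h0 hD] hx.
pose y := z + rowE d (trunc n x).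
have xn : `|x n| <= dl by exact: hx.
have -> : z + rowE d (trunc n.+1 x) = y + x n *: ev o.
  rewrite /y -addrA; congr (_ + _); apply/rowP => i; rewrite !mxE eqxx /= /trunc.
  have -> : (i == o) = (i == n :> nat) by [].
  by case: (ltngtP i n) => h; rewrite ?mulr0 ?mulr1 ?addr0 ?add0r ?h ?ltnSn //;
    [rewrite ltnS ltnW|rewrite ltnNge h].
have incube (s : R) i : `|s| <= `|x n| -> `|(y + s *: ev o) ord0 i - z ord0 i| <= dl.
  move=> hs; rewrite !mxE eqxx /= /trunc.
  have -> : (i == o) = (i == n :> nat) by [].
  rewrite [X in `|X|](_ : _ = (if (i < n)%N then x i else 0) + s * (i == n :> nat)%:R); last by ring.
  case: (ltngtP i n) => h; rewrite ?mulr0 ?mulr1 ?addr0 ?add0r ?normr0 //.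
    by apply: hx; exact: ltnW.
  exact: le_trans xn.
have := @taylor1 z e Gs o J hG l y (x n) B _.
move=> /(_ _) hT.
have {}hT : `|Gs l (y + x n *: ev o) - \sum_(0 <= j < J) Gs (nseq j o ++ l) y / j`!%:R * x n ^+ j| <= `|B| * dl ^+ J.
  apply: le_trans (hT _) _.
    move=> s hs; split.
      move=> i; apply: le_lt_trans (incube s i hs) _; apply: le_lt_trans hD _; apply: le_lt_trans D2 _.
      by apply: lt_le_trans (_ : Num.min dB e <= e); [lra|rewrite ge_min lexx orbT].
    apply: hBd => i; apply: le_lt_trans (incube s i hs) _; apply: le_lt_trans hD _; apply: le_lt_trans D2 _.
    by apply: lt_le_trans (_ : Num.min dB e <= dB); [lra|rewrite ge_min lexx].
  apply: (@le_trans _ _ (`|B| * `|x n| ^+ J)); first by rewrite ler_wpM2r ?exprn_ge0 // ler_norm.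
  by rewrite ler_wpM2l // lerXn2r ?nnegrE.
have eT j : (fun al => Gs (lst n.+1 (updn al n j) ++ l) z / (\prod_(0 <= i < n.+1) (updn al n j i)`!)%:R) =
   (fun al => (j`!%:R)^-1 * T (nseq j o ++ l) al).
  apply/funext => al; rewrite /T /= [updn al n j n]/updn eqxx /nseqo insubT -/o -catA.
  have -> : lst n (updn al n j) = lst n al.
    by apply: lst_ext => i hi; rewrite /updn ltn_eqF.
  rewrite big_nat_recr //= [updn al n j n]/updn eqxx.
  have -> : (\prod_(0 <= i < n) (updn al n j i)`! = \prod_(0 <= i < n) (al i)`!)%N.
    by apply: eq_big_nat => i /andP[_ hi]; rewrite /updn ltn_eqF.
  have -> : Sub n hn = o by [].
  by rewrite natrM invfM [X in _ * X]mulrC mulrCA.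
rewrite [tpoly n.+1 _ _ _]/=.
under eq_bigr do rewrite eT tpoly_scale.
rewrite -(subrK (\sum_(0 <= j < J) Gs (nseq j o ++ l) y / j`!%:R * x n ^+ j) (Gs l (y + x n *: ev o))) -addrA.
rewrite addrC mulrDl; apply: le_trans (ler_normD _ _) _; apply: lerD => //.
rewrite -sumrB mulr_suml; apply: le_trans (ler_norm_sum _ _ _) _.
apply: ler_sum_nat => j /andP[_ hj].
have hCj : `|Gs (nseq j o ++ l) y - tpoly n J (T (nseq j o ++ l)) x| <= `|C j| * dl ^+ J.
  apply: le_trans (hC j hj dl x _ (pdS hx)) _; first by rewrite h0 (le_trans hD).
  by rewrite ler_wpM2r ?exprn_ge0 // ler_norm.
rewrite [X in `|X|](_ : _ = (j`!%:R)^-1 * ((Gs (nseq j o ++ l) y - tpoly n J (T (nseq j o ++ l)) x) * x n ^+ j)); last by ring.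
rewrite normrM [X in X * _](_ : _ = (j`!%:R)^-1); last by rewrite ger0_norm // invr_ge0.
apply: (@le_trans _ _ (1 * (`|C j| * dl ^+ J * D0 ^+ j))); last by rewrite mul1r; apply: eqW_le; ring.
apply: ler_pM; rewrite ?invr_ge0 //.
  by rewrite invf_le1 ?ltr0n ?fact_gt0 // ler1n fact_gt0.
rewrite normrM normrX; apply: ler_pM; rewrite ?exprn_ge0 //.
by rewrite lerXn2r ?nnegrE ?(ltW D00) // (le_trans xn).
Qed.

End SmoothTaylor.

(** * Local extension *)

Section LocalExtension.
Variables (R : realType) (d : nat).
Local Notation E := (nat -> R).
Local Notation EC := (nat -> R[i]).
Local Notation E0 := (@E0 R (vR R)).
Local Notation Ar := (@A R (vR R)).
Local Notation AGr := (@AG R (vR R)).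
Local Notation ARr := (@AR R (vR R)).
Local Notation pdr := (@pd R (vR R)).

Lemma AG1_flat (g : R -> R) : AGr 1 (fun x => g (x 0%N)) ->
  (forall J, exists C dl : R, 0 < dl /\ forall t : R, `|t| <= dl -> `|g t| <= C * `|t| ^+ J) ->
  exists2 e : R, 0 < e & forall t : R, `|t| <= e -> g t = 0.
Proof.
move=> [r [M [r0 /A_inv [c [m [hc hm h]]]]]] flat.
have c0 j : exists a : R, `|a| <= m j /\ forall x, c j x = a by have [a [h1 h2]] := hc j; exists a.
have [b hb] := choice c0.
have cvb (t : R) : `|t| <= r -> cv (K := vR R) (fun J => \sum_(0 <= k < J) b k * t ^+ k) (g t).
  move=> tr; have := h (fun=> t) (fun i _ => tr); apply: cv_ext => J.
  by apply: eq_bigr => j _; rewrite (hb j).2.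
have bz j : b j = 0.
  apply: (@ps_flat R (vR R) b r M g (fun=> True)) => //.
  - move=> J; apply: le_trans (hm J); apply: ler_sum => i _.
    by rewrite ler_wpM2r ?exprn_ge0 ?(ltW r0) //; exact: (hb i).1.
  - exact: accumT.
  - by move=> t _ ht; exact: cvb.
  - by move=> J; have [C [dl [dl0 hC]]] := flat J; exists C, dl; split => // t _; exact: hC.
exists r => // t tr; apply: (cv_uniq (cvb t tr)); apply: cv_ext (cv_cst _) => J.
by rewrite big1 // => j _; rewrite bz mul0r.
Qed.

Lemma sg_le2 (t : R) : `|sg t| <= 2 * `|t|.
Proof.
rewrite /sg normrM normfV (gtr0_norm (sg_den t)) normrM ger0_norm // ler_pdivrMr ?sg_den //.
by rewrite ler_peMr ?mulr_ge0 // lerDl sqr_ge0.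
Qed.

Lemma smooth_pfam (W : set 'rV[R]_d) F z (e : R) : cube z e `<=` W -> smooth_on W F ->
  pfam z e (fun l => ipd l F).
Proof. by move=> hW hF l i u hu; have [_ h] := hF l u (hW u hu); split. Qed.

Lemma smooth_cont (W : set 'rV[R]_d) F u : smooth_on W F -> W u -> forall l (eps : R), 0 < eps ->
  exists2 dl : R, 0 < dl & forall y, cube u dl y -> `|ipd l F y - ipd l F u| < eps.
Proof.
move=> hF Wu l eps eps0; have [h _] := hF l u Wu.
have [dl dl0 hdl] := nbhs_box (@cvgr_dist_lt _ _ _ _ _ _ _ h _ eps0).
by exists dl => // y hy; have := hdl y hy; rewrite /= distrC.
Qed.

(** With m the order, replacing (m+1)^m by m! costs e^(m+1), and replacing m! by the product of the
    al_i! costs 2^(d m); both are geometric in m. *)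
Lemma coef_bound (Gs : seq 'I_d -> 'rV[R]_d -> R) (x0 : 'rV[R]_d) N (rho h0 C : R) :
  0 < rho -> 0 < h0 -> 0 < C ->
  (forall l, rho ^+ (N * size l) * (h0 / (size l).+1%:R) ^+ size l * `|Gs l x0|
     <= 2 ^+ size l * C * C ^+ (N * size l)) ->
  exists M B : R, 0 < B /\ forall al : nat -> nat,
    `|Gs (lst d d al) x0 / (\prod_(0 <= i < d) (al i)`!)%:R| <= M * B ^+ (\sum_(0 <= i < d) al i).
Proof.
move=> rho0 h00 C0 h.
pose Q := 2 * C ^+ N / (rho ^+ N * h0).
have Q0 : 0 < Q by rewrite divr_gt0 ?mulr_gt0 ?exprn_gt0.
exists (C * expR 1), (Q * expR 1 * 2 ^+ d); split.
  by apply: mulr_gt0; [apply: mulr_gt0 => //; exact: expR_gt0|exact: exprn_gt0].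
move=> al; have := h (lst d d al); rewrite size_lst //.
set m := (\sum_(0 <= i < d) al i)%N; set G := Gs _ _; set P := (\prod_(0 <= i < d) (al i)`!)%N => hG.
have P0 : 0 < P%:R :> R.
  rewrite ltr0n /P; elim: (d) => [|n IH]; first by rewrite big_geq.
  by rewrite big_nat_recr //= muln_gt0 IH fact_gt0.
have m10 : 0 < m.+1%:R :> R by rewrite ltr0n.
have k0 : 0 < rho ^+ (N * m) * (h0 / m.+1%:R) ^+ m by rewrite mulr_gt0 ?exprn_gt0 ?divr_gt0.
have hG1 : `|G| <= C * Q ^+ m * m.+1%:R ^+ m.
  rewrite -(ler_pM2l k0); apply: le_trans hG _; apply: eqW_le.
  rewrite /Q !exprM !expr_div_n !exprMn; field.
  by rewrite !expf_neq0 // gt_eqF.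
rewrite normrM normfV (gtr0_norm P0) ler_pdivrMr //; apply: le_trans hG1 _.
apply: (@le_trans _ _ (C * Q ^+ m * (expR m.+1%:R * m`!%:R))).
  by rewrite ler_pM2l ?exp_fact // mulr_gt0 ?exprn_gt0.
have eE : expR m.+1%:R = expR 1 * expR 1 ^+ m :> R.
  by rewrite -natr1 expRD mulrC -expRM_natl mulr1.
apply: (@le_trans _ _ (C * Q ^+ m * (expR m.+1%:R * (2 ^+ (d * m) * P%:R)))).
  rewrite ler_pM2l ?mulr_gt0 ?exprn_gt0 // ler_pM2l ?expR_gt0 //.
  by rewrite -natrX -natrM ler_nat fact_multi.
by rewrite eE exprM !exprMn; apply: eqW_le; ring.
Qed.

(** The smooth function and the sum of its Taylor series share the truncations [tpoly], so they
    differ by O(dl^J) for every J. *)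
Lemma taylor_flat (Gs : seq 'I_d -> 'rV[R]_d -> R) (x0 : 'rV[R]_d) (e M B : R) : 0 < e -> pfam x0 e Gs ->
  (forall l (eps : R), 0 < eps -> exists2 dl : R, 0 < dl & forall y, cube x0 dl y -> `|Gs l y - Gs l x0| < eps) ->
  0 < B -> (forall al : nat -> nat,
    `|Gs (lst d d al) x0 / (\prod_(0 <= i < d) (al i)`!)%:R| <= M * B ^+ (\sum_(0 <= i < d) al i)) ->
  exists (r Mr : R) (F : E -> R) (Fc : EC -> R[i]),
  [/\ 0 < r, Ar d r Mr F, A (K := vC R) d r Mr Fc,
      forall x, pdr d r x -> Fc (fun i => (x i)%:C%C) = ((F x)%:C)%C &
      forall J, exists C dl0 : R, 0 < dl0 /\ forall (dl : R) (x : E), 0 <= dl <= dl0 -> pdr d dl x ->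
        `|Gs [::] (x0 + rowE d x) - F x| <= C * dl ^+ J].
Proof.
move=> e0 hG hcont B0 hT.
have [F [Fc [h1 h2 h3 h4]]] := ps_exists B0 hT.
exists (2 * B)^-1, (2 ^+ d * M), F, Fc; split => //; first by rewrite invr_gt0 mulr_gt0.
move=> J; have [C1 hC1] := h4 J.
have hB l : exists B dl : R, 0 < dl /\ forall y, cube x0 dl y -> `|Gs l y| <= B.
  have [dl dl0 hdl] := hcont l 1 ltr01; exists (`|Gs l x0| + 1), dl; split => // y hy.
  rewrite -(subrK (Gs l x0) (Gs l y)) addrC; apply: le_trans (ler_normD _ _) _.
  by rewrite lerD2l ltW // hdl.
have [C2 [dl0 [dl00 hC2]]] := taylor_smooth J e0 hG hB (leqnn d) [::].
exists (C2 + C1), (Num.min dl0 (2 * B)^-1); split; first by rewrite lt_min dl00 invr_gt0 mulr_gt0.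
move=> dl x /andP[h5]; rewrite le_min => /andP[h6 h7] hx.
have := hC2 dl x _ hx; rewrite h5 h6 => /(_ isT) k2.
have := hC1 dl x _ hx; rewrite h5 h7 => /(_ isT) k1.
have eT : (fun al => Gs (lst d d al ++ [::]) x0 / (\prod_(0 <= i < d) (al i)`!)%:R) =
  (fun al => Gs (lst d d al) x0 / (\prod_(0 <= i < d) (al i)`!)%:R) by apply/funext => al; rewrite cats0.
rewrite eT in k2.
have eR : rowE d (trunc d x) = rowE d x by apply/rowP => i; rewrite !mxE /trunc ltn_ord.
rewrite eR in k2; move: k1 k2; move: (tpoly _ _ _ _) => P k1 k2.
rewrite [X in `|X|](_ : _ = (Gs [::] (x0 + rowE d x) - P) - (F x - P)); last by ring.
by rewrite mulrDl; apply: le_trans (ler_normB _ _) _; apply: lerD.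
Qed.

(** Points of disagreement accumulating at x0 would carry an ultrafilter, so a single chart would
    reach one of them, and its radial curve would join x0 to that point inside X. *)
Lemma agree_near (X : set 'rV[R]_d) f F0 (x0 : 'rV[R]_d) (e r Mr : R) (F : E -> R) :
  closed X -> subanalytic X -> curve_analytic X f -> 0 < e ->
  (forall y, cube x0 e y -> X y -> F0 y = f y) -> 0 < r -> Ar d r Mr F ->
  (forall J, exists C dl0 : R, 0 < dl0 /\ forall (dl : R) (x : E), 0 <= dl <= dl0 -> pdr d dl x ->
        `|F0 (x0 + rowE d x) - F x| <= C * dl ^+ J) ->
  exists2 rho : R, 0 < rho & forall y, X y -> cube x0 rho y -> f y = F (seqE (y - x0)).
Proof.
move=> cX sX hf e0 Ff r0 hF flat; apply: contrapT => no.
pose Bad : set 'rV[R]_d := [set y | X y /\ f y <> F (seqE (y - x0))].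
pose G : set_system 'rV[R]_d := [set Q | exists2 rho : R, 0 < rho & forall y, Bad y -> cube x0 rho y -> Q y].
have PG : ProperFilter G.
  apply: Build_ProperFilter.
    move=> [rho rho0 h]; apply: no; exists rho => // y Xy hy; apply: contrapT => ne.
    exact: (h y).
  apply: Build_Filter.
  - by exists 1.
  - move=> P Q [a a0 ha] [b b0 hb]; exists (Num.min a b); first by rewrite lt_min a0.
    by move=> y By hy; split; [apply: ha|apply: hb] => // i; have := hy i; rewrite lt_min => /andP[].
  - by move=> P Q PQ [a a0 ha]; exists a => // y By hy; apply/PQ/ha.
have [U [UF hU]] := ultraFilterLemma PG.
have UB : U Bad by apply: hU; exists 1.
have Ux i : infl U (fun w : 'rV[R]_d => w ord0 i - x0 ord0 i).
  by move=> a a0; apply: hU; exists a => // y _; apply.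
have [|N [Phi [q [u1 u2 u3 [rX [rX0 u4]] u5]]]] := @unif_exists R _ U UF d X x0 id cX sX Ux.
  by apply: filterS UB => w [].
have [s [s0 [M hs]]] := AG_common_all u1.
(* Shrinking the chart by ta brings the norms of its components below the radius r of F. *)
pose ta := Num.min 1 (r / (`|M| + 1)).
have M10 : 0 < `|M| + 1 by rewrite ltr_wpDl.
have ta0 : 0 < ta by rewrite lt_min ltr01 divr_gt0.
have ta1 : ta <= 1 by rewrite ge_min lexx.
have taM : ta * M <= r.
  have : ta * (`|M| + 1) <= r by rewrite -ler_pdivlMr // ge_min lexx orbT.
  by have := ler_norm M; nra.
pose s' := Num.min (ta * s) rX; have s'0 : 0 < s' by rewrite lt_min mulr_gt0.
have hPhi i : (i < d)%N -> Ar N s' r (fun x => Phi x i).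
  move=> hi; apply: (@A_le _ _ _ _ (ta * M)) => //; apply: A_shrink (A_scaling s0 (ltW ta0) ta1 (hs i hi) (u2 i hi)).
    exact: ltW.
  by rewrite ge_min lexx.
have hX x : pdr N s' x -> X (x0 + rowE d (Phi x)).
  by move=> hx; apply: u4; apply: pd_le hx; rewrite ge_min lexx orbT.
pose rho := s' / 2; have rho0 : 0 < rho by rewrite /rho; lra.
have rr : rho < s' by rewrite /rho; lra.
have v1 : U [set w | forall i, (i < N)%N -> `|q w i| < rho] by apply: ae_all => i hi; exact: u3.
have := filter_ex (filterI (filterI UB u5) v1) => -[w [[[Xw nw] /= ew] hq]].
pose p := q w.
have hp : pdr N rho p by move=> i hi; exact/ltW/hq.
have pu (u : R) : `|u| <= 1 -> pdr N rho (fun i => p i * u).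
  by move=> hu i hi /=; rewrite normrM; apply: le_trans (hp i hi); rewrite ler_piMr.
have hXu (u : R) : `|u| <= 1 -> X (x0 + rowE d (Phi (fun i => p i * u))).
  by move=> hu; apply: hX; apply: pd_le (pu u hu); exact: ltW.
pose g (t : R) := f (x0 + rowE d (Phi (fun i => p i * sg t))) - F (Phi (fun i => p i * sg t)).
have hFP : ARr N s' (fun x => F (Phi x)) by exists Mr; apply: (A_comp s'0 hF).
have hg t : AGr 1 (fun x => g (t + x 0%N)).
  apply: AG_sub; last exact: (AG_sgcurve t rho0 rr hFP hp).
  apply: (curve_f hf rho0 rr _ hp hXu) => i hi.
  by exists r; exact: hPhi.
have small (t : R) : `|t| <= 1 / 2 -> forall i, (i < d)%N -> `|Phi (fun i => p i * sg t) i| <= 2 * `|t| * r.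
  move=> ht i hi; have t20 : 0 <= 2 * `|t| by rewrite mulr_ge0.
  have t21 : 2 * `|t| <= 1 by lra.
  have hA := A_scaling s'0 t20 t21 (hPhi i hi) (u2 i hi).
  apply: (A_bound (K := vR R) _ hA); first by rewrite mulr_ge0 // ltW.
  move=> j hj /=; rewrite normrM mulrC ler_pM ?sg_le2 //.
  by apply: le_trans (hp j hj) _; exact: ltW.
have g0 : exists2 e : R, 0 < e & forall t : R, `|t| <= e -> g t = 0.
  apply: AG1_flat; first by apply: AG_ext1 (hg 0) => x; rewrite add0r.
  move=> J; have [C [dl0 [dl00 hC]]] := flat J.
  pose dd := Num.min (1 / 2) (Num.min (dl0 / (2 * r)) (e / (4 * r))).
  have dd0 : 0 < dd by rewrite !lt_min !divr_gt0 // mulr_gt0.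
  exists (C * (2 * r) ^+ J), dd; split => // t; rewrite !le_min => /and3P[k1 k2 k3].
  have k2' : 2 * `|t| * r <= dl0 by move: k2; rewrite ler_pdivlMr ?mulr_gt0 //; lra.
  have k3' : 2 * `|t| * r < e by move: k3; rewrite ler_pdivlMr ?mulr_gt0 //; lra.
  have sm := small t k1.
  have d0 : 0 <= 2 * `|t| * r <= dl0 by rewrite k2' !mulr_ge0 // ltW.
  have := hC _ _ d0 sm; rewrite Ff.
  - have -> : (2 * `|t| * r) ^+ J = (2 * r) ^+ J * `|t| ^+ J by rewrite -exprMn; congr (_ ^+ _); ring.
    by rewrite mulrA.
  - move=> i; rewrite !mxE [X in `|X|](_ : _ = Phi (fun i => p i * sg t) i); last by ring.
    exact: le_lt_trans (sm i (ltn_ord i)) k3'.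
  - exact: hXu (sg_le1 t).
(* Since sg 1 = 1, the parameter 1 is the point of disagreement. *)
have g1 : g 1 = 0.
  apply: (@line_identity R (vR R) g) => [t _|]; first exact: hg.
  by have [a a0 ha] := g0; exists a => // t /andP[t0 ta']; apply: ha; rewrite ger0_norm.
apply: nw; move/eqP: g1; rewrite /g sg1 subr_eq0 => /eqP.
have -> : (fun i => p i * 1) = p by apply/funext => i; rewrite mulr1.
rewrite ew => ->.
have -> : x0 + rowE d (Phi (q w)) - x0 = rowE d (Phi p) by rewrite addrC addKr.
apply: (A_dep hF) => [i hi|i hi]; last by rewrite rowEK.
apply: (A_bound (K := vR R) (ltW s'0) (hPhi i hi)).
by apply: pd_le hp; exact: ltW.
Qed.

Lemma local_ext (X : set 'rV[R]_d) f (x0 : 'rV[R]_d) : fat X -> subanalytic X -> Cinf_on X f ->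
  curve_analytic X f -> X x0 ->
  exists (r M : R) (F : E -> R) (Fc : EC -> R[i]),
  [/\ 0 < r, A (K := vC R) d r M Fc,
      forall x, pdr d r x -> Fc (fun i => (x i)%:C%C) = ((F x)%:C)%C &
      forall y, X y -> cube x0 r y -> f y = F (seqE (y - x0))].
Proof.
move=> fX sX hC hf Xx0; have [W [F0 [oW [Wx0 [sm F0f]]]]] := hC x0 Xx0.
have [e e0 he] := open_box oW Wx0.
have cW : cube x0 e `<=` W by move=> y hy; exact: he.
have hG := smooth_pfam cW sm.
have hcont := smooth_cont sm Wx0.
have Ff y : cube x0 e y -> X y -> F0 y = f y by move=> /cW; exact: F0f.
have Fc0 y : cube x0 e y -> forall eps : R, 0 < eps -> exists2 dl : R, 0 < dl &
     forall y', cube y dl y' -> `|F0 y' - F0 y| < eps.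
  by move=> hy; exact: (smooth_cont sm (cW y hy) [::]).
have [c [N [rho [z0 [h0 [C [N0 rho01 h00 C0 [hc c0 hz]]]]]]]] := horn_bounds fX sX Xx0 hf e0 Fc0 Ff.
have db := deriv_bound e0 hG hcont N0 rho01 h00 C0 hc c0 hz.
have [rho0 _] := andP rho01.
have [M [B [B0 hT]]] := @coef_bound (fun l => ipd l F0) x0 N rho h0 C rho0 h00 C0 db.
have [r [Mr [F [Fc [r0 hF hFc eF fl]]]]] := @taylor_flat (fun l => ipd l F0) x0 e M B e0 hG hcont B0 hT.
have [_ [cX _]] := fX.
have [rho' rho'0 hag] := agree_near cX sX hf e0 Ff r0 hF fl.
pose r1 := Num.min r rho'; have r10 : 0 < r1 by rewrite lt_min r0.
have r1r : r1 <= r by rewrite ge_min lexx.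
exists r1, Mr, F, Fc; split => //.
- by apply: A_shrink hFc => //; exact: ltW.
- by move=> x hx; apply: eF; exact: pd_le hx.
- by move=> y Xy hy; apply: hag => // i; apply: lt_le_trans (hy i) _; rewrite ge_min lexx orbT.
Qed.

End LocalExtension.

(** * Gluing *)

Section Gluing.
Variables (R : realType) (d : nat).
Local Notation E := (nat -> R).
Local Notation EC := (nat -> R[i]).
Local Notation C0 := (@E0 R (vC R)).
Local Notation Ac := (@A R (vC R)).
Local Notation AGc := (@AG R (vC R)).
Local Notation ARc := (@AR R (vC R)).
Local Notation pdr := (@pd R (vR R)).
Local Notation pdc := (@pd R (vC R)).

Definition disc (z : 'rV[R[i]]_d) (e : R) : set 'rV[R[i]]_d :=
  [set w | forall i, nuC (w ord0 i - z ord0 i) < e].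

(** The default b - 1 of the maximum covers d = 0. *)
Lemma fin_slack (a : 'I_d -> R) (b : R) : (forall i, a i < b) -> exists2 c : R, c < b & forall i, a i <= c.
Proof.
move=> h; exists (\big[Num.max/(b - 1)]_(i < d) a i); last by move=> i; exact: le_bigmax.
by apply/bigmax_ltP; split => [|i _]; [lra|exact: h].
Qed.

Lemma pdc_seqE (z : 'rV[R[i]]_d) (r : R) : (forall i, nuC (z ord0 i) <= r) -> pdc d r (seqE z).
Proof. by move=> h i hi; rewrite (seqE_ord _ (Ordinal hi)); exact: h. Qed.

(* The difference vanishes near y1, being zero at real points, and then along the
   segment from y1 to z. *)
Lemma expansions_agree (f : 'rV[R]_d -> R) (x x' y1 : 'rV[R]_d) (z : 'rV[R[i]]_d) (de de' eta M M' : R)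
  (F F' : E -> R) (Fc Fc' : EC -> R[i]) :
  0 < de -> 0 < de' -> 0 < eta ->
  Ac d de M Fc -> Ac d de' M' Fc' ->
  (forall v, pdr d de v -> Fc (fun i => (v i)%:C%C) = ((F v)%:C)%C) ->
  (forall v, pdr d de' v -> Fc' (fun i => (v i)%:C%C) = ((F' v)%:C)%C) ->
  (forall y, cube y1 eta y -> f y = F (seqE (y - x))) ->
  (forall y, cube y1 eta y -> f y = F' (seqE (y - x'))) ->
  disc (complexify x) (3 / 4 * de) (complexify y1) -> disc (complexify x') (3 / 4 * de') (complexify y1) ->
  disc (complexify x) (3 / 4 * de) z -> disc (complexify x') (3 / 4 * de') z ->
  Fc (seqE (z - complexify x)) = Fc' (seqE (z - complexify x')).
Proof.
move=> de0 de'0 eta0 hF hF' eF eF' fF fF' hy hy' hz hz'.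
(* Recentring inside the disc of radius 3/4 dd leaves the radius dd / 4. *)
have rec (xx : 'rV[R]_d) (dd MM : R) (GG : EC -> R[i]) (u : 'rV[R[i]]_d) : 0 < dd -> Ac d dd MM GG ->
    disc (complexify xx) (3 / 4 * dd) u ->
    ARc d (dd / 4) (fun v => GG (fun i => seqE (u - complexify xx) i + v i)).
  move=> dd0 hG hu; apply: (@AR_recenter R (vC R) d dd (3 / 4 * dd) (dd / 4)); [lra|lra| |by exists MM].
  by apply: pdc_seqE => i; rewrite !mxE; apply: ltW; have := hu i; rewrite !mxE.
pose t0 := Num.min (de / 4) (de' / 4).
have t00 : 0 < t0 by rewrite lt_min; apply/andP; split; lra.
have t0d : t0 <= de / 4 by rewrite ge_min lexx.
have t0d' : t0 <= de' / 4 by rewrite ge_min lexx orbT.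
pose yc := complexify y1.
pose D (v : EC) := Fc (fun i => seqE (yc - complexify x) i + v i) - Fc' (fun i => seqE (yc - complexify x') i + v i).
have hD : ARc d t0 D.
  apply: (@AR_sub R (vC R)) => //; first exact: (AR_le t00 t0d (rec x de M Fc yc de0 hF hy)).
  exact: (AR_le t00 t0d' (rec x' de' M' Fc' yc de'0 hF' hy')).
have [MD hMD] := hD.
pose S := fun w : R[i] => exists s : R, w = (s%:C)%C.
have accS : accum0 (K := vC R) S.
  move=> e e0; exists ((e / 2)%:C)%C; split; first by exists (e / 2).
  by rewrite /= nuC_real gtr0_norm; lra.
pose rho := Num.min t0 (eta / 2).
have rho0 : 0 < rho by rewrite lt_min t00; lra.
have Dz v : pdc d t0 v -> D v = 0.
  apply: (A_identity t00 accS rho0 hMD) => {}v hv vS.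
  have [s hs] : {s : nat -> R & forall i, (i < d)%N -> v i = ((s i)%:C)%C}.
    apply: (@choice _ _ (fun i s => (i < d)%N -> v i = (s%:C)%C)) => i.
    by have [hi|hi] := ltnP i d; [have [s es] := vS i hi; exists s|exists 0].
  have sr i : (i < d)%N -> `|s i| <= rho by move=> hi; have := hv i hi; rewrite hs //= nuC_real.
  pose y := y1 + rowE d s.
  have hyc : cube y1 eta y.
    move=> i; rewrite !mxE [X in `|X|](_ : _ = s i); last by ring.
    apply: le_lt_trans (sr i (ltn_ord i)) _.
    have : rho <= eta / 2 by rewrite ge_min lexx orbT.
    lra.
  have eval (xx : 'rV[R]_d) (dd MM : R) (GG : EC -> R[i]) (G : E -> R) : 0 < dd -> t0 <= dd / 4 -> Ac d dd MM GG ->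
      (forall v, pdr d dd v -> GG (fun i => (v i)%:C%C) = ((G v)%:C)%C) ->
      disc (complexify xx) (3 / 4 * dd) yc ->
      GG (fun i => seqE (yc - complexify xx) i + v i) = ((G (seqE (y - xx)))%:C)%C.
    move=> dd0 tdd hG eG hu; rewrite -eG.
      have ee i : (i < d)%N -> (seqE (y - xx) i)%:C%C = seqE (yc - complexify xx) i + v i.
        move=> hi; rewrite !(seqE_ord _ (Ordinal hi)) !mxE hs //= -!rmorphB -rmorphD /=.
        by congr (_%:C)%C; ring.
      apply: (A_dep hG) => [i hi|i hi]; last by rewrite ee.
      apply: le_trans (nuCD _ _) _; have := hv i hi; have := hu (Ordinal hi).
      rewrite (seqE_ord _ (Ordinal hi)) !mxE /=.
      have : rho <= t0 by rewrite ge_min lexx.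
      lra.
    move=> i hi /=; rewrite (seqE_ord _ (Ordinal hi)) !mxE.
    have := hu (Ordinal hi); rewrite !mxE -rmorphB /= nuC_real => h1.
    rewrite [X in `|X|](_ : _ = (y1 ord0 (Ordinal hi) - xx ord0 (Ordinal hi)) + s i); last by rewrite /=; ring.
    apply: le_trans (ler_normD _ _) _; have := sr i hi.
    have : rho <= t0 by rewrite ge_min lexx.
    lra.
  rewrite /D (eval x de M Fc F) // (eval x' de' M' Fc' F') // -fF // -fF' //.
  by rewrite subrr.
pose l (u : R[i]) := yc + u *: (z - yc).
pose h (u : R[i]) := Fc (seqE (l u - complexify x)) - Fc' (seqE (l u - complexify x')).
suff : h 1 = 0.
  have -> : h 1 = Fc (seqE (z - complexify x)) - Fc' (seqE (z - complexify x')).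
    have l1 : l 1 = z by rewrite /l scale1r addrCA subrr addr0.
    by rewrite /h l1.
  by move/eqP; rewrite subr_eq0 => /eqP.
apply: (@line_identity R (vC R) h) => [t /andP[t_0 t_1]|].
  have conv (xx : 'rV[R]_d) (dd : R) : disc (complexify xx) (3 / 4 * dd) yc -> disc (complexify xx) (3 / 4 * dd) z ->
      disc (complexify xx) (3 / 4 * dd) (l (t%:C)%C).
    move=> k1 k2 i; rewrite !mxE.
    have := k1 i; have := k2 i; rewrite !mxE; set a := z ord0 i; set b := (y1 ord0 i)%:C%C; set q := (xx ord0 i)%:C%C.
    have -> : b + (t%:C)%C * (a - b) - q = ((1 - t)%:C)%C * (b - q) + (t%:C)%C * (a - q).
      by rewrite rmorphB /= rmorph1; ring.
    move=> h1 h2; apply: le_lt_trans (nuCD _ _) _; rewrite !nuCM !nuC_real (ger0_norm t_0) ger0_norm; last by lra.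
    pose m := Num.max (nuC (a - q)) (nuC (b - q)).
    have m1 : m < 3 / 4 * dd by rewrite gt_max h1.
    have m2 : nuC (a - q) <= m by rewrite le_max lexx.
    have m3 : nuC (b - q) <= m by rewrite le_max lexx orbT.
    by apply: le_lt_trans m1; nra.
  have dz i : (i < d)%N -> AGc 1 (fun v => v 0%N * seqE (z - yc) i).
    by move=> hi; apply: AG_mul; [exact: AG_coord|exact: AG_cst].
  have dz0 i : (i < d)%N -> C0 0%N * seqE (z - yc) i = 0 by rewrite /E0 mul0r.
  have one (xx : 'rV[R]_d) (dd MM : R) (GG : EC -> R[i]) : 0 < dd -> Ac d dd MM GG ->
      disc (complexify xx) (3 / 4 * dd) yc -> disc (complexify xx) (3 / 4 * dd) z ->
      AGc 1 (fun v => GG (seqE (l (t%:C%C + v 0%N) - complexify xx))).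
    move=> dd0 hG k1 k2; have dd4 : 0 < dd / 4 by lra.
    have hr := AR_AG dd4 (rec _ _ _ _ _ dd0 hG (conv _ _ k1 k2)).
    have [rd [rd0 dep]] := AG_dep hr.
    apply: AG_ext (AG_comp hr dz dz0).
    apply: near0T => v; congr GG; apply/funext => i.
    have [hi|hi] := ltnP i d.
      by rewrite !(seqE_ord _ (Ordinal hi)) !mxE; ring.
    by rewrite !seqE_out // mulr0 addr0.
  by apply: AG_sub; [exact: one hF hy hz|exact: one hF' hy' hz'].
pose B := \sum_(i < d) nuC ((z - yc) ord0 i) + 1.
have B0 : 0 < B by rewrite ltr_wpDl // sumr_ge0 // => i _; exact: nuC_ge0.
exists (t0 / B); first by rewrite divr_gt0.
move=> t /andP[t_0]; rewrite ler_pdivlMr // => tB.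
have := Dz (fun i => (t%:C)%C * seqE (z - yc) i); rewrite /D => Dz'.
rewrite /h /=; set u1 := seqE _; set u2 := seqE _.
have -> : u1 = (fun i => seqE (yc - complexify x) i + (t%:C)%C * seqE (z - yc) i).
  apply/funext => i; rewrite /u1; have [hi|hi] := ltnP i d.
    by rewrite !(seqE_ord _ (Ordinal hi)) !mxE; ring.
  by rewrite !seqE_out // mulr0 addr0.
have -> : u2 = (fun i => seqE (yc - complexify x') i + (t%:C)%C * seqE (z - yc) i).
  apply/funext => i; rewrite /u2; have [hi|hi] := ltnP i d.
    by rewrite !(seqE_ord _ (Ordinal hi)) !mxE; ring.
  by rewrite !seqE_out // mulr0 addr0.
apply: Dz' => i hi; rewrite /= nuCM nuC_real (ger0_norm t_0); apply: le_trans tB; rewrite ler_wpM2l //.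
rewrite (seqE_ord _ (Ordinal hi)) /B (bigD1 (Ordinal hi)) //= -addrA lerDl addr_ge0 // sumr_ge0 // => j _.
exact: nuC_ge0.
Qed.

(** Centres of quarter discs that meet are less than de/2 apart. An interior point of X near the
    centre of the smaller disc then lies in both discs of relative radius 3/4. *)
Lemma discs_agree (X : set 'rV[R]_d) (f : 'rV[R]_d -> R) (x x' : 'rV[R]_d) (z : 'rV[R[i]]_d) (de de' M M' : R)
  (F F' : E -> R) (Fc Fc' : EC -> R[i]) : fat X -> X x' -> 0 < de' -> de' <= de ->
  Ac d de M Fc -> Ac d de' M' Fc' ->
  (forall v, pdr d de v -> Fc (fun i => (v i)%:C%C) = ((F v)%:C)%C) ->
  (forall v, pdr d de' v -> Fc' (fun i => (v i)%:C%C) = ((F' v)%:C)%C) ->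
  (forall y, X y -> cube x de y -> f y = F (seqE (y - x))) ->
  (forall y, X y -> cube x' de' y -> f y = F' (seqE (y - x'))) ->
  disc (complexify x) (de / 4) z -> disc (complexify x') (de' / 4) z ->
  Fc (seqE (z - complexify x)) = Fc' (seqE (z - complexify x')).
Proof.
move=> fX Xx' de'0 dd hF hF' eF eF' fF fF' hz hz'; have de0 : 0 < de by lra.
have xx i : `|x' ord0 i - x ord0 i| < de / 2.
  have := hz i; have := hz' i; rewrite !mxE -nuC_real rmorphB /=.
  set a := (x' ord0 i)%:C%C; set b := (x ord0 i)%:C%C; set w := z ord0 i => h1 h2.
  have -> : a - b = (w - b) - (w - a) by ring.
  have h3 : nuC (w - b - (w - a)) <= nuC (w - b) + nuC (w - a) := @nuB R (vC R) (w - b) (w - a).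
  by apply: le_lt_trans h3 _; lra.
have [_ [_ eX]] := fX.
have e8 : 0 < de' / 8 by lra.
have := Xx'; rewrite eX => /(_ _ (box_nbhs x' e8)) [y1 [iX hy1]].
have [e1 e10 he1] := open_box (@open_interior _ X) iX.
pose eta := Num.min e1 (de' / 8); have eta0 : 0 < eta by rewrite lt_min e10.
have inX y : cube y1 eta y -> X y.
  move=> hy; apply: interior_subset; apply: he1 => i.
  by have := hy i; rewrite lt_min => /andP[].
have y8 y i : cube y1 eta y -> `|y ord0 i - x' ord0 i| < de' / 4.
  move=> hy; have := hy i; rewrite lt_min => /andP[_ h1]; have := hy1 i => /= h2.
  rewrite [X in `|X|](_ : _ = (y ord0 i - y1 ord0 i) + (y1 ord0 i - x' ord0 i)); last by ring.
  by apply: le_lt_trans (ler_normD _ _) _; lra.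
have yx y i : cube y1 eta y -> `|y ord0 i - x ord0 i| < 3 / 4 * de.
  move=> hy; have := y8 y i hy; have := xx i => h1 h2.
  rewrite [X in `|X|](_ : _ = (y ord0 i - x' ord0 i) + (x' ord0 i - x ord0 i)); last by ring.
  by apply: le_lt_trans (ler_normD _ _) _; lra.
have y1in : cube y1 eta y1 by move=> i; rewrite subrr normr0.
apply: (@expansions_agree f x x' y1 z de de' eta M M' F F' Fc Fc') => //.
- move=> y hy; apply: fF; first exact: inX.
  by move=> i; apply: lt_trans (yx y i hy) _; lra.
- move=> y hy; apply: fF'; first exact: inX.
  by move=> i; apply: lt_trans (y8 y i hy) _; lra.
- by move=> i; rewrite !mxE -rmorphB /= nuC_real; exact: yx.
- by move=> i; rewrite !mxE -rmorphB /= nuC_real; apply: lt_trans (y8 y1 i y1in) _; lra.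
- by move=> i; apply: lt_trans (hz i) _; lra.
- by move=> i; apply: lt_trans (hz' i) _; lra.
Qed.

End Gluing.

Theorem theorem1p16 (R : realType) (d : nat) (X : set 'rV[R]_d) (f : 'rV[R]_d -> R) :
  fat X -> subanalytic X -> Cinf_on X f ->
  (forall c : R -> 'rV[R]_d, real_analytic_curve c -> (forall t, X (c t)) ->
     forall t : R, analytic_at (fun s : 'rV[R]_1 => f (c (s ord0 ord0))) (const_mx t)) ->
  exists (V : set 'rV[R[i]]_d) (F : 'rV[R[i]]_d -> R[i]),
    sup_open V /\ (forall x, X x -> V (complexify x)) /\
    holomorphic_on V F /\
    (forall x, X x -> F (complexify x) = ((f x)%:C)%C).
Proof.
move=> fX sX hC hf.
pose T := (R * R * ((nat -> R) -> R) * ((nat -> R[i]) -> R[i]))%type.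
pose Q (x : 'rV[R]_d) (t : T) := let: (r, M, F, Fc) := t in
  [/\ 0 < r, A (K := vC R) d r M Fc,
      forall v, pd (K := vR R) d r v -> Fc (fun i => (v i)%:C%C) = ((F v)%:C)%C &
      forall y, X y -> cube x r y -> f y = F (seqE (y - x))].
have [D hD] : {D : 'rV[R]_d -> T & forall x, X x -> Q x (D x)}.
  apply: (@choice _ _ (fun x t => X x -> Q x t)) => x.
  have [Xx|nX] := pselect (X x); last by exists (0, 0, (fun=> 0), (fun=> 0)).
  by have [r [M [F [Fc hF]]]] := local_ext fX sX hC hf Xx; exists (r, M, F, Fc).
pose rad x := (D x).1.1.1; pose Fc x := (D x).2; pose Fr x := (D x).1.2; pose Mb x := (D x).1.1.2.
have hD' x : X x -> [/\ 0 < rad x, A (K := vC R) d (rad x) (Mb x) (Fc x),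
    forall v, pd (K := vR R) d (rad x) v -> Fc x (fun i => (v i)%:C%C) = ((Fr x v)%:C)%C &
    forall y, X y -> cube x (rad x) y -> f y = Fr x (seqE (y - x))].
  by move=> Xx; have := hD x Xx; rewrite /rad /Mb /Fc /Fr; case: (D x) => [[[r M] F] G].
(* Quarter radii are what [discs_agree] asks for: discs that overlap then have compatible
   expansions. *)
pose V : set 'rV[R[i]]_d := [set z | exists x, X x /\ disc (complexify x) (rad x / 4) z].
have [ch hch] : {ch : 'rV[R[i]]_d -> 'rV[R]_d & forall z, V z -> X (ch z) /\ disc (complexify (ch z)) (rad (ch z) / 4) z}.
  apply: (@choice _ _ (fun z x => V z -> X x /\ disc (complexify x) (rad x / 4) z)) => z.
  by have [[x hx]|nV] := pselect (V z); [exists x|exists 0].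
(* An arbitrary centre is chosen for each z; [FE] shows that the value does not depend on it. *)
pose F z := Fc (ch z) (seqE (z - complexify (ch z))).
have FE z x : X x -> disc (complexify x) (rad x / 4) z -> F z = Fc x (seqE (z - complexify x)).
  move=> Xx hz; have Vz : V z by exists x.
  have [Xc hc] := hch z Vz; rewrite /F.
  have [r1 A1 e1 f1] := hD' _ Xc; have [r2 A2 e2 f2] := hD' _ Xx.
  have [le|/ltW le] := leP (rad x) (rad (ch z)).
    exact: discs_agree fX Xx r2 le A1 A2 e1 e2 f1 f2 hc hz.
  by apply/esym; exact: discs_agree fX Xc r1 le A2 A1 e2 e1 f2 f1 hz hc.
have slack z x : disc (complexify x) (rad x / 4) z -> exists2 e : R, 0 < e &
    forall w : 'rV[R[i]]_d, (forall i, nuC (w ord0 i - z ord0 i) < e) -> disc (complexify x) (rad x / 4) w.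
  move=> hz; have [c cb hc] := fin_slack hz; exists (rad x / 4 - c); first by lra.
  move=> w hw i; have := hw i; have := hc i.
  have -> : w ord0 i - complexify x ord0 i = (w ord0 i - z ord0 i) + (z ord0 i - complexify x ord0 i) by ring.
  by move=> h1 h2; apply: le_lt_trans (nuCD _ _) _; lra.
exists V, F; split; last split; last split.
- move=> z [x [Xx hz]]; have [e e0 he] := slack z x hz.
  exists (e%:C)%C; split; first by have := e0; rewrite -(ltcR 0 e).
  move=> w hw; exists x; split => //; apply: he => i.
  by have := hw i; rewrite nuCE ltcR.
- move=> x Xx; exists x; split => // i; rewrite subrr.
  have [r0 _ _ _] := hD' _ Xx.
  have -> : nuC (0 : R[i]) = 0 by rewrite /nuC normr0.
  by lra.
- move=> z [x [Xx hz]]; have [e e0 he] := slack z x hz.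
  have [r0 hA _ _] := hD' _ Xx.
  pose g (v : nat -> R[i]) := Fc x (fun i => seqE (z - complexify x) i + v i).
  have pdz : pd (K := vC R) d (rad x / 4) (seqE (z - complexify x)).
    by apply: pdc_seqE => i; rewrite !mxE; apply: ltW; have := hz i; rewrite !mxE.
  have r2 : 0 < rad x / 2 by lra.
  have r3 : rad x / 4 + rad x / 2 <= rad x by lra.
  have hg : AG (K := vC R) d g.
    by apply: AR_AG r2 (AR_recenter r2 r3 pdz _); exists (Mb x).
  apply: (AG_analyticC hg); exists (Num.min (e / 2) (rad x / 2)); split.
    by rewrite lt_min r2 andbT; lra.
  move=> v hv; rewrite (FE _ x) //; last first.
    apply: he => i; rewrite !mxE [X in nuC X](_ : _ = v i); last by ring.
    by have := hv i (ltn_ord i); rewrite le_min /= => /andP[h1 _]; lra.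
  rewrite /g; apply/esym/(A_dep hA) => i hi.
    apply: le_trans (nuCD _ _) _; have := pdz i hi; have := hv i hi.
    by rewrite le_min /= => /andP[_ h1]; lra.
  by rewrite !(seqE_ord _ (Ordinal hi)) !mxE; ring.
- move=> x Xx; have [r0 hA eF fF] := hD' _ Xx.
  have dx : disc (complexify x) (rad x / 4) (complexify x).
    move=> i; rewrite subrr; have -> : nuC (0 : R[i]) = 0 by rewrite /nuC normr0.
    by lra.
  rewrite (FE _ x) // (fF x) //; last by move=> i; rewrite subrr normr0.
  rewrite -eF; last first.
    by move=> i hi; rewrite (seqE_ord _ (Ordinal hi)) !mxE subrr /= normr0 ltW.
  congr Fc; apply/funext => i; rewrite !subrr; have [hi|hi] := ltnP i d.
    by rewrite !(seqE_ord _ (Ordinal hi)) !mxE.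
  by rewrite !seqE_out.
Qed.
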